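(* Let $\xi(s)=\frac{1}{2}s(s-1)\pi^{-s/2}\Gamma(\frac{s}{2})\zeta(s)$ and write $\xi(\frac12+\beta+it)=u(t,\beta)+iv(t,\beta)$ with $u,v$ real, for $t\ge0$, $\beta\in(0,1/2]$. The following are equivalent: (i) the Riemann Hypothesis, i.e. $\xi(\frac12+\beta+it)\neq0$ for all $\beta\in(0,1/2]$, $t\ge 0$; (ii) the peak-valley structure holds: for every $\beta\in(0,1/2]$ and every root-interval $I_j=[t_j,t_{j+1}]$ of $u(\cdot,\beta)$, the values $v(t_j,\beta)$ and $v(t_{j+1},\beta)$ are nonzero with opposite signs, and $v(t'_j,\beta)=0$ at some interior point $t'_j$ of $I_j$ (so that $|u|$ is a peak curve and $|v|/\beta$ a valley curve on $I_j$).
   Context: For fixed $\beta$, a root-interval of $u(\cdot,\beta)$ is an interval $I_j=[t_j,t_{j+1}]$ with $t_j<t_{j+1}$, $u(t_j,\beta)=u(t_{j+1},\beta)=0$ and $|u(t,\beta)|>0$ for all $t$ in the interior of $I_j$. *)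

(* Defs.v *)
From Stdlib Require Import Reals.
From Coquelicot Require Import Coquelicot.
Open Scope R_scope.

Definition Cint_gen (f : R -> C) (Fa Fb : (R -> Prop) -> Prop) : C :=
  (RInt_gen (fun x => fst (f x)) Fa Fb, RInt_gen (fun x => snd (f x)) Fa Fb).

Definition cpow_pos (x : R) (s : C) : C :=
  (exp (fst s * ln x) * cos (snd s * ln x),
   exp (fst s * ln x) * sin (snd s * ln x)).

Definition Gamma (z : C) : C :=
  Cint_gen (fun x => Cmult (cpow_pos x (Cminus z 1)) (RtoC (exp (- x))))
           (at_right 0) (Rbar_locally p_infty).

(* Riemann zeta function on Re s > 0, s <> 1, by its standard analytic
   continuation  zeta(s) = s/(s-1) - s int_1^oo {x} x^(-s-1) dx  *)
Definition zeta (s : C) : C :=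
  Cminus (Cdiv s (Cminus s 1))
    (Cmult s (Cint_gen (fun x => Cmult (RtoC (frac_part x))
                                     (cpow_pos x (Cminus (Copp s) 1)))
                       (at_point 1) (Rbar_locally p_infty))).

(* Riemann xi function xi(s) = 1/2 s (s-1) pi^(-s/2) Gamma(s/2) zeta(s),
   (valid for Re s > 0), with its removable singularity xi(1) = 1/2. *)
Definition xi (s : C) : C :=
  if Req_EM_T (fst s) 1 then
    if Req_EM_T (snd s) 0 then RtoC (1/2)
    else Cmult (Cmult (Cmult (Cmult (RtoC (1/2)) s) (Cminus s 1))
                 (Cmult (cpow_pos PI (Copp (Cdiv s 2))) (Gamma (Cdiv s 2))))
               (zeta s)
  else Cmult (Cmult (Cmult (Cmult (RtoC (1/2)) s) (Cminus s 1))
                 (Cmult (cpow_pos PI (Copp (Cdiv s 2))) (Gamma (Cdiv s 2))))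
               (zeta s).

Definition u (t beta : R) : R := fst (xi (1/2 + beta, t)).
Definition v (t beta : R) : R := snd (xi (1/2 + beta, t)).

Definition root_interval (f : R -> R) (a b : R) : Prop :=
  0 <= a /\ a < b /\ f a = 0 /\ f b = 0 /\
  (forall t, a < t < b -> 0 < Rabs (f t)).

(* Main.v *)
Require Import Defs.
From Stdlib Require Import Reals Lra Lia Psatz ZArith Arith Classical ClassicalEpsilon Machin.
From Coquelicot Require Import Coquelicot.
Open Scope R_scope.

(** Write [Xi z = xi (1/2 + z)]. It is the two-sided Laplace transform of the even function
    [Phi w = e^(w/2) sum_n (4 PI^2 n^4 e^(4w) - 6 PI n^2 e^(2w)) e^(- PI n^2 e^(2w))], and the
    integral may be taken along any horizontal line of the strip [|Im w| < PI/4].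

    Assume that [Xi] has no zero with positive real part. A Harnack inequality for [M - ln |Xi|] gives
    [|Xi (x + i y)| >= exp (- C (1 + |y|)^3)], which is enough to apply Phragmén-Lindelöf to
    [Xi (z - a) / Xi (z + a)] on [0 <= Re z <= 30]: its modulus is 1 on [Re z = 0] by the functional
    equation, and less than 1 on [Re z = 30] by the growth of Gamma. Letting [a] tend to 0, [|Xi|] is
    strictly increasing in the real part; at a zero of [u] this says [v * u' < 0], hence the
    alternation of the signs of [v] at the ends of a root-interval.

    Conversely, at a zero [beta + i a] of [Xi] both [u] and [v] vanish, so [a] is not an endpoint of
    a root-interval; since zeros of [u] are isolated, [a] is the only one. Then [u t] or
    [u t * (cosh (eta a) - cosh (eta t))] is nonnegative for all [t]. As [u t * cosh (y t)] is the Fourier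
    transform of [x |-> Re (Phi (x + i y) e^(beta (x + i y)))], Poisson summation shows that
    [h y = Phi (i y) cos (beta y)] satisfies [0 <= h y] or
    [h (y + eta) + h (y - eta) <= 2 cosh (eta a) h y]. Both are false for [eta = atan (1/19)] and
    [y = PI/4 - 2 eta], where the values of [Phi] at [i y], [i (y + eta)], [i (y - eta)] are about
    -17, -22 and 2.5. *)

(** * Integrals of tame functions over the real line *)

(** [Gamma] and [zeta] are given by improper real integrals, so contour shifts are done by hand,
    differentiating in a homotopy parameter, and the passage from [xi] to [Phi] avoids analytic
    continuation: the Dirichlet sums corrected by [N^(1-s)/(s-1)] converge to [zeta s] for all
    [Re s > 0], and the same truncation on the kernel side leaves an error that stays integrable. In
    the first implication the obstacle is the denominator. Nonvanishing of [Xi (z + a)] carries no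
    rate, and the maximum principle on an unbounded strip needs one; Harnack transports it from
    [Re z = 30], where every factor of [xi] is under explicit control: [zeta] is close to 1 and
    Gamma already grows. In the converse the only available information is the sign of a Fourier
    transform. Poisson summation with Cesaro means converts it into the sign of the function at 0
    without inverting the transform. The freedom in [y] supplies the contradiction: [Phi] is
    positive on the real axis, but oscillates near [i PI/4], where the terms of its series are large
    and alternate in sign. *)

Definition integral (f : R -> R) : R :=
  real (Lim_seq (fun n => RInt f (- INR n) (INR n))).

(** This majorant is used throughout because its primitive [K * atan x] turns every tail estimate
    into a difference of arctangents. *)
Definition dominated (K : R) (f : R -> R) : Prop :=
  forall x, Rabs (f x) <= K / (1 + x ^ 2).

(** A substitute for Lebesgue integrability that is closed under linear operations and makes the
    value of [integral] independent of the windows that exhaust the line. *)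
Definition tame (f : R -> R) : Prop :=
  (forall x, continuous f x) /\ exists K, dominated K f.

Lemma sq_pos1 (x : R) : 0 < 1 + x ^ 2.
Proof. nra. Qed.

Lemma dominated_nonneg (K : R) (f : R -> R) : dominated K f -> 0 <= K.
Proof.
  intros H. specialize (H 0). pose proof (Rabs_pos (f 0)).
  replace (K / (1 + 0 ^ 2)) with K in H by field. lra.
Qed.

Lemma cont_ex_RInt (f : R -> R) (a b : R) :
  (forall x, continuous f x) -> ex_RInt f a b.
Proof. intros H. apply (ex_RInt_continuous (V := R_CompleteNormedModule)); auto. Qed.

Lemma RInt_dominated (K : R) (f : R -> R) (a b : R) :
  (forall x, continuous f x) -> dominated K f -> a <= b ->
  Rabs (RInt f a b) <= K * (atan b - atan a).
Proof.
  intros Hc Hd Hab.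
  assert (Hk : is_RInt (fun x => K * / (1 + x ^ 2)) a b (K * (atan b - atan a))).
  { assert (H := is_RInt_derive (V := R_CompleteNormedModule) (fun x => K * atan x)
                   (fun x => K * / (1 + x ^ 2)) a b).
    replace (K * (atan b - atan a)) with (minus (K * atan b) (K * atan a))
      by (unfold minus, plus, opp; simpl; ring).
    apply H; intros x _.
    - auto_derive; auto. unfold Rsqr. simpl. field. nra.
    - apply (ex_derive_continuous (V := R_NormedModule)). auto_derive. simpl. nra. }
  eapply Rle_trans. { apply abs_RInt_le; auto. apply cont_ex_RInt; auto. }
  rewrite <- (is_RInt_unique _ _ _ _ Hk).
  apply RInt_le; auto.
  - apply cont_ex_RInt. intros x. apply continuous_comp; auto. apply continuous_Rabs.
  - eexists; apply Hk.
Qed.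

Lemma is_lim_seq_atan_p (u : nat -> R) :
  is_lim_seq u p_infty -> is_lim_seq (fun n => atan (u n)) (PI / 2).
Proof.
  intros Hu.
  apply is_lim_seq_ext_loc with (fun n => PI / 2 - atan (/ u n)).
  - apply is_lim_seq_spec in Hu. destruct (Hu 0) as [N HN]. exists N. intros n Hn.
    rewrite atan_inv by auto. ring.
  - replace (Finite (PI / 2)) with (Finite (PI / 2 - atan 0)) by (rewrite atan_0; f_equal; ring).
    apply is_lim_seq_minus'; [apply is_lim_seq_const|].
    apply (is_lim_seq_continuous atan).
    + apply continuity_pt_filterlim. apply continuous_atan.
    + replace (Finite 0) with (Rbar_inv p_infty) by reflexivity.
      apply is_lim_seq_inv; auto. discriminate.
Qed.

Lemma is_lim_seq_atan_m (u : nat -> R) :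
  is_lim_seq u m_infty -> is_lim_seq (fun n => atan (u n)) (- (PI / 2)).
Proof.
  intros Hu. apply is_lim_seq_ext with (fun n => - atan (- u n)).
  - intros n. rewrite atan_opp. ring.
  - apply (is_lim_seq_opp _ (PI / 2)). apply is_lim_seq_atan_p.
    apply (is_lim_seq_opp _ m_infty). exact Hu.
Qed.

Lemma RInt_gap (K : R) (f : R -> R) (a b c d : R) :
  (forall x, continuous f x) -> dominated K f -> c <= a -> a <= b -> b <= d ->
  Rabs (RInt f c d - RInt f a b) <= K * (atan a - atan c) + K * (atan d - atan b).
Proof.
  intros Hc Hd H1 H2 H3.
  assert (E : RInt f c d = RInt f c a + (RInt f a b + RInt f b d)).
  { rewrite <- (RInt_Chasles f c a d); try apply cont_ex_RInt; auto.
    rewrite <- (RInt_Chasles f a b d); try apply cont_ex_RInt; auto. }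
  replace (RInt f c d - RInt f a b) with (RInt f c a + RInt f b d) by lra.
  eapply Rle_trans; [apply Rabs_triang|].
  apply Rplus_le_compat; apply RInt_dominated; auto.
Qed.

Lemma integral_cv (f : R -> R) :
  tame f -> is_lim_seq (fun n => RInt f (- INR n) (INR n)) (integral f).
Proof.
  intros [Hc [K Hd]].
  apply Lim_seq_correct'.
  apply ex_lim_seq_cauchy_corr.
  assert (Hat : ex_lim_seq_cauchy (fun n => atan (INR n))).
  { apply ex_lim_seq_cauchy_corr. eexists. apply is_lim_seq_atan_p, is_lim_seq_INR. }
  pose proof (dominated_nonneg K f Hd) as HK.
  intros eps.
  (* The denominator [2 * K + 1] stays positive when [K = 0]. *)
  assert (He : 0 < eps / (2 * K + 1)). { apply Rdiv_lt_0_compat. apply cond_pos. lra. }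
  destruct (Hat (mkposreal _ He)) as [N HN]. exists N.
  assert (Hw : forall n m, (N <= n)%nat -> (n <= m)%nat ->
     Rabs (RInt f (- INR m) (INR m) - RInt f (- INR n) (INR n)) < eps).
  { intros n m Hn Hm.
    assert (HI := le_INR _ _ Hm). assert (H0 := pos_INR n).
    eapply Rle_lt_trans. { apply RInt_gap; eauto; lra. }
    rewrite !atan_opp.
    assert (Hs := HN m n ltac:(lia) Hn). simpl in Hs.
    assert (Hs2 : atan (INR m) - atan (INR n) < eps / (2 * K + 1)).
    { eapply Rle_lt_trans; [apply Rle_abs|apply Hs]. }
    assert (Hs3 : 0 <= atan (INR m) - atan (INR n)).
    { destruct HI as [HI|HI]; [|rewrite HI; lra]. apply atan_increasing in HI. lra. }
    assert (Hs4 : (2 * K + 1) * (atan (INR m) - atan (INR n)) < eps).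
    { apply Rmult_lt_compat_l with (r := 2 * K + 1) in Hs2; [|lra].
      replace ((2 * K + 1) * (eps / (2 * K + 1))) with (pos eps) in Hs2 by (field; lra). lra. }
    nra. }
  intros n m Hn Hm. destruct (Nat.le_ge_cases n m).
  - rewrite Rabs_minus_sym. apply Hw; auto.
  - apply Hw; auto.
Qed.

Lemma integral_tail (K : R) (f : R -> R) (a b : R) :
  (forall x, continuous f x) -> dominated K f -> a <= b ->
  Rabs (integral f - RInt f a b) <= K * (PI / 2 + atan a) + K * (PI / 2 - atan b).
Proof.
  intros Hc Hd Hab.
  assert (Hl : is_lim_seq (fun n => Rabs (RInt f (- INR n) (INR n) - RInt f a b))
                 (Rabs (integral f - RInt f a b))).
  { apply (is_lim_seq_abs _ (integral f - RInt f a b)).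
    apply is_lim_seq_minus'. apply integral_cv; split; eauto. apply is_lim_seq_const. }
  apply (is_lim_seq_le_loc _ (fun _ => K * (PI / 2 + atan a) + K * (PI / 2 - atan b)) _ _)
    with (3 := is_lim_seq_const _) (2 := Hl).
  destruct (INR_unbounded (Rabs a + Rabs b)) as [N HN].
  exists N. intros n Hn. apply le_INR in Hn.
  pose proof (dominated_nonneg K f Hd) as HK.
  assert (- INR n <= a) by (unfold Rabs in HN; destruct (Rcase_abs a), (Rcase_abs b); lra).
  assert (b <= INR n) by (unfold Rabs in HN; destruct (Rcase_abs a), (Rcase_abs b); lra).
  eapply Rle_trans. { apply RInt_gap; eauto. }
  destruct (atan_bound (INR n)), (atan_bound (- INR n)). nra.
Qed.

Lemma integral_bound (K : R) (f : R -> R) :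
  (forall x, continuous f x) -> dominated K f -> Rabs (integral f) <= 4 * K.
Proof.
  intros Hc Hd. assert (H := integral_tail K f 0 0 Hc Hd (Rle_refl 0)).
  rewrite RInt_point, atan_0 in H. pose proof (dominated_nonneg K f Hd).
  unfold zero in H; simpl in H. rewrite Rminus_0_r in H. pose proof PI_4. nra.
Qed.

Lemma integral_cv_gen (f : R -> R) (a b : nat -> R) :
  tame f -> is_lim_seq a m_infty -> is_lim_seq b p_infty ->
  is_lim_seq (fun n => RInt f (a n) (b n)) (integral f).
Proof.
  intros [Hc [K Hd]] Ha Hb.
  assert (Hz : is_lim_seq (fun n => K * (PI / 2 + atan (a n)) + K * (PI / 2 - atan (b n))) 0).
  { replace 0 with (K * (PI / 2 + - (PI / 2)) + K * (PI / 2 - PI / 2)) by ring.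
    apply is_lim_seq_plus'; apply (is_lim_seq_scal_l _ _ (Finite _)).
    - apply is_lim_seq_plus'; [apply is_lim_seq_const|].
      apply is_lim_seq_atan_m; auto.
    - apply is_lim_seq_minus'; [apply is_lim_seq_const|].
      apply is_lim_seq_atan_p; auto. }
  apply is_lim_seq_ext with (fun n => integral f - (integral f - RInt f (a n) (b n))).
  { intros n; ring. }
  replace (Finite (integral f)) with (Finite (integral f - 0)) by (f_equal; ring).
  apply is_lim_seq_minus'; [apply is_lim_seq_const|].
  apply is_lim_seq_abs_0.
  apply is_lim_seq_le_le_loc with (u := fun _ => 0) (3 := Hz); [|apply is_lim_seq_const].
  assert (H1 : eventually (fun n => a n < 0)).
  { apply is_lim_seq_spec in Ha. apply (Ha 0). }
  assert (H2 : eventually (fun n => 0 < b n)).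
  { apply is_lim_seq_spec in Hb. apply (Hb 0). }
  destruct H1 as [N1 H1], H2 as [N2 H2]. exists (max N1 N2). intros n Hn. split.
  - apply Rabs_pos.
  - apply integral_tail; auto. assert (a n < 0) by (apply H1; lia).
    assert (0 < b n) by (apply H2; lia). lra.
Qed.

Lemma integral_unique (f : R -> R) (l : R) :
  is_lim_seq (fun n => RInt f (- INR n) (INR n)) l -> integral f = l.
Proof. intros H. unfold integral. rewrite (is_lim_seq_unique _ _ H). reflexivity. Qed.

Lemma integral_ext (f g : R -> R) : (forall x, f x = g x) -> integral f = integral g.
Proof.
  intros H. unfold integral. f_equal. apply Lim_seq_ext. intros n.
  apply RInt_ext. intros; apply H.
Qed.

Lemma tame_ext (f g : R -> R) : (forall x, f x = g x) -> tame f -> tame g.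
Proof.
  intros H [Hc [K Hd]]. split.
  - intros x. apply continuous_ext with f; auto.
  - exists K. intros x. rewrite <- H. apply Hd.
Qed.

Lemma tame_plus (f g : R -> R) : tame f -> tame g -> tame (fun x => f x + g x).
Proof.
  intros [Hf [K Hk]] [Hg [L Hl]]. split.
  - intros x. apply (continuous_plus (V := R_NormedModule)); auto.
  - exists (K + L). intros x. eapply Rle_trans; [apply Rabs_triang|].
    replace ((K + L) / (1 + x ^ 2)) with (K / (1 + x ^ 2) + L / (1 + x ^ 2))
      by (field; pose proof (sq_pos1 x); lra).
    apply Rplus_le_compat; auto.
Qed.

Lemma tame_scal (c : R) (f : R -> R) : tame f -> tame (fun x => c * f x).
Proof.
  intros [Hf [K Hk]]. split.
  - intros x. apply (continuous_scal_r (V := R_NormedModule)); auto.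
  - exists (Rabs c * K). intros x. rewrite Rabs_mult. unfold Rdiv. rewrite Rmult_assoc.
    apply Rmult_le_compat_l. apply Rabs_pos. apply Hk.
Qed.

Lemma tame_minus (f g : R -> R) : tame f -> tame g -> tame (fun x => f x - g x).
Proof.
  intros Hf Hg. apply tame_ext with (fun x => f x + (-1) * g x). intros; ring.
  apply tame_plus; auto. apply tame_scal; auto.
Qed.

Lemma tame_mult_bounded (f g : R -> R) (M : R) :
  tame f -> (forall x, continuous g x) -> (forall x, Rabs (g x) <= M) -> tame (fun x => f x * g x).
Proof.
  intros [Hf [K Hk]] Hg HM. split.
  - intros x. apply (continuous_mult (K := R_AbsRing)); auto.
  - exists (K * M). intros x. rewrite Rabs_mult.
    replace (K * M / (1 + x ^ 2)) with (K / (1 + x ^ 2) * M) by (field; pose proof (sq_pos1 x); lra).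
    apply Rmult_le_compat; auto; apply Rabs_pos.
Qed.

Lemma integral_plus (f g : R -> R) :
  tame f -> tame g -> integral (fun x => f x + g x) = integral f + integral g.
Proof.
  intros Hf Hg. apply integral_unique.
  apply is_lim_seq_ext with (fun n => RInt f (- INR n) (INR n) + RInt g (- INR n) (INR n)).
  - intros n. symmetry. apply (RInt_plus (V := R_CompleteNormedModule));
      apply cont_ex_RInt; [apply Hf|apply Hg].
  - apply is_lim_seq_plus'; apply integral_cv; auto.
Qed.

Lemma integral_scal (c : R) (f : R -> R) :
  tame f -> integral (fun x => c * f x) = c * integral f.
Proof.
  intros Hf. apply integral_unique.
  apply is_lim_seq_ext with (fun n => c * RInt f (- INR n) (INR n)).
  - intros n. symmetry. apply (RInt_scal (V := R_CompleteNormedModule)).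
    apply cont_ex_RInt; apply Hf.
  - apply (is_lim_seq_scal_l _ c (Finite _)); apply integral_cv; auto.
Qed.

Lemma integral_minus (f g : R -> R) :
  tame f -> tame g -> integral (fun x => f x - g x) = integral f - integral g.
Proof.
  intros Hf Hg.
  rewrite (integral_ext _ (fun x => f x + (-1) * g x)) by (intros; ring).
  rewrite integral_plus, integral_scal; auto. ring. apply tame_scal; auto.
Qed.

Lemma integral_le (f g : R -> R) :
  tame f -> tame g -> (forall x, f x <= g x) -> integral f <= integral g.
Proof.
  intros Hf Hg H.
  apply (is_lim_seq_le _ _ (integral f) (integral g) (fun n =>
    RInt_le f g (- INR n) (INR n) ltac:(pose proof (pos_INR n); lra)
      (cont_ex_RInt f _ _ (proj1 Hf)) (cont_ex_RInt g _ _ (proj1 Hg)) (fun x _ => H x))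
    (integral_cv f Hf) (integral_cv g Hg)).
Qed.

Lemma tame_0 : tame (fun _ => 0).
Proof.
  split. intros x; apply continuous_const.
  exists 0. intros x. rewrite Rabs_R0. unfold Rdiv; rewrite Rmult_0_l. lra.
Qed.

Lemma integral_0 : integral (fun _ => 0) = 0.
Proof.
  rewrite (integral_ext _ (fun x => 0 * 0)) by (intros; ring).
  rewrite integral_scal by apply tame_0. ring.
Qed.

Lemma integral_ge_0 (f : R -> R) : tame f -> (forall x, 0 <= f x) -> 0 <= integral f.
Proof. intros Hf H. rewrite <- integral_0. apply integral_le; auto. apply tame_0. Qed.

Lemma integral_ge_RInt (f : R -> R) (a b : R) :
  tame f -> (forall x, 0 <= f x) -> a <= b -> RInt f a b <= integral f.
Proof.
  intros Hf H Hab.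
  apply (is_lim_seq_le_loc (fun _ => RInt f a b) _ (RInt f a b) (integral f))
    with (2 := is_lim_seq_const _) (3 := integral_cv f Hf).
  destruct (INR_unbounded (Rabs a + Rabs b)) as [N HN].
  exists N. intros n Hn. apply le_INR in Hn.
  assert (- INR n <= a) by (unfold Rabs in HN; destruct (Rcase_abs a), (Rcase_abs b); lra).
  assert (b <= INR n) by (unfold Rabs in HN; destruct (Rcase_abs a), (Rcase_abs b); lra).
  destruct Hf as [Hc _].
  assert (E : RInt f (- INR n) (INR n) = RInt f (- INR n) a + (RInt f a b + RInt f b (INR n))).
  { rewrite <- (RInt_Chasles f (- INR n) a (INR n)); try apply cont_ex_RInt; auto.
    rewrite <- (RInt_Chasles f a b (INR n)); try apply cont_ex_RInt; auto. }
  rewrite E.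
  assert (0 <= RInt f (- INR n) a) by (apply RInt_ge_0; auto; apply cont_ex_RInt; auto).
  assert (0 <= RInt f b (INR n)) by (apply RInt_ge_0; auto; apply cont_ex_RInt; auto).
  lra.
Qed.

Lemma integral_gt_0 (f : R -> R) :
  tame f -> (forall x, 0 < f x) -> 0 < integral f.
Proof.
  intros Hf H.
  assert (H1 : RInt f 0 1 <= integral f).
  { apply integral_ge_RInt; auto. intros; left; auto. lra. }
  assert (H2 : 0 < RInt f 0 1). { apply RInt_gt_0; auto. lra. intros; apply Hf. }
  lra.
Qed.

(** Integration by parts on the whole line in its usual disguise: the boundary values of the
    primitive tend to 0. *)
Lemma integral_derivative (F f : R -> R) (K : R) :
  (forall x, is_derive F x (f x)) -> tame f -> dominated K F -> integral f = 0.
Proof.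
  intros HF Hf HK. apply integral_unique.
  assert (HD : forall (s : R), s = 1 \/ s = -1 -> is_lim_seq (fun n => F (s * INR n)) 0).
  { intros s Hs. apply is_lim_seq_abs_0.
    apply is_lim_seq_le_le_loc with (u := fun _ => 0) (w := fun n => K * / INR n).
    - exists 1%nat. intros n Hn. split. apply Rabs_pos.
      eapply Rle_trans; [apply HK|]. apply Rmult_le_compat_l.
      eapply dominated_nonneg; eauto.
      apply le_INR in Hn. simpl in Hn. apply Rinv_le_contravar. lra. destruct Hs; subst; nra.
    - apply is_lim_seq_const.
    - replace (Finite 0) with (Rbar_mult K 0) by (simpl; f_equal; ring).
      apply is_lim_seq_scal_l.
      replace (Finite 0) with (Rbar_inv p_infty) by reflexivity.
      apply is_lim_seq_inv. apply is_lim_seq_INR. discriminate. }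
  apply is_lim_seq_ext with (fun n => F (1 * INR n) - F (-1 * INR n)).
  - intros n. symmetry. apply is_RInt_unique.
    replace (-1 * INR n) with (- INR n) by ring. rewrite Rmult_1_l.
    apply (is_RInt_derive (V := R_CompleteNormedModule)); intros; auto. apply Hf.
  - replace (Finite 0) with (Finite (0 - 0)) by (f_equal; ring).
    apply is_lim_seq_minus'; apply HD; auto.
Qed.

Lemma integral_affine (f : R -> R) (L c : R) :
  0 < L -> tame f -> tame (fun x => f (L * x + c)) ->
  integral (fun x => f (L * x + c)) = / L * integral f.
Proof.
  intros HL Hf Hg. apply integral_unique.
  apply is_lim_seq_ext with (fun n => / L * RInt f (L * (- INR n) + c) (L * INR n + c)).
  - intros n. rewrite <- (RInt_comp_lin (V := R_CompleteNormedModule)) by (apply cont_ex_RInt; apply Hf).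
    rewrite <- (RInt_scal (V := R_CompleteNormedModule)).
    + apply RInt_ext. intros x _. unfold scal; simpl; unfold mult; simpl. field. lra.
    + apply cont_ex_RInt. intros x. apply (continuous_scal_r (V := R_NormedModule)). apply Hg.
  - apply (is_lim_seq_scal_l _ (/ L) (Finite _)). apply integral_cv_gen; auto.
    + apply is_lim_seq_spec. intros M.
      destruct (INR_unbounded ((Rabs M + Rabs c) / L)) as [N HN]. exists N. intros n Hn. apply le_INR in Hn.
      apply Rmult_lt_compat_l with (r := L) in HN; auto.
      replace (L * ((Rabs M + Rabs c) / L)) with (Rabs M + Rabs c) in HN by (field; lra).
      assert (L * INR N <= L * INR n) by nra.
      unfold Rabs in HN; destruct (Rcase_abs M), (Rcase_abs c); lra.
    + apply is_lim_seq_spec. intros M.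
      destruct (INR_unbounded ((Rabs M + Rabs c) / L)) as [N HN]. exists N. intros n Hn. apply le_INR in Hn.
      apply Rmult_lt_compat_l with (r := L) in HN; auto.
      replace (L * ((Rabs M + Rabs c) / L)) with (Rabs M + Rabs c) in HN by (field; lra).
      assert (L * INR N <= L * INR n) by nra.
      unfold Rabs in HN; destruct (Rcase_abs M), (Rcase_abs c); lra.
Qed.

Lemma is_derive_lim_0 (f : R -> R) (x l : R) (K : R) :
  (forall h, Rabs h <= 1 -> Rabs (f (x + h) - f x - h * l) <= K * h ^ 2) -> is_derive f x l.
Proof.
  intros H.
  assert (HK : 0 <= K).
  { specialize (H 1). rewrite Rabs_R1 in H. pose proof (Rabs_pos (f (x + 1) - f x - 1 * l)).
    specialize (H (Rle_refl 1)). lra. }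
  apply is_derive_Reals. intros eps Heps.
  assert (Hd : 0 < Rmin 1 (eps / (K + 1))).
  { apply Rmin_pos. lra. apply Rdiv_lt_0_compat; lra. }
  exists (mkposreal _ Hd). intros h Hh Hlt. simpl in Hlt.
  assert (H1 : Rabs h < 1) by (eapply Rlt_le_trans; [apply Hlt|apply Rmin_l]).
  assert (H2 : Rabs h < eps / (K + 1)) by (eapply Rlt_le_trans; [apply Hlt|apply Rmin_r]).
  replace ((f (x + h) - f x) / h - l) with ((f (x + h) - f x - h * l) / h) by (field; auto).
  unfold Rdiv. rewrite Rabs_mult, Rabs_inv.
  assert (Hp : 0 < Rabs h) by (apply Rabs_pos_lt; auto).
  apply Rmult_lt_reg_r with (Rabs h); auto. rewrite Rmult_assoc, Rinv_l, Rmult_1_r by lra.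
  eapply Rle_lt_trans; [apply H; lra|].
  rewrite <- Rsqr_pow2, Rsqr_abs. unfold Rsqr. rewrite <- Rmult_assoc.
  apply Rmult_lt_compat_r; auto.
  apply Rmult_lt_compat_l with (r := K + 1) in H2; [|lra].
  replace ((K + 1) * (eps / (K + 1))) with eps in H2 by (field; lra). lra.
Qed.

Lemma taylor1_bound (g g1 g2 : R -> R) (x B : R) :
  (forall t, is_derive g t (g1 t)) -> (forall t, is_derive g1 t (g2 t)) ->
  (forall t, Rabs (t - x) <= 1 -> Rabs (g2 t) <= B) ->
  forall h, Rabs h <= 1 -> Rabs (g (x + h) - g x - h * g1 x) <= B * h ^ 2.
Proof.
  intros H1 H2 HB h Hh.
  destruct (MVT_cor4 (fun t => g t - t * g1 x) (fun t => g1 t - g1 x) x (Rabs h)) with (b := x + h)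
    as [c [Hc1 Hc2]].
  - intros c _. apply (is_derive_minus (K := R_AbsRing) (V := R_NormedModule) g (fun t => t * g1 x)); auto.
    auto_derive; auto. ring.
  - right. f_equal. ring.
  - replace (x + h - x) with h in * by ring.
    replace (g (x + h) - g x - h * g1 x) with (g (x + h) - (x + h) * g1 x - (g x - x * g1 x)) by ring.
    rewrite Hc1.
    destruct (MVT_cor4 g1 g2 x (Rabs h)) with (b := c) as [d [Hd1 Hd2]]; auto.
    rewrite Hd1, !Rabs_mult.
    assert (Hb := HB d ltac:(lra)).
    rewrite <- Rsqr_pow2, Rsqr_abs. unfold Rsqr.
    pose proof (Rabs_pos (g2 d)). pose proof (Rabs_pos (c - x)). pose proof (Rabs_pos h).
    apply Rle_trans with (B * Rabs h * Rabs h); [|right; ring].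
    apply Rmult_le_compat_r; auto. apply Rmult_le_compat; auto.
Qed.

(** Differentiation under the integral sign: a majorant of the second derivative, uniform for [t]
    within distance 1 of [x], makes the integrated first-order Taylor remainder [O(h^2)]. *)
Lemma integral_is_derive (f f1 f2 : R -> R -> R) (x K : R) :
  (forall t w, is_derive (fun t => f t w) t (f1 t w)) ->
  (forall t w, is_derive (fun t => f1 t w) t (f2 t w)) ->
  (forall t, tame (f t)) -> tame (f1 x) ->
  (forall t, Rabs (t - x) <= 1 -> dominated K (f2 t)) ->
  is_derive (fun t => integral (f t)) x (integral (f1 x)).
Proof.
  intros H1 H2 Hf Hf1 HK.
  apply is_derive_lim_0 with (4 * K). intros h Hh.
  assert (Ht : tame (fun w => f (x + h) w - f x w - h * f1 x w)).
  { apply tame_minus. apply tame_minus; auto. apply tame_scal; auto. }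
  replace (integral (f (x + h)) - integral (f x) - h * integral (f1 x))
    with (integral (fun w => f (x + h) w - f x w - h * f1 x w)).
  2:{ rewrite integral_minus, integral_minus, integral_scal; auto.
      apply tame_minus; auto. apply tame_scal; auto. }
  rewrite Rmult_assoc. apply integral_bound. apply Ht.
  intros w. unfold Rdiv. replace (K * h ^ 2 * / (1 + w ^ 2)) with (K / (1 + w ^ 2) * h ^ 2) by (unfold Rdiv; ring).
  apply (taylor1_bound (fun t => f t w) (fun t => f1 t w) (fun t => f2 t w)); auto.
  intros t Ht'. apply HK; auto.
Qed.

(** Cauchy's theorem in real form: [P dx + Q dt] is a closed form, [D] being both [dP/dt] and
    [dQ/dx]. The integral of [P] over a window changes with [t] only through [Q] at the two ends,
    and these contributions vanish as the window grows. *)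
Lemma integral_homotopy (P D Q : R -> R -> R) (K : R) :
  (forall x t, is_derive (fun t => P x t) t (D x t)) ->
  (forall x t, is_derive (fun x => Q x t) x (D x t)) ->
  (forall x t, continuity_2d_pt D x t) ->
  (forall x t, continuous (fun x => P x t) x) ->
  tame (fun x => P x 0) -> tame (fun x => P x 1) ->
  (forall x t, 0 <= t <= 1 -> Rabs (Q x t) <= K / (1 + x ^ 2)) ->
  integral (fun x => P x 0) = integral (fun x => P x 1).
Proof.
  intros HP HQ HD HPc H0 H1 HK.
  assert (HK0 : 0 <= K).
  { specialize (HK 0 0 ltac:(lra)). pose proof (Rabs_pos (Q 0 0)).
    replace (K / (1 + 0 ^ 2)) with K in HK by field. lra. }
  assert (HDc : forall x t, continuous (fun x => D x t) x).
  { intros x t. apply continuity_pt_filterlim. specialize (HD x t). intros eps Heps.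
    destruct (HD (mkposreal _ Heps)) as [d Hd]. exists d. split. apply cond_pos.
    intros y [_ Hy]. simpl in *. unfold Rdist in *. apply Hd; auto.
    replace (t - t) with 0 by ring. rewrite Rabs_R0. apply cond_pos. }
  assert (HJ : forall n, Rabs (RInt (fun x => P x 1) (- INR n) (INR n)
                     - RInt (fun x => P x 0) (- INR n) (INR n)) <= 2 * (K / (1 + INR n ^ 2))).
  { intros n.
    destruct (MVT_gen (fun t => RInt (fun x => P x t) (- INR n) (INR n)) 0 1
              (fun t => Q (INR n) t - Q (- INR n) t)) as [c [Hc1 Hc2]].
    - intros t _.
      assert (E : RInt (fun x => Derive (fun t => P x t) t) (- INR n) (INR n)
                 = Q (INR n) t - Q (- INR n) t).
      { apply is_RInt_unique. apply (is_RInt_ext (fun x => D x t)).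
        - intros x _. symmetry. apply is_derive_unique. apply HP.
        - apply (is_RInt_derive (V := R_CompleteNormedModule) (fun x => Q x t)); intros; auto. }
      rewrite <- E.
      apply (is_derive_RInt_param (fun t x => P x t)).
      + exists (mkposreal _ Rlt_0_1). intros s _ x _. eexists. apply HP.
      + intros x _. apply continuity_2d_pt_ext with (fun t x => D x t).
        * intros s y. symmetry. apply is_derive_unique. apply HP.
        * intros eps. destruct (HD x t eps) as [d Hd]. exists d. intros s y Hs Hy. apply Hd; auto.
      + exists (mkposreal _ Rlt_0_1). intros s _. apply cont_ex_RInt. auto.
    - intros t _. apply continuity_pt_filterlim.
      apply (ex_derive_continuous (V := R_NormedModule) (fun t => RInt (fun x => P x t) (- INR n) (INR n))).
      eexists.
      apply (is_derive_RInt_param (fun t x => P x t)).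
      + exists (mkposreal _ Rlt_0_1). intros s _ x _. eexists. apply HP.
      + intros x _. apply continuity_2d_pt_ext with (fun t x => D x t).
        * intros s y. symmetry. apply is_derive_unique. apply HP.
        * intros eps. destruct (HD x t eps) as [d Hd]. exists d. intros s y Hs Hy. apply Hd; auto.
      + exists (mkposreal _ Rlt_0_1). intros s _. apply cont_ex_RInt. auto.
    - rewrite Rmin_left, Rmax_right in Hc1 by lra.
      rewrite Hc2. rewrite Rminus_0_r, Rmult_1_r.
      assert (A1 := HK (INR n) c Hc1). assert (A2 := HK (- INR n) c Hc1).
      replace ((- INR n) ^ 2) with (INR n ^ 2) in A2 by ring.
      eapply Rle_trans; [apply Rabs_triang|]. rewrite Rabs_Ropp. lra. }
  assert (Hl : is_lim_seq (fun n => RInt (fun x => P x 1) (- INR n) (INR n)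
                     - RInt (fun x => P x 0) (- INR n) (INR n))
       (integral (fun x => P x 1) - integral (fun x => P x 0))).
  { apply is_lim_seq_minus'; apply integral_cv; auto. }
  assert (Hz : is_lim_seq (fun n => RInt (fun x => P x 1) (- INR n) (INR n)
                     - RInt (fun x => P x 0) (- INR n) (INR n)) 0).
  { apply is_lim_seq_abs_0.
    apply is_lim_seq_le_le_loc with (u := fun _ => 0) (w := fun n => (2 * K) * / INR n).
    - exists 1%nat. intros n Hn. split. apply Rabs_pos.
      eapply Rle_trans; [apply HJ|]. unfold Rdiv. rewrite <- Rmult_assoc. apply Rmult_le_compat_l. lra.
      apply le_INR in Hn. simpl in Hn. apply Rinv_le_contravar; nra.
    - apply is_lim_seq_const.
    - replace (Finite 0) with (Rbar_mult (2 * K) 0) by (simpl; f_equal; ring).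
      apply is_lim_seq_scal_l.
      replace (Finite 0) with (Rbar_inv p_infty) by reflexivity.
      apply is_lim_seq_inv. apply is_lim_seq_INR. discriminate. }
  assert (E := is_lim_seq_unique _ _ Hl). rewrite (is_lim_seq_unique _ _ Hz) in E.
  injection E. lra.
Qed.

Lemma C_ext (z w : C) : fst z = fst w -> snd z = snd w -> z = w.
Proof. destruct z, w; simpl; intros; subst; auto. Qed.

(** * The complex exponential *)

Definition Cexp (z : C) : C := (exp (fst z) * cos (snd z), exp (fst z) * sin (snd z)).

Lemma Cexp_plus (z w : C) : Cexp (z + w) = (Cexp z * Cexp w)%C.
Proof.
  apply C_ext; unfold Cexp, Cmult, Cplus; simpl; rewrite exp_plus.
  - rewrite cos_plus. ring.
  - rewrite sin_plus. ring.
Qed.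

Lemma Cexp_0 : Cexp 0 = 1%C.
Proof. apply C_ext; unfold Cexp; simpl; rewrite exp_0, ?cos_0, ?sin_0; ring. Qed.

Lemma Cmod_Cexp (z : C) : Cmod (Cexp z) = exp (fst z).
Proof.
  unfold Cmod, Cexp; simpl fst; simpl snd.
  replace ((exp (fst z) * cos (snd z)) ^ 2 + (exp (fst z) * sin (snd z)) ^ 2)
    with (exp (fst z) ^ 2).
  - apply sqrt_pow2. left; apply exp_pos.
  - pose proof (sin2_cos2 (snd z)). unfold Rsqr in H. nra.
Qed.

Lemma Cexp_neq_0 (z : C) : Cexp z <> 0%C.
Proof. apply Cmod_gt_0. rewrite Cmod_Cexp. apply exp_pos. Qed.

Lemma Cexp_opp (z : C) : Cexp (- z) = (/ Cexp z)%C.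
Proof.
  assert (H : (Cexp (- z) * Cexp z)%C = 1%C).
  { rewrite <- Cexp_plus, <- Cexp_0. f_equal. ring. }
  pose proof (Cexp_neq_0 z).
  rewrite <- (Cmult_1_r (Cexp (- z))), <- (Cinv_r (Cexp z)), Cmult_assoc, H; auto. ring.
Qed.

Lemma Cexp_R (x : R) : Cexp x = RtoC (exp x).
Proof. apply C_ext; unfold Cexp; simpl; rewrite ?cos_0, ?sin_0; ring. Qed.

Lemma fst_Cmod (z : C) : Rabs (fst z) <= Cmod z.
Proof. apply re_le_Cmod. Qed.

Lemma snd_Cmod (z : C) : Rabs (snd z) <= Cmod z.
Proof. eapply Rle_trans; [apply Rmax_r|apply Rmax_Cmod]. Qed.

Lemma Cmod_le_sum (z : C) : Cmod z <= Rabs (fst z) + Rabs (snd z).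
Proof.
  replace z with (RtoC (fst z) + RtoC (snd z) * Ci)%C at 1.
  - eapply Rle_trans; [apply Cmod_triangle|].
    rewrite Cmod_mult, Cmod_Ci, !Cmod_R. lra.
  - apply C_ext; simpl; ring.
Qed.

(** * Derivatives and integrals of complex functions of a real variable *)

Definition Cder (f : R -> C) (x : R) (l : C) : Prop :=
  is_derive (fun t => fst (f t)) x (fst l) /\ is_derive (fun t => snd (f t)) x (snd l).

Lemma Cder_eq (f : R -> C) (x : R) (l l' : C) : Cder f x l -> l = l' -> Cder f x l'.
Proof. intros H <-; auto. Qed.

Lemma Cder_ext (f g : R -> C) (x : R) (l : C) :
  (forall t, f t = g t) -> Cder f x l -> Cder g x l.
Proof.
  intros H [H1 H2]. split.
  - apply is_derive_ext with (fun t => fst (f t)); auto. intros; rewrite H; auto.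
  - apply is_derive_ext with (fun t => snd (f t)); auto. intros; rewrite H; auto.
Qed.

Lemma Cder_const (c : C) (x : R) : Cder (fun _ => c) x 0%C.
Proof. split; apply (is_derive_const (K := R_AbsRing) (V := R_NormedModule)). Qed.

Lemma Cder_RtoC (f : R -> R) (x l : R) : is_derive f x l -> Cder (fun t => RtoC (f t)) x (RtoC l).
Proof. intros H; split; simpl; auto. apply (is_derive_const (K := R_AbsRing) (V := R_NormedModule)). Qed.

Lemma Cder_id (x : R) : Cder (fun t => RtoC t) x 1%C.
Proof. apply Cder_RtoC. apply (is_derive_id (K := R_AbsRing)). Qed.

Lemma Cder_plus (f g : R -> C) (x : R) (l m : C) :
  Cder f x l -> Cder g x m -> Cder (fun t => f t + g t)%C x (l + m)%C.
Proof.
  intros [H1 H2] [H3 H4].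
  split; simpl; apply (is_derive_plus (K := R_AbsRing) (V := R_NormedModule)); auto.
Qed.

Lemma Cder_opp (f : R -> C) (x : R) (l : C) : Cder f x l -> Cder (fun t => - f t)%C x (- l)%C.
Proof.
  intros [H1 H2].
  split; simpl; apply (is_derive_opp (K := R_AbsRing) (V := R_NormedModule)); auto.
Qed.

Lemma Cder_minus (f g : R -> C) (x : R) (l m : C) :
  Cder f x l -> Cder g x m -> Cder (fun t => f t - g t)%C x (l - m)%C.
Proof. intros H1 H2. apply Cder_plus; auto. apply Cder_opp; auto. Qed.

Lemma Rder_mult (f g : R -> R) (x l m : R) :
  is_derive f x l -> is_derive g x m -> is_derive (fun t => f t * g t) x (l * g x + f x * m).
Proof.
  intros H1 H2. apply (is_derive_mult (K := R_AbsRing)); auto.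
  intros; unfold mult; simpl; ring.
Qed.

Lemma Cder_mult (f g : R -> C) (x : R) (l m : C) :
  Cder f x l -> Cder g x m -> Cder (fun t => f t * g t)%C x (l * g x + f x * m)%C.
Proof.
  intros [H1 H2] [H3 H4]. split; simpl.
  - assert (H := is_derive_minus (K := R_AbsRing) (V := R_NormedModule) _ _ _ _ _
      (Rder_mult _ _ _ _ _ H1 H3) (Rder_mult _ _ _ _ _ H2 H4)).
    unfold minus, plus, opp in H; simpl in H.
    evar_last. apply H. ring.
  - assert (H := is_derive_plus (K := R_AbsRing) (V := R_NormedModule) _ _ _ _ _
      (Rder_mult _ _ _ _ _ H1 H4) (Rder_mult _ _ _ _ _ H2 H3)).
    unfold plus in H; simpl in H.
    evar_last. apply H. ring.
Qed.

Lemma Cder_Cexp (f : R -> C) (x : R) (l : C) :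
  Cder f x l -> Cder (fun t => Cexp (f t)) x (l * Cexp (f x))%C.
Proof.
  intros [H1 H2].
  assert (He : is_derive (fun t => exp (fst (f t))) x (fst l * exp (fst (f x)))).
  { apply (is_derive_comp (K := R_AbsRing) (V := R_NormedModule) exp); auto. apply is_derive_exp. }
  assert (Hc : is_derive (fun t => cos (snd (f t))) x (snd l * - sin (snd (f x)))).
  { apply (is_derive_comp (K := R_AbsRing) (V := R_NormedModule) cos); auto. apply is_derive_cos. }
  assert (Hs : is_derive (fun t => sin (snd (f t))) x (snd l * cos (snd (f x)))).
  { apply (is_derive_comp (K := R_AbsRing) (V := R_NormedModule) sin); auto. apply is_derive_sin. }
  split; unfold Cexp; simpl.
  - evar_last. apply (Rder_mult _ _ _ _ _ He Hc). ring.
  - evar_last. apply (Rder_mult _ _ _ _ _ He Hs). ring.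
Qed.

(** Builds the derivative by recursion on the expression; [Cder_eq] then leaves an identity for
    [ring] against the expected form. *)
Ltac cder :=
  lazymatch goal with
  | |- Cder (fun _ => ?c) _ _ => apply (Cder_const c)
  | |- Cder (fun t => RtoC t) _ _ => apply Cder_id
  | |- Cder RtoC _ _ => apply Cder_id
  | |- Cder (fun t => Cplus (@?f t) (@?g t)) _ _ => apply (Cder_plus f g); cder
  | |- Cder (fun t => Cminus (@?f t) (@?g t)) _ _ => apply (Cder_minus f g); cder
  | |- Cder (fun t => Copp (@?f t)) _ _ => apply (Cder_opp f); cder
  | |- Cder (fun t => Cmult (@?f t) (@?g t)) _ _ => apply (Cder_mult f g); cder
  | |- Cder (fun t => Cexp (@?f t)) _ _ => apply (Cder_Cexp f); cder
  end.

Definition Ccont (f : R -> C) : Prop :=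
  forall x, continuous (fun t => fst (f t)) x /\ continuous (fun t => snd (f t)) x.

Lemma Ccont_mult (f g : R -> C) : Ccont f -> Ccont g -> Ccont (fun x => f x * g x)%C.
Proof.
  intros Hf Hg x. destruct (Hf x), (Hg x). split; simpl.
  - apply (continuous_minus (V := R_NormedModule));
      apply (continuous_mult (K := R_AbsRing)); auto.
  - apply (continuous_plus (V := R_NormedModule));
      apply (continuous_mult (K := R_AbsRing)); auto.
Qed.

Lemma Ccont_plus (f g : R -> C) : Ccont f -> Ccont g -> Ccont (fun x => f x + g x)%C.
Proof.
  intros Hf Hg x. destruct (Hf x), (Hg x).
  split; simpl; apply (continuous_plus (V := R_NormedModule)); auto.
Qed.

Definition Cintegral (f : R -> C) : C :=
  (integral (fun x => fst (f x)), integral (fun x => snd (f x))).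

Definition Ctame (f : R -> C) : Prop :=
  tame (fun x => fst (f x)) /\ tame (fun x => snd (f x)).

Lemma Ctame_intro (f : R -> C) (K : R) :
  Ccont f -> (forall x, Cmod (f x) <= K / (1 + x ^ 2)) -> Ctame f.
Proof.
  intros Hc HK. split; (split; [intros x; apply Hc|exists K; intros x]).
  - eapply Rle_trans; [apply fst_Cmod|auto].
  - eapply Rle_trans; [apply snd_Cmod|auto].
Qed.

Lemma Ctame_cont (f : R -> C) : Ctame f -> Ccont f.
Proof. intros [[H1 _] [H2 _]] x; auto. Qed.

Lemma Ctame_ext (f g : R -> C) : (forall x, f x = g x) -> Ctame f -> Ctame g.
Proof.
  intros H [H1 H2]. split.
  - apply tame_ext with (fun x => fst (f x)); auto. intros; rewrite H; auto.
  - apply tame_ext with (fun x => snd (f x)); auto. intros; rewrite H; auto.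
Qed.

Lemma Ctame_plus (f g : R -> C) : Ctame f -> Ctame g -> Ctame (fun x => f x + g x)%C.
Proof. intros [] []; split; simpl; apply tame_plus; auto. Qed.

Lemma Ctame_scal (c : C) (f : R -> C) : Ctame f -> Ctame (fun x => c * f x)%C.
Proof.
  intros []; split; simpl; [apply tame_minus|apply tame_plus]; apply tame_scal; auto.
Qed.

Lemma Ctame_minus (f g : R -> C) : Ctame f -> Ctame g -> Ctame (fun x => f x - g x)%C.
Proof. intros [] []; split; simpl; apply tame_minus; auto. Qed.

Lemma Cintegral_ext (f g : R -> C) : (forall x, f x = g x) -> Cintegral f = Cintegral g.
Proof.
  intros H. unfold Cintegral. f_equal; apply integral_ext; intros; rewrite H; auto.
Qed.

Lemma Cintegral_plus (f g : R -> C) :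
  Ctame f -> Ctame g -> Cintegral (fun x => f x + g x)%C = (Cintegral f + Cintegral g)%C.
Proof. intros [] []. apply C_ext; simpl; apply integral_plus; auto. Qed.

Lemma Cintegral_minus (f g : R -> C) :
  Ctame f -> Ctame g -> Cintegral (fun x => f x - g x)%C = (Cintegral f - Cintegral g)%C.
Proof. intros [] []. apply C_ext; simpl; apply integral_minus; auto. Qed.

Lemma Cintegral_scal (c : C) (f : R -> C) :
  Ctame f -> Cintegral (fun x => c * f x)%C = (c * Cintegral f)%C.
Proof.
  intros []. apply C_ext; simpl.
  - rewrite integral_minus, !integral_scal; auto; apply tame_scal; auto.
  - rewrite integral_plus, !integral_scal; auto; try apply tame_scal; auto. 
Qed.

Lemma Cmod_Cintegral_le (f : R -> C) (g : R -> R) :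
  Ctame f -> tame g -> (forall x, Cmod (f x) <= g x) -> Cmod (Cintegral f) <= integral g.
Proof.
  intros Hf Hg H.
  destruct (Req_dec (Cmod (Cintegral f)) 0) as [E|E].
  { rewrite E. apply integral_ge_0; auto. intros x. eapply Rle_trans; [apply Cmod_ge_0|apply H]. }
  pose proof (Cmod_ge_0 (Cintegral f)) as Hp.
  set (J := Cintegral f) in *.
  (* rotate [J] onto the positive axis *)
  assert (E1 : Cmod J * Cmod J = fst (Cconj J * J)%C).
  { replace (Cmod J * Cmod J) with (Cmod J ^ 2) by ring. rewrite Cmod2_alt.
    simpl. unfold Re, Im. ring. }
  assert (E2 : (Cconj J * J)%C = Cintegral (fun x => Cconj J * f x)%C).
  { unfold J at 2. rewrite Cintegral_scal; auto. }
  rewrite E2 in E1. simpl in E1.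
  assert (L : fst (Cintegral (fun x => Cconj J * f x)%C) <= Cmod J * integral g).
  { rewrite <- integral_scal; auto. apply integral_le.
    - apply (Ctame_scal (Cconj J) f Hf).
    - apply tame_scal; auto.
    - intros x. eapply Rle_trans; [apply Rle_abs|]. eapply Rle_trans; [apply fst_Cmod|].
      rewrite Cmod_mult, Cmod_conj. apply Rmult_le_compat_l; auto. }
  simpl in L. rewrite <- E1 in L. apply Rmult_le_reg_l with (Cmod J); lra.
Qed.

Lemma tame_majorant (K : R) : tame (fun x => K / (1 + x ^ 2)).
Proof.
  split.
  - intros x. apply (ex_derive_continuous (V := R_NormedModule)). auto_derive. nra.
  - exists (Rabs K). intros x. unfold Rdiv. rewrite Rabs_mult. right. f_equal.
    apply Rabs_pos_eq. left; apply Rinv_0_lt_compat. apply sq_pos1.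
Qed.

Lemma integral_majorant (K : R) : 0 <= K -> integral (fun x => K / (1 + x ^ 2)) <= 4 * K.
Proof.
  intros HK. eapply Rle_trans; [apply Rle_abs|]. apply integral_bound.
  apply tame_majorant. intros x. right. apply Rabs_pos_eq.
  apply Rmult_le_pos; auto. left; apply Rinv_0_lt_compat. apply sq_pos1.
Qed.

Lemma Cintegral_bound (f : R -> C) (K : R) :
  Ccont f -> (forall x, Cmod (f x) <= K / (1 + x ^ 2)) -> Cmod (Cintegral f) <= 4 * K.
Proof.
  intros Hf H.
  assert (HK : 0 <= K).
  { specialize (H 0). pose proof (Cmod_ge_0 (f 0)).
    replace (K / (1 + 0 ^ 2)) with K in H by field. lra. }
  eapply Rle_trans; [|apply integral_majorant; auto].
  apply Cmod_Cintegral_le; auto. eapply Ctame_intro; eauto. apply tame_majorant.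
Qed.

Lemma Cintegral_derivative (F f : R -> C) (K : R) :
  (forall x, Cder F x (f x)) -> Ctame f -> (forall x, Cmod (F x) <= K / (1 + x ^ 2)) ->
  Cintegral f = 0%C.
Proof.
  intros HF [H1 H2] HK. apply C_ext; simpl.
  - apply integral_derivative with (fun x => fst (F x)) K; auto. intros; apply HF.
    intros x. eapply Rle_trans; [apply fst_Cmod|auto].
  - apply integral_derivative with (fun x => snd (F x)) K; auto. intros; apply HF.
    intros x. eapply Rle_trans; [apply snd_Cmod|auto].
Qed.

Lemma Cintegral_affine (f : R -> C) (L c : R) :
  0 < L -> Ctame f -> Ctame (fun x => f (L * x + c)%R) ->
  Cintegral (fun x => f (L * x + c)%R) = (/ L * Cintegral f)%C.
Proof.
  intros HL [H1 H2] [H3 H4].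
  replace (/ RtoC L)%C with (RtoC (/ L)) by (rewrite RtoC_inv; auto; lra).
  apply C_ext; simpl.
  - rewrite (integral_affine (fun x => fst (f x))); auto. ring.
  - rewrite (integral_affine (fun x => snd (f x))); auto. ring.
Qed.

Definition C2cont (f : R -> R -> C) : Prop :=
  forall x t, continuity_2d_pt (fun x t => fst (f x t)) x t /\
              continuity_2d_pt (fun x t => snd (f x t)) x t.

Lemma C2cont_const (c : C) : C2cont (fun _ _ => c).
Proof. intros x t; split; apply continuity_2d_pt_const. Qed.

Lemma C2cont_fst : C2cont (fun x _ => RtoC x).
Proof. intros x t; split; simpl. apply continuity_2d_pt_id1. apply continuity_2d_pt_const. Qed.

Lemma C2cont_snd : C2cont (fun _ t => RtoC t).
Proof. intros x t; split; simpl. apply continuity_2d_pt_id2. apply continuity_2d_pt_const. Qed.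

Lemma C2cont_plus (f g : R -> R -> C) :
  C2cont f -> C2cont g -> C2cont (fun x t => f x t + g x t)%C.
Proof.
  intros Hf Hg x t. destruct (Hf x t), (Hg x t). split; simpl; apply continuity_2d_pt_plus; auto.
Qed.

Lemma C2cont_opp (f : R -> R -> C) : C2cont f -> C2cont (fun x t => - f x t)%C.
Proof.
  intros Hf x t. destruct (Hf x t). split; simpl; apply continuity_2d_pt_opp; auto.
Qed.

Lemma C2cont_minus (f g : R -> R -> C) :
  C2cont f -> C2cont g -> C2cont (fun x t => f x t - g x t)%C.
Proof. intros. apply C2cont_plus; auto. apply C2cont_opp; auto. Qed.

Lemma C2cont_mult (f g : R -> R -> C) :
  C2cont f -> C2cont g -> C2cont (fun x t => f x t * g x t)%C.
Proof.
  intros Hf Hg x t. destruct (Hf x t), (Hg x t). split; simpl.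
  - apply continuity_2d_pt_minus; apply continuity_2d_pt_mult; auto.
  - apply continuity_2d_pt_plus; apply continuity_2d_pt_mult; auto.
Qed.

Lemma C2cont_Cexp (f : R -> R -> C) : C2cont f -> C2cont (fun x t => Cexp (f x t)).
Proof.
  intros Hf x t. destruct (Hf x t) as [H1 H2].
  split; simpl; apply continuity_2d_pt_mult;
    first [ apply (continuity_1d_2d_pt_comp exp) | apply (continuity_1d_2d_pt_comp cos)
          | apply (continuity_1d_2d_pt_comp sin) ]; auto;
    apply derivable_continuous_pt;
    first [ apply derivable_pt_exp | apply derivable_pt_cos | apply derivable_pt_sin ].
Qed.

Ltac c2cont :=
  lazymatch goal with
  | |- C2cont (fun _ _ => ?c) => apply (C2cont_const c)
  | |- C2cont (fun x _ => RtoC x) => apply C2cont_fst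
  | |- C2cont (fun _ t => RtoC t) => apply C2cont_snd
  | |- C2cont (fun x t => Cplus (@?f x t) (@?g x t)) => apply (C2cont_plus f g); c2cont
  | |- C2cont (fun x t => Cminus (@?f x t) (@?g x t)) => apply (C2cont_minus f g); c2cont
  | |- C2cont (fun x t => Copp (@?f x t)) => apply (C2cont_opp f); c2cont
  | |- C2cont (fun x t => Cmult (@?f x t) (@?g x t)) => apply (C2cont_mult f g); c2cont
  | |- C2cont (fun x t => Cexp (@?f x t)) => apply (C2cont_Cexp f); c2cont
  end.

Lemma Cintegral_homotopy (P D Q : R -> R -> C) (K : R) :
  (forall x t, Cder (fun t => P x t) t (D x t)) ->
  (forall x t, Cder (fun x => Q x t) x (D x t)) ->
  C2cont D -> (forall t, Ccont (fun x => P x t)) ->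
  Ctame (fun x => P x 0) -> Ctame (fun x => P x 1) ->
  (forall x t, 0 <= t <= 1 -> Cmod (Q x t) <= K / (1 + x ^ 2)) ->
  Cintegral (fun x => P x 0) = Cintegral (fun x => P x 1).
Proof.
  intros HP HQ HD Hc [H0 H0'] [H1 H1'] HK. apply C_ext; simpl.
  - apply integral_homotopy with (P := fun x t => fst (P x t)) (D := fun x t => fst (D x t))
      (Q := fun x t => fst (Q x t)) (K := K); auto.
    + intros; apply HP. + intros; apply HQ. + intros; apply HD. + intros; apply Hc.
    + intros x t Ht. eapply Rle_trans; [apply fst_Cmod|auto].
  - apply integral_homotopy with (P := fun x t => snd (P x t)) (D := fun x t => snd (D x t))
      (Q := fun x t => snd (Q x t)) (K := K); auto.
    + intros; apply HP. + intros; apply HQ. + intros; apply HD. + intros; apply Hc.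
    + intros x t Ht. eapply Rle_trans; [apply snd_Cmod|auto].
Qed.

(** * Fejér kernels and Poisson summation *)

Fixpoint dirichlet (j : nat) (x : R) : R :=
  match j with
  | O => 1
  | S k => dirichlet k x + 2 * cos (2 * PI * INR (S k) * x)
  end.

Fixpoint fejer (N : nat) (x : R) : R :=
  match N with
  | O => 0
  | S k => fejer k x + dirichlet k x
  end.

Lemma dirichlet_sin (j : nat) (x : R) :
  dirichlet j x * sin (PI * x) = sin ((2 * INR j + 1) * (PI * x)).
Proof.
  induction j.
  - simpl. replace ((2 * 0 + 1) * (PI * x)) with (PI * x) by ring. ring.
  - cbn [dirichlet]. rewrite Rmult_plus_distr_r, IHj.
    rewrite S_INR.
    replace (2 * PI * (INR j + 1) * x) with ((2 * INR j + 2) * (PI * x)) by ring.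
    replace ((2 * INR j + 1) * (PI * x)) with ((2 * INR j + 2) * (PI * x) - PI * x) by ring.
    replace ((2 * (INR j + 1) + 1) * (PI * x)) with ((2 * INR j + 2) * (PI * x) + PI * x) by ring.
    rewrite sin_minus, sin_plus. ring.
Qed.

(** Multiplying by the squared sine instead of dividing by it keeps the closed form true at the
    integers, where both sides vanish. *)
Lemma fejer_sin (N : nat) (x : R) :
  fejer N x * (sin (PI * x)) ^ 2 = (sin (INR N * (PI * x))) ^ 2.
Proof.
  induction N.
  - change (INR 0) with 0. rewrite (Rmult_0_l (PI * x)), sin_0. simpl. ring.
  - cbn [fejer]. rewrite Rmult_plus_distr_r, IHN.
    replace (dirichlet N x * sin (PI * x) ^ 2) with (dirichlet N x * sin (PI * x) * sin (PI * x)) by ring.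
    rewrite dirichlet_sin. rewrite S_INR.
    replace ((2 * INR N + 1) * (PI * x)) with (INR N * (PI * x) + (INR N * (PI * x) + PI * x)) by ring.
    replace ((INR N + 1) * (PI * x)) with (INR N * (PI * x) + PI * x) by ring.
    set (p := INR N * (PI * x)). rewrite sin_plus. rewrite (sin_plus p), (cos_plus p).
    pose proof (sin2_cos2 p). pose proof (sin2_cos2 (PI * x)). unfold Rsqr in *.
    set (s := sin p) in *. set (c := cos p) in *. set (a := sin (PI * x)) in *. set (b := cos (PI * x)) in *.
    apply Rminus_diag_uniq.
    match goal with |- ?t = 0 => replace t with (s * s * (1 - (a * a + b * b))) by ring end.
    rewrite H0. ring.
Qed.

Lemma sin_mult_0 (k : nat) (y : R) : sin y = 0 -> sin (INR k * y) = 0.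
Proof.
  intros H. induction k.
  - simpl. rewrite Rmult_0_l. apply sin_0.
  - rewrite S_INR. replace ((INR k + 1) * y) with (INR k * y + y) by ring.
    rewrite sin_plus, IHk, H. ring.
Qed.

(** Away from the integers the closed form is a quotient of squares; at an integer it degenerates to
    [0 = 0], and positivity comes from [dirichlet j x >= 1] instead. *)
Lemma fejer_nonneg (N : nat) (x : R) : 0 <= fejer N x.
Proof.
  destruct (Req_dec (sin (PI * x)) 0) as [H|H].
  - assert (Hd : forall j, 1 <= dirichlet j x).
    { induction j; cbn [dirichlet]. lra.
      replace (2 * PI * INR (S j) * x) with (2 * (INR (S j) * (PI * x))) by ring.
      rewrite cos_2a_sin, (sin_mult_0 (S j) _ H). lra. }
    induction N; simpl. lra. specialize (Hd N). lra.
  - assert (E := fejer_sin N x). 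
    assert (0 < sin (PI * x) ^ 2) by nra.
    apply Rmult_le_reg_r with (sin (PI * x) ^ 2); auto. rewrite E. nra.
Qed.

(** The bound does not depend on [N], so after division by [N] the kernel is negligible outside a
    neighbourhood of the integers. *)
Lemma fejer_away (N : nat) (d x : R) :
  0 < d -> d <= Rabs x -> Rabs x <= 1 / 2 -> fejer N x <= / (sin (PI * d)) ^ 2.
Proof.
  intros Hd Hx Hx2. pose proof PI_RGT_0.
  assert (0 < sin (PI * d)). { apply sin_gt_0; nra. }
  assert (Hs : sin (PI * d) <= Rabs (sin (PI * x))).
  { assert (sin (PI * d) <= sin (PI * Rabs x)). { apply sin_incr_1; nra. }
    unfold Rabs in H1 at 1. destruct (Rcase_abs x).
    - replace (PI * - x) with (- (PI * x)) in H1 by ring. rewrite sin_neg in H1.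
      rewrite Rabs_left; lra.
    - rewrite Rabs_pos_eq; lra. }
  assert (E := fejer_sin N x).
  assert (Hb := SIN_bound (INR N * (PI * x))).
  assert (Hq : sin (PI * d) ^ 2 <= sin (PI * x) ^ 2).
  { rewrite <- (pow2_abs (sin (PI * x))). apply pow_incr. lra. }
  assert (0 < sin (PI * d) ^ 2) by nra.
  apply Rmult_le_reg_r with (sin (PI * d) ^ 2); auto. rewrite Rinv_l by lra.
  pose proof (fejer_nonneg N x).
  apply Rle_trans with (fejer N x * sin (PI * x) ^ 2). nra. rewrite E. nra.
Qed.

Lemma dirichlet_continuous (j : nat) (x : R) : continuous (dirichlet j) x.
Proof.
  induction j.
  - apply continuous_const.
  - apply (continuous_plus (V := R_NormedModule) (dirichlet j)); auto.
    apply (ex_derive_continuous (V := R_NormedModule)). auto_derive. auto.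
Qed.

Lemma fejer_continuous (j : nat) (x : R) : continuous (fejer j) x.
Proof.
  induction j.
  - apply continuous_const.
  - apply (continuous_plus (V := R_NormedModule) (fejer j)); auto. apply dirichlet_continuous.
Qed.

Lemma dirichlet_bound (j : nat) (x : R) : Rabs (dirichlet j x) <= 1 + 2 * INR j.
Proof.
  induction j.
  - simpl. rewrite Rabs_R1. lra.
  - cbn [dirichlet]. eapply Rle_trans; [apply Rabs_triang|]. rewrite S_INR, Rabs_mult, (Rabs_pos_eq 2) by lra.
    assert (Rabs (cos (2 * PI * (INR j + 1) * x)) <= 1) by (apply Rabs_le; apply COS_bound). lra.
Qed.

Lemma fejer_bound (N : nat) : exists M, forall x, Rabs (fejer N x) <= M.
Proof.
  induction N as [|N [M HM]].
  - exists 0. intros. simpl. rewrite Rabs_R0. lra.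
  - exists (M + (1 + 2 * INR N)). intros x. simpl. eapply Rle_trans; [apply Rabs_triang|].
    apply Rplus_le_compat; auto. apply dirichlet_bound.
Qed.

Lemma sin_INR_PI (k : nat) : sin (INR k * PI) = 0.
Proof. apply sin_mult_0. apply sin_PI. Qed.

Lemma RInt_dirichlet (j : nat) : RInt (dirichlet j) (- (1 / 2)) (1 / 2) = 1.
Proof.
  induction j.
  - simpl. rewrite RInt_const. unfold scal; simpl; unfold mult; simpl. lra.
  - assert (E : is_RInt (fun x => 2 * cos (2 * PI * INR (S j) * x)) (- (1 / 2)) (1 / 2) 0).
    { assert (Hj : 0 < INR (S j)) by (apply lt_0_INR; lia). pose proof PI_RGT_0.
      assert (Hsin := sin_INR_PI (S j)). remember (INR (S j)) as J eqn:EJ.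
      assert (H0 := is_RInt_derive (V := R_CompleteNormedModule)
        (fun x => sin (2 * PI * J * x) / (PI * J))
        (fun x => 2 * cos (2 * PI * J * x)) (- (1 / 2)) (1 / 2)).
      assert (Em : minus (sin (2 * PI * J * (1 / 2)) / (PI * J))
                (sin (2 * PI * J * - (1 / 2)) / (PI * J)) = 0).
      { replace (2 * PI * J * (1 / 2)) with (J * PI) by field.
        replace (2 * PI * J * - (1 / 2)) with (- (J * PI)) by field.
        rewrite sin_neg, Hsin. unfold minus, plus, opp; simpl. field. split; lra. }
      rewrite <- Em. apply H0.
      - intros x _. auto_derive; auto. field. split; lra.
      - intros x _. apply (ex_derive_continuous (V := R_NormedModule)). auto_derive; auto. }
    rewrite (RInt_ext _ (fun x => plus (dirichlet j x) (2 * cos (2 * PI * INR (S j) * x)))).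
    2:{ intros; reflexivity. }
    rewrite (RInt_plus (V := R_CompleteNormedModule)).
    + rewrite IHj, (is_RInt_unique _ _ _ _ E). unfold plus; simpl. lra.
    + apply cont_ex_RInt. apply dirichlet_continuous.
    + eexists; apply E.
Qed.

Lemma RInt_fejer (N : nat) : RInt (fejer N) (- (1 / 2)) (1 / 2) = INR N.
Proof.
  induction N.
  - simpl. rewrite RInt_const. unfold scal; simpl; unfold mult; simpl. lra.
  - rewrite (RInt_ext _ (fun x => plus (fejer N x) (dirichlet N x))) by (intros; reflexivity).
    rewrite (RInt_plus (V := R_CompleteNormedModule)).
    + rewrite IHN, RInt_dirichlet, S_INR. reflexivity.
    + apply cont_ex_RInt. apply fejer_continuous.
    + apply cont_ex_RInt. apply dirichlet_continuous.
Qed.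

Lemma dirichlet_period (j m : nat) (x : R) : dirichlet j (x + INR m) = dirichlet j x.
Proof.
  induction j; cbn [dirichlet]; auto. rewrite IHj. do 2 f_equal.
  replace (2 * PI * INR (S j) * (x + INR m)) with (2 * PI * INR (S j) * x + 2 * INR (S j * m) * PI)
    by (rewrite mult_INR; ring).
  apply cos_period.
Qed.

Lemma fejer_period (N m : nat) (x : R) : fejer N (x + INR m) = fejer N x.
Proof. induction N; simpl; auto. rewrite IHN, dirichlet_period; auto. Qed.

Lemma fejer_period' (N m : nat) (x : R) : fejer N (x + - INR m) = fejer N x.
Proof. rewrite <- (fejer_period N m (x + - INR m)). f_equal. ring. Qed.

(** The argument of [a] is real so that both the values of a function at the integers and the
    averages [cell N] can be summed. *)
Fixpoint zsum (a : R -> R) (M : nat) : R :=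
  match M with
  | O => a 0
  | S m => zsum a m + (a (INR (S m)) + a (- INR (S m)))
  end.

(** Normalised to mean 1 over a period; the index is shifted to avoid a division by [INR 0]. *)
Definition fejer_mean (N : nat) (x : R) : R := fejer (S N) x / INR (S N).

Section Cells.
Variables (f : R -> R) (K : R).
Hypothesis f_cont : forall x, continuous f x.
Hypothesis f_dom : dominated K f.

Definition cell (N : nat) (n : R) : R :=
  RInt (fun x => f (x + n) * fejer_mean N x) (- (1 / 2)) (1 / 2).

Lemma fejer_mean_continuous (N : nat) (x : R) : continuous (fejer_mean N) x.
Proof.
  unfold fejer_mean, Rdiv.
  apply (continuous_mult (K := R_AbsRing) (fejer (S N)) (fun _ => / INR (S N))).
  apply fejer_continuous. apply continuous_const.
Qed.

Lemma fejer_mean_nonneg (N : nat) (x : R) : 0 <= fejer_mean N x.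
Proof.
  apply Rmult_le_pos. apply fejer_nonneg. left. apply Rinv_0_lt_compat. apply lt_0_INR. lia.
Qed.

Lemma RInt_fejer_mean (N : nat) : RInt (fejer_mean N) (- (1 / 2)) (1 / 2) = 1.
Proof.
  assert (HN : 0 < INR (S N)) by (apply lt_0_INR; lia).
  rewrite (RInt_ext _ (fun x => scal (/ INR (S N)) (fejer (S N) x))).
  2:{ intros. unfold fejer_mean, scal; simpl; unfold mult; simpl. field. simpl in HN. lra. }
  rewrite (RInt_scal (V := R_CompleteNormedModule)).
  - rewrite RInt_fejer. unfold scal; simpl; unfold mult. apply Rinv_l. simpl in HN; lra.
  - apply cont_ex_RInt. apply fejer_continuous.
Qed.

Lemma cell_integrand_continuous (N : nat) (n x : R) :
  continuous (fun x => f (x + n) * fejer_mean N x) x.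
Proof.
  apply (continuous_mult (K := R_AbsRing) (fun x => f (x + n))).
  - apply (continuous_comp (fun x => x + n) f); auto.
    apply (continuous_plus (V := R_NormedModule) (fun x => x)). apply continuous_id. apply continuous_const.
  - apply fejer_mean_continuous.
Qed.

(** Two regimes share one hypothesis: near the centre the oscillation of [f] is at most [A] and the
    kernel has mean 1; far from it the kernel itself is small and [B] bounds the product. *)
Lemma cell_error (N : nat) (n A B : R) :
  (forall x, Rabs x <= 1 / 2 -> Rabs (f (x + n) - f n) * fejer_mean N x <= A * fejer_mean N x + B) ->
  Rabs (cell N n - f n) <= A + B.
Proof.
  intros H.
  assert (E : cell N n - f n = RInt (fun x => (f (x + n) - f n) * fejer_mean N x) (- (1 / 2)) (1 / 2)).
  { rewrite (RInt_ext _ (fun x => minus (f (x + n) * fejer_mean N x) (scal (f n) (fejer_mean N x)))).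
    2:{ intros; unfold minus, plus, opp, scal; simpl; unfold mult; simpl. ring. }
    rewrite (RInt_minus (V := R_CompleteNormedModule)), (RInt_scal (V := R_CompleteNormedModule)), RInt_fejer_mean.
    - unfold cell, minus, plus, opp, scal; simpl; unfold mult; simpl. ring.
    - apply cont_ex_RInt. apply fejer_mean_continuous.
    - apply cont_ex_RInt. apply cell_integrand_continuous.
    - apply cont_ex_RInt. intros x. apply (continuous_scal_r (V := R_NormedModule)). apply fejer_mean_continuous. }
  rewrite E.
  assert (Hc : forall x, continuous (fun x => (f (x + n) - f n) * fejer_mean N x) x).
  { intros x. apply continuous_ext with (fun x => f (x + n) * fejer_mean N x - f n * fejer_mean N x).
    intros; simpl; ring. apply (continuous_minus (V := R_NormedModule)).
    apply cell_integrand_continuous. apply (continuous_scal_r (V := R_NormedModule)). apply fejer_mean_continuous. }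
  eapply Rle_trans. { apply abs_RInt_le. lra. apply cont_ex_RInt; auto. }
  replace (A + B) with (RInt (fun x => plus (scal A (fejer_mean N x)) B) (- (1 / 2)) (1 / 2)).
  - apply RInt_le. lra.
    + apply cont_ex_RInt. intros x. apply continuous_comp; auto. apply continuous_Rabs.
    + apply cont_ex_RInt. intros x. apply (continuous_plus (V := R_NormedModule)).
      apply (continuous_scal_r (V := R_NormedModule)). apply fejer_mean_continuous. apply continuous_const.
    + intros x Hx. rewrite Rabs_mult, (Rabs_pos_eq (fejer_mean N x)) by apply fejer_mean_nonneg.
      apply H. apply Rabs_le; lra.
  - rewrite (RInt_plus (V := R_CompleteNormedModule)), (RInt_scal (V := R_CompleteNormedModule)), RInt_fejer_mean, RInt_const.
    + unfold plus, scal; simpl; unfold mult; simpl. field.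
    + apply cont_ex_RInt. apply fejer_mean_continuous.
    + apply cont_ex_RInt. intros x. apply (continuous_scal_r (V := R_NormedModule)). apply fejer_mean_continuous.
    + apply cont_ex_RInt. intros x. apply continuous_const.
Qed.

Lemma cell_cv (n : R) : is_lim_seq (fun N => cell N n) (f n).
Proof.
  apply is_lim_seq_spec. intros eps.
  assert (Hf := f_cont n). apply continuity_pt_filterlim in Hf.
  destruct (Hf (eps / 2)) as [d [Hd Hd2]]. { pose proof (cond_pos eps). lra. }
  pose proof (dominated_nonneg K f f_dom) as HK.
  (* Strictly inside the radius of continuity, and inside the half cell on which [fejer_away]
     applies. *)
  set (d1 := Rmin (d / 2) (1 / 2)).
  assert (Hd1 : 0 < d1) by (unfold d1; apply Rmin_pos; lra).
  assert (Hd1' : d1 < d) by (unfold d1; eapply Rle_lt_trans; [apply Rmin_l|lra]).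
  assert (Hd1'' : d1 <= 1 / 2) by (unfold d1; apply Rmin_r).
  pose proof PI_RGT_0 as HP.
  assert (Hs : 0 < sin (PI * d1)) by (apply sin_gt_0; nra).
  assert (Hs2 : 0 < / sin (PI * d1) ^ 2) by (apply Rinv_0_lt_compat; nra).
  set (W := 2 * K * / sin (PI * d1) ^ 2).
  assert (HW : 0 <= W) by (unfold W; nra).
  destruct (INR_unbounded (2 * W / eps + 1)) as [N0 HN0].
  exists N0. intros N HN. apply le_INR in HN. pose proof (cond_pos eps) as He.
  assert (HSN : INR N < INR (S N)) by (rewrite S_INR; lra).
  assert (HSN0 : 0 < INR (S N)) by (apply lt_0_INR; lia).
  assert (HB : W / INR (S N) < eps / 2).
  { apply Rmult_lt_reg_r with (INR (S N)); auto. unfold Rdiv at 1. rewrite Rmult_assoc, Rinv_l by lra.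
    assert (2 * W / eps < INR (S N)) by lra.
    apply Rmult_lt_compat_r with (r := eps) in H; auto.
    replace (2 * W / eps * eps) with (2 * W) in H by (field; lra). lra. }
  eapply Rle_lt_trans. { apply cell_error with (A := eps / 2) (B := W / INR (S N)).
    intros x Hx.
    destruct (Rlt_le_dec (Rabs x) d1) as [Hl|Hl].
    - assert (Rabs (f (x + n) - f n) <= eps / 2).
      { destruct (Req_dec x 0) as [->|Hx0].
        - rewrite Rplus_0_l, Rminus_diag, Rabs_R0. lra.
        - left. apply Hd2. split. split. exact Logic.I. intros E. apply Hx0. lra.
          simpl. unfold Rdist. replace (x + n - n) with x by ring. lra. }
      assert (0 <= W / INR (S N)).
      { apply Rmult_le_pos; auto. left. apply Rinv_0_lt_compat; auto. }
      pose proof (fejer_mean_nonneg N x). nra.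
    - assert (Rabs (f (x + n) - f n) <= 2 * K).
      { assert (forall y, Rabs (f y) <= K).
        { intros y. eapply Rle_trans; [apply f_dom|]. rewrite <- (Rmult_1_r K) at 2.
          apply Rmult_le_compat_l; auto. rewrite <- Rinv_1. apply Rinv_le_contravar; nra. }
        unfold Rminus. eapply Rle_trans; [apply Rabs_triang|]. rewrite Rabs_Ropp.
        pose proof (H n). pose proof (H (x + n)). lra. }
      assert (Hm : fejer_mean N x <= / sin (PI * d1) ^ 2 / INR (S N)).
      { apply Rmult_le_compat_r. left; apply Rinv_0_lt_compat; auto. apply fejer_away; auto. }
      pose proof (fejer_mean_nonneg N x). pose proof (Rabs_pos (f (x + n) - f n)).
      assert (Rabs (f (x + n) - f n) * fejer_mean N x <= 2 * K * (/ sin (PI * d1) ^ 2 / INR (S N))).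
      { apply Rmult_le_compat; auto. }
      unfold W, Rdiv in *. nra. }
  lra.
Qed.

Lemma dominated_near (n x : R) : 1 <= n -> Rabs x <= 1 / 2 ->
  Rabs (f (x + n)) <= K * / (1 + (n - 1 / 2) ^ 2) /\ Rabs (f (x + - n)) <= K * / (1 + (n - 1 / 2) ^ 2).
Proof.
  intros Hn Hx. pose proof (dominated_nonneg K f f_dom) as HK.
  assert (Hx' : - (1 / 2) <= x <= 1 / 2) by (unfold Rabs in Hx; destruct (Rcase_abs x); lra).
  split; (eapply Rle_trans; [apply f_dom|]; apply Rmult_le_compat_l; auto; apply Rinv_le_contravar; nra).
Qed.

Lemma cell_bound (N : nat) (n B : R) :
  (forall x, Rabs x <= 1 / 2 -> Rabs (f (x + n)) <= B) -> Rabs (cell N n) <= B.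
Proof.
  intros H. unfold cell.
  eapply Rle_trans. { apply abs_RInt_le. lra. apply cont_ex_RInt; apply cell_integrand_continuous. }
  replace B with (RInt (fun x => scal B (fejer_mean N x)) (- (1 / 2)) (1 / 2)).
  - apply RInt_le. lra.
    + apply cont_ex_RInt. intros x. apply continuous_comp. apply cell_integrand_continuous. apply continuous_Rabs.
    + apply cont_ex_RInt. intros x. apply (continuous_scal_r (V := R_NormedModule)). apply fejer_mean_continuous.
    + intros x Hx. rewrite Rabs_mult, (Rabs_pos_eq (fejer_mean N x)) by apply fejer_mean_nonneg.
      apply Rmult_le_compat_r. apply fejer_mean_nonneg. apply H. apply Rabs_le; lra.
  - rewrite (RInt_scal (V := R_CompleteNormedModule)), RInt_fejer_mean.
    unfold scal; simpl; unfold mult; simpl. ring.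
    apply cont_ex_RInt. apply fejer_mean_continuous.
Qed.

Lemma telescope_inv (n : R) : 2 <= n -> / (1 + (n - 1 / 2) ^ 2) <= / (n - 1) - / n.
Proof.
  intros Hn. replace (/ (n - 1) - / n) with (/ (n * (n - 1))) by (field; lra).
  apply Rinv_le_contravar; nra.
Qed.

(** [telescope_inv] replaces the majorant by [1/(n-1) - 1/n]; the factor 2 counts [n] and [-n]. The
    shift by 1/2 in the majorant leaves room for a whole cell around [n]. *)
Lemma zsum_gap (a : R -> R) (C : R) (M m : nat) : (1 <= M)%nat ->
  (forall n, 1 <= n -> Rabs (a n) <= C * / (1 + (n - 1 / 2) ^ 2) /\ Rabs (a (- n)) <= C * / (1 + (n - 1 / 2) ^ 2)) ->
  Rabs (zsum a (m + M) - zsum a M) <= 2 * C * (/ INR M - / INR (m + M)).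
Proof.
  intros HM Ha.
  assert (HC : 0 <= C).
  { destruct (Ha 1 (Rle_refl 1)) as [H _]. pose proof (Rabs_pos (a 1)).
    assert (0 < / (1 + (1 - 1 / 2) ^ 2)) by (apply Rinv_0_lt_compat; lra). nra. }
  induction m.
  - simpl. rewrite !Rminus_diag, Rabs_R0. lra.
  - change (S m + M)%nat with (S (m + M)). cbn [zsum].
    replace (zsum a (m + M) + (a (INR (S (m + M))) + a (- INR (S (m + M)))) - zsum a M)
      with ((zsum a (m + M) - zsum a M) + (a (INR (S (m + M))) + a (- INR (S (m + M))))) by ring.
    eapply Rle_trans; [apply Rabs_triang|].
    assert (Hn : 2 <= INR (S (m + M))). { replace 2 with (INR 2) by reflexivity. apply le_INR. lia. }
    destruct (Ha (INR (S (m + M))) ltac:(lra)) as [H1 H2].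
    pose proof (telescope_inv _ Hn) as Ht.
    replace (INR (S (m + M)) - 1) with (INR (m + M)) in Ht by (rewrite S_INR; ring).
    assert (Rabs (a (INR (S (m + M))) + a (- INR (S (m + M)))) <= 2 * C * (/ INR (m + M) - / INR (S (m + M)))).
    { eapply Rle_trans; [apply Rabs_triang|].
      apply Rmult_le_compat_l with (r := C) in Ht; auto. lra. }
    lra.
Qed.

(** The kernel has period 1, so the cells tile an interval with half-integer ends. *)
Lemma zsum_cells (N M : nat) :
  zsum (cell N) M = RInt (fun x => f x * fejer_mean N x) (- INR M - 1 / 2) (INR M + 1 / 2).
Proof.
  assert (Hc : forall x, continuous (fun x => f x * fejer_mean N x) x).
  { intros x. apply (continuous_mult (K := R_AbsRing)); auto. apply fejer_mean_continuous. }
  assert (Hcell : forall n, (forall x, fejer_mean N (x + n) = fejer_mean N x) ->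
    cell N n = RInt (fun x => f x * fejer_mean N x) (n - 1 / 2) (n + 1 / 2)).
  { intros n Hn. unfold cell.
    assert (E := RInt_comp_lin (V := R_CompleteNormedModule) (fun x => f x * fejer_mean N x) 1 n (- (1 / 2)) (1 / 2)
       (cont_ex_RInt _ _ _ Hc)).
    replace (1 * - (1 / 2) + n) with (n - 1 / 2) in E by ring.
    replace (1 * (1 / 2) + n) with (n + 1 / 2) in E by ring.
    rewrite <- E. apply RInt_ext. intros x _. unfold scal; simpl; unfold mult; simpl.
    rewrite !Rmult_1_l, Hn. auto. }
  induction M.
  - simpl. rewrite Hcell. f_equal; ring. intros x; f_equal; ring.
  - cbn [zsum]. rewrite IHM, !Hcell.
    2:{ intros x. unfold fejer_mean. rewrite fejer_period'. auto. }
    2:{ intros x. unfold fejer_mean. rewrite fejer_period. auto. }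
    rewrite S_INR.
    rewrite <- (RInt_Chasles _ (- (INR M + 1) - 1 / 2) (- INR M - 1 / 2) (INR M + 1 + 1 / 2));
      try (apply cont_ex_RInt; auto).
    rewrite <- (RInt_Chasles _ (- INR M - 1 / 2) (INR M + 1 / 2) (INR M + 1 + 1 / 2));
      try (apply cont_ex_RInt; auto).
    unfold plus; simpl.
    replace (- (INR M + 1) + 1 / 2) with (- INR M - 1 / 2) by field.
    replace (INR M + 1 - 1 / 2) with (INR M + 1 / 2) by field. ring.
Qed.

Lemma zsum_cv_cells (M : nat) : is_lim_seq (fun N => zsum (cell N) M) (zsum f M).
Proof.
  induction M; simpl.
  - apply cell_cv.
  - apply is_lim_seq_plus'; auto. apply is_lim_seq_plus'; apply cell_cv.
Qed.

Lemma tame_fejer (N : nat) : tame (fun x => f x * fejer_mean N x).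
Proof.
  destruct (fejer_bound (S N)) as [M HM].
  apply tame_mult_bounded with (M / INR (S N)).
  - split; eauto.
  - apply fejer_mean_continuous.
  - intros x. unfold fejer_mean, Rdiv. rewrite Rabs_mult, Rabs_inv, (Rabs_pos_eq (INR (S N))) by apply pos_INR.
    apply Rmult_le_compat_r; auto. left; apply Rinv_0_lt_compat, lt_0_INR; lia.
Qed.

Lemma zsum_ex_lim : ex_finite_lim_seq (zsum f).
Proof.
  apply ex_lim_seq_cauchy_corr. intros eps. pose proof (cond_pos eps) as He.
  pose proof (dominated_nonneg K f f_dom) as HK.
  destruct (INR_unbounded (2 * K / eps + 1)) as [M0 HM0].
  assert (Hq : 0 <= 2 * K / eps). { apply Rmult_le_pos. lra. left; apply Rinv_0_lt_compat; auto. }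
  assert (Hw : forall M m, (M0 <= M)%nat -> Rabs (zsum f (m + M) - zsum f M) < eps).
  { intros M m HM. apply le_INR in HM.
    assert (1 <= M)%nat. { apply INR_le. simpl. lra. }
    eapply Rle_lt_trans. { apply zsum_gap; auto. intros n Hn.
      destruct (dominated_near n 0 Hn) as [H1 H2]. rewrite Rabs_R0; lra. rewrite !Rplus_0_l in *. eauto. }
    assert (0 < / INR (m + M)). { apply Rinv_0_lt_compat. apply lt_0_INR. lia. }
    assert (0 < INR M) by lra.
    assert (2 * K / INR M < eps).
    { apply Rmult_lt_reg_r with (INR M); auto. unfold Rdiv. rewrite Rmult_assoc, Rinv_l by lra.
      assert (2 * K / eps < INR M) by lra. apply Rmult_lt_compat_r with (r := eps) in H2; auto.
      replace (2 * K / eps * eps) with (2 * K) in H2 by (field; lra). lra. }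
    unfold Rdiv in *. nra. }
  exists M0. intros n m Hn Hm. destruct (Nat.le_ge_cases n m).
  - rewrite Rabs_minus_sym. replace m with ((m - n) + n)%nat by lia. auto.
  - replace n with ((n - m) + m)%nat by lia. auto.
Qed.

(** An exchange of limits: the cells beyond [M] contribute at most [2 K / M] uniformly in [N], and
    the finitely many others converge to the values of [f]. *)
Lemma fejer_integral_cv (S0 : R) : is_lim_seq (zsum f) S0 ->
  is_lim_seq (fun N => integral (fun x => f x * fejer_mean N x)) S0.
Proof.
  intros HS. apply is_lim_seq_spec. intros eps. pose proof (cond_pos eps) as He.
  pose proof (dominated_nonneg K f f_dom) as HK.
  (* Two tails of size [2 K / M], one of the integral and one of the lattice sum, must together stay
     below [eps / 3]. *)
  destruct (INR_unbounded (12 * K / eps + 1)) as [M HM].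
  assert (Hq : 0 <= 12 * K / eps). { apply Rmult_le_pos. lra. left; apply Rinv_0_lt_compat; auto. }
  assert (HM1 : (1 <= M)%nat). { apply INR_le. simpl. lra. }
  assert (HMp : 0 < INR M) by lra.
  assert (HKM : 4 * K * / INR M < eps / 3).
  { apply Rmult_lt_reg_r with (INR M); auto. rewrite Rmult_assoc, Rinv_l by lra.
    assert (12 * K / eps < INR M) by lra. apply Rmult_lt_compat_r with (r := eps) in H; auto.
    replace (12 * K / eps * eps) with (12 * K) in H by (field; lra). lra. }
  assert (Hz := zsum_cv_cells M). apply is_lim_seq_spec in Hz.
  assert (He3 : 0 < eps / 3) by lra.
  destruct (Hz (mkposreal _ He3)) as [N0 HN0]. simpl in HN0.
  exists N0. intros N HN. specialize (HN0 N HN).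
  assert (Hlim1 : Rabs (integral (fun x => f x * fejer_mean N x) - zsum (cell N) M) <= 2 * K * / INR M).
  { assert (Hl : is_lim_seq (fun m => Rabs (zsum (cell N) (m + M) - zsum (cell N) M))
       (Rabs (integral (fun x => f x * fejer_mean N x) - zsum (cell N) M))).
    { apply (is_lim_seq_abs _ (Finite _)). apply is_lim_seq_minus'; [|apply is_lim_seq_const].
      apply (is_lim_seq_incr_n (zsum (cell N)) M).
      apply is_lim_seq_ext with (fun M => RInt (fun x => f x * fejer_mean N x) (- INR M - 1 / 2) (INR M + 1 / 2)).
      { intros; symmetry; apply zsum_cells. }
      apply integral_cv_gen. apply tame_fejer.
      - apply is_lim_seq_le_m_loc with (fun n => - INR n).
        + exists O. intros; lra.
        + apply (is_lim_seq_opp _ p_infty). apply is_lim_seq_INR.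
      - apply is_lim_seq_le_p_loc with INR.
        + exists O. intros; lra. + apply is_lim_seq_INR. }
    apply (is_lim_seq_le _ (fun _ => 2 * K * / INR M) (Finite _) (Finite _)) with (2 := Hl) (3 := is_lim_seq_const _).
    intros m. eapply Rle_trans.
    { apply zsum_gap with (C := K); auto. intros n Hn. split; apply cell_bound; intros x Hx;
        apply (dominated_near n x Hn Hx). }
    assert (0 < / INR (m + M)). { apply Rinv_0_lt_compat. apply lt_0_INR. lia. } nra. }
  assert (Hlim2 : Rabs (S0 - zsum f M) <= 2 * K * / INR M).
  { assert (Hl : is_lim_seq (fun m => Rabs (zsum f (m + M) - zsum f M)) (Rabs (S0 - zsum f M))).
    { apply (is_lim_seq_abs _ (Finite _)). apply is_lim_seq_minus'; [|apply is_lim_seq_const].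
      apply (is_lim_seq_incr_n (zsum f) M). auto. }
    apply (is_lim_seq_le _ (fun _ => 2 * K * / INR M) (Finite _) (Finite _)) with (2 := Hl) (3 := is_lim_seq_const _).
    intros m. eapply Rle_trans.
    { apply zsum_gap with (C := K); auto. intros n Hn. 
      destruct (dominated_near n 0 Hn) as [H1 H2]. rewrite Rabs_R0; lra. rewrite !Rplus_0_l in *. eauto. }
    assert (0 < / INR (m + M)). { apply Rinv_0_lt_compat. apply lt_0_INR. lia. } nra. }
  replace (integral (fun x => f x * fejer_mean N x) - S0) with
    ((integral (fun x => f x * fejer_mean N x) - zsum (cell N) M) + (zsum (cell N) M - zsum f M)
     - (S0 - zsum f M)) by ring.
  unfold Rminus at 1. eapply Rle_lt_trans; [apply Rabs_triang|]. rewrite Rabs_Ropp.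
  assert (Rabs (integral (fun x => f x * fejer_mean N x) - zsum (cell N) M + (zsum (cell N) M - zsum f M))
     <= 2 * K * / INR M + eps / 3).
  { eapply Rle_trans; [apply Rabs_triang|]. lra. }
  lra.
Qed.
End Cells.

(** * Fourier partial sums, their Cesaro means, and Poisson summation *)

Fixpoint fourier_sum (f : R -> R) (j : nat) : R :=
  match j with
  | O => integral f
  | S k => fourier_sum f k + 2 * integral (fun x => f x * cos (2 * PI * INR (S k) * x))
  end.

Fixpoint cesaro_sum (f : R -> R) (N : nat) : R :=
  match N with
  | O => 0
  | S k => cesaro_sum f k + fourier_sum f k
  end.

Lemma tame_cos (f : R -> R) (w : R) : tame f -> tame (fun x => f x * cos (w * x)).
Proof.
  intros Hf. apply tame_mult_bounded with 1; auto.
  - intros x. apply (ex_derive_continuous (V := R_NormedModule)). auto_derive. auto.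
  - intros x. apply Rabs_le. apply COS_bound.
Qed.

Lemma fourier_sum_spec (f : R -> R) (j : nat) : tame f ->
  tame (fun x => f x * dirichlet j x) /\ integral (fun x => f x * dirichlet j x) = fourier_sum f j.
Proof.
  intros Hf. induction j as [|j [IH1 IH2]].
  - split. apply tame_ext with f; auto. intros; simpl; ring.
    simpl. apply integral_ext. intros; ring.
  - assert (Hs : tame (fun x => 2 * (f x * cos (2 * PI * INR (S j) * x)))).
    { apply tame_scal, tame_cos; auto. }
    split.
    + apply tame_ext with (fun x => f x * dirichlet j x + 2 * (f x * cos (2 * PI * INR (S j) * x))).
      intros; cbn [dirichlet]; ring. apply tame_plus; auto.
    + cbn [fourier_sum]. rewrite <- IH2, <- integral_scal by (apply tame_cos; auto).
      rewrite <- integral_plus; auto. apply integral_ext. intros; cbn [dirichlet]; ring.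
Qed.

Lemma cesaro_sum_spec (f : R -> R) (N : nat) : tame f ->
  tame (fun x => f x * fejer N x) /\ integral (fun x => f x * fejer N x) = cesaro_sum f N.
Proof.
  intros Hf. induction N as [|N [IH1 IH2]].
  - split. apply tame_ext with (fun _ => 0); [intros; simpl; ring|apply tame_0].
    cbn [cesaro_sum]. rewrite <- integral_0. apply integral_ext. intros; cbn [fejer]; ring.
  - destruct (fourier_sum_spec f N Hf) as [H1 H2]. split.
    + apply tame_ext with (fun x => f x * fejer N x + f x * dirichlet N x).
      intros; simpl; ring. apply tame_plus; auto.
    + cbn [cesaro_sum]. rewrite <- IH2, <- H2, <- integral_plus; auto.
      apply integral_ext. intros; cbn [fejer]; ring.
Qed.

Lemma cesaro_mean_cv (f : R -> R) : tame f -> exists S0 : R,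
  is_lim_seq (zsum f) S0 /\ is_lim_seq (fun N => cesaro_sum f (S N) / INR (S N)) S0.
Proof.
  intros Hf. destruct Hf as [Hc [K HK]].
  destruct (zsum_ex_lim f K HK) as [S0 HS0]. exists S0. split; auto.
  apply is_lim_seq_ext with (fun N => integral (fun x => f x * fejer_mean N x)).
  - intros N. destruct (cesaro_sum_spec f (S N) (conj Hc (ex_intro _ K HK))) as [H1 H2].
    rewrite <- H2. unfold fejer_mean, Rdiv. rewrite Rmult_comm, <- integral_scal; auto.
    apply integral_ext. intros; ring.
  - eapply fejer_integral_cv; eauto.
Qed.

(** The Cesaro means of the Fourier side converge to the lattice sum for every tame [f]; when the
    partial sums converge too, Cesaro's theorem identifies the two limits. *)
Lemma poisson_summation (f : R -> R) (S0 S1 : R) : tame f ->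
  is_lim_seq (zsum f) S0 -> is_lim_seq (fourier_sum f) S1 -> S0 = S1.
Proof.
  intros Hf H0 H1. destruct (cesaro_mean_cv f Hf) as [S2 [H2 H3]].
  assert (H4 : is_lim_seq (fun N => cesaro_sum f (S N) / INR (S N)) S1).
  { assert (Hu : Un_cv (fourier_sum f) S1) by (apply is_lim_seq_Reals; auto).
    apply Cesaro_1 in Hu. apply is_lim_seq_Reals in Hu. apply (is_lim_seq_incr_1 _ S1) in Hu.
    eapply is_lim_seq_ext; [|apply Hu]. intros N.
    assert (E : forall n, sum_f_R0 (fourier_sum f) n = cesaro_sum f (S n)).
    { induction n.
      - cbn [cesaro_sum sum_f_R0]. symmetry. apply Rplus_0_l.
      - cbn [sum_f_R0]. rewrite IHn. reflexivity. }
    cbv beta. rewrite E. reflexivity. }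
  apply is_lim_seq_unique in H0. apply is_lim_seq_unique in H2.
  apply is_lim_seq_unique in H3. apply is_lim_seq_unique in H4.
  rewrite H2 in H0. rewrite H3 in H4. congruence.
Qed.

(** The sign of the coefficients passes to the Cesaro means, and these converge to the lattice
    sum. *)
Lemma poisson_positivity (f : R -> R) (S0 : R) : tame f -> is_lim_seq (zsum f) S0 ->
  (forall k : nat, 0 <= integral (fun x => f x * cos (2 * PI * INR k * x))) -> 0 <= S0.
Proof.
  intros Hf H0 Hk. destruct (cesaro_mean_cv f Hf) as [S2 [H2 H3]].
  assert (Hs : forall j, 0 <= fourier_sum f j).
  { induction j.
    - simpl. rewrite (integral_ext _ (fun x => f x * cos (2 * PI * INR 0 * x))). auto.
      intros x. simpl. rewrite Rmult_0_r, Rmult_0_l, cos_0. ring.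
    - cbn [fourier_sum]. specialize (Hk (S j)). lra. }
  assert (Hc : forall j, 0 <= cesaro_sum f j).
  { induction j; simpl. lra. specialize (Hs j). lra. }
  assert (E : S0 = S2).
  { apply is_lim_seq_unique in H0. apply is_lim_seq_unique in H2. congruence. }
  subst. apply (is_lim_seq_le (fun _ => 0) _ (Finite 0) (Finite S2)) with (3 := H3) (2 := is_lim_seq_const _).
  intros N. apply Rmult_le_pos. auto. left; apply Rinv_0_lt_compat, lt_0_INR; lia.
Qed.

(** * Polynomials against exponentials *)

Lemma exp_le_exp (x y : R) : x <= y -> exp x <= exp y.
Proof. intros [H|H]. left; apply exp_increasing; auto. subst; right; auto. Qed.

Lemma exp_pow (x : R) (n : nat) : exp x ^ n = exp (INR n * x).
Proof.
  induction n.
  - simpl. rewrite Rmult_0_l, exp_0; auto.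
  - rewrite S_INR. simpl. rewrite IHn, <- exp_plus. f_equal. ring.
Qed.

(** For a positive exponent [m] and [M = 1 + m / c], one has [1 + X <= M (1 + c X / m) <= M exp (c X
    / m)]; take the [m]-th power. *)
Lemma poly_exp_bound (n : nat) (c : R) : 0 < c ->
  exists K, 0 < K /\ forall X, 0 <= X -> (1 + X) ^ n <= K * exp (c * X).
Proof.
  intros Hc. destruct n as [|n].
  { exists 1. split. lra. intros X HX. simpl.
    pose proof (exp_ineq1_le (c * X)). nra. }
  assert (Hn : 0 < INR (S n)) by (apply lt_0_INR; lia).
  set (M := 1 + INR (S n) / c).
  assert (HM : 0 < INR (S n) / c) by (apply Rdiv_lt_0_compat; auto).
  exists (M ^ S n). split. { apply pow_lt. unfold M; lra. }
  intros X HX.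
  replace (exp (c * X)) with (exp (c * X / INR (S n)) ^ S n).
  - rewrite <- Rpow_mult_distr. apply pow_incr. split. lra.
    pose proof (exp_ineq1_le (c * X / INR (S n))).
    assert (0 <= c * X / INR (S n)).
    { apply Rmult_le_pos. nra. left; apply Rinv_0_lt_compat; auto. }
    assert (INR (S n) / c * (c * X / INR (S n)) = X) by (field; lra).
    unfold M. nra.
  - rewrite exp_pow. f_equal. field. lra.
Qed.

(** Two extra powers in [n + 2] pay for the factor [1 + x ^ 2]. *)
Lemma majorant_exp (n : nat) (c : R) : 0 < c ->
  exists K, forall x, (1 + Rabs x) ^ n * exp (- (c * Rabs x)) <= K / (1 + x ^ 2).
Proof.
  intros Hc. destruct (poly_exp_bound (n + 2) c Hc) as [K [HK0 HK]]. exists K. intros x.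
  pose proof (Rabs_pos x) as Hx. specialize (HK (Rabs x) Hx).
  apply Rmult_le_reg_r with (1 + x ^ 2); [nra|].
  unfold Rdiv. rewrite Rmult_assoc, (Rmult_assoc K), Rinv_l by (pose proof (sq_pos1 x); lra).
  rewrite exp_Ropp.
  assert (He := exp_pos (c * Rabs x)).
  apply Rmult_le_reg_r with (exp (c * Rabs x)); auto.
  replace ((1 + Rabs x) ^ n * (/ exp (c * Rabs x) * (1 + x ^ 2)) * exp (c * Rabs x))
    with ((1 + Rabs x) ^ n * (1 + x ^ 2)) by (field; lra).
  rewrite Rmult_1_r. eapply Rle_trans; [|apply HK]. rewrite pow_add.
  apply Rmult_le_compat_l. apply pow_le; lra. rewrite <- (pow2_abs x). nra.
Qed.

(** * Limits of complex sequences *)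

Definition is_Clim (a : nat -> C) (l : C) : Prop :=
  is_lim_seq (fun n => fst (a n)) (fst l) /\ is_lim_seq (fun n => snd (a n)) (snd l).

Definition Clim (a : nat -> C) : C :=
  (real (Lim_seq (fun n => fst (a n))), real (Lim_seq (fun n => snd (a n)))).

Lemma is_Clim_unique (a : nat -> C) (l : C) : is_Clim a l -> Clim a = l.
Proof.
  intros [H1 H2]. apply is_lim_seq_unique in H1. apply is_lim_seq_unique in H2.
  unfold Clim. rewrite H1, H2. destruct l; reflexivity.
Qed.

Lemma is_Clim_eq (a : nat -> C) (l m : C) : is_Clim a l -> is_Clim a m -> l = m.
Proof. intros H1 H2. rewrite <- (is_Clim_unique a l), <- (is_Clim_unique a m); auto. Qed.

Lemma is_Clim_ext (a b : nat -> C) (l : C) : (forall n, a n = b n) -> is_Clim a l -> is_Clim b l.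
Proof.
  intros H [H1 H2]. split; eapply is_lim_seq_ext; try eassumption; intros; simpl; rewrite H; auto.
Qed.

Lemma is_Clim_const (l : C) : is_Clim (fun _ => l) l.
Proof. split; apply is_lim_seq_const. Qed.

Lemma is_Clim_plus (a b : nat -> C) (l m : C) :
  is_Clim a l -> is_Clim b m -> is_Clim (fun n => a n + b n)%C (l + m)%C.
Proof. intros [] []; split; simpl; apply is_lim_seq_plus'; auto. Qed.

Lemma is_Clim_mult (a b : nat -> C) (l m : C) :
  is_Clim a l -> is_Clim b m -> is_Clim (fun n => a n * b n)%C (l * m)%C.
Proof.
  intros [] []; split; simpl; [apply is_lim_seq_minus'|apply is_lim_seq_plus'];
    apply is_lim_seq_mult'; auto.
Qed.

Lemma is_Clim_incr (a : nat -> C) (l : C) : is_Clim a l <-> is_Clim (fun n => a (S n)) l.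
Proof.
  split; intros [H1 H2]; split.
  - apply (is_lim_seq_incr_1 (fun n => fst (a n))) in H1; auto.
  - apply (is_lim_seq_incr_1 (fun n => snd (a n))) in H2; auto.
  - apply (is_lim_seq_incr_1 (fun n => fst (a n))); auto.
  - apply (is_lim_seq_incr_1 (fun n => snd (a n))); auto.
Qed.

Lemma is_Clim_squeeze (a : nat -> C) (l : C) (e : nat -> R) :
  (forall n, Cmod (a n - l) <= e n) -> is_lim_seq e 0 -> is_Clim a l.
Proof.
  intros H He.
  assert (G : forall p : C -> R, (forall z, Rabs (p z) <= Cmod z) ->
     (forall z w, p (z - w)%C = p z - p w) -> is_lim_seq (fun n => p (a n)) (p l)).
  { intros p Hp Hl.
    apply is_lim_seq_ext with (fun n => p (a n - l)%C + p l). { intros; rewrite Hl; ring. }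
    replace (Finite (p l)) with (Finite (0 + p l)) by (f_equal; ring).
    apply is_lim_seq_plus'; [|apply is_lim_seq_const].
    apply is_lim_seq_abs_0.
    apply is_lim_seq_le_le with (u := fun _ => 0) (w := e); auto. 2: apply is_lim_seq_const.
    intros n. split. apply Rabs_pos. eapply Rle_trans; [apply Hp|auto]. }
  split; apply G; intros; auto using fst_Cmod, snd_Cmod.
Qed.

Lemma is_Clim_Cmod (a : nat -> C) (l : C) : is_Clim a l -> is_lim_seq (fun n => Cmod (a n)) (Cmod l).
Proof.
  intros [H1 H2]. unfold Cmod.
  apply (is_lim_seq_continuous sqrt (fun n => fst (a n) ^ 2 + snd (a n) ^ 2)).
  - apply continuous_sqrt_pt || (apply continuity_pt_sqrt; nra).
  - apply is_lim_seq_plus'; simpl; apply is_lim_seq_mult'; auto; apply is_lim_seq_mult'; auto;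
      apply is_lim_seq_const.
Qed.

Lemma is_Clim_Cmod_le (a : nat -> C) (l : C) (B : R) :
  is_Clim a l -> (forall n, Cmod (a n) <= B) -> Cmod l <= B.
Proof.
  intros H HB. apply (is_lim_seq_le _ (fun _ => B) (Cmod l) B HB).
  apply is_Clim_Cmod; auto. apply is_lim_seq_const.
Qed.

Fixpoint Csum (a : nat -> C) (N : nat) : C :=
  match N with
  | O => 0%C
  | S n => (Csum a n + a n)%C
  end.

Lemma Csum_ext (a b : nat -> C) (N : nat) : (forall n, (n < N)%nat -> a n = b n) -> Csum a N = Csum b N.
Proof. induction N; intros H; simpl; auto. rewrite IHN, H; auto. Qed.

Lemma Csum_scal (c : C) (a : nat -> C) (N : nat) : Csum (fun n => c * a n)%C N = (c * Csum a N)%C.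
Proof. induction N; simpl. ring. rewrite IHN. ring. Qed.

Lemma Csum_plus (a b : nat -> C) (N : nat) : Csum (fun n => a n + b n)%C N = (Csum a N + Csum b N)%C.
Proof. induction N; simpl. ring. rewrite IHN. ring. Qed.

Lemma Csum_gap (a : nat -> C) (b : nat -> R) (N m : nat) :
  (forall n, Cmod (a n) <= b n - b (S n)) -> Cmod (Csum a (m + N) - Csum a N) <= b N - b (m + N)%nat.
Proof.
  intros H. induction m.
  - simpl. replace (Csum a N - Csum a N)%C with (RtoC 0) by ring. rewrite Cmod_0. lra.
  - change (S m + N)%nat with (S (m + N)). cbn [Csum].
    replace (Csum a (m + N) + a (m + N)%nat - Csum a N)%C
      with ((Csum a (m + N) - Csum a N) + a (m + N)%nat)%C by ring.
    eapply Rle_trans; [apply Cmod_triangle|]. specialize (H (m + N)%nat). lra.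
Qed.

Lemma Clim_cauchy (a : nat -> C) (e : nat -> R) :
  (forall N m, Cmod (a (m + N)%nat - a N)%C <= e N) -> is_lim_seq e 0 -> is_Clim a (Clim a).
Proof.
  intros H He.
  assert (G : forall p : C -> R, (forall z, Rabs (p z) <= Cmod z) ->
     (forall z w, p (z - w)%C = p z - p w) ->
     is_lim_seq (fun n => p (a n)) (real (Lim_seq (fun n => p (a n))))).
  { intros p Hp Hl. apply Lim_seq_correct'. apply ex_lim_seq_cauchy_corr.
    intros eps. apply is_lim_seq_spec in He. destruct (He eps) as [N0 HN0]. exists N0.
    assert (Hw : forall n m, (N0 <= n)%nat -> Rabs (p (a (m + n)%nat) - p (a n)) < eps).
    { intros n m Hn. rewrite <- Hl. eapply Rle_lt_trans; [apply Hp|].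
      eapply Rle_lt_trans; [apply H|]. specialize (HN0 n Hn). rewrite Rminus_0_r in HN0.
      eapply Rle_lt_trans; [apply Rle_abs|auto]. }
    intros n m Hn Hm. destruct (Nat.le_ge_cases n m).
    - rewrite Rabs_minus_sym. replace m with ((m - n) + n)%nat by lia. auto.
    - replace n with ((n - m) + m)%nat by lia. auto. }
  split; apply G; intros; auto using fst_Cmod, snd_Cmod.
Qed.

(** [b] plays the part of the tail of a majorant series: telescoping yields convergence and the
    remainder bound together. *)
Lemma Csum_cv (a : nat -> C) (b : nat -> R) :
  (forall n, Cmod (a n) <= b n - b (S n)) -> is_lim_seq b 0 ->
  is_Clim (Csum a) (Clim (Csum a)) /\ forall N, Cmod (Clim (Csum a) - Csum a N) <= b N.
Proof.
  intros H Hb.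
  assert (Hdec : forall n, b (S n) <= b n).
  { intros n. specialize (H n). pose proof (Cmod_ge_0 (a n)). lra. }
  assert (Hpos : forall n, 0 <= b n).
  { intros n. apply (is_lim_seq_decr_compare b 0); auto. }
  assert (Hgap : forall N m, Cmod (Csum a (m + N)%nat - Csum a N)%C <= b N).
  { intros N m. eapply Rle_trans; [apply Csum_gap; eauto|]. specialize (Hpos (m + N)%nat). lra. }
  assert (Hl : is_Clim (Csum a) (Clim (Csum a))) by (eapply Clim_cauchy; eauto).
  split; auto. intros N.
  apply is_Clim_Cmod_le with (fun m => Csum a (m + N) - Csum a N)%C; auto.
  apply (is_Clim_plus (fun m => Csum a (m + N)) (fun _ => - Csum a N)%C).
  - destruct Hl as [H1 H2]. split; simpl.
    + apply (is_lim_seq_incr_n (fun n => fst (Csum a n)) N); auto.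
    + apply (is_lim_seq_incr_n (fun n => snd (Csum a n)) N); auto.
  - apply is_Clim_const.
Qed.

(** * The kernel *)

Definition gauss (Z : C) : C := Cexp (- (PI * (Z * Z))).

Definition quartic (Z : C) : C := (4 * (PI * PI) * (Z * Z * (Z * Z)) - 6 * PI * (Z * Z))%C.

(** With [T = Z d/dZ] this is [T^2 + T] applied to [gauss]. It vanishes at 0, is its own Fourier
    transform, and its Mellin transform is that of [gauss] times [s (s - 1)], the factor that
    cancels the poles in [xi]. *)
Definition hermite (Z : C) : C := (quartic Z * gauss Z)%C.

(** The double cone of opening [arccos c] around the real axis, in a polynomial form that is stable
    under real scaling; for [c > 0] it is where [gauss] decays. *)
Definition sector (c : R) (Z : C) : Prop := c * Cmod Z ^ 2 <= fst (Z * Z)%C.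

Lemma sector_scal (c x : R) (Z : C) : sector c Z -> sector c (x * Z)%C.
Proof.
  unfold sector. intros H. rewrite Cmod_mult, Cmod_R.
  replace (fst (x * Z * (x * Z))%C) with (x ^ 2 * fst (Z * Z)%C) by (simpl; ring).
  rewrite Rpow_mult_distr, pow2_abs. nra.
Qed.

Lemma Cmod_gauss_sector (c : R) (Z : C) : sector c Z -> Cmod (gauss Z) <= exp (- (PI * c * Cmod Z ^ 2)).
Proof.
  intros H. unfold gauss. rewrite Cmod_Cexp. apply exp_le_exp.
  replace (fst (- (PI * (Z * Z)))%C) with (- (PI * fst (Z * Z)%C)) by (simpl; ring).
  unfold sector in H. pose proof PI_RGT_0. nra.
Qed.

Lemma gauss_sector_bound (n : nat) (c : R) : 0 < c ->
  exists K, 0 < K /\ forall Z, sector c Z -> (1 + Cmod Z) ^ n * Cmod (gauss Z) <= K * exp (- Cmod Z).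
Proof.
  intros Hc. destruct (poly_exp_bound n 1 ltac:(lra)) as [K [HK HK1]].
  pose proof PI_RGT_0 as HP.
  assert (Hpc : 0 < PI * c) by nra.
  exists (K * exp (/ (PI * c))). split. { apply Rmult_lt_0_compat; auto. apply exp_pos. }
  intros Z HZ. pose proof (Cmod_ge_0 Z) as HZ0. set (X := Cmod Z) in *.
  apply Rle_trans with (K * exp (1 * X) * exp (- (PI * c * X ^ 2))).
  - apply Rmult_le_compat; auto. apply pow_le; lra. apply Cmod_ge_0. apply Cmod_gauss_sector; auto.
  - rewrite !Rmult_assoc. apply Rmult_le_compat_l; [lra|]. rewrite <- !exp_plus. apply exp_le_exp.
    assert (H : 0 <= (PI * c) * (X - / (PI * c)) ^ 2) by (apply Rmult_le_pos; [lra|apply pow2_ge_0]).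
    replace ((PI * c) * (X - / (PI * c)) ^ 2) with (PI * c * X ^ 2 - 2 * X + / (PI * c)) in H by (field; nra).
    lra.
Qed.

Lemma Cmod_quartic (Z : C) : Cmod (quartic Z) <= 100 * (1 + Cmod Z) ^ 4.
Proof.
  unfold quartic, Cminus. eapply Rle_trans; [apply Cmod_triangle|].
  rewrite Cmod_opp, !Cmod_mult, !Cmod_R.
  pose proof PI_RGT_0. pose proof PI_4. rewrite !(Rabs_pos_eq PI), (Rabs_pos_eq 4), (Rabs_pos_eq 6) by lra.
  pose proof (Cmod_ge_0 Z). set (X := Cmod Z) in *.
  assert (PI * PI <= 16) by nra.
  assert (4 * (PI * PI) * (X * X * (X * X)) <= 64 * (X * X * (X * X))) by (apply Rmult_le_compat_r; nra).
  assert (6 * PI * (X * X) <= 24 * (X * X)) by nra.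
  assert ((1 + X) ^ 4 = 1 + 4 * X + 6 * (X * X) + 4 * (X * X * X) + X * X * (X * X)) by ring.
  assert (0 <= X * X * X) by nra. assert (0 <= X * X * (X * X)) by nra. nra.
Qed.

Lemma hermite_bound (c : R) : 0 < c ->
  exists K, 0 < K /\ forall Z, sector c Z -> Cmod (hermite Z) <= K * exp (- Cmod Z).
Proof.
  intros Hc. destruct (gauss_sector_bound 4 c Hc) as [K [HK H]].
  exists (100 * K). split. lra. intros Z HZ. unfold hermite. rewrite Cmod_mult.
  pose proof (Cmod_quartic Z). specialize (H Z HZ). pose proof (Cmod_ge_0 (gauss Z)).
  pose proof (Cmod_ge_0 (quartic Z)). nra.
Qed.

Lemma hermite_opp (Z : C) : hermite (- Z) = hermite Z.
Proof. unfold hermite, quartic, gauss. replace (- Z * - Z)%C with (Z * Z)%C by ring. auto. Qed.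

Lemma hermite_0 : hermite 0 = 0%C.
Proof. unfold hermite, quartic. ring. Qed.

(** The term of index [n] belongs to the integer [n + 1]; the same shift occurs in [dterm]. *)
Definition kernel_term (r : C) (n : nat) : C := hermite (INR (S n) * r).

Definition kernel (r : C) : C := Clim (Csum (kernel_term r)).

Lemma exp_neg_gap (X : R) : 0 < X -> X / (1 + X) <= 1 - exp (- X).
Proof.
  intros HX. rewrite exp_Ropp. pose proof (exp_ineq1_le X).
  assert (/ exp X <= / (1 + X)) by (apply Rinv_le_contravar; lra).
  replace (X / (1 + X)) with (1 - / (1 + X)) by (field; lra). lra.
Qed.

(** [b] in the proof is the exact geometric tail [K exp (-n X) / (exp X - 1)], weakened at the end
    by [exp X - 1 >= X]. *)
Lemma geometric_majorant (K X : R) (a : nat -> C) : 0 < K -> 0 < X ->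
  (forall n, Cmod (a n) <= K * exp (- (INR (S n) * X))) ->
  is_Clim (Csum a) (Clim (Csum a)) /\
  forall N, Cmod (Clim (Csum a) - Csum a N) <= K / X * exp (- (INR N * X)).
Proof.
  intros HK HX Ha.
  set (b := fun n => K / (1 - exp (- X)) * exp (- (INR (S n) * X))).
  assert (Hg := exp_neg_gap X HX).
  assert (Hq : 0 < X / (1 + X)) by (apply Rdiv_lt_0_compat; lra).
  assert (H0 : 0 < 1 - exp (- X)) by lra.
  assert (Hb1 : forall n, Cmod (a n) <= b n - b (S n)).
  { intros n. eapply Rle_trans; [apply Ha|]. unfold b.
    replace (exp (- (INR (S (S n)) * X))) with (exp (- (INR (S n) * X)) * exp (- X)).
    - right. field. lra.
    - rewrite <- exp_plus. f_equal. rewrite (S_INR (S n)). ring. }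
  assert (Hb3 : forall n, b n <= K / X * exp (- (INR n * X))).
  { intros n. unfold b. rewrite S_INR.
    replace (- ((INR n + 1) * X)) with (- (INR n * X) + - X) by ring. rewrite exp_plus.
    pose proof (exp_pos (- (INR n * X))).
    replace (K / (1 - exp (- X)) * (exp (- (INR n * X)) * exp (- X)))
      with (K * (exp (- X) / (1 - exp (- X))) * exp (- (INR n * X))) by (field; lra).
    apply Rmult_le_compat_r; [lra|]. apply Rmult_le_compat_l; [lra|].
    apply Rmult_le_reg_r with ((1 - exp (- X)) * X). nra.
    replace (exp (- X) / (1 - exp (- X)) * ((1 - exp (- X)) * X)) with (exp (- X) * X) by (field; lra).
    replace (/ X * ((1 - exp (- X)) * X)) with (1 - exp (- X)) by (field; lra).
    assert (exp (- X) * (1 + X) <= 1).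
    { rewrite exp_Ropp. pose proof (exp_pos X). pose proof (exp_ineq1_le X).
      apply Rmult_le_reg_l with (exp X); auto. rewrite <- Rmult_assoc, Rinv_r by lra. lra. }
    lra. }
  assert (Hb2 : is_lim_seq b 0).
  { apply is_lim_seq_ext with (fun n => K / (1 - exp (- X)) * exp (- X) * exp (- X) ^ n).
    - intros n. unfold b. rewrite exp_pow, Rmult_assoc, <- exp_plus, S_INR. do 2 f_equal. ring.
    - replace (Finite 0) with (Rbar_mult (K / (1 - exp (- X)) * exp (- X)) 0) by (simpl; f_equal; ring).
      apply is_lim_seq_scal_l. apply is_lim_seq_geom.
      rewrite Rabs_pos_eq; [lra|left; apply exp_pos]. }
  destruct (Csum_cv a b Hb1 Hb2) as [H1 H2]. split; auto.
  intros N. eapply Rle_trans; [apply H2|apply Hb3].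
Qed.

Lemma kernel_cv (c : R) : 0 < c -> exists K, 0 < K /\ forall r, sector c r -> r <> 0%C ->
  is_Clim (Csum (kernel_term r)) (kernel r) /\
  forall N, Cmod (kernel r - Csum (kernel_term r) N) <= K / Cmod r * exp (- (INR N * Cmod r)).
Proof.
  intros Hc. destruct (hermite_bound c Hc) as [K [HK H]]. exists K. split; auto.
  intros r Hr Hr0. apply geometric_majorant; auto. apply Cmod_gt_0; auto.
  intros n. unfold kernel_term.
  assert (E : Cmod (INR (S n) * r) = INR (S n) * Cmod r).
  { rewrite Cmod_mult, Cmod_R, Rabs_pos_eq; auto. apply pos_INR. }
  rewrite <- E. apply H. apply sector_scal; auto.
Qed.

(** The remainder after one term already carries the factor [exp (- Cmod r)], and so does the first
    term. *)
Lemma kernel_bound (c : R) : 0 < c -> exists K, 0 < K /\ forall r, sector c r -> 1 <= Cmod r ->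
  Cmod (kernel r) <= K * exp (- Cmod r).
Proof.
  intros Hc. destruct (kernel_cv c Hc) as [K [HK H]]. destruct (hermite_bound c Hc) as [L [HL H2]].
  exists (K + L). split. lra. intros r Hr Hr1.
  assert (Hr0 : r <> 0%C). { apply Cmod_gt_0. lra. }
  destruct (H r Hr Hr0) as [_ H3]. specialize (H3 1%nat).
  replace (kernel r) with (kernel r - Csum (kernel_term r) 1 + Csum (kernel_term r) 1)%C by ring.
  eapply Rle_trans; [apply Cmod_triangle|].
  pose proof (exp_pos (- Cmod r)) as He.
  assert (K / Cmod r * exp (- (INR 1 * Cmod r)) <= K * exp (- Cmod r)).
  { simpl. rewrite Rmult_1_l. apply Rmult_le_compat_r; [lra|].
    rewrite <- (Rmult_1_r K) at 2. apply Rmult_le_compat_l; [lra|].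
    rewrite <- Rinv_1. apply Rinv_le_contravar; lra. }
  assert (Cmod (Csum (kernel_term r) 1) <= L * exp (- Cmod r)).
  { simpl. rewrite Cplus_0_l. unfold kernel_term. simpl INR. rewrite Cmult_1_l. apply H2; auto. }
  lra.
Qed.

Lemma Ccont_ex (f : R -> C) : (forall x, exists l, Cder f x l) -> Ccont f.
Proof.
  intros H x. destruct (H x) as [l [H1 H2]].
  split; apply (ex_derive_continuous (V := R_NormedModule)); eexists; eauto.
Qed.

Ltac ccont := apply Ccont_ex; intros; eexists; cder.

Lemma Ctame_exp (f : R -> C) (K : R) (n : nat) (c : R) : 0 < c ->
  Ccont f -> (forall x, Cmod (f x) <= K * ((1 + Rabs x) ^ n * exp (- (c * Rabs x)))) -> Ctame f.
Proof.
  intros Hc Hf HK. destruct (majorant_exp n c Hc) as [L HL].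
  assert (HK0 : 0 <= K).
  { specialize (HK 0). pose proof (Cmod_ge_0 (f 0)). rewrite Rabs_R0 in HK.
    replace ((1 + 0) ^ n) with 1 in HK by (rewrite Rplus_0_r; symmetry; apply pow1).
    rewrite Rmult_0_r, Ropp_0, exp_0 in HK. lra. }
  apply Ctame_intro with (K * L); auto. intros x. eapply Rle_trans; [apply HK|].
  unfold Rdiv. rewrite Rmult_assoc. apply Rmult_le_compat_l; auto.
Qed.

(** A completed square whose constant depends only on [m], [A], [B], so that one bound serves all
    the lines of a homotopy. *)
Lemma gauss_line (m A B : R) : 0 < m -> exists K, 0 < K /\ forall (p q : C) (x : R),
  m <= fst (p * p)%C -> Cmod p <= A -> Cmod q <= B ->
  Cmod (gauss (p * x + q)) <= K * exp (- Rabs x).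
Proof.
  intros Hm. pose proof PI_RGT_0 as HP.
  set (L := PI * (2 * A * B) + 1).
  exists (exp (PI * (B * B) + L ^ 2 / (4 * (PI * m)))). split. apply exp_pos.
  intros p q x Hp HA HB.
  unfold gauss. rewrite Cmod_Cexp, <- exp_plus. apply exp_le_exp.
  replace (fst (- (PI * ((p * x + q) * (p * x + q))))%C)
    with (- (PI * (fst (p * p)%C * x ^ 2 + 2 * x * fst (p * q)%C + fst (q * q)%C))) by (simpl; ring).
  assert (H1 : Rabs (fst (p * q)%C) <= A * B).
  { eapply Rle_trans; [apply fst_Cmod|]. rewrite Cmod_mult.
    apply Rmult_le_compat; auto; apply Cmod_ge_0. }
  assert (H2 : Rabs (fst (q * q)%C) <= B * B).
  { eapply Rle_trans; [apply fst_Cmod|]. rewrite Cmod_mult.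
    apply Rmult_le_compat; auto; apply Cmod_ge_0. }
  assert (H3 : - (2 * (A * B) * Rabs x) <= 2 * x * fst (p * q)%C).
  { assert (Rabs (x * fst (p * q)%C) <= Rabs x * (A * B)).
    { rewrite Rabs_mult. apply Rmult_le_compat_l; auto. apply Rabs_pos. }
    pose proof (Rle_abs (- (x * fst (p * q)%C))). rewrite Rabs_Ropp in H0. nra. }
  assert (H4 : - (B * B) <= fst (q * q)%C).
  { pose proof (Rle_abs (- fst (q * q)%C)). rewrite Rabs_Ropp in H. lra. }
  assert (H5 : m * x ^ 2 <= fst (p * p)%C * x ^ 2) by (apply Rmult_le_compat_r; [apply pow2_ge_0|auto]).
  assert (H6 : 0 <= PI * m * (Rabs x - L / (2 * (PI * m))) ^ 2).
  { apply Rmult_le_pos. nra. apply pow2_ge_0. }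
  replace (PI * m * (Rabs x - L / (2 * (PI * m))) ^ 2)
    with (PI * (m * Rabs x ^ 2) - L * Rabs x + L ^ 2 / (4 * (PI * m))) in H6 by (field; nra).
  rewrite pow2_abs in H6.
  assert (H7 : PI * (m * x ^ 2 - 2 * (A * B) * Rabs x - B * B)
     <= PI * (fst (p * p)%C * x ^ 2 + 2 * x * fst (p * q)%C + fst (q * q)%C)).
  { apply Rmult_le_compat_l; lra. }
  unfold L in *. lra.
Qed.

(** * The kernel as a theta function *)

Section Fourier.
Variable r : C.
Hypothesis r_re : 0 <= fst r.
Hypothesis r_sq : 0 < fst (r * r)%C.

Lemma r_neq_0 : r <> 0%C.
Proof. intros E. rewrite E in r_sq. simpl in r_sq. lra. Qed.

Definition rline (t : R) : C := (1 + t * (r - 1))%C.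

(** The quotient [a / (1 + a)] is the minimum over [t] of [(1-t)^2 + t^2 a], where [a = Re (r^2)];
    the cross term is nonnegative because [Re r >= 0]. *)
Lemma rline_sq (t : R) : 0 <= t <= 1 ->
  fst (r * r)%C / (1 + fst (r * r)%C) <= fst (rline t * rline t)%C.
Proof.
  intros Ht. set (a := fst (r * r)%C) in *.
  replace (fst (rline t * rline t)%C) with ((1 - t) ^ 2 + 2 * t * (1 - t) * fst r + t ^ 2 * a)
    by (unfold a, rline; simpl; ring).
  assert (0 <= 2 * t * (1 - t) * fst r) by (apply Rmult_le_pos; nra).
  apply Rmult_le_reg_r with (1 + a); [lra|].
  unfold Rdiv. rewrite Rmult_assoc, Rinv_l, Rmult_1_r by lra.
  assert (0 <= (1 - t - t * a) ^ 2) by apply pow2_ge_0.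
  nra.
Qed.

Lemma Cmod_rline (t : R) : 0 <= t <= 1 -> Cmod (rline t) <= 1 + Cmod r.
Proof.
  intros Ht. unfold rline. replace (1 + t * (r - 1))%C with (RtoC (1 - t) + t * r)%C.
  - eapply Rle_trans; [apply Cmod_triangle|]. rewrite Cmod_mult, !Cmod_R, !Rabs_pos_eq by lra.
    pose proof (Cmod_ge_0 r). nra.
  - rewrite RtoC_minus. ring.
Qed.

(** A single homotopy turns the line from direction 1 to direction [r] and shifts it by [Ci * b];
    [P] and [Q] are the two components of [gauss w dw]. *)
Lemma gauss_homotopy (b : C) :
  Cintegral (fun x : R => r * gauss (r * x + Ci * b))%C = Cintegral (fun x : R => gauss x).
Proof.
  set (w := fun x t : R => (rline t * x + t * (Ci * b))%C).
  set (a := fst (r * r)%C).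
  assert (Hm : 0 < a / (1 + a)) by (apply Rdiv_lt_0_compat; unfold a; lra).
  destruct (gauss_line (a / (1 + a)) (1 + Cmod r) (Cmod b) Hm) as [K [HK HG]].
  assert (HGw : forall x t, 0 <= t <= 1 -> Cmod (gauss (w x t)) <= K * exp (- Rabs x)).
  { intros x t Ht. apply HG. apply rline_sq; auto. apply Cmod_rline; auto.
    rewrite !Cmod_mult, Cmod_Ci, Cmod_R, Rabs_pos_eq by lra.
    pose proof (Cmod_ge_0 b). nra. }
  set (P := fun x t : R => (rline t * gauss (w x t))%C).
  set (Q := fun x t : R => (((r - 1) * x + Ci * b) * gauss (w x t))%C).
  set (D := fun x t : R => ((r - 1) * gauss (w x t)
       - 2 * PI * rline t * ((r - 1) * x + Ci * b) * w x t * gauss (w x t))%C).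
  assert (Hcont : forall t, Ccont (fun x => P x t)).
  { intros t. unfold P, w, gauss, rline. ccont. }
  assert (HP : forall t, 0 <= t <= 1 -> Ctame (fun x => P x t)).
  { intros t Ht. apply Ctame_exp with ((1 + Cmod r) * K) 0%nat 1; auto. lra.
    intros x. unfold P. rewrite Cmod_mult. simpl. rewrite !Rmult_1_l, Rmult_assoc.
    apply Rmult_le_compat; auto using Cmod_ge_0, Cmod_rline. }
  assert (HQ : exists K2, forall x t, 0 <= t <= 1 -> Cmod (Q x t) <= K2 / (1 + x ^ 2)).
  { destruct (majorant_exp 1 1 Rlt_0_1) as [L HL].
    exists ((Cmod (r - 1) + Cmod b) * K * L). intros x t Ht. unfold Q. rewrite Cmod_mult.
    apply Rle_trans with ((Cmod (r - 1) + Cmod b) * (1 + Rabs x) * (K * exp (- Rabs x))).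
    - apply Rmult_le_compat; auto using Cmod_ge_0.
      eapply Rle_trans; [apply Cmod_triangle|]. rewrite !Cmod_mult, Cmod_Ci, Cmod_R.
      pose proof (Cmod_ge_0 (r - 1)). pose proof (Cmod_ge_0 b). pose proof (Rabs_pos x). nra.
    - specialize (HL x). rewrite Rmult_1_l in HL. rewrite pow_1 in HL.
      replace ((Cmod (r - 1) + Cmod b) * (1 + Rabs x) * (K * exp (- Rabs x)))
        with ((Cmod (r - 1) + Cmod b) * K * ((1 + Rabs x) * exp (- Rabs x))) by ring.
      unfold Rdiv. rewrite (Rmult_assoc _ L). apply Rmult_le_compat_l; auto.
      pose proof (Cmod_ge_0 (r - 1)). pose proof (Cmod_ge_0 b). nra. }
  destruct HQ as [K2 HQ].
  assert (E := Cintegral_homotopy P D Q K2).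
  rewrite (Cintegral_ext (fun x => gauss x) (fun x => P x 0)).
  2:{ intros x. unfold P, w, rline.
      replace (1 + 0 * (r - 1))%C with (RtoC 1) by ring.
      replace (1 * x + 0 * (Ci * b))%C with (RtoC x) by ring. ring. }
  rewrite E; auto.
  - apply Cintegral_ext. intros x. unfold P, w, rline.
    replace (1 + 1 * (r - 1))%C with r by ring.
    replace (r * x + 1 * (Ci * b))%C with (r * x + Ci * b)%C by ring. auto.
  - intros x t. unfold P, D, w, gauss, rline. eapply Cder_eq. cder. ring.
  - intros x t. unfold Q, D, w, gauss, rline. eapply Cder_eq. cder. ring.
  - unfold D, w, gauss, rline. c2cont.
  - apply HP; lra.
  - apply HP; lra.
Qed.

(** The Gaussian integral is left unevaluated here; its value 1 drops out of the functional equation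
    of the kernel at [r = 1]. *)
Definition gaussian_mass : C := Cintegral (fun x : R => gauss x).

Lemma hermite_line_tame : Ctame (fun x : R => hermite (r * x)%C).
Proof.
  assert (Hm : 0 < fst (r * r)%C) by auto.
  destruct (gauss_line _ (Cmod r) 0 Hm) as [K [HK HG]].
  apply Ctame_exp with (100 * (1 + Cmod r) ^ 4 * K) 4%nat 1. lra.
  - unfold hermite, quartic, gauss. ccont.
  - intros x. rewrite Rmult_1_l. unfold hermite. rewrite Cmod_mult.
    assert (H1 := Cmod_quartic (r * x)%C).
    assert (H2 : Cmod (gauss (r * x)) <= K * exp (- Rabs x)).
    { replace (r * x)%C with (r * x + 0)%C by ring. apply HG; lra || (rewrite Cmod_0; lra). }
    assert (H3 : (1 + Cmod (r * x)) ^ 4 <= ((1 + Cmod r) * (1 + Rabs x)) ^ 4).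
    { apply pow_incr. rewrite Cmod_mult, Cmod_R. pose proof (Cmod_ge_0 r). pose proof (Rabs_pos x). split; nra. }
    rewrite Rpow_mult_distr in H3.
    apply Rle_trans with (100 * ((1 + Cmod r) ^ 4 * (1 + Rabs x) ^ 4) * (K * exp (- Rabs x))).
    + apply Rmult_le_compat; auto using Cmod_ge_0. lra.
    + right; ring.
Qed.

(* The cubic below is the antiderivative that exhibits [hermite] as a fixed point of the Fourier transform. *)
Lemma hermite_fourier (k : R) :
  Cintegral (fun x : R => hermite (r * x) * Cexp (- (Ci * (2 * PI * (k * x)))))%C
  = (gaussian_mass / r * hermite (k / r))%C.
Proof.
  pose proof r_neq_0 as Hr.
  set (b := (k / r)%C).
  assert (Hk : RtoC k = (b * r)%C) by (unfold b; field; auto).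
  (* Completing the square with [k = b r] turns the Fourier factor into a shift of the Gaussian
     argument by [Ci * b], which [gauss_homotopy] removes. *)
  assert (He : forall x : R, (gauss (r * x) * Cexp (- (Ci * (2 * PI * (k * x)))))%C
              = (gauss b * gauss (r * x + Ci * b))%C).
  { intros x. unfold gauss. rewrite <- !Cexp_plus. f_equal. rewrite Hk.
    transitivity (- (PI * (r * x * (r * x) + 2 * Ci * b * (r * x))))%C. ring.
    replace ((r * x + Ci * b) * (r * x + Ci * b))%C
      with (r * x * (r * x) + 2 * Ci * b * (r * x) + (Ci * Ci) * (b * b))%C by ring.
    replace (Ci * Ci)%C with (- (1))%C by (apply C_ext; simpl; ring). ring. }
  destruct (gauss_line _ (Cmod r) (Cmod b) r_sq) as [K [HK HG]].
  assert (HGb : forall x : R, Cmod (gauss (r * x + Ci * b)) <= K * exp (- Rabs x)).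
  { intros x. apply HG; try lra. rewrite Cmod_mult, Cmod_Ci. lra. }
  set (cub := fun X : C => (- (2 * PI) * (X * X * X) + 2 * PI * Ci * b * (X * X) + 2 * PI * (b * b) * X
      + (2 * Ci * b - 2 * PI * Ci * (b * b * b)))%C).
  assert (Hcub : exists L, 0 <= L /\ forall x : R, Cmod (cub (r * x)%C) <= L * (1 + Rabs x) ^ 3).
  { set (A0 := Cmod (- (2 * PI) * (r * r * r))%C). set (A1 := Cmod (2 * PI * Ci * b * (r * r))%C).
    set (A2 := Cmod (2 * PI * (b * b) * r)%C).
    set (A3 := Cmod (2 * Ci * b - 2 * PI * Ci * (b * b * b))%C).
    exists (A0 + A1 + A2 + A3).
    assert (0 <= A0 /\ 0 <= A1 /\ 0 <= A2 /\ 0 <= A3) as (? & ? & ? & ?) by (repeat split; apply Cmod_ge_0).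
    split. lra. intros x. unfold cub.
    replace (- (2 * PI) * (r * x * (r * x) * (r * x)) + 2 * PI * Ci * b * (r * x * (r * x)) +
      2 * PI * (b * b) * (r * x) + (2 * Ci * b - 2 * PI * Ci * (b * b * b)))%C with
     (- (2 * PI) * (r * r * r) * (x * x * x) + 2 * PI * Ci * b * (r * r) * (x * x) +
      2 * PI * (b * b) * r * x + (2 * Ci * b - 2 * PI * Ci * (b * b * b)))%C by ring.
    eapply Rle_trans; [apply Cmod_triangle|].
    eapply Rle_trans; [apply Rplus_le_compat_r; eapply Rle_trans; [apply Cmod_triangle|];
      apply Rplus_le_compat_r; apply Cmod_triangle|].
    rewrite (Cmod_mult (- (2 * PI) * (r * r * r))), (Cmod_mult (2 * PI * Ci * b * (r * r))),
      (Cmod_mult (2 * PI * (b * b) * r)).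
    fold A0 A1 A2 A3. rewrite !Cmod_mult, !Cmod_R. pose proof (Rabs_pos x). set (X := Rabs x) in *.
    assert (X * X * X <= (1 + X) ^ 3) by (simpl; nra).
    assert (X * X <= (1 + X) ^ 3) by (simpl; nra).
    assert (X <= (1 + X) ^ 3) by (simpl; nra). assert (1 <= (1 + X) ^ 3) by (simpl; nra).
    assert (A0 * (X * X * X) <= A0 * (1 + X) ^ 3) by (apply Rmult_le_compat_l; auto).
    assert (A1 * (X * X) <= A1 * (1 + X) ^ 3) by (apply Rmult_le_compat_l; auto).
    assert (A2 * X <= A2 * (1 + X) ^ 3) by (apply Rmult_le_compat_l; auto).
    assert (A3 * 1 <= A3 * (1 + X) ^ 3) by (apply Rmult_le_compat_l; auto).
    lra. }
  destruct Hcub as [L [HL0 HL]].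
  set (g := fun x : R => (r * (gauss (r * x + Ci * b)))%C).
  assert (Hg : Ctame g).
  { apply Ctame_exp with (Cmod r * K) 0%nat 1. lra. unfold g, gauss; ccont.
    intros x. unfold g. rewrite Cmod_mult, Rmult_1_l. simpl. rewrite Rmult_1_l, Rmult_assoc.
    apply Rmult_le_compat_l; auto. apply Cmod_ge_0. }
  assert (Hh : Ctame (fun x : R => hermite (r * x) * Cexp (- (Ci * (2 * PI * (k * x)))))%C).
  { assert (Ht := hermite_line_tame). destruct Ht as [[_ [K1 Ht1]] [_ [K2 Ht2]]].
    apply Ctame_intro with (K1 + K2). unfold hermite, quartic, gauss; ccont.
    intros x. rewrite Cmod_mult, Cmod_Cexp.
    replace (fst (- (Ci * (2 * PI * (k * x))))%C) with 0 by (simpl; ring).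
    rewrite exp_0, Rmult_1_r. eapply Rle_trans; [apply Cmod_le_sum|].
    specialize (Ht1 x). specialize (Ht2 x). unfold Rdiv in *. lra. }
  destruct (majorant_exp 3 1 Rlt_0_1) as [M HM].
  assert (E0 : Cintegral (fun x : R => r * (hermite (r * x) * Cexp (- (Ci * (2 * PI * (k * x)))))
       - (quartic b * gauss b) * g x)%C = 0%C).
  { apply Cintegral_derivative with (fun x : R => gauss b * (cub (r * x) * gauss (r * x + Ci * b)))%C
      (Cmod (gauss b) * (L * K * M)).
    - intros x. unfold hermite.
      replace (r * (quartic (r * x) * gauss (r * x) * Cexp (- (Ci * (2 * PI * (k * x))))))%C
        with (r * (quartic (r * x) * (gauss (r * x) * Cexp (- (Ci * (2 * PI * (k * x)))))))%C by ring.
      rewrite He. unfold g, gauss at 2 3, cub, quartic. eapply Cder_eq. cder.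
      unfold gauss.
      apply C_ext; simpl; ring.
    - apply Ctame_minus. apply Ctame_scal; auto. apply Ctame_scal; auto.
    - intros x.
      rewrite !Cmod_mult. specialize (HM x). rewrite Rmult_1_l in HM.
      unfold Rdiv. rewrite Rmult_assoc. apply Rmult_le_compat_l. apply Cmod_ge_0.
      apply Rle_trans with (L * (1 + Rabs x) ^ 3 * (K * exp (- Rabs x))).
      + apply Rmult_le_compat; auto using Cmod_ge_0.
      + replace (L * (1 + Rabs x) ^ 3 * (K * exp (- Rabs x))) with (L * K * ((1 + Rabs x) ^ 3 * exp (- Rabs x))) by ring.
        rewrite (Rmult_assoc (L * K)). apply Rmult_le_compat_l; auto. nra. }
  rewrite Cintegral_minus, !Cintegral_scal in E0; auto using Ctame_scal.
  unfold g in E0. rewrite gauss_homotopy in E0. fold gaussian_mass in E0.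
  fold (hermite b) in E0.
  set (J := Cintegral _) in *.
  replace J with ((r * J - hermite b * gaussian_mass) / r + gaussian_mass / r * hermite b)%C by (field; auto).
  rewrite E0. field; auto.
Qed.
End Fourier.

Lemma cos_Cexp (y : R) : RtoC (cos y) = (/ 2 * (Cexp (- (Ci * y)) + Cexp (Ci * y)))%C.
Proof.
  replace (/ 2)%C with (RtoC (/ 2)) by (apply RtoC_inv; lra).
  apply C_ext; unfold Cexp; simpl.
  - replace (- (0 * y - 1 * 0)) with 0 by ring. replace (0 * y - 1 * 0) with 0 by ring.
    replace (- (0 * 0 + 1 * y)) with (- y) by ring. replace (0 * 0 + 1 * y) with y by ring.
    rewrite exp_0, cos_neg, sin_neg. field.
  - replace (- (0 * y - 1 * 0)) with 0 by ring. replace (0 * y - 1 * 0) with 0 by ring.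
    replace (- (0 * 0 + 1 * y)) with (- y) by ring. replace (0 * 0 + 1 * y) with y by ring.
    rewrite exp_0, cos_neg, sin_neg. field.
Qed.

Lemma Ctame_bounded (f g : R -> C) (M : R) : Ctame f -> Ccont g -> (forall x, Cmod (g x) <= M) ->
  Ctame (fun x => f x * g x)%C.
Proof.
  intros Hf Hg HM. assert (Hc := Ctame_cont f Hf). destruct Hf as [[_ [K1 H1]] [_ [K2 H2]]].
  apply Ctame_intro with ((K1 + K2) * M).
  - apply Ccont_mult; auto.
  - intros x. rewrite Cmod_mult.
    replace ((K1 + K2) * M / (1 + x ^ 2)) with ((K1 / (1 + x ^ 2) + K2 / (1 + x ^ 2)) * M)
      by (field; pose proof (sq_pos1 x); lra).
    apply Rmult_le_compat; auto using Cmod_ge_0.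
    eapply Rle_trans; [apply Cmod_le_sum|]. apply Rplus_le_compat; [apply H1|apply H2].
Qed.

Lemma hermite_cos (r : C) (k : R) : 0 <= fst r -> 0 < fst (r * r)%C ->
  Cintegral (fun x : R => hermite (r * x) * cos (2 * PI * k * x))%C
  = (gaussian_mass / r * hermite (k / r))%C.
Proof.
  intros H1 H2. pose proof (r_neq_0 r H2) as Hr.
  assert (Ht := hermite_line_tame r H2).
  assert (Hb : forall k : R, Ctame (fun x : R => hermite (r * x) * Cexp (- (Ci * (2 * PI * (k * x)))))%C).
  { intros k'. apply Ctame_bounded with 1; auto. ccont.
    intros x. rewrite Cmod_Cexp. replace (fst (- (Ci * (2 * PI * (k' * x))))%C) with 0 by (simpl; ring).
    rewrite exp_0. lra. }
  rewrite (Cintegral_ext _ (fun x : R => / 2 * ((hermite (r * x) * Cexp (- (Ci * (2 * PI * (k * x))))) +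
     (hermite (r * x) * Cexp (- (Ci * (2 * PI * ((- k)%R * x)))))))%C).
  - rewrite Cintegral_scal, Cintegral_plus, !hermite_fourier; auto using Ctame_plus.
    replace ((- k)%R / r)%C with (- (k / r))%C by (rewrite RtoC_opp; field; auto).
    rewrite hermite_opp. field. auto.
  - intros x. rewrite cos_Cexp, !RtoC_mult, RtoC_opp.
    replace (- (Ci * (2 * PI * k * x)))%C with (- (Ci * (2 * PI * (k * x))))%C by ring.
    replace (Ci * (2 * PI * k * x))%C with (- (Ci * (2 * PI * (- k * x))))%C by ring. ring.
Qed.

Lemma sector_inv (c : R) (r : C) : r <> 0%C -> sector c r -> sector c (/ r).
Proof.
  unfold sector. intros Hr H. assert (Hm : 0 < Cmod r ^ 2) by (apply pow_lt, Cmod_gt_0; auto).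
  rewrite Cmod_inv by auto.
  replace (fst (/ r * / r)%C) with (fst (r * r)%C / (Cmod r ^ 2) ^ 2).
  - replace (c * (/ Cmod r) ^ 2) with (c * Cmod r ^ 2 / (Cmod r ^ 2) ^ 2).
    + apply Rmult_le_compat_r; auto. left. apply Rinv_0_lt_compat. nra.
    + field. intros E; rewrite E in Hm; simpl in Hm; lra.
  - rewrite Cmod2_alt in *. unfold Re, Im in *. destruct r as [a b]. simpl in *. field. nra.
Qed.

Lemma fst_RtoC_mult (x : R) (z : C) : fst (x * z)%C = x * fst z.
Proof. simpl. ring. Qed.
Lemma snd_RtoC_mult (x : R) (z : C) : snd (x * z)%C = x * snd z.
Proof. simpl. ring. Qed.

(** Poisson summation for [x |-> hermite (r x)]. Both sides are twice a sum over positive integers,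
    since [hermite] is even and vanishes at 0. The generic real-linear [p] treats the real and
    imaginary parts at once. *)
Lemma kernel_functional_r (c : R) (r : C) : 0 < c -> sector c r -> 0 <= fst r -> r <> 0%C ->
  kernel r = (gaussian_mass / r * kernel (/ r))%C.
Proof.
  intros Hc Hs Hr1 Hr.
  assert (Hsq : 0 < fst (r * r)%C).
  { unfold sector in Hs. assert (0 < Cmod r ^ 2) by (apply pow_lt, Cmod_gt_0; auto). nra. }
  assert (Hri : (/ r)%C <> 0%C).
  { intros E. apply Hr. rewrite <- (Cmult_1_r r), <- (Cinv_r r), E; auto. ring. }
  destruct (kernel_cv c Hc) as [K [_ HK]].
  destruct (HK r Hs Hr) as [HL1 _]. destruct (HK (/ r)%C (sector_inv c r Hr Hs) Hri) as [HL2 _].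
  assert (Ht := hermite_line_tame r Hsq).
  assert (Hrhs : is_Clim (fun N => gaussian_mass / r * Csum (kernel_term (/ r)) N)%C
                  (gaussian_mass / r * kernel (/ r))%C).
  { apply (is_Clim_mult (fun _ => gaussian_mass / r)%C); auto. apply is_Clim_const. }
  assert (G : forall p : C -> R,
     (forall z w, p (z + w)%C = p z + p w) -> (forall (x : R) z, p (x * z)%C = x * p z) ->
     (forall f, Ctame f -> tame (fun x => p (f x))) ->
     (forall f, p (Cintegral f) = integral (fun x => p (f x))) ->
     (forall a l, is_Clim a l -> is_lim_seq (fun n => p (a n)) (p l)) ->
     p (kernel r) = p (gaussian_mass / r * kernel (/ r))%C).
  { intros p Hp1 Hp2 Hp3 Hp4 Hp5.
    assert (Hp0 : p 0%C = 0). { replace (RtoC 0) with (0 * 0)%C by ring. rewrite Hp2. ring. }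
    assert (E : 2 * p (kernel r) = 2 * p (gaussian_mass / r * kernel (/ r))%C); [|lra].
    apply (poisson_summation (fun x => p (hermite (r * x)))); auto.
    - apply is_lim_seq_ext with (fun M => 2 * p (Csum (kernel_term r) M)).
      + induction n; cbn [zsum Csum].
        * rewrite Hp0. replace (r * 0)%C with (RtoC 0) by ring. rewrite hermite_0, Hp0. ring.
        * rewrite Hp1, <- IHn. unfold kernel_term.
          replace (r * (- INR (S n))%R)%C with (- (INR (S n) * r))%C by (rewrite RtoC_opp; ring).
          rewrite hermite_opp. replace (r * INR (S n))%C with (INR (S n) * r)%C by ring. ring.
      + apply (is_lim_seq_scal_l _ 2 (p (kernel r))). apply Hp5. auto.
    - apply is_lim_seq_ext with (fun M => 2 * p (gaussian_mass / r * Csum (kernel_term (/ r)) M)%C).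
      + induction n; cbn [fourier_sum Csum].
        * replace (gaussian_mass / r * 0)%C with (RtoC 0) by ring. rewrite Hp0.
          rewrite (integral_ext _ (fun x => p (hermite (r * x) * cos (2 * PI * 0 * x))%C)).
          -- rewrite <- Hp4, hermite_cos; auto.
             replace (0 / r)%C with (RtoC 0) by (field; auto). rewrite hermite_0.
             replace (gaussian_mass / r * 0)%C with (RtoC 0) by ring. rewrite Hp0. ring.
          -- intros x. rewrite Rmult_0_r, Rmult_0_l, cos_0. f_equal. ring.
        * replace (gaussian_mass / r * (Csum (kernel_term (/ r)) n + kernel_term (/ r) n))%C
            with (gaussian_mass / r * Csum (kernel_term (/ r)) n + gaussian_mass / r * hermite (INR (S n) / r))%C
            by (unfold kernel_term, Cdiv; ring).
          rewrite Hp1, Rmult_plus_distr_l, IHn. f_equal. f_equal.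
          rewrite <- hermite_cos, Hp4; auto. apply integral_ext. intros x.
          rewrite Cmult_comm, Hp2. ring.
      + apply (is_lim_seq_scal_l _ 2 (p (gaussian_mass / r * kernel (/ r))%C)). apply Hp5. auto. }
  apply C_ext.
  - apply (G fst); intros; auto using fst_RtoC_mult. apply H. apply H.
  - apply (G snd); intros; auto using snd_RtoC_mult. apply H. apply H.
Qed.

(** * The kernel in exponential coordinates on the strip of half-width [PI / 4] *)

Lemma Cmod_Cexp_sq (z : C) : Cmod (Cexp z) ^ 2 = exp (2 * fst z).
Proof. rewrite Cmod_Cexp, exp_pow. reflexivity. Qed.

Lemma fst_Cexp_sq (z : C) : fst (Cexp z * Cexp z)%C = exp (2 * fst z) * cos (2 * snd z).
Proof.
  rewrite <- Cexp_plus. unfold Cexp; simpl. f_equal; f_equal; ring.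
Qed.

Lemma Cexp_sector (z : C) : sector (cos (2 * snd z)) (Cexp z).
Proof. unfold sector. rewrite Cmod_Cexp_sq, fst_Cexp_sq. lra. Qed.

Lemma cos_2_pos (y : R) : Rabs y < PI / 4 -> 0 < cos (2 * y).
Proof.
  intros H. assert (- (PI / 4) < y < PI / 4) by (unfold Rabs in H; destruct (Rcase_abs y); lra).
  apply cos_gt_0; lra.
Qed.

Lemma Cexp_re_pos (z : C) : Rabs (snd z) < PI / 4 -> 0 < fst (Cexp z).
Proof.
  intros H. assert (- (PI / 4) < snd z < PI / 4) by (unfold Rabs in H; destruct (Rcase_abs (snd z)); lra).
  pose proof PI_RGT_0. simpl. apply Rmult_lt_0_compat. apply exp_pos. apply cos_gt_0; lra.
Qed.

Lemma kernel_functional_aux (z : C) : Rabs (snd z) < PI / 4 ->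
  kernel (Cexp z) = (gaussian_mass * Cexp (- z) * kernel (Cexp (- z)))%C.
Proof.
  intros H. rewrite (kernel_functional_r (cos (2 * snd z))).
  - rewrite Cexp_opp. unfold Cdiv. auto.
  - apply cos_2_pos; auto.
  - apply Cexp_sector.
  - left. apply Cexp_re_pos; auto.
  - apply Cexp_neq_0.
Qed.

Lemma hermite_R (x : R) : hermite x = RtoC ((4 * (PI * PI) * (x * x * (x * x)) - 6 * PI * (x * x)) * exp (- (PI * (x * x)))).
Proof.
  unfold hermite, quartic, gauss.
  replace (- (PI * (x * x)))%C with (RtoC (- (PI * (x * x)))) by (rewrite RtoC_opp, !RtoC_mult; auto).
  rewrite Cexp_R, RtoC_mult. f_equal. rewrite RtoC_minus, !RtoC_mult. auto.
Qed.

Lemma PI_gt_3 : 3 < PI.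
Proof. pose proof PI2_3_2. lra. Qed.

(** For [y >= 1] the polynomial factor is [2 PI y^2 (2 PI y^2 - 3)], so every term of the series is
    positive. *)
Lemma kernel_real_pos (x : R) : 1 <= x -> snd (kernel x) = 0 /\ 0 < fst (kernel x).
Proof.
  intros Hx.
  assert (Hs : sector 1 x). { unfold sector. rewrite Cmod_R, pow2_abs. simpl. lra. }
  assert (Hx0 : RtoC x <> 0%C). { intros E. apply RtoC_inj in E. lra. }
  destruct (kernel_cv 1 Rlt_0_1) as [K [_ HK]]. destruct (HK x Hs Hx0) as [[H1 H2] _].
  assert (Ht : forall n, snd (kernel_term x n) = 0 /\ 0 < fst (kernel_term x n)).
  { intros n. unfold kernel_term. rewrite <- RtoC_mult, hermite_R. split; [reflexivity|].
    unfold RtoC; cbn [fst]. apply Rmult_lt_0_compat; [|apply exp_pos].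
    assert (Hn : 1 <= INR (S n)) by (rewrite S_INR; pose proof (pos_INR n); lra).
    set (y := INR (S n) * x). assert (Hy : 1 <= y) by (unfold y; nra). clearbody y.
    replace (4 * (PI * PI) * (y * y * (y * y)) - 6 * PI * (y * y)) with (2 * PI * (y * y) * (2 * PI * (y * y) - 3)) by ring.
    pose proof PI_gt_3. assert (1 <= y * y) by nra.
    assert (3 * 1 <= PI * (y * y)) by (apply Rmult_le_compat; lra). apply Rmult_lt_0_compat; lra. }
  split.
  - assert (E : is_lim_seq (fun n => snd (Csum (kernel_term x) n)) 0).
    { apply is_lim_seq_ext with (fun _ => 0); [|apply is_lim_seq_const].
      induction n; [reflexivity|].
      change (0 = snd (Csum (kernel_term x) n) + snd (kernel_term x n)).
      rewrite <- IHn. destruct (Ht n) as [Hz _]. rewrite Hz. ring. }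
    apply is_lim_seq_unique in E. apply is_lim_seq_unique in H2. rewrite E in H2. injection H2; auto.
  - apply Rlt_le_trans with (fst (kernel_term x 0)). apply Ht.
    apply (is_lim_seq_le_loc (fun _ => fst (kernel_term x 0)) _ (Finite _) (Finite _)) with (3 := H1) (2 := is_lim_seq_const _).
    exists 1%nat. intros n Hn. induction Hn.
    + change (fst (kernel_term x 0) <= 0 + fst (kernel_term x 0)). lra.
    + change (fst (kernel_term x 0) <= fst (Csum (kernel_term x) m) + fst (kernel_term x m)).
      destruct (Ht m). lra.
Qed.

(** At [z = 0] the functional equation reads [kernel 1 = gaussian_mass * kernel 1], and [kernel 1]
    is positive. *)
Lemma gaussian_mass_1 : gaussian_mass = 1%C.
Proof.
  assert (E := kernel_functional_aux 0).
  simpl snd in E. rewrite Rabs_R0 in E. specialize (E ltac:(pose proof PI_RGT_0; lra)).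
  replace (- 0)%C with (RtoC 0) in E by ring. rewrite Cexp_0 in E.
  assert (Hk : kernel 1 <> 0%C).
  { intros E1. destruct (kernel_real_pos 1 (Rle_refl 1)) as [_ H]. rewrite E1 in H. simpl in H. apply (Rlt_irrefl 0 H). }
  assert (H : ((gaussian_mass - 1) * kernel 1)%C = 0%C).
  { replace ((gaussian_mass - 1) * kernel 1)%C with (gaussian_mass * 1 * kernel 1 - kernel 1)%C by ring.
    rewrite <- E. ring. }
  destruct (Ceq_dec (gaussian_mass - 1)%C 0%C) as [H1|H1].
  - replace gaussian_mass with ((gaussian_mass - 1) + 1)%C by ring. rewrite H1. ring.
  - exfalso. apply (Cmult_neq_0 _ _ H1 Hk H).
Qed.

(** The factor [Cexp (z / 2)] distributes the [1 / r] of the functional equation evenly between [r]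
    and [1 / r], which makes the function even. *)
Definition Phi (z : C) : C := (Cexp (z / 2) * kernel (Cexp z))%C.

Lemma Phi_even (z : C) : Rabs (snd z) < PI / 4 -> Phi (- z) = Phi z.
Proof.
  intros H. unfold Phi. rewrite (kernel_functional_aux z H), gaussian_mass_1.
  replace (Cexp (- z / 2)) with (Cexp (z / 2) * Cexp (- z))%C. ring.
  rewrite <- Cexp_plus. f_equal. field.
Qed.

Lemma fst_half (z : C) : fst (z / 2)%C = fst z / 2.
Proof. unfold Cdiv. replace (/ 2)%C with (RtoC (/ 2)) by (apply RtoC_inv; lra). simpl. field. Qed.
Lemma snd_half (z : C) : snd (z / 2)%C = snd z / 2.
Proof. unfold Cdiv. replace (/ 2)%C with (RtoC (/ 2)) by (apply RtoC_inv; lra). simpl. field. Qed.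

(** Every rate [A] is reached because [kernel] decays doubly exponentially for [x >= 0]. The other
    half-line follows by evenness, which is why [y] and [- y] are estimated together. *)
Lemma Phi_decay (y A : R) : Rabs y < PI / 4 ->
  exists K, 0 < K /\ forall x, Cmod (Phi (x, y)) <= K * exp (- (A * Rabs x)).
Proof.
  intros Hy.
  assert (H : exists K, 0 < K /\ forall x s, 0 <= x -> (s = y \/ s = - y) -> Cmod (Phi (x, s)) <= K * exp (- (A * x))).
  { destruct (kernel_bound (cos (2 * y)) (cos_2_pos y Hy)) as [K [HK HB]].
    set (B := Rabs A + 1).
    exists (K * exp (B ^ 2)). split. { apply Rmult_lt_0_compat; auto; apply exp_pos. }
    intros x s Hx Hs. unfold Phi. rewrite Cmod_mult, Cmod_Cexp, fst_half. simpl fst.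
    assert (Hb : Cmod (kernel (Cexp (x, s))) <= K * exp (- exp x)).
    { replace (exp x) with (Cmod (Cexp (x, s))) by (rewrite Cmod_Cexp; auto). apply HB.
      - replace (cos (2 * y)) with (cos (2 * snd (x, s))). apply Cexp_sector.
        simpl. destruct Hs; subst; auto. rewrite <- cos_neg. f_equal. ring.
      - rewrite Cmod_Cexp. simpl. rewrite <- exp_0. apply exp_le_exp; auto. }
    apply Rle_trans with (exp (x / 2) * (K * exp (- exp x))).
    { apply Rmult_le_compat_l; auto. left; apply exp_pos. }
    replace (exp (x / 2) * (K * exp (- exp x))) with (K * exp (x / 2 + - exp x)) by (rewrite exp_plus; ring).
    rewrite Rmult_assoc, <- exp_plus. apply Rmult_le_compat_l; [lra|]. apply exp_le_exp.
    assert (Hxp : (1 + x / 2) ^ 2 <= exp x).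
    { replace (exp x) with (exp (x / 2) ^ 2).
      - apply pow_incr. pose proof (exp_ineq1_le (x / 2)). lra.
      - rewrite exp_pow. f_equal. simpl. field. }
    assert (A * x <= Rabs A * x). { apply Rmult_le_compat_r; auto. apply Rle_abs. }
    pose proof (Rabs_pos A). unfold B in *. 
    assert (0 <= (x / 2 - Rabs A) ^ 2) by apply pow2_ge_0. nra. }
  destruct H as [K [HK H]]. exists K. split; auto. intros x.
  unfold Rabs. destruct (Rcase_abs x) as [Hx|Hx].
  - rewrite <- Phi_even by auto.
    replace (- (x, y))%C with ((- x, - y) : C) by (apply C_ext; simpl; auto).
    apply H; auto. lra.
  - apply H; auto. lra.
Qed.

(** Uniformity is asked for on a right half-line only: the bound available for the kernel series
    degenerates as [t] tends to minus infinity. *)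
Lemma continuous_of_approx (f : R -> R) (u : nat -> R -> R) (e : nat -> R) (x0 x : R) :
  x0 < x -> (forall n t, continuous (u n) t) ->
  (forall n t, x0 <= t -> Rabs (f t - u n t) <= e n) -> is_lim_seq e 0 -> continuous f x.
Proof.
  intros Hx Hu He Hl. apply continuity_pt_filterlim. intros eps Heps.
  apply is_lim_seq_spec in Hl. assert (He3 : 0 < eps / 3) by lra.
  destruct (Hl (mkposreal _ He3)) as [N HN]. specialize (HN N (Nat.le_refl N)). simpl in HN.
  rewrite Rminus_0_r in HN. apply Rle_lt_trans with (1 := Rle_abs _) in HN.
  assert (Hc := Hu N x). apply continuity_pt_filterlim in Hc. destruct (Hc (eps / 3) He3) as [d [Hd Hd2]].
  exists (Rmin d (x - x0)). split. apply Rmin_pos; lra.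
  intros y [_ Hy]. simpl in *. unfold Rdist in *.
  assert (H1 : Rabs (y - x) < d) by (eapply Rlt_le_trans; [apply Hy|apply Rmin_l]).
  assert (H2 : Rabs (y - x) < x - x0) by (eapply Rlt_le_trans; [apply Hy|apply Rmin_r]).
  assert (Hy0 : x0 <= y). { unfold Rabs in H2; destruct (Rcase_abs (y - x)); lra. }
  assert (H3 : Rabs (u N y - u N x) < eps / 3).
  { destruct (Req_dec x y) as [<-|Hn].
    - rewrite Rminus_diag, Rabs_R0; lra.
    - apply Hd2. split; auto. split; auto. exact Logic.I. }
  replace (f y - f x) with ((f y - u N y) + ((u N y - u N x) - (f x - u N x))) by ring.
  assert (H4 := He N y Hy0). assert (H5 := He N x ltac:(lra)).
  eapply Rle_lt_trans; [apply Rabs_triang|].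
  assert (Rabs (u N y - u N x - (f x - u N x)) <= Rabs (u N y - u N x) + Rabs (f x - u N x)).
  { unfold Rminus at 1. eapply Rle_trans; [apply Rabs_triang|]. rewrite Rabs_Ropp. lra. }
  lra.
Qed.

Lemma Ccont_Csum (a : R -> nat -> C) (N : nat) : (forall n, Ccont (fun x => a x n)) ->
  Ccont (fun x => Csum (a x) N).
Proof.
  intros H. induction N; cbn [Csum].
  - intros x; split; apply continuous_const.
  - apply Ccont_plus; auto.
Qed.

Lemma RtoC_line (x y : R) : ((x, y) : C) = (x + Ci * y)%C.
Proof. apply C_ext; simpl; ring. Qed.

Lemma Ccont_ext (f g : R -> C) : (forall x, f x = g x) -> Ccont f -> Ccont g.
Proof.
  intros H Hf x. destruct (Hf x). split.
  - apply continuous_ext with (fun x => fst (f x)); auto. intros; rewrite H; auto.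
  - apply continuous_ext with (fun x => snd (f x)); auto. intros; rewrite H; auto.
Qed.

Lemma kernel_cont (y : R) : Rabs y < PI / 4 -> Ccont (fun x => kernel (Cexp (x, y))).
Proof.
  intros Hy x.
  destruct (kernel_cv (cos (2 * y)) (cos_2_pos y Hy)) as [K [HK HB]].
  set (e := fun n => K / exp (x - 1) * exp (- (INR n * exp (x - 1)))).
  assert (He : forall n t, x - 1 <= t -> Cmod (kernel (Cexp (t, y)) - Csum (kernel_term (Cexp (t, y))) n) <= e n).
  { intros n t Ht. destruct (HB (Cexp (t, y))) as [_ H2].
    - apply (Cexp_sector (t, y)).
    - apply Cexp_neq_0.
    - eapply Rle_trans; [apply H2|]. rewrite Cmod_Cexp. simpl fst. unfold e.
      assert (exp (x - 1) <= exp t) by (apply exp_le_exp; auto).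
      pose proof (exp_pos (x - 1)).
      apply Rmult_le_compat.
      + apply Rmult_le_pos. lra. left; apply Rinv_0_lt_compat, exp_pos.
      + left; apply exp_pos.
      + apply Rmult_le_compat_l. lra. apply Rinv_le_contravar; auto.
      + apply exp_le_exp. pose proof (pos_INR n). nra. }
  assert (Hl : is_lim_seq e 0).
  { apply is_lim_seq_ext with (fun n => K / exp (x - 1) * exp (- exp (x - 1)) ^ n).
    - intros n. unfold e. rewrite exp_pow. do 2 f_equal. ring.
    - replace (Finite 0) with (Rbar_mult (K / exp (x - 1)) 0) by (simpl; f_equal; ring).
      apply is_lim_seq_scal_l. apply is_lim_seq_geom.
      rewrite Rabs_pos_eq by (left; apply exp_pos). apply Rlt_le_trans with (exp 0); [|rewrite exp_0; lra].
      apply exp_increasing. pose proof (exp_pos (x - 1)). lra. }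
  assert (Hc : forall n, Ccont (fun t => Csum (kernel_term (Cexp (t, y))) n)).
  { intros n. apply (Ccont_Csum (fun t => kernel_term (Cexp (t, y)))). intros m.
    apply Ccont_ext with (fun t : R => kernel_term (Cexp (t + Ci * y)) m).
    { intros; rewrite RtoC_line; auto. }
    unfold kernel_term, hermite, quartic, gauss. ccont. }
  split.
  - apply continuous_of_approx with (fun n t => fst (Csum (kernel_term (Cexp (t, y))) n)) e (x - 1); auto. lra.
    + intros n t. apply Hc.
    + intros n t Ht. eapply Rle_trans; [|apply (He n t Ht)]. apply (fst_Cmod (_ - _)%C).
  - apply continuous_of_approx with (fun n t => snd (Csum (kernel_term (Cexp (t, y))) n)) e (x - 1); auto. lra.
    + intros n t. apply Hc.
    + intros n t Ht. eapply Rle_trans; [|apply (He n t Ht)]. apply (snd_Cmod (_ - _)%C).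
Qed.

Lemma Phi_cont (y : R) : Rabs y < PI / 4 -> Ccont (fun x => Phi (x, y)).
Proof.
  intros Hy. apply Ccont_mult; [|apply kernel_cont; auto].
  apply Ccont_ext with (fun x : R => Cexp ((x + Ci * y) * / 2)). intros; rewrite RtoC_line; auto.
  ccont.
Qed.

Lemma Cexp_conj (z : C) : Cexp (Cconj z) = Cconj (Cexp z).
Proof. unfold Cexp, Cconj; simpl. rewrite cos_neg, sin_neg. f_equal; ring. Qed.

Lemma Cconj_R (x : R) : Cconj x = x.
Proof. apply C_ext; simpl; ring. Qed.

Lemma hermite_conj (z : C) : hermite (Cconj z) = Cconj (hermite z).
Proof.
  unfold hermite, quartic, gauss.
  rewrite !Cmult_conj, <- Cexp_conj, Copp_conj, Cminus_conj, !Cmult_conj, !Cconj_R. auto.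
Qed.

Lemma kernel_conj (z : C) : kernel (Cconj z) = Cconj (kernel z).
Proof.
  assert (E : forall n, Csum (kernel_term (Cconj z)) n = Cconj (Csum (kernel_term z) n)).
  { induction n; cbn [Csum].
    - apply C_ext; simpl; ring.
    - rewrite Cplus_conj, IHn. f_equal. unfold kernel_term. rewrite <- hermite_conj, Cmult_conj, Cconj_R. auto. }
  unfold kernel, Clim, Cconj. simpl. f_equal.
  - f_equal. apply Lim_seq_ext. intros n. rewrite E. reflexivity.
  - rewrite (Lim_seq_ext _ (fun n => - snd (Csum (kernel_term z) n))).
    + rewrite Lim_seq_opp. destruct (Lim_seq _); simpl; ring.
    + intros n. rewrite E. reflexivity.
Qed.

Lemma Phi_conj (z : C) : Phi (Cconj z) = Cconj (Phi z).
Proof.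
  assert (E : (Cconj z / 2)%C = Cconj (z / 2)).
  { apply C_ext.
    - change (fst (Cconj (z / 2)%C)) with (fst (z / 2)%C). rewrite !fst_half. reflexivity.
    - change (snd (Cconj (z / 2)%C)) with (- snd (z / 2)%C). rewrite !snd_half. simpl. field. }
  unfold Phi. rewrite Cmult_conj, <- kernel_conj, E, !Cexp_conj. auto.
Qed.

Lemma Phi_imaginary (y : R) : Rabs y < PI / 4 -> snd (Phi (0, y)) = 0.
Proof.
  intros H. assert (E := Phi_even (0, y) H). 
  replace (- (0, y))%C with (Cconj (0, y)) in E by (apply C_ext; simpl; ring).
  rewrite Phi_conj in E. assert (E2 : - snd (Phi (0, y)) = snd (Phi (0, y))) by (rewrite <- E at 2; reflexivity). lra.
Qed.

Lemma Phi_real (x : R) : snd (Phi (x, 0)) = 0 /\ 0 < fst (Phi (x, 0)).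
Proof.
  assert (H : forall x, 0 <= x -> snd (Phi (x, 0)) = 0 /\ 0 < fst (Phi (x, 0))).
  { clear x. intros x Hx. unfold Phi.
    assert (Hh : ((x, 0) / 2)%C = RtoC (x / 2)) by (apply C_ext; rewrite ?fst_half, ?snd_half; simpl; field).
    rewrite Hh, Cexp_R. change ((x, 0) : C) with (RtoC x). rewrite Cexp_R.
    destruct (kernel_real_pos (exp x)) as [H1 H2]. { rewrite <- exp_0. apply exp_le_exp; auto. }
    rewrite snd_RtoC_mult, fst_RtoC_mult, H1. pose proof (exp_pos (x / 2)).
    split. ring. apply Rmult_lt_0_compat; auto. }
  destruct (Rle_dec 0 x) as [Hx|Hx]; auto.
  rewrite <- (Phi_even (x, 0)). 2:{ simpl. rewrite Rabs_R0. pose proof PI_RGT_0. lra. }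
  replace (- (x, 0))%C with ((- x, 0) : C) by (apply C_ext; simpl; ring). apply H. lra.
Qed.

(** For negative [x] the factor [exp (a x)] decays by itself; for positive [x],
    [exp x >= (1 + x/2)^2] and a completed square give the constant. *)
Lemma dexp_bound (a b : R) : 0 < a -> 0 < b ->
  exists K, 0 < K /\ forall x, exp (a * x - b * exp x) <= K * exp (- (a * Rabs x)).
Proof.
  intros Ha Hb. exists (exp (4 * a ^ 2 / b)). split. apply exp_pos.
  intros x. rewrite <- exp_plus. apply exp_le_exp.
  assert (Hq : 0 <= 4 * a ^ 2 / b). { apply Rmult_le_pos. nra. left; apply Rinv_0_lt_compat; auto. }
  assert (He := exp_pos x).
  unfold Rabs. destruct (Rcase_abs x). { nra. }
  assert (Hxp : (1 + x / 2) ^ 2 <= exp x).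
  { replace (exp x) with (exp (x / 2) ^ 2).
    - apply pow_incr. pose proof (exp_ineq1_le (x / 2)). lra.
    - rewrite exp_pow. f_equal. simpl. field. }
  assert (0 <= b / 4 * (x - 4 * a / b) ^ 2). { apply Rmult_le_pos. lra. apply pow2_ge_0. }
  replace (b / 4 * (x - 4 * a / b) ^ 2) with (b / 4 * x ^ 2 - 2 * a * x + 4 * a ^ 2 / b) in H by (field; lra).
  assert (b * exp x >= b * (x ^ 2 / 4)). { apply Rle_ge. apply Rmult_le_compat_l. lra. nra. }
  nra.
Qed.

Lemma cos_2_mono (y z : R) : Rabs z <= Rabs y -> Rabs y < PI / 4 -> cos (2 * y) <= cos (2 * z).
Proof.
  intros H1 H2.
  assert (E : forall t, cos (2 * t) = cos (2 * Rabs t)).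
  { intros t. unfold Rabs. destruct (Rcase_abs t); auto. rewrite <- cos_neg. f_equal; ring. }
  rewrite (E y), (E z). pose proof (Rabs_pos z). pose proof (Rabs_pos y). pose proof PI_RGT_0.
  apply cos_decr_1; lra.
Qed.

Lemma sector_weaken (c d : R) (Z : C) : c <= d -> sector d Z -> sector c Z.
Proof. unfold sector. intros H H1. pose proof (pow2_ge_0 (Cmod Z)). nra. Qed.

Lemma sector_line (y t x : R) : Rabs t <= Rabs y -> Rabs y < PI / 4 -> sector (cos (2 * y)) (Cexp (x, t)).
Proof.
  intros H1 H2. apply sector_weaken with (cos (2 * t)). apply cos_2_mono; auto.
  apply (Cexp_sector (x, t)).
Qed.

Lemma Cmod_Cexp_line (s : C) (x t y : R) : Rabs t <= Rabs y ->
  Cmod (Cexp (s * (x, t))%C) <= exp (fst s * x) * exp (Rabs (snd s) * Rabs y).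
Proof.
  intros H. rewrite Cmod_Cexp, <- exp_plus. apply exp_le_exp. simpl.
  assert (Rabs (snd s * t) <= Rabs (snd s) * Rabs y).
  { rewrite Rabs_mult. apply Rmult_le_compat_l; auto. apply Rabs_pos. }
  pose proof (Rle_abs (- (snd s * t))). rewrite Rabs_Ropp in H1. lra.
Qed.

(** Uniform in the angle [t], so that it also controls the intermediate lines of a contour shift. *)
Lemma line_bound (s : C) (y N : R) (k : nat) : 0 < fst s -> Rabs y < PI / 4 -> 0 < N ->
  exists K, 0 < K /\ forall x t, Rabs t <= Rabs y ->
    Cmod (Cexp (s * (x, t))%C) * ((1 + Cmod (N * Cexp (x, t))) ^ k * Cmod (gauss (N * Cexp (x, t))%C))
    <= K * exp (- (fst s * Rabs x)).
Proof.
  intros Hs Hy HN.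
  destruct (gauss_sector_bound k (cos (2 * y)) (cos_2_pos y Hy)) as [K1 [HK1 H1]].
  destruct (dexp_bound (fst s) N Hs HN) as [K2 [HK2 H2]].
  exists (exp (Rabs (snd s) * Rabs y) * (K1 * K2)). split.
  { apply Rmult_lt_0_compat. apply exp_pos. nra. }
  intros x t Ht. pose proof (exp_pos (Rabs (snd s) * Rabs y)) as He.
  apply Rle_trans with (exp (fst s * x) * exp (Rabs (snd s) * Rabs y) * (K1 * exp (- (N * exp x)))).
  - apply Rmult_le_compat.
    + apply Cmod_ge_0.
    + apply Rmult_le_pos. apply pow_le. pose proof (Cmod_ge_0 (N * Cexp (x, t))). lra. apply Cmod_ge_0.
    + apply Cmod_Cexp_line; auto.
    + replace (N * exp x) with (Cmod (N * Cexp (x, t))%C).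
      * apply H1. apply sector_scal. apply sector_line; auto.
      * rewrite Cmod_mult, Cmod_R, Cmod_Cexp, Rabs_pos_eq by lra. reflexivity.
  - specialize (H2 x). unfold Rminus in H2. rewrite exp_plus in H2.
    replace (exp (fst s * x) * exp (Rabs (snd s) * Rabs y) * (K1 * exp (- (N * exp x))))
      with (exp (Rabs (snd s) * Rabs y) * K1 * (exp (fst s * x) * exp (- (N * exp x)))) by ring.
    replace (exp (Rabs (snd s) * Rabs y) * (K1 * K2) * exp (- (fst s * Rabs x)))
      with (exp (Rabs (snd s) * Rabs y) * K1 * (K2 * exp (- (fst s * Rabs x)))) by ring.
    apply Rmult_le_compat_l; auto. nra.
Qed.

(** * The Mellin representation of xi *)

(** The Mellin transform of [gauss (N r)] along the ray of argument [y], in the variable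
    [x = ln |r|]. *)
Definition mellin (s : C) (N y : R) : C :=
  Cintegral (fun x : R => Cexp (s * (x + Ci * y)) * gauss (N * Cexp (x + Ci * y)))%C.

(** [Gamma_mellin] identifies it with [PI^(-s/2) Gamma(s/2)]. *)
Definition gamma_factor (s : C) : C := (2 * mellin s 1 0)%C.

Section Mellin.
Variables (s : C) (y : R).
Hypothesis s_pos : 0 < fst s.
Hypothesis y_small : Rabs y < PI / 4.

Lemma mellin_poly_bound (N : R) (k : nat) (p : C -> C) (A : R) : 0 < N ->
  (forall Z, Cmod (p Z) <= A * (1 + Cmod Z) ^ k) ->
  exists K, 0 < K /\ forall x t : R, Rabs t <= Rabs y ->
   Cmod (Cexp (s * (x + Ci * t)) * (p (N * Cexp (x + Ci * t)) * gauss (N * Cexp (x + Ci * t))))%C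
   <= K * exp (- (fst s * Rabs x)).
Proof.
  intros HN Hp. destruct (line_bound s y N k s_pos y_small HN) as [K [HK H]].
  assert (HA : 0 <= A).
  { specialize (Hp 0%C). pose proof (Cmod_ge_0 (p 0%C)). rewrite Cmod_0, Rplus_0_r, pow1 in Hp. lra. }
  exists (A * K + 1). split. nra. intros x t Ht. specialize (H x t Ht).
  rewrite <- RtoC_line, !Cmod_mult.
  pose proof (Hp (N * Cexp (x, t))%C) as Hp'. rewrite Cmod_mult in Hp'.
  rewrite Cmod_mult in H.
  set (G := Cmod (gauss (N * Cexp (x, t))%C)) in *. set (W := Cmod (Cexp (s * (x, t))%C)) in *.
  assert (0 <= G) by apply Cmod_ge_0. assert (0 <= W) by apply Cmod_ge_0.
  pose proof (exp_pos (- (fst s * Rabs x))).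
  apply Rle_trans with (A * (W * ((1 + Cmod N * Cmod (Cexp (x, t))) ^ k * G))).
  - replace (A * (W * ((1 + Cmod N * Cmod (Cexp (x, t))) ^ k * G)))
      with (W * ((A * (1 + Cmod N * Cmod (Cexp (x, t))) ^ k) * G)) by ring.
    apply Rmult_le_compat_l; auto. apply Rmult_le_compat_r; auto.
  - apply Rle_trans with (A * (K * exp (- (fst s * Rabs x)))). apply Rmult_le_compat_l; auto. nra.
Qed.

Lemma mellin_poly_tame (N : R) (k : nat) (p : C -> C) (A t : R) : 0 < N ->
  (forall Z, Cmod (p Z) <= A * (1 + Cmod Z) ^ k) -> Rabs t <= Rabs y ->
  Ccont (fun x : R => p (N * Cexp (x + Ci * t))%C) ->
  Ctame (fun x : R => Cexp (s * (x + Ci * t)) * (p (N * Cexp (x + Ci * t)) * gauss (N * Cexp (x + Ci * t))))%C.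
Proof.
  intros HN Hp Ht Hc. destruct (mellin_poly_bound N k p A HN Hp) as [K [HK H]].
  apply Ctame_exp with K 0%nat (fst s); auto.
  - apply Ccont_mult. ccont. apply Ccont_mult; auto. unfold gauss. ccont.
  - intros x. simpl. rewrite Rmult_1_l. apply H; auto.
Qed.

Lemma mellin_tame (N t : R) : 0 < N -> Rabs t <= Rabs y ->
  Ctame (fun x : R => Cexp (s * (x + Ci * t)) * gauss (N * Cexp (x + Ci * t)))%C.
Proof.
  intros HN Ht. apply Ctame_ext with
    (fun x : R => Cexp (s * (x + Ci * t)) * (1 * gauss (N * Cexp (x + Ci * t))))%C.
  { intros; ring. }
  apply (mellin_poly_tame N 0 (fun _ => 1%C) 1); auto.
  - intros Z. rewrite Cmod_1. simpl. lra.
  - ccont.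
Qed.

(** Rotation of the ray: the path moves by [Ci y] per unit of [t], hence [Q = Ci y P]. *)
Lemma mellin_line (N : R) : 0 < N -> mellin s N y = mellin s N 0.
Proof.
  intros HN. symmetry. unfold mellin.
  set (P := fun x t : R => (Cexp (s * (x + Ci * (t * y))) * gauss (N * Cexp (x + Ci * (t * y))))%C).
  set (D := fun x t : R => (Ci * y * (s - 2 * PI * (N * Cexp (x + Ci * (t * y))) * (N * Cexp (x + Ci * (t * y)))) * P x t)%C).
  set (Q := fun x t : R => (Ci * y * P x t)%C).
  assert (Hb : exists K, 0 < K /\ forall x t : R, 0 <= t <= 1 -> Cmod (P x t) <= K * exp (- (fst s * Rabs x))).
  { destruct (mellin_poly_bound N 0 (fun _ => 1%C) 1) as [K [HK H]]; auto.
    { intros Z. rewrite Cmod_1. simpl. lra. }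
    exists K. split; auto. intros x t Ht. unfold P. rewrite <- RtoC_mult.
    specialize (H x (t * y)). rewrite Cmult_1_l in H. apply H.
    rewrite Rabs_mult, (Rabs_pos_eq t) by lra. pose proof (Rabs_pos y). nra. }
  destruct Hb as [K [HK Hb]].
  destruct (majorant_exp 0 (fst s) s_pos) as [M HM].
  assert (HQ : forall x t, 0 <= t <= 1 -> Cmod (Q x t) <= Rabs y * (K * M) / (1 + x ^ 2)).
  { intros x t Ht. unfold Q. rewrite !Cmod_mult, Cmod_Ci, Cmod_R, Rmult_1_l.
    unfold Rdiv. rewrite Rmult_assoc. apply Rmult_le_compat_l. apply Rabs_pos.
    eapply Rle_trans; [apply Hb; auto|]. rewrite Rmult_assoc. apply Rmult_le_compat_l. lra.
    specialize (HM x). simpl pow in HM at 1. rewrite Rmult_1_l in HM. auto. }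
  assert (HPt : forall t, 0 <= t <= 1 -> Ctame (fun x => P x t)).
  { intros t Ht. apply Ctame_ext with
      (fun x : R => Cexp (s * (x + Ci * (t * y)%R)) * gauss (N * Cexp (x + Ci * (t * y)%R)))%C.
    { intros x. unfold P. rewrite RtoC_mult. auto. }
    apply mellin_tame; auto. rewrite Rabs_mult, (Rabs_pos_eq t) by lra. pose proof (Rabs_pos y). nra. }
  transitivity (Cintegral (fun x => P x 0)).
  { apply Cintegral_ext. intros x. unfold P. replace (x + Ci * (0 * y))%C with (x + Ci * 0)%C by ring. auto. }
  transitivity (Cintegral (fun x => P x 1)).
  2:{ apply Cintegral_ext. intros x. unfold P. replace (x + Ci * (1 * y))%C with (x + Ci * y)%C by ring. auto. }
  apply Cintegral_homotopy with D Q (Rabs y * (K * M)); auto; try (apply HPt; lra).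
  - intros x t. unfold P, D, gauss. eapply Cder_eq. cder. unfold P, gauss. ring.
  - intros x t. unfold Q, D, P, gauss. eapply Cder_eq. cder. ring.
  - unfold D, P, gauss. c2cont.
  - intros t. unfold P, gauss. ccont.
Qed.

(** The scaling by [N] is the translation [x |-> x + ln N]; this is how [N^(-s)] enters. *)
Lemma mellin_scale (N : R) : 0 < N -> mellin s N 0 = (Cexp (- (s * ln N)) * mellin s 1 0)%C.
Proof.
  intros HN.
  set (f := fun x : R => (Cexp (s * x) * gauss (Cexp x))%C).
  assert (H0 : Rabs 0 <= Rabs y) by (rewrite Rabs_R0; apply Rabs_pos).
  assert (Hf : Ctame f).
  { apply Ctame_ext with (2 := mellin_tame 1 0 Rlt_0_1 H0). intros x. unfold f.
    replace (x + Ci * 0)%C with (RtoC x) by ring. rewrite Cmult_1_l. auto. }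
  assert (E : forall x : R, f (1 * x + ln N)%R = (Cexp (s * ln N) * (Cexp (s * (x + Ci * 0)) * gauss (N * Cexp (x + Ci * 0))))%C).
  { intros x. unfold f. replace (x + Ci * 0)%C with (RtoC x) by ring.
    rewrite Rmult_1_l, RtoC_plus, Cmult_plus_distr_l, !Cexp_plus, (Cexp_R (ln N)), exp_ln by auto.
    rewrite (Cmult_comm (Cexp x)). ring. }
  assert (Hg : Ctame (fun x => f (1 * x + ln N)%R)).
  { apply Ctame_ext with (1 := fun x => eq_sym (E x)). apply Ctame_scal. apply mellin_tame; auto. }
  assert (A := Cintegral_affine f 1 (ln N) Rlt_0_1 Hf Hg).
  rewrite (Cintegral_ext _ _ E), Cintegral_scal in A by (apply mellin_tame; auto).
  fold (mellin s N 0) in A.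
  assert (B : Cintegral f = mellin s 1 0).
  { apply Cintegral_ext. intros x. unfold f. replace (x + Ci * 0)%C with (RtoC x) by ring. rewrite Cmult_1_l. auto. }
  rewrite B in A. rewrite Cexp_opp.
  pose proof (Cexp_neq_0 (s * ln N)).
  replace (mellin s N 0) with (/ Cexp (s * ln N) * (Cexp (s * ln N) * mellin s N 0))%C by (field; auto).
  rewrite A. field. auto.
Qed.

Lemma Cmod_sq_le (Z : C) : Cmod (2 * PI * (Z * Z)) <= 8 * (1 + Cmod Z) ^ 2.
Proof.
  rewrite !Cmod_mult, !Cmod_R, !Rabs_pos_eq; try lra. 2: pose proof PI_RGT_0; lra.
  pose proof PI_4. pose proof (Cmod_ge_0 Z). pose proof PI_RGT_0. nra.
Qed.

(** Two integrations by parts in one step: [p] is chosen so that the derivative of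
    [Cexp (s z) p gauss] is [s (s - 1)] times the Gaussian integrand minus the [hermite]
    integrand. *)
Lemma mellin_hermite (N : R) : 0 < N ->
  Ctame (fun x : R => Cexp (s * (x + Ci * y)) * hermite (N * Cexp (x + Ci * y)))%C /\
  Cintegral (fun x : R => Cexp (s * (x + Ci * y)) * hermite (N * Cexp (x + Ci * y)))%C
  = (s * (s - 1) * mellin s N y)%C.
Proof.
  intros HN.
  assert (Ht : Ctame (fun x : R => Cexp (s * (x + Ci * y)) * hermite (N * Cexp (x + Ci * y)))%C).
  { apply (mellin_poly_tame N 4 quartic 100); auto. apply Cmod_quartic. lra. unfold quartic. ccont. }
  split; auto.
  assert (Hm := mellin_tame N y HN (Rle_refl _)).
  set (p := fun Z : C => ((s - 1) + 2 * PI * (Z * Z))%C).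
  assert (Hp : forall Z, Cmod (p Z) <= (Cmod (s - 1) + 8) * (1 + Cmod Z) ^ 2).
  { intros Z. unfold p. eapply Rle_trans; [apply Cmod_triangle|].
    pose proof (Cmod_sq_le Z). pose proof (Cmod_ge_0 Z). pose proof (Cmod_ge_0 (s - 1)).
    assert (1 <= (1 + Cmod Z) ^ 2) by nra. nra. }
  destruct (mellin_poly_bound N 2 p _ HN Hp) as [K [HK HB]].
  destruct (majorant_exp 0 (fst s) s_pos) as [M HM].
  assert (E : Cintegral (fun x : R => s * (s - 1) * (Cexp (s * (x + Ci * y)) * gauss (N * Cexp (x + Ci * y)))
     - Cexp (s * (x + Ci * y)) * hermite (N * Cexp (x + Ci * y)))%C = 0%C).
  { apply Cintegral_derivative with
      (fun x : R => Cexp (s * (x + Ci * y)) * (p (N * Cexp (x + Ci * y)) * gauss (N * Cexp (x + Ci * y))))%C (K * M).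
    - intros x. unfold p, hermite, quartic, gauss. eapply Cder_eq. cder. ring.
    - apply Ctame_minus; auto. apply Ctame_scal; auto.
    - intros x. eapply Rle_trans; [apply HB; lra|]. unfold Rdiv. rewrite Rmult_assoc. apply Rmult_le_compat_l. lra.
      specialize (HM x). simpl pow in HM at 1. rewrite Rmult_1_l in HM. auto. }
  rewrite Cintegral_minus, Cintegral_scal in E; auto using Ctame_scal.
  fold (mellin s N y) in E.
  match goal with |- ?J = ?R0 => replace J with (R0 - (R0 - J))%C by ring end.
  rewrite E. ring.
Qed.

(** One integration by parts; it evaluates the correction term of [kernel_approx]. *)
Lemma mellin_sq (N : R) : 0 < N ->
  Ctame (fun x : R => Cexp (s * (x + Ci * y)) * (2 * PI * ((N * Cexp (x + Ci * y)) * (N * Cexp (x + Ci * y))) * gauss (N * Cexp (x + Ci * y))))%C /\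
  Cintegral (fun x : R => Cexp (s * (x + Ci * y)) * (2 * PI * ((N * Cexp (x + Ci * y)) * (N * Cexp (x + Ci * y))) * gauss (N * Cexp (x + Ci * y))))%C
  = (s * mellin s N y)%C.
Proof.
  intros HN.
  set (h := fun x : R => (Cexp (s * (x + Ci * y)) * (2 * PI * ((N * Cexp (x + Ci * y)) * (N * Cexp (x + Ci * y))) * gauss (N * Cexp (x + Ci * y))))%C).
  assert (Ht : Ctame h).
  { apply (mellin_poly_tame N 2 (fun Z => 2 * PI * (Z * Z))%C 8); auto. apply Cmod_sq_le. lra. ccont. }
  split; auto.
  assert (Hm := mellin_tame N y HN (Rle_refl _)).
  destruct (mellin_poly_bound N 0 (fun _ => 1%C) 1) as [K [HK HB]]; auto.
  { intros Z. rewrite Cmod_1. simpl. lra. }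
  destruct (majorant_exp 0 (fst s) s_pos) as [M HM].
  assert (E : Cintegral (fun x : R => s * (Cexp (s * (x + Ci * y)) * gauss (N * Cexp (x + Ci * y))) - h x)%C = 0%C).
  { apply Cintegral_derivative with
      (fun x : R => Cexp (s * (x + Ci * y)) * (1 * gauss (N * Cexp (x + Ci * y))))%C (K * M).
    - intros x. unfold h, gauss. eapply Cder_eq. cder. ring.
    - apply Ctame_minus; auto. apply Ctame_scal; auto.
    - intros x. eapply Rle_trans; [apply HB; lra|]. unfold Rdiv. rewrite Rmult_assoc. apply Rmult_le_compat_l. lra.
      specialize (HM x). simpl pow in HM at 1. rewrite Rmult_1_l in HM. auto. }
  rewrite Cintegral_minus, Cintegral_scal in E; auto using Ctame_scal.
  fold (mellin s N y) in E.
  match goal with |- ?J = ?R0 => replace J with (R0 - (R0 - J))%C by ring end.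
  rewrite E. ring.
Qed.
End Mellin.

Definition dirichlet_sum (s : C) (N : nat) : C := Csum (fun n => Cexp (- (s * ln (INR (S n))))) N.

(** The sum of [n^(-s)] for [n <= N] plus [N^(1-s)/(s-1)], multiplied by [s (s - 1)] and by the
    Gamma factor, with the pole at 1 cleared. *)
Definition xi_approx (s : C) (N : nat) : C :=
  ((s * (s - 1) * dirichlet_sum s N + s * (INR N * Cexp (- (s * ln (INR N))))) * gamma_factor s)%C.

(** The added term is the integral of [hermite (x r)] over [x >= N], as in Euler-Maclaurin
    summation. The bare partial sum comes with a remainder bound of order [1/|r|], which is not
    integrable against [r^s] when [Re s <= 1]. *)
Definition kernel_approx (r : C) (N : nat) : C :=
  (Csum (kernel_term r) N + INR N * (2 * PI * ((INR N * r) * (INR N * r)) * gauss (INR N * r)))%C.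

Lemma xi_approx_integral (s : C) (y : R) (N : nat) : 0 < fst s -> Rabs y < PI / 4 -> (1 <= N)%nat ->
  Ctame (fun x : R => Cexp (s * (x + Ci * y)) * kernel_approx (Cexp (x + Ci * y)) N)%C /\
  xi_approx s N = (2 * Cintegral (fun x : R => Cexp (s * (x + Ci * y)) * kernel_approx (Cexp (x + Ci * y)) N))%C.
Proof.
  intros Hs Hy HN.
  assert (Hn : forall n, 0 < INR (S n)) by (intros; apply lt_0_INR; lia).
  assert (HNp : 0 < INR N) by (apply lt_0_INR; lia).
  assert (Hms : forall n : R, 0 < n -> mellin s n y = (Cexp (- (s * ln n)) * mellin s 1 0)%C).
  { intros n Hn0. rewrite (mellin_line s y Hs Hy n Hn0). apply (mellin_scale s y Hs Hy n Hn0). }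
  assert (HA : forall M, Ctame (fun x : R => Cexp (s * (x + Ci * y)) * Csum (kernel_term (Cexp (x + Ci * y))) M)%C /\
    Cintegral (fun x : R => Cexp (s * (x + Ci * y)) * Csum (kernel_term (Cexp (x + Ci * y))) M)%C
    = (s * (s - 1) * dirichlet_sum s M * mellin s 1 0)%C).
  { induction M as [|M [IH1 IH2]].
    - assert (E : forall x : R, (0 * (Cexp (s * (x + Ci * y)) * gauss (1 * Cexp (x + Ci * y))))%C =
         (Cexp (s * (x + Ci * y)) * Csum (kernel_term (Cexp (x + Ci * y))) 0)%C). { intros; simpl; ring. }
      assert (Hm := mellin_tame s y Hs Hy 1 y Rlt_0_1 (Rle_refl _)).
      split. apply Ctame_ext with (1 := E). apply Ctame_scal; auto.
      rewrite <- (Cintegral_ext _ _ E), Cintegral_scal by auto. unfold dirichlet_sum; simpl; ring.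
    - destruct (mellin_hermite s y Hs Hy (INR (S M)) (Hn M)) as [H1 H2].
      assert (E : forall x : R, (Cexp (s * (x + Ci * y)) * Csum (kernel_term (Cexp (x + Ci * y))) M +
         Cexp (s * (x + Ci * y)) * hermite (INR (S M) * Cexp (x + Ci * y)))%C =
         (Cexp (s * (x + Ci * y)) * Csum (kernel_term (Cexp (x + Ci * y))) (S M))%C).
      { intros; cbn [Csum]. unfold kernel_term at 3. ring. }
      split. apply Ctame_ext with (1 := E). apply Ctame_plus; auto.
      rewrite <- (Cintegral_ext _ _ E), Cintegral_plus, IH2, H2, Hms by auto.
      unfold dirichlet_sum; cbn [Csum]; ring. }
  destruct (HA N) as [HA1 HA2].
  destruct (mellin_sq s y Hs Hy (INR N) HNp) as [HB1 HB2].
  assert (E : forall x : R, (Cexp (s * (x + Ci * y)) * Csum (kernel_term (Cexp (x + Ci * y))) N +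
     INR N * (Cexp (s * (x + Ci * y)) * (2 * PI * ((INR N * Cexp (x + Ci * y)) * (INR N * Cexp (x + Ci * y))) * gauss (INR N * Cexp (x + Ci * y)))))%C =
     (Cexp (s * (x + Ci * y)) * kernel_approx (Cexp (x + Ci * y)) N)%C).
  { intros x. unfold kernel_approx. ring. }
  split.
  - apply Ctame_ext with (1 := E). apply Ctame_plus; auto. apply Ctame_scal; auto.
  - rewrite <- (Cintegral_ext _ _ E), Cintegral_plus, Cintegral_scal, HA2, HB2, Hms; auto using Ctame_scal.
    unfold xi_approx, gamma_factor. ring.
Qed.

(** * Error of the truncated kernel and passage to the limit *)

Definition hermite_der (Z : C) : C :=
  ((16 * (PI * PI) * (Z * Z * Z) - 12 * PI * Z - 2 * PI * Z * quartic Z) * gauss Z)%C.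

Lemma hermite_der_bound (c : R) : 0 < c ->
  exists K, 0 < K /\ forall Z, sector c Z -> Cmod (hermite_der Z) <= K * exp (- Cmod Z).
Proof.
  intros Hc. destruct (gauss_sector_bound 5 c Hc) as [K [HK H]].
  exists (2000 * K). split. lra. intros Z HZ. unfold hermite_der. rewrite Cmod_mult.
  specialize (H Z HZ). pose proof (Cmod_ge_0 (gauss Z)) as Hg.
  assert (Hp : Cmod (16 * (PI * PI) * (Z * Z * Z) - 12 * PI * Z - 2 * PI * Z * quartic Z) <= 2000 * (1 + Cmod Z) ^ 5).
  { unfold Cminus. eapply Rle_trans; [apply Cmod_triangle|].
    eapply Rle_trans; [apply Rplus_le_compat_r, Cmod_triangle|].
    rewrite !Cmod_opp, !Cmod_mult, !Cmod_R. pose proof (Cmod_quartic Z) as Hq.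
    pose proof PI_RGT_0. pose proof PI_4.
    rewrite !(Rabs_pos_eq PI), (Rabs_pos_eq 16), (Rabs_pos_eq 12), (Rabs_pos_eq 2) by lra.
    pose proof (Cmod_ge_0 Z) as HX. pose proof (Cmod_ge_0 (quartic Z)) as HQ0.
    set (X := Cmod Z) in *. set (Q := Cmod (quartic Z)) in *.
    assert (HqH1 : 1 <= (1 + X) ^ 2) by nra.
    assert (HqH3 : X * X * X <= (1 + X) ^ 5).
    { apply Rle_trans with ((1 + X) ^ 3). simpl; nra. replace ((1 + X) ^ 5) with ((1 + X) ^ 3 * (1 + X) ^ 2) by ring.
      assert (0 <= (1 + X) ^ 3) by (apply pow_le; lra). nra. }
    assert (HqH4 : X <= (1 + X) ^ 5).
    { apply Rle_trans with ((1 + X) ^ 1). simpl; nra. apply Rle_pow; [lra|lia]. }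
    assert (HqH5 : X * Q <= 100 * (1 + X) ^ 5).
    { apply Rle_trans with ((1 + X) * (100 * (1 + X) ^ 4)). apply Rmult_le_compat; lra. right; ring. }
    assert (HXX : 0 <= X * X * X) by (assert (0 <= X * X) by nra; nra).
    assert (HP2 : PI * PI <= 16) by nra.
    assert (16 * (PI * PI) * (X * X * X) <= 256 * (1 + X) ^ 5).
    { apply Rle_trans with (256 * (X * X * X)). apply Rmult_le_compat_r; lra. lra. }
    assert (12 * PI * X <= 48 * (1 + X) ^ 5). { apply Rle_trans with (48 * X). apply Rmult_le_compat_r; lra. lra. }
    assert (2 * PI * X * Q <= 800 * (1 + X) ^ 5).
    { apply Rle_trans with (8 * (X * Q)). rewrite Rmult_assoc. apply Rmult_le_compat_r. nra. lra. lra. }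
    lra. }
  apply Rle_trans with (2000 * (1 + Cmod Z) ^ 5 * Cmod (gauss Z)).
  - apply Rmult_le_compat_r; auto.
  - rewrite Rmult_assoc. lra.
Qed.

Lemma MVT_abs (f f' : R -> R) (a b M : R) : a <= b ->
  (forall x, is_derive f x (f' x)) -> (forall x, a <= x <= b -> Rabs (f' x) <= M) ->
  Rabs (f b - f a) <= M * (b - a).
Proof.
  intros Hab Hd HM. destruct (MVT_gen f a b f') as [c [Hc E]].
  - intros; auto.
  - intros x _. apply continuity_pt_filterlim. apply (ex_derive_continuous (V := R_NormedModule)). eexists; eauto.
  - rewrite Rmin_left, Rmax_right in Hc by auto. rewrite E, Rabs_mult, (Rabs_pos_eq (b - a)) by lra.
    apply Rmult_le_compat_r. lra. auto.
Qed.

(** The error is the sum over [n >= N] of [hermite ((n+1) r)] minus the mean of [hermite (x r)] over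
    [[n, n+1]], bounded through [hermite_der]. The factor [|r|] of the chain rule cancels the
    [1/|r|] of the geometric series, so the bound stays finite as [r] tends to 0. *)
Lemma kernel_approx_error (c : R) : 0 < c -> exists K, 0 < K /\ forall r N, sector c r -> r <> 0%C ->
  Cmod (kernel r - kernel_approx r N) <= K * (1 + Cmod r) * exp (- (INR N * Cmod r)).
Proof.
  intros Hc. destruct (hermite_der_bound c Hc) as [K [HK HD]].
  destruct (gauss_sector_bound 3 c Hc) as [K3 [HK3 HG3]].
  destruct (kernel_cv c Hc) as [K4 [_ HKV]].
  exists (2 * K). split. lra. intros r N Hr Hr0.
  set (X := Cmod r). assert (HX : 0 < X) by (apply Cmod_gt_0; auto).
  set (A := fun x : R => (- (2 * PI) * (r * r) * (x * x * x) * gauss (x * r))%C).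
  set (f := fun x : R => hermite (x * r)%C).
  set (f' := fun x : R => (r * hermite_der (x * r))%C).
  assert (HA : forall x, Cder A x (f x)).
  { intros x. unfold A, f, hermite, quartic, gauss. eapply Cder_eq. cder. ring. }
  assert (Hf : forall x, Cder f x (f' x)).
  { intros x. unfold f', f, hermite, hermite_der, quartic, gauss. eapply Cder_eq. cder. ring. }
  assert (Hf' : forall (n : nat) (x : R), INR n <= x -> Cmod (f' x) <= X * (K * exp (- (INR n * X)))).
  { intros n x Hx. unfold f'. rewrite Cmod_mult. apply Rmult_le_compat_l. lra.
    eapply Rle_trans. { apply HD. apply sector_scal; auto. }
    apply Rmult_le_compat_l. lra. apply exp_le_exp. rewrite Cmod_mult, Cmod_R, Rabs_pos_eq.
    fold X. nra. pose proof (pos_INR n). lra. }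
  set (a := fun n : nat => (f (INR (S n)) - (A (INR (S n)) - A (INR n)))%C).
  (* The mean value points of the real and imaginary parts differ, hence a generic projection [p]
     and the factor 2 in [Ha]. *)
  assert (Hstep : forall p : C -> R, (forall z, Rabs (p z) <= Cmod z) -> (forall z w, p (z - w)%C = p z - p w) ->
      (forall g x l, Cder g x l -> is_derive (fun t => p (g t)) x (p l)) ->
      forall n, Rabs (p (a n)) <= X * (K * exp (- (INR n * X)))).
  { intros p Hp1 Hp2 Hp3 n. unfold a. rewrite !Hp2.
    assert (HS : INR (S n) = INR n + 1) by apply S_INR.
    destruct (MVT_gen (fun t => p (A t)) (INR n) (INR (S n)) (fun t => p (f t))) as [c0 [Hc0 E]].
    - intros x _. apply Hp3. apply HA.
    - intros x _. apply continuity_pt_filterlim. apply (ex_derive_continuous (V := R_NormedModule)).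
      eexists. apply Hp3. apply HA.
    - rewrite Rmin_left, Rmax_right in Hc0 by lra. rewrite E.
      replace (p (f (INR (S n))) - p (f c0) * (INR (S n) - INR n)) with (p (f (INR (S n))) - p (f c0))
        by (rewrite HS; ring).
      eapply Rle_trans.
      + apply (MVT_abs (fun t => p (f t)) (fun t => p (f' t)) c0 (INR (S n)) (X * (K * exp (- (INR n * X))))); [lra| |].
        * intros x. apply Hp3. apply Hf.
        * intros x Hx. eapply Rle_trans; [apply Hp1|]. apply Hf'. lra.
      + rewrite <- (Rmult_1_r (X * _)) at 2. apply Rmult_le_compat_l; [|lra].
        pose proof (exp_pos (- (INR n * X))). apply Rmult_le_pos. lra. nra. }
  assert (Ha : forall n, Cmod (a n) <= 2 * (X * (K * exp (- (INR n * X))))).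
  { intros n. eapply Rle_trans; [apply Cmod_le_sum|].
    assert (H1 := Hstep fst fst_Cmod (fun z w => eq_refl) (fun g x l H => proj1 H) n).
    assert (H2 := Hstep snd snd_Cmod (fun z w => eq_refl) (fun g x l H => proj2 H) n). lra. }
  set (b := fun n : nat => 2 * X * K / (1 - exp (- X)) * exp (- (INR n * X))).
  assert (Hgap := exp_neg_gap X HX).
  assert (Hq : 0 < X / (1 + X)) by (apply Rdiv_lt_0_compat; lra).
  assert (Hab : forall n, Cmod (a n) <= b n - b (S n)).
  { intros n. eapply Rle_trans; [apply Ha|]. unfold b. rewrite S_INR.
    replace (- ((INR n + 1) * X)) with (- (INR n * X) + - X) by ring. rewrite exp_plus.
    right. field. lra. }
  assert (Hgeo : forall L, is_lim_seq (fun n => L * exp (- (INR n * X))) 0).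
  { intros L. apply is_lim_seq_ext with (fun n => L * exp (- X) ^ n).
    - intros n. rewrite exp_pow. do 2 f_equal. ring.
    - replace (Finite 0) with (Rbar_mult L 0) by (simpl; f_equal; ring).
      apply is_lim_seq_scal_l. apply is_lim_seq_geom.
      rewrite Rabs_pos_eq by (left; apply exp_pos). lra. }
  destruct (Csum_cv a b Hab (Hgeo _)) as [Hcv Htail].
  assert (HA0 : A 0 = 0%C). { unfold A. ring. }
  assert (Hsum : forall n, Csum a n = (Csum (kernel_term r) n - A (INR n))%C).
  { induction n.
    - cbn [Csum]. change (INR 0) with 0. rewrite HA0. ring.
    - cbn [Csum]. rewrite IHn. unfold a, kernel_term, f. ring. }
  assert (HAlim : is_Clim (fun n => - A (INR n))%C 0%C).
  { apply is_Clim_squeeze with (fun n => 8 / X * K3 * exp (- (INR n * X))); [|apply Hgeo].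
    intros n. replace (- A (INR n) - 0)%C with (- A (INR n))%C by ring. rewrite Cmod_opp.
    unfold A. rewrite !Cmod_mult, Cmod_opp, Cmod_mult, !Cmod_R. pose proof PI_RGT_0. pose proof PI_4.
    pose proof (pos_INR n). rewrite (Rabs_pos_eq 2), (Rabs_pos_eq PI), (Rabs_pos_eq (INR n)) by lra. fold X.
    assert (Hs := HG3 (INR n * r)%C (sector_scal c _ _ Hr)).
    rewrite Cmod_mult, Cmod_R, Rabs_pos_eq in Hs by lra. fold X in Hs.
    pose proof (Cmod_ge_0 (gauss (INR n * r)%C)). set (G := Cmod (gauss (INR n * r)%C)) in *.
    set (Y := INR n * X) in *. assert (0 <= Y) by (unfold Y; nra).
    replace (2 * PI * (X * X) * (INR n * INR n * INR n) * G) with (2 * PI / X * (Y * Y * Y * G)) by (unfold Y; field; lra).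
    replace (8 / X * K3 * exp (- Y)) with (8 / X * (K3 * exp (- Y))) by ring. apply Rmult_le_compat.
    - apply Rmult_le_pos. lra. left; apply Rinv_0_lt_compat; auto.
    - apply Rmult_le_pos; auto. assert (0 <= Y * Y) by nra. nra.
    - apply Rmult_le_compat_r. left; apply Rinv_0_lt_compat; auto. lra.
    - eapply Rle_trans; [|apply Hs]. apply Rmult_le_compat_r; auto. simpl. nra. }
  assert (Hk : Clim (Csum a) = kernel r).
  { apply is_Clim_eq with (Csum a); auto.
    destruct (HKV r Hr Hr0) as [HL _].
    apply is_Clim_ext with (fun n => Csum (kernel_term r) n + - A (INR n))%C.
    { intros n. rewrite Hsum. ring. }
    replace (kernel r) with (kernel r + 0)%C by ring.
    apply (is_Clim_plus (Csum (kernel_term r)) (fun n => - A (INR n))%C); auto. }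
  specialize (Htail N). rewrite Hk, Hsum in Htail.
  replace (kernel_approx r N) with (Csum (kernel_term r) N - A (INR N))%C
    by (unfold kernel_approx, A; ring).
  eapply Rle_trans; [apply Htail|]. unfold b.
  apply Rmult_le_compat_r. left; apply exp_pos.
  replace (2 * X * K / (1 - exp (- X))) with (2 * K * (X / (1 - exp (- X)))) by (field; lra).
  apply Rmult_le_compat_l. lra.
  apply Rmult_le_reg_r with (1 - exp (- X)). lra.
  unfold Rdiv. rewrite Rmult_assoc, Rinv_l, Rmult_1_r by lra.
  apply Rmult_le_compat_l with (r := 1 + X) in Hgap; [|lra].
  replace ((1 + X) * (X / (1 + X))) with X in Hgap by (field; lra). lra.
Qed.

Lemma Phi_kernel (s z : C) : (Cexp (s * z) * kernel (Cexp z))%C = (Phi z * Cexp ((s - / 2) * z))%C.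
Proof.
  unfold Phi. replace (s * z)%C with (z / 2 + (s - / 2) * z)%C by (field). rewrite Cexp_plus. ring.
Qed.

Lemma Phi_transform_tame (y : R) (z : C) : Rabs y < PI / 4 ->
  Ctame (fun x : R => Phi (x, y) * Cexp (z * (x, y)))%C.
Proof.
  intros Hy. destruct (Phi_decay y (Rabs (fst z) + 1) Hy) as [K [HK H]].
  apply Ctame_exp with (K * exp (Rabs (snd z) * Rabs y)) 0%nat 1. lra.
  - apply Ccont_mult. apply Phi_cont; auto.
    apply Ccont_ext with (fun x : R => Cexp (z * (x + Ci * y))). intros; rewrite RtoC_line; auto. ccont.
  - intros x. rewrite Cmod_mult. simpl pow. rewrite !Rmult_1_l.
    pose proof (Cmod_Cexp_line z x y y (Rle_refl _)) as H1. specialize (H x).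
    assert (H2 : exp (fst z * x) <= exp (Rabs (fst z) * Rabs x)).
    { apply exp_le_exp. rewrite <- Rabs_mult. apply Rle_abs. }
    pose proof (exp_pos (Rabs (snd z) * Rabs y)).
    apply Rle_trans with (K * exp (- ((Rabs (fst z) + 1) * Rabs x)) * (exp (Rabs (fst z) * Rabs x) * exp (Rabs (snd z) * Rabs y))).
    + apply Rmult_le_compat; auto using Cmod_ge_0. eapply Rle_trans; [apply H1|]. apply Rmult_le_compat_r; lra.
    + replace (- ((Rabs (fst z) + 1) * Rabs x)) with (- (Rabs (fst z) * Rabs x) + - Rabs x) by ring.
      rewrite exp_plus, exp_Ropp. right. field. pose proof (exp_pos (Rabs (fst z) * Rabs x)). lra.
Qed.

Definition Phi_transform (y : R) (z : C) : C :=
  Cintegral (fun x : R => Phi (x, y) * Cexp (z * (x, y)))%C.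

(** The integrated error is [O(N^(-a))] with [a = Re s / 2]. Since the sequence does not involve
    [y], neither does its limit. *)
Lemma xi_approx_cv (s : C) (y : R) : 0 < fst s -> Rabs y < PI / 4 ->
  is_Clim (fun n => xi_approx s (S n)) (2 * Phi_transform y (s - / 2))%C.
Proof.
  intros Hs Hy.
  destruct (kernel_approx_error (cos (2 * y)) (cos_2_pos y Hy)) as [K [HK HE]].
  set (a := fst s / 2). assert (Ha : 0 < a) by (unfold a; lra).
  destruct (dexp_bound a (1 / 4) Ha ltac:(lra)) as [K2 [HK2 H2]].
  destruct (majorant_exp 0 a Ha) as [M HM].
  set (e0 := exp (Rabs (snd s) * Rabs y)).
  assert (He0 : 0 < e0) by apply exp_pos.
  set (B := e0 * (4 * K) * exp (a * ln (fst s)) * K2 * M).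
  set (g := fun x : R => (Cexp (s * (x + Ci * y)) * kernel (Cexp (x + Ci * y)))%C).
  assert (Eg : forall x : R, g x = (Phi (x, y) * Cexp ((s - / 2) * (x, y)))%C).
  { intros x. unfold g. rewrite <- RtoC_line. apply Phi_kernel. }
  assert (Hg : Ctame g).
  { apply Ctame_ext with (1 := fun x => eq_sym (Eg x)). apply Phi_transform_tame; auto. }
  assert (Hbound : forall n (x : R), Cmod (Cexp (s * (x + Ci * y)) * kernel_approx (Cexp (x + Ci * y)) (S n) - g x)%C
      <= B * exp (- (a * ln (INR (S n)))) / (1 + x ^ 2)).
  { intros n x. unfold g.
    replace (Cexp (s * (x + Ci * y)) * kernel_approx (Cexp (x + Ci * y)) (S n) - Cexp (s * (x + Ci * y)) * kernel (Cexp (x + Ci * y)))%C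
      with (- (Cexp (s * (x + Ci * y)) * (kernel (Cexp (x + Ci * y)) - kernel_approx (Cexp (x + Ci * y)) (S n))))%C by ring.
    rewrite Cmod_opp, Cmod_mult, <- RtoC_line.
    assert (Hn1 : 1 <= INR (S n)). { rewrite S_INR. pose proof (pos_INR n). lra. }
    set (N := INR (S n)) in *.
    assert (HE1 := HE (Cexp (x, y)) (S n) (Cexp_sector (x, y)) (Cexp_neq_0 _)). fold N in HE1.
    rewrite Cmod_Cexp in HE1. simpl fst in HE1.
    assert (H1 := Cmod_Cexp_line s x y y (Rle_refl _)). fold e0 in H1.
    assert (Hex := exp_pos x).
    apply Rle_trans with (exp (fst s * x) * e0 * (K * (1 + exp x) * exp (- (N * exp x)))).
    { apply Rmult_le_compat; auto using Cmod_ge_0. }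
    (* split [exp (-N e^x)] in two halves: one beats [N^(-a)], the other gives integrability *)
    assert (Hhalf : exp (a * x - N / 2 * exp x) <= exp (a * ln (fst s)) * exp (- (a * ln N))).
    { rewrite <- exp_plus. apply exp_le_exp.
      assert (Hv := exp_ineq1_le (x - (ln (fst s) - ln N))).
      assert (Ev : exp (x - (ln (fst s) - ln N)) = exp x * N / fst s).
      { replace (x - (ln (fst s) - ln N)) with (x + (ln N + - ln (fst s))) by ring.
        rewrite !exp_plus, exp_Ropp, !exp_ln by lra. field. lra. }
      rewrite Ev in Hv. apply Rmult_le_compat_l with (r := a) in Hv; [|lra].
      replace (a * (exp x * N / fst s)) with (N / 2 * exp x) in Hv by (unfold a; field; lra). lra. }
    assert (H14 : (1 + exp x) * exp (- (1 / 4 * exp x)) <= 4).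
    { rewrite exp_Ropp. pose proof (exp_pos (1 / 4 * exp x)). pose proof (exp_ineq1_le (1 / 4 * exp x)).
      apply Rmult_le_reg_r with (exp (1 / 4 * exp x)); auto. rewrite Rmult_assoc, Rinv_l by lra. lra. }
    assert (Hrest : exp (a * x) * ((1 + exp x) * exp (- (N / 2 * exp x))) <= 4 * (K2 * exp (- (a * Rabs x)))).
    { apply Rle_trans with (4 * exp (a * x - 1 / 4 * exp x)).
      - unfold Rminus. rewrite exp_plus.
        replace (exp (- (N / 2 * exp x))) with (exp (- (1 / 4 * exp x)) * exp (- (1 / 4 * exp x)) * exp (- ((N - 1) / 2 * exp x))).
        2:{ rewrite <- !exp_plus. f_equal. field. }
        assert (exp (- ((N - 1) / 2 * exp x)) <= 1).
        { apply Rle_trans with (exp 0); [apply exp_le_exp|rewrite exp_0; lra].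
          assert (0 <= (N - 1) / 2 * exp x) by (apply Rmult_le_pos; lra). lra. }
        pose proof (exp_pos (a * x)). pose proof (exp_pos (- (1 / 4 * exp x))). pose proof (exp_pos (- ((N - 1) / 2 * exp x))).
        replace (exp (a * x) * ((1 + exp x) * (exp (- (1 / 4 * exp x)) * exp (- (1 / 4 * exp x)) * exp (- ((N - 1) / 2 * exp x)))))
          with ((exp (a * x) * exp (- (1 / 4 * exp x))) * (((1 + exp x) * exp (- (1 / 4 * exp x))) * exp (- ((N - 1) / 2 * exp x)))) by ring.
        rewrite (Rmult_comm 4). apply Rmult_le_compat_l. nra.
        apply Rle_trans with (4 * 1); [|lra]. apply Rmult_le_compat; auto; try lra.
        apply Rmult_le_pos; lra.
      - apply Rmult_le_compat_l. lra. apply H2. }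
    assert (HMx := HM x). simpl pow in HMx at 1. rewrite Rmult_1_l in HMx.
    replace (exp (fst s * x)) with (exp (a * x) * exp (a * x)) by (rewrite <- exp_plus; f_equal; unfold a; field).
    replace (exp (- (N * exp x))) with (exp (- (N / 2 * exp x)) * exp (- (N / 2 * exp x))) by (rewrite <- exp_plus; f_equal; field).
    unfold Rminus in Hhalf. rewrite exp_plus in Hhalf.
    pose proof (exp_pos (a * x)). pose proof (exp_pos (- (N / 2 * exp x))). pose proof (exp_pos (a * ln (fst s))).
    pose proof (exp_pos (- (a * ln N))).
    apply Rle_trans with (e0 * K * ((exp (a * ln (fst s)) * exp (- (a * ln N))) * (4 * (K2 * (M / (1 + x ^ 2)))))).
    - replace (exp (a * x) * exp (a * x) * e0 * (K * (1 + exp x) * (exp (- (N / 2 * exp x)) * exp (- (N / 2 * exp x)))))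
        with (e0 * K * ((exp (a * x) * exp (- (N / 2 * exp x))) * (exp (a * x) * ((1 + exp x) * exp (- (N / 2 * exp x)))))) by ring.
      apply Rmult_le_compat_l. nra. apply Rmult_le_compat; auto.
      + nra.
      + apply Rmult_le_pos. lra. nra.
      + eapply Rle_trans; [apply Hrest|]. apply Rmult_le_compat_l. lra. apply Rmult_le_compat_l. lra. auto.
    - right. unfold B. field. pose proof (sq_pos1 x). lra. }
  apply is_Clim_squeeze with (fun n => 2 * (4 * (B * exp (- (a * ln (INR (S n))))))).
  - intros n. destruct (xi_approx_integral s y (S n) Hs Hy ltac:(lia)) as [Ht E].
    rewrite E. replace (Phi_transform y (s - / 2)) with (Cintegral g) by (apply Cintegral_ext; auto).
    set (P := Cintegral (fun x : R => (Cexp (s * (x + Ci * y)) * kernel_approx (Cexp (x + Ci * y)) (S n))%C)).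
    replace (2 * P - 2 * Cintegral g)%C with (2 * (P - Cintegral g))%C by ring. unfold P.
    rewrite <- Cintegral_minus by auto.
    rewrite Cmod_mult, Cmod_R, Rabs_pos_eq by lra. apply Rmult_le_compat_l. lra.
    apply Cintegral_bound; auto. apply Ctame_cont. apply Ctame_minus; auto.
  - replace (Finite 0) with (Finite (2 * (4 * (B * 0)))) by (f_equal; ring).
    apply (is_lim_seq_scal_l _ 2 (4 * (B * 0))). apply (is_lim_seq_scal_l _ 4 (B * 0)).
    apply (is_lim_seq_scal_l _ B 0).
    apply (is_lim_comp_seq exp _ m_infty 0). apply is_lim_exp_m. exists O; discriminate.
    apply (is_lim_seq_opp _ p_infty).
    apply (is_lim_seq_incr_1 (fun n => a * ln (INR n))).
    assert (Hl : is_lim_seq (fun n => ln (INR n)) p_infty).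
    { apply (is_lim_comp_seq ln INR p_infty p_infty). apply is_lim_ln_p. exists O; discriminate. apply is_lim_seq_INR. }
    apply is_lim_seq_spec. apply is_lim_seq_spec in Hl. intros m. destruct (Hl (m / a)) as [N0 H0].
    exists N0. intros n Hn. specialize (H0 n Hn). apply Rmult_lt_compat_l with (r := a) in H0; auto.
    replace (a * (m / a)) with m in H0 by (field; lra). auto.
Qed.

(** * The Gamma factor as an integral over the line *)

Lemma cpow_pos_Cexp (x : R) (z : C) : cpow_pos x z = Cexp (z * ln x).
Proof.
  unfold cpow_pos, Cexp; simpl.
  replace (fst z * ln x - snd z * 0) with (fst z * ln x) by ring.
  replace (fst z * 0 + snd z * ln x) with (snd z * ln x) by ring. auto.
Qed.

Lemma atan_near (eps : R) : 0 < eps -> exists M, 0 < M /\ PI / 2 - atan M < eps.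
Proof.
  intros He. assert (H := is_lim_seq_atan_p _ is_lim_seq_INR). apply is_lim_seq_spec in H.
  destruct (H (mkposreal _ He)) as [N HN]. specialize (HN (S N) ltac:(lia)). simpl pos in HN.
  exists (INR (S N)). split. apply lt_0_INR; lia.
  pose proof (Rle_abs (- (atan (INR (S N)) - PI / 2))). rewrite Rabs_Ropp in H0. lra.
Qed.

(** The substitution [x = PI exp (2 w)]. Endpoints near 0 and near infinity become windows
    containing [[-M, M]], which [integral_tail] controls. *)
Lemma RInt_gen_exp_subst (f : R -> R) :
  (forall x, 0 < x -> continuous f x) ->
  tame (fun w => 2 * PI * exp (2 * w) * f (PI * exp (2 * w))) ->
  RInt_gen f (at_right 0) (Rbar_locally p_infty) = integral (fun w => 2 * PI * exp (2 * w) * f (PI * exp (2 * w))).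
Proof.
  intros Hf Hq. set (q := fun w => 2 * PI * exp (2 * w) * f (PI * exp (2 * w))) in *.
  pose proof PI_RGT_0 as HP.
  apply (is_RInt_gen_unique (V := R_CompleteNormedModule)).
  intros P [eps HPe]. pose proof (cond_pos eps) as He.
  destruct Hq as [Hc [K HK]]. pose proof (dominated_nonneg K q HK) as HK0.
  destruct (atan_near (eps / (2 * K + 1))) as [M [HM0 HM]]. { apply Rdiv_lt_0_compat; lra. }
  assert (Hrep : forall x, 0 < x -> PI * exp (2 * (ln (x / PI) / 2)) = x).
  { intros x Hx. replace (2 * (ln (x / PI) / 2)) with (ln (x / PI)) by field.
    rewrite exp_ln. field; lra. apply Rdiv_lt_0_compat; auto. }
  assert (Hln : forall x y, 0 < x -> 0 < y -> x < y -> ln (x / PI) < ln (y / PI)).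
  { intros x y Hx Hy Hxy. apply ln_increasing. apply Rdiv_lt_0_compat; auto.
    apply Rmult_lt_compat_r; auto. apply Rinv_0_lt_compat; auto. }
  assert (HlnM : forall t, ln (PI * exp (2 * t) / PI) / 2 = t).
  { intros t. replace (PI * exp (2 * t) / PI) with (exp (2 * t)) by (field; lra). rewrite ln_exp. field. }
  assert (Ha0 : 0 < PI * exp (2 * - M)). { apply Rmult_lt_0_compat; auto; apply exp_pos. }
  assert (Hb0 : 0 < PI * exp (2 * M)). { apply Rmult_lt_0_compat; auto; apply exp_pos. }
  apply (Filter_prod _ _ _ (fun a => 0 < a < PI * exp (2 * - M)) (fun b => PI * exp (2 * M) < b)).
  - exists (mkposreal _ Ha0). intros a Ha Hpos. split; auto.
    unfold ball in Ha; simpl in Ha; unfold AbsRing_ball, abs, minus, plus, opp in Ha; simpl in Ha.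
    pose proof (Rle_abs (a + - 0)). lra.
  - exists (PI * exp (2 * M)). auto.
  - intros a b [Ha1 Ha2] Hb. simpl.
    set (al := ln (a / PI) / 2). set (be := ln (b / PI) / 2).
    assert (Hal : al < - M). { unfold al. rewrite <- (HlnM (- M)). apply Rmult_lt_compat_r. lra. apply Hln; auto. }
    assert (Hbe : M < be). { unfold be. rewrite <- (HlnM M). apply Rmult_lt_compat_r. lra. apply Hln; lra. }
    exists (RInt q al be). split.
    + assert (Hex : ex_RInt f a b).
      { apply (ex_RInt_continuous (V := R_CompleteNormedModule)). intros z Hz. apply Hf.
        assert (PI * exp (2 * - M) < PI * exp (2 * M)).
        { apply Rmult_lt_compat_l; auto. apply exp_increasing. lra. }
        rewrite Rmin_left in Hz by lra. lra. }
      assert (E : RInt q al be = RInt f a b).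
      { assert (E1 := RInt_comp (V := R_CompleteNormedModule) f (fun w => PI * exp (2 * w)) (fun w => 2 * PI * exp (2 * w)) al be).
        rewrite <- (Hrep a), <- (Hrep b) by lra. fold al be. rewrite <- E1. reflexivity.
        - intros w _. apply Hf. apply Rmult_lt_0_compat; auto; apply exp_pos.
        - intros w _. split. auto_derive; auto. ring.
          apply (ex_derive_continuous (V := R_NormedModule)). auto_derive; auto. }
      rewrite E. apply (RInt_correct (V := R_CompleteNormedModule)); auto.
    + apply HPe. unfold ball; simpl; unfold AbsRing_ball, abs, minus, plus, opp; simpl.
      replace (RInt q al be + - integral q) with (- (integral q - RInt q al be)) by ring. rewrite Rabs_Ropp.
      eapply Rle_lt_trans. { apply (integral_tail K); auto. lra. }
      apply atan_increasing in Hal. apply atan_increasing in Hbe. rewrite atan_opp in Hal.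
      apply Rmult_lt_compat_l with (r := 2 * K + 1) in HM; [|lra].
      replace ((2 * K + 1) * (eps / (2 * K + 1))) with (pos eps) in HM by (field; lra). 
      destruct (atan_bound M). nra.
Qed.

Lemma Gamma_mellin (s : C) : 0 < fst s ->
  (cpow_pos PI (- (s / 2)) * Gamma (s / 2))%C = gamma_factor s.
Proof.
  intros Hs. pose proof PI_RGT_0 as HP.
  set (z := (s / 2)%C).
  set (h := fun x : R => (cpow_pos x (z - 1) * RtoC (exp (- x)))%C).
  assert (Hlnpi : forall w, ln (PI * exp (2 * w)) = ln PI + 2 * w).
  { intros w. rewrite ln_mult, ln_exp; auto. apply exp_pos. }
  assert (Eq : forall w : R, (RtoC (2 * PI * exp (2 * w)) * h (PI * exp (2 * w))%R)%C
      = (2 * Cexp (z * ln PI) * (Cexp (s * (w + Ci * 0)) * gauss (1 * Cexp (w + Ci * 0))))%C).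
  { intros w. unfold h. rewrite cpow_pos_Cexp, Hlnpi. replace (w + Ci * 0)%C with (RtoC w) by ring.
    rewrite Cmult_1_l. unfold gauss. rewrite <- (Cexp_plus w w).
    replace (RtoC (2 * PI * exp (2 * w))) with (2 * Cexp (ln PI + 2 * w)%R)%C.
    2:{ rewrite Cexp_R, exp_plus, exp_ln by auto. rewrite !RtoC_mult. ring. }
    replace (RtoC (exp (- (PI * exp (2 * w))))) with (Cexp (- (PI * Cexp (w + w)))).
    2:{ rewrite <- RtoC_plus, Cexp_R, <- RtoC_mult, <- RtoC_opp, Cexp_R. do 4 f_equal. f_equal; ring. }
    transitivity (2 * (Cexp (ln PI + 2 * w)%R * Cexp ((z - 1) * (ln PI + 2 * w)%R)) * Cexp (- (PI * Cexp (w + w))))%C. ring.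
    rewrite <- Cexp_plus.
    replace ((ln PI + 2 * w)%R + (z - 1) * (ln PI + 2 * w)%R)%C with (z * ln PI + s * w)%C.
    2:{ unfold z. rewrite RtoC_plus, RtoC_mult. field. }
    rewrite Cexp_plus. ring. }
  assert (H0 : Rabs 0 < PI / 4) by (rewrite Rabs_R0; lra).
  assert (Hm := mellin_tame s 0 Hs H0 1 0 Rlt_0_1 (Rle_refl _)).
  assert (Ht := Ctame_scal (2 * Cexp (z * ln PI))%C _ Hm).
  apply Ctame_ext with (1 := fun w => eq_sym (Eq w)) in Ht.
  assert (Hc : forall x, 0 < x -> continuous (fun t => fst (h t)) x /\ continuous (fun t => snd (h t)) x).
  { intros x Hx. 
    assert (Hd : Cder (fun t : R => Cexp ((z - 1) * ln t) * Cexp (- t))%C x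
       ((z - 1) * / x * Cexp ((z - 1) * ln x) * Cexp (- x) + Cexp ((z - 1) * ln x) * (- (1) * Cexp (- x)))%C).
    { apply Cder_mult.
      - apply (Cder_Cexp (fun t : R => ((z - 1) * ln t)%C)). eapply Cder_eq.
        apply (Cder_mult (fun _ => (z - 1)%C) (fun t => RtoC (ln t))). apply Cder_const.
        apply Cder_RtoC. apply is_derive_ln; auto. rewrite RtoC_inv by lra. ring.
      - cder. }
    destruct Hd as [Hd1 Hd2]. split.
    - apply continuous_ext with (fun t : R => fst (Cexp ((z - 1) * ln t) * Cexp (- t))%C).
      { intros t. unfold h. rewrite cpow_pos_Cexp, <- RtoC_opp, Cexp_R. auto. }
      apply (ex_derive_continuous (V := R_NormedModule)). eexists; eauto.
    - apply continuous_ext with (fun t : R => snd (Cexp ((z - 1) * ln t) * Cexp (- t))%C).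
      { intros t. unfold h. rewrite cpow_pos_Cexp, <- RtoC_opp, Cexp_R. auto. }
      apply (ex_derive_continuous (V := R_NormedModule)). eexists; eauto. }
  assert (HG : Gamma z = Cintegral (fun w : R => RtoC (2 * PI * exp (2 * w)) * h (PI * exp (2 * w))%R)%C).
  { unfold Gamma, Cint_gen. fold h. destruct Ht as [Ht1 Ht2].
    apply C_ext; cbn [fst snd Cintegral].
    - transitivity (RInt_gen (fun x => fst (h x)) (at_right 0) (Rbar_locally p_infty)); [reflexivity|].
      rewrite (RInt_gen_exp_subst (fun x => fst (h x))).
      + apply integral_ext. intros w. rewrite fst_RtoC_mult. auto.
      + intros x Hx. exact (proj1 (Hc x Hx)).
      + apply tame_ext with (2 := Ht1). intros w. rewrite fst_RtoC_mult. auto.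
    - transitivity (RInt_gen (fun x => snd (h x)) (at_right 0) (Rbar_locally p_infty)); [reflexivity|].
      rewrite (RInt_gen_exp_subst (fun x => snd (h x))).
      + apply integral_ext. intros w. rewrite snd_RtoC_mult. auto.
      + intros x Hx. exact (proj2 (Hc x Hx)).
      + apply tame_ext with (2 := Ht2). intros w. rewrite snd_RtoC_mult. auto. }
  rewrite HG, (Cintegral_ext _ _ Eq), Cintegral_scal by auto.
  rewrite cpow_pos_Cexp. replace (- z * ln PI)%C with (- (z * ln PI))%C by ring. rewrite Cexp_opp.
  unfold gamma_factor, mellin. field. apply Cexp_neq_0.
Qed.

(** * Corrected Dirichlet sums converge to [zeta] *)

Lemma frac_part_interval (n : nat) (x : R) : INR n <= x < INR n + 1 -> frac_part x = x - INR n.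
Proof.
  intros H. unfold frac_part. rewrite <- (Int_part_spec x (Z.of_nat n)).
  - rewrite <- INR_IZR_INZ. auto.
  - rewrite <- INR_IZR_INZ. lra.
Qed.

Section Zeta.
Variable s : C.
Hypothesis s_pos : 0 < fst s.
Hypothesis s_neq_1 : s <> 1%C.

Let E (x : R) : C := Cexp (- (s * ln x)).
Let f (x : R) : C := (RtoC (frac_part x) * cpow_pos x (- s - 1))%C.

Lemma zeta_s_neq_0 : s <> 0%C.
Proof. intros H. rewrite H in s_pos. simpl in s_pos. lra. Qed.

Lemma one_minus_s_neq_0 : (1 - s)%C <> 0%C.
Proof. intros H. apply s_neq_1. replace s with (1 - (1 - s))%C by ring. rewrite H. ring. Qed.

Lemma cpow_E (x : R) : 0 < x -> cpow_pos x (- s - 1) = (E x * / x)%C.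
Proof.
  intros Hx. rewrite cpow_pos_Cexp.
  replace ((- s - 1) * ln x)%C with (- (s * ln x) + - ln x)%C by ring.
  rewrite Cexp_plus, (Cexp_opp (ln x)), (Cexp_R (ln x)), exp_ln by auto. reflexivity.
Qed.

Lemma Cder_E (x : R) : 0 < x -> Cder E x (- (s * / x) * E x)%C.
Proof.
  intros Hx. unfold E. apply (Cder_Cexp (fun x : R => (- (s * ln x))%C)).
  apply (Cder_opp (fun x : R => (s * ln x)%C)). eapply Cder_eq.
  apply (Cder_mult (fun _ => s) (fun t => RtoC (ln t))). apply Cder_const.
  apply Cder_RtoC. apply is_derive_ln; auto. rewrite RtoC_inv by lra. ring.
Qed.

(** On [[n, n+1)] the fractional part is [x - n], and one integration by parts of [(x - n) x^(-s-1)]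
    gives this primitive. *)
Let prim (n : nat) (x : R) : C := (x * E x * / (s * (1 - s)) - (x - INR n) * E x * / s)%C.
Let dprim (n : nat) (x : R) : C := ((x - INR n) * (E x * / x))%C.

Lemma Cder_prim (n : nat) (x : R) : 0 < x -> Cder (prim n) x (dprim n x).
Proof.
  intros Hx. pose proof zeta_s_neq_0. pose proof one_minus_s_neq_0.
  assert (RtoC x <> 0%C). { intros Q. apply RtoC_inj in Q. lra. }
  unfold prim, dprim. eapply Cder_eq.
  - apply (Cder_minus (fun x : R => (x * E x * / (s * (1 - s)))%C) (fun x : R => ((x - INR n) * E x * / s)%C)).
    + apply (Cder_mult (fun x : R => (x * E x)%C) (fun _ => (/ (s * (1 - s)))%C)).
      apply (Cder_mult (fun x : R => RtoC x) E). apply Cder_id. apply Cder_E; auto. apply Cder_const.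
    + apply (Cder_mult (fun x : R => ((x - INR n) * E x)%C) (fun _ => (/ s)%C)).
      apply (Cder_mult (fun x : R => (x - INR n)%C) E). apply (Cder_minus (fun x : R => RtoC x) (fun _ => RtoC (INR n))).
      apply Cder_id. apply Cder_const. apply Cder_E; auto. apply Cder_const.
  - field. auto.
Qed.

Lemma continuous_dprim (n : nat) (x : R) : 0 < x -> continuous (fun t => fst (dprim n t)) x /\ continuous (fun t => snd (dprim n t)) x.
Proof.
  intros Hx.
  assert (Hd : exists l, Cder (dprim n) x l).
  { eexists. unfold dprim. apply (Cder_mult (fun x : R => (x - INR n)%C) (fun x : R => (E x * / x)%C)).
    apply (Cder_minus (fun x : R => RtoC x) (fun _ => RtoC (INR n))). apply Cder_id. apply Cder_const.
    apply (Cder_mult E). apply Cder_E; auto.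
    apply Cder_ext with (fun t => RtoC (/ t)).
    { intros t. apply C_ext; unfold RtoC, Cinv; simpl.
      - destruct (Req_dec t 0) as [->|Ht]. rewrite Rinv_0. unfold Rdiv. ring. field; auto.
      - unfold Rdiv. ring. }
    apply Cder_RtoC. apply (is_derive_inv (fun t => t)). apply (is_derive_id (K := R_AbsRing)). lra. }
  destruct Hd as [l [H1 H2]]. split; apply (ex_derive_continuous (V := R_NormedModule)); eexists; eauto.
Qed.

Lemma f_interval (n : nat) (x : R) : (1 <= n)%nat -> INR n < x < INR n + 1 -> f x = dprim n x.
Proof.
  intros Hn Hx. apply le_INR in Hn. simpl in Hn. unfold f, dprim. rewrite (frac_part_interval n), cpow_E, RtoC_minus; auto; lra.
Qed.

Lemma is_RInt_piece (n : nat) (b : R) : (1 <= n)%nat -> INR n <= b <= INR n + 1 ->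
  is_RInt (fun x => fst (f x)) (INR n) b (fst (prim n b - prim n (INR n))%C) /\
  is_RInt (fun x => snd (f x)) (INR n) b (snd (prim n b - prim n (INR n))%C).
Proof.
  intros Hn Hb. assert (Hn' := Hn). apply le_INR in Hn'. simpl in Hn'.
  split.
  - apply (is_RInt_ext (fun x => fst (dprim n x))).
    + intros x Hx. rewrite Rmin_left, Rmax_right in Hx by lra. rewrite (f_interval n); auto. lra.
    + apply (is_RInt_derive (V := R_CompleteNormedModule) (fun x => fst (prim n x)));
        intros x Hx; rewrite Rmin_left in Hx by lra.
      * apply Cder_prim. lra. * exact (proj1 (continuous_dprim n x ltac:(lra))).
  - apply (is_RInt_ext (fun x => snd (dprim n x))).
    + intros x Hx. rewrite Rmin_left, Rmax_right in Hx by lra. rewrite (f_interval n); auto. lra.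
    + apply (is_RInt_derive (V := R_CompleteNormedModule) (fun x => snd (prim n x)));
        intros x Hx; rewrite Rmin_left in Hx by lra.
      * apply Cder_prim. lra. * exact (proj2 (continuous_dprim n x ltac:(lra))).
Qed.

(** What the pieces on [[n, n+1]] telescope to between 1 and [m + 1]: a power and a Dirichlet
    sum. *)
Let J (m : nat) : C :=
  ((INR (S m) * E (INR (S m)) - 1) * / (s * (1 - s)) - (dirichlet_sum s (S m) - 1) * / s)%C.

Lemma E_1 : E 1 = 1%C.
Proof. unfold E. rewrite ln_1. replace (- (s * 0))%C with (RtoC 0) by ring. apply Cexp_0. Qed.

Lemma is_RInt_J (m : nat) :
  is_RInt (fun x => fst (f x)) 1 (INR (S m)) (fst (J m)) /\ is_RInt (fun x => snd (f x)) 1 (INR (S m)) (snd (J m)).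
Proof.
  pose proof zeta_s_neq_0. pose proof one_minus_s_neq_0.
  induction m as [|m [IH1 IH2]].
  - assert (HJ : J 0 = 0%C).
    { unfold J, dirichlet_sum. cbn [Csum]. change (INR 1) with 1. fold (E 1). rewrite E_1. field. auto. }
    rewrite HJ. split; apply (is_RInt_point (V := R_NormedModule)).
  - destruct (is_RInt_piece (S m) (INR (S (S m)))) as [H1 H2]. lia. rewrite (S_INR (S m)). lra.
    assert (HJ : J (S m) = (J m + (prim (S m) (INR (S (S m))) - prim (S m) (INR (S m))))%C).
    { unfold J, prim, dirichlet_sum. cbn [Csum]. fold (E (INR (S (S m)))). fold (E (INR (S m))).
      rewrite (S_INR (S m)), RtoC_plus. field. auto. }
    rewrite HJ. split.
    + apply (is_RInt_Chasles (V := R_NormedModule) _ 1 (INR (S m))); auto.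
    + apply (is_RInt_Chasles (V := R_NormedModule) _ 1 (INR (S m))); auto.
Qed.

Lemma f_small (n : nat) (x : R) : (1 <= n)%nat -> INR n <= x -> Cmod (f x) <= / INR n.
Proof.
  intros Hn Hx. apply le_INR in Hn. simpl in Hn. unfold f. rewrite Cmod_mult, Cmod_R, cpow_pos_Cexp, Cmod_Cexp.
  destruct (base_fp x). rewrite Rabs_pos_eq by lra.
  replace (fst ((- s - 1) * ln x)%C) with (- ln x + - (fst s * ln x)) by (simpl; ring).
  rewrite exp_plus, !exp_Ropp, exp_ln by lra.
  assert (0 <= ln x). { rewrite <- ln_1. destruct (Req_dec 1 x) as [<-|]. lra. left. apply ln_increasing; lra. }
  assert (/ exp (fst s * ln x) <= 1).
  { rewrite <- Rinv_1. apply Rinv_le_contravar. lra. rewrite <- exp_0. apply exp_le_exp. nra. }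
  assert (/ x <= / INR n) by (apply Rinv_le_contravar; lra).
  assert (0 < / x) by (apply Rinv_0_lt_compat; lra).
  assert (0 < / exp (fst s * ln x)) by (apply Rinv_0_lt_compat, exp_pos).
  assert (/ x * / exp (fst s * ln x) <= / x) by nra.
  assert (0 <= / x * / exp (fst s * ln x)) by nra. nra.
Qed.

(** The improper integral must admit all large real endpoints; beyond the last integer [n] the
    missing piece is at most [1/n]. *)
Lemma RInt_gen_lattice (g : R -> R) (l : R) (c : nat -> R) :
  (forall n b, (1 <= n)%nat -> INR n <= b <= INR n + 1 -> ex_RInt g (INR n) b) ->
  (forall n x, (1 <= n)%nat -> INR n <= x -> Rabs (g x) <= / INR n) ->
  (forall m, is_RInt g 1 (INR (S m)) (c m)) -> is_lim_seq c l ->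
  is_RInt_gen g (at_point 1) (Rbar_locally p_infty) l.
Proof.
  intros Hex Hg Hc Hl P [eps HP]. pose proof (cond_pos eps) as He.
  assert (He2 : 0 < eps / 2) by lra.
  apply is_lim_seq_spec in Hl. destruct (Hl (mkposreal _ He2)) as [N0 HN0]. simpl in HN0.
  destruct (INR_unbounded (2 / eps + 1)) as [N1 HN1].
  apply (Filter_prod _ _ _ (fun a => a = 1) (fun b => INR (S (N0 + N1)) + 1 < b)).
  - reflexivity.
  - exists (INR (S (N0 + N1)) + 1). auto.
  - intros a b -> Hb. simpl.
    assert (Hb0 : 0 <= b). { pose proof (pos_INR (S (N0 + N1))). lra. }
    destruct (nfloor_ex b Hb0) as [n Hn].
    assert (Hnn : (S (N0 + N1) < n)%nat). { apply INR_lt. lra. }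
    destruct n as [|m]; [lia|].
    assert (Hex1 := Hex (S m) b ltac:(lia) ltac:(lra)).
    exists (c m + RInt g (INR (S m)) b). split.
    + apply (is_RInt_Chasles (V := R_NormedModule) _ 1 (INR (S m))); auto.
      apply (RInt_correct (V := R_CompleteNormedModule)); auto.
    + apply HP. change (Rabs (c m + RInt g (INR (S m)) b + - l) < eps).
      replace (c m + RInt g (INR (S m)) b + - l) with ((c m - l) + RInt g (INR (S m)) b) by ring.
      eapply Rle_lt_trans; [apply Rabs_triang|].
      assert (H1 := HN0 m ltac:(lia)).
      assert (H2 : Rabs (RInt g (INR (S m)) b) <= (b - INR (S m)) * / INR (S m)).
      { apply abs_RInt_le_const; auto. lra. intros t Ht. apply Hg. lia. lra. }
      assert (Hm : INR N1 <= INR (S m)) by (apply le_INR; lia).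
      assert (H2e : 0 < 2 / eps) by (apply Rdiv_lt_0_compat; lra).
      assert (H3 : / INR (S m) < eps / 2).
      { replace (eps / 2) with (/ (2 / eps)) by (field; lra). apply Rinv_lt_contravar. nra. lra. }
      assert (0 < / INR (S m)) by (apply Rinv_0_lt_compat; lra).
      assert ((b - INR (S m)) * / INR (S m) <= 1 * / INR (S m)) by (apply Rmult_le_compat_r; lra).
      lra.
Qed.

Lemma J_cauchy : is_Clim J (Clim J).
Proof.
  assert (Hstep : forall n, (1 <= n)%nat -> forall x, INR n <= x ->
     Cmod (f x) <= exp (- ((fst s + 1) * ln x))).
  { intros n Hn x Hx. apply le_INR in Hn. simpl in Hn. unfold f. rewrite Cmod_mult, Cmod_R, cpow_pos_Cexp, Cmod_Cexp.
    destruct (base_fp x). rewrite Rabs_pos_eq by lra.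
    replace (fst ((- s - 1) * ln x)%C) with (- ((fst s + 1) * ln x)) by (simpl; ring).
    pose proof (exp_pos (- ((fst s + 1) * ln x))). nra. }
  (* the majorant [x^(-sigma-1)] has primitive [-x^(-sigma)/sigma] *)
  set (B := fun x : R => 2 / fst s * exp (- (fst s * ln x))).
  assert (HB : forall n m : nat, Cmod (J (m + n)%nat - J n) <= B (INR (S n))).
  { intros n m.
    destruct (is_RInt_J n) as [H1 H2]. destruct (is_RInt_J (m + n)) as [H3 H4].
    assert (Hord : INR (S n) <= INR (S (m + n))) by (apply le_INR; lia).
    assert (Hn1 : 1 <= INR (S n)). { rewrite S_INR. pose proof (pos_INR n). lra. }
    set (phi := fun x => exp (- ((fst s + 1) * ln x))).
    assert (Hphi : is_RInt phi (INR (S n)) (INR (S (m + n))) (B (INR (S n)) / 2 - B (INR (S (m + n))) / 2)).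
    { replace (B (INR (S n)) / 2 - B (INR (S (m + n))) / 2) with
        (minus (- / fst s * exp (- (fst s * ln (INR (S (m + n)))))) (- / fst s * exp (- (fst s * ln (INR (S n)))))).
      2:{ unfold B, minus, plus, opp; simpl. field. lra. }
      apply (is_RInt_derive (V := R_CompleteNormedModule) (fun x => - / fst s * exp (- (fst s * ln x))));
        intros x Hx; rewrite Rmin_left, Rmax_right in Hx by lra.
      - auto_derive. lra. unfold phi. replace (- ((fst s + 1) * ln x)) with (- (fst s * ln x) + - ln x) by ring.
        rewrite exp_plus, exp_Ropp with (x := ln x), exp_ln by lra. field. split; lra.
      - apply (ex_derive_continuous (V := R_NormedModule)). unfold phi. auto_derive. lra. }
    assert (Hcomp : forall p : C -> R, (forall z, Rabs (p z) <= Cmod z) ->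
       is_RInt (fun x => p (f x)) 1 (INR (S n)) (p (J n)) -> is_RInt (fun x => p (f x)) 1 (INR (S (m + n))) (p (J (m + n)%nat)) ->
       Rabs (p (J (m + n)%nat) - p (J n)) <= B (INR (S n)) / 2).
    { intros p Hp Q1 Q2.
      assert (Q3 : is_RInt (fun x => p (f x)) (INR (S n)) (INR (S (m + n))) (p (J (m + n)%nat) - p (J n))).
      { replace (p (J (m + n)%nat) - p (J n)) with (plus (opp (p (J n))) (p (J (m + n)%nat)))
          by (unfold plus, opp; simpl; ring).
        apply (is_RInt_Chasles (V := R_NormedModule) _ _ 1); auto.
        apply (is_RInt_swap (V := R_NormedModule)). auto. }
      assert (Q4 := norm_RInt_le (V := R_NormedModule) (fun x => p (f x)) phi _ _ _ _ Hord
         (fun x Hx => Rle_trans _ _ _ (Hp (f x)) (Hstep (S n) ltac:(lia) x (proj1 Hx))) Q3 Hphi).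
      change (Rabs (p (J (m + n)%nat) - p (J n)) <= B (INR (S n)) / 2 - B (INR (S (m + n))) / 2) in Q4.
      assert (0 < B (INR (S (m + n)))). { unfold B. apply Rmult_lt_0_compat. apply Rdiv_lt_0_compat; lra. apply exp_pos. }
      lra. }
    eapply Rle_trans; [apply Cmod_le_sum|].
    assert (C1 := Hcomp fst fst_Cmod H1 H3). assert (C2 := Hcomp snd snd_Cmod H2 H4).
    change (Rabs (fst (J (m + n)%nat) - fst (J n)) + Rabs (snd (J (m + n)%nat) - snd (J n)) <= B (INR (S n))). lra. }
  apply Clim_cauchy with (fun n => B (INR (S n))). intros n m; apply HB.
  replace (Finite 0) with (Rbar_mult (2 / fst s) 0) by (simpl; f_equal; ring).
  unfold B. apply is_lim_seq_scal_l.
  apply (is_lim_comp_seq exp _ m_infty 0). apply is_lim_exp_m. exists O; discriminate.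
  apply (is_lim_seq_opp _ p_infty).
  apply (is_lim_seq_incr_1 (fun n => fst s * ln (INR n))).
  assert (Hl : is_lim_seq (fun n => ln (INR n)) p_infty).
  { apply (is_lim_comp_seq ln INR p_infty p_infty). apply is_lim_ln_p. exists O; discriminate. apply is_lim_seq_INR. }
  apply is_lim_seq_spec. apply is_lim_seq_spec in Hl. intros k. destruct (Hl (k / fst s)) as [N0 H0].
  exists N0. intros n Hn. specialize (H0 n Hn). apply Rmult_lt_compat_l with (r := fst s) in H0; auto.
  replace (fst s * (k / fst s)) with k in H0 by (field; lra). auto.
Qed.

(** [s/(s-1) - s J] collapses algebraically to the corrected Dirichlet sum, so the definition
    through [frac_part] meets the truncation used on the kernel side. *)
Lemma zeta_cv :
  is_Clim (fun n => dirichlet_sum s (S n) + INR (S n) * Cexp (- (s * ln (INR (S n)))) / (s - 1))%C (zeta s).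
Proof.
  pose proof zeta_s_neq_0. pose proof one_minus_s_neq_0.
  assert (Hs1 : (s - 1)%C <> 0%C). { intros Q. apply one_minus_s_neq_0. replace (1 - s)%C with (- (s - 1))%C by ring. rewrite Q. ring. }
  assert (HZ : zeta s = (s / (s - 1) - s * Clim J)%C).
  { unfold zeta, Cint_gen. fold f. destruct J_cauchy as [H1 H2].
    rewrite (is_RInt_gen_unique (V := R_CompleteNormedModule) (fun x => fst (f x)) (fst (Clim J))),
      (is_RInt_gen_unique (V := R_CompleteNormedModule) (fun x => snd (f x)) (snd (Clim J))).
    - destruct (Clim J); reflexivity.
    - apply RInt_gen_lattice with (fun n => snd (J n)); auto.
      + intros n b Hn Hb. eexists. apply is_RInt_piece; eauto.
      + intros n x Hn Hx. eapply Rle_trans; [apply snd_Cmod|]. apply f_small; auto.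
      + intros m. exact (proj2 (is_RInt_J m)).
    - apply RInt_gen_lattice with (fun n => fst (J n)); auto.
      + intros n b Hn Hb. eexists. apply is_RInt_piece; eauto.
      + intros n x Hn Hx. eapply Rle_trans; [apply fst_Cmod|]. apply f_small; auto.
      + intros m. exact (proj1 (is_RInt_J m)). }
  rewrite HZ.
  apply is_Clim_ext with (fun n => s / (s - 1) + (- s) * J n)%C.
  { intros n. unfold J, E. field. auto. }
  replace (s / (s - 1) - s * Clim J)%C with (s / (s - 1) + - s * Clim J)%C by ring.
  apply (is_Clim_plus (fun _ => (s / (s - 1))%C) (fun n => (- s * J n)%C)). apply is_Clim_const.
  apply (is_Clim_mult (fun _ => (- s)%C) J). apply is_Clim_const. apply J_cauchy.
Qed.
End Zeta.

(** One sequence, [xi_approx s (S n)], has two limits: [zeta_cv] computes it on the arithmetic side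
    and [xi_approx_cv] on the kernel side. *)
Lemma xi_transform (s : C) (y : R) : 0 < fst s -> s <> 1%C -> Rabs y < PI / 4 ->
  xi s = Phi_transform y (s - / 2).
Proof.
  intros Hs H1 Hy.
  assert (Hs1 : (s - 1)%C <> 0%C). { intros Q. apply H1. replace s with (s - 1 + 1)%C by ring. rewrite Q. ring. }
  assert (Ex : xi s = (/ 2 * (s * (s - 1) * zeta s * gamma_factor s))%C).
  { rewrite <- Gamma_mellin by auto. unfold xi.
    replace (RtoC (1 / 2)) with (/ 2)%C by (unfold Rdiv; rewrite Rmult_1_l; rewrite RtoC_inv; auto; lra).
    destruct (Req_EM_T (fst s) 1) as [E1|E1]; [destruct (Req_EM_T (snd s) 0) as [E2|E2]|]; try ring.
    exfalso. apply H1. apply C_ext; simpl; auto. }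
  assert (L1 : is_Clim (fun n => xi_approx s (S n)) (s * (s - 1) * zeta s * gamma_factor s)%C).
  { apply is_Clim_ext with (fun n => s * (s - 1) * (dirichlet_sum s (S n) + INR (S n) * Cexp (- (s * ln (INR (S n)))) / (s - 1)) * gamma_factor s)%C.
    { intros n. unfold xi_approx. field. auto. }
    apply (is_Clim_mult _ (fun _ => gamma_factor s)); [|apply is_Clim_const].
    apply (is_Clim_mult (fun _ => (s * (s - 1))%C)); [apply is_Clim_const|]. apply zeta_cv; auto. }
  rewrite Ex, (is_Clim_eq _ _ _ L1 (xi_approx_cv s y Hs Hy)). field.
Qed.

(** * Monotonicity and lower bounds for the Gamma factor *)

Definition weight (a w : R) : R := exp (a * w) * exp (- (PI * exp (2 * w))).

Definition real_mellin (a : R) : R := integral (weight a).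

Lemma zero_lt_PI_4 : Rabs 0 < PI / 4.
Proof. rewrite Rabs_R0. pose proof PI_RGT_0. lra. Qed.

Lemma mellin_integrand (s : C) (w : R) :
  (Cexp (s * (w + Ci * 0)) * gauss (1 * Cexp (w + Ci * 0)))%C = (weight (fst s) w * Cexp (Ci * (snd s * w)))%C.
Proof.
  replace (w + Ci * 0)%C with (RtoC w) by ring. rewrite Cmult_1_l. unfold gauss, weight.
  rewrite <- (Cexp_plus w w), <- RtoC_plus, Cexp_R, <- RtoC_mult, <- RtoC_opp, Cexp_R.
  replace (s * w)%C with (RtoC (fst s * w) + Ci * (snd s * w))%C by (apply C_ext; simpl; ring).
  rewrite Cexp_plus, Cexp_R, RtoC_mult. replace (w + w) with (2 * w) by ring. ring.
Qed.

Lemma weight_pos (a w : R) : 0 < weight a w.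
Proof. apply Rmult_lt_0_compat; apply exp_pos. Qed.

Lemma tame_weight (a : R) : 0 < a -> tame (weight a).
Proof.
  intros Ha. destruct (mellin_tame a 0 Ha zero_lt_PI_4 1 0 Rlt_0_1 (Rle_refl _)) as [H _].
  apply tame_ext with (2 := H). intros w. rewrite mellin_integrand.
  rewrite fst_RtoC_mult. unfold Cexp; simpl. replace (0 * (0 * w - 0 * 0) - 1 * (0 * 0 + 0 * w)) with 0 by ring.
  replace (0 * (0 * 0 + 0 * w) + 1 * (0 * w - 0 * 0)) with 0 by ring. rewrite exp_0, cos_0. ring.
Qed.

Lemma real_mellin_pos (a : R) : 0 < a -> 0 < real_mellin a.
Proof. intros Ha. apply integral_gt_0. apply tame_weight; auto. apply weight_pos. Qed.

(** A unimodular factor recentres the oscillation at [mu]; [mellin_lower] places [mu] where the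
    weight is concentrated. *)
Lemma fst_rotated (s : C) (mu : R) : 0 < fst s ->
  tame (fun w => weight (fst s) w * cos (snd s * (w - mu))) /\
  fst (Cexp (- (Ci * (snd s * mu))) * mellin s 1 0)%C = integral (fun w => weight (fst s) w * cos (snd s * (w - mu))).
Proof.
  intros Hs.
  assert (Hm := mellin_tame s 0 Hs zero_lt_PI_4 1 0 Rlt_0_1 (Rle_refl _)).
  assert (E : forall w : R, (Cexp (- (Ci * (snd s * mu))) * (Cexp (s * (w + Ci * 0)) * gauss (1 * Cexp (w + Ci * 0))))%C
     = (weight (fst s) w * Cexp (Ci * (snd s * (w - mu))))%C).
  { intros w. rewrite mellin_integrand.
    replace (Ci * (snd s * (w - mu)))%C with (- (Ci * (snd s * mu)) + Ci * (snd s * w))%C by ring.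
    rewrite Cexp_plus. ring. }
  assert (Ef : forall w, fst (weight (fst s) w * Cexp (Ci * (snd s * (w - mu))))%C = weight (fst s) w * cos (snd s * (w - mu))).
  { intros w. rewrite fst_RtoC_mult. f_equal. rewrite <- RtoC_minus, <- RtoC_mult. unfold Cexp; simpl.
    replace (0 * (snd s * (w - mu)) - 1 * 0) with 0 by ring.
    replace (0 * 0 + 1 * (snd s * (w - mu))) with (snd s * (w - mu)) by ring. rewrite exp_0. ring. }
  split.
  - assert (Ht := Ctame_scal (Cexp (- (Ci * (snd s * mu)))) _ Hm).
    destruct Ht as [H1 _]. apply tame_ext with (2 := H1). intros w. rewrite E. apply Ef.
  - unfold mellin. rewrite <- Cintegral_scal by auto. simpl fst. apply integral_ext.
    intros w. rewrite <- Ef, <- E. auto.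
Qed.

Lemma mellin_real (a : R) : 0 < a -> Cmod (mellin a 1 0) = real_mellin a.
Proof.
  intros Ha.
  assert (E : mellin a 1 0 = RtoC (real_mellin a)).
  { unfold mellin. rewrite (Cintegral_ext _ (fun w => RtoC (weight a w))).
    - apply C_ext; simpl. reflexivity. apply integral_0.
    - intros w. rewrite mellin_integrand. simpl snd. replace (Ci * (0 * w))%C with (RtoC 0) by ring.
      rewrite Cexp_0, Cmult_1_r. reflexivity. }
  rewrite E, Cmod_R. apply Rabs_pos_eq. left. apply real_mellin_pos; auto.
Qed.

Lemma mellin_recurrence (s : C) : 0 < fst s -> mellin (s + 2) 1 0 = (s / (2 * PI) * mellin s 1 0)%C.
Proof.
  intros Hs. destruct (mellin_sq s 0 Hs zero_lt_PI_4 1 Rlt_0_1) as [H1 H2].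
  pose proof PI_RGT_0.
  assert (HP : RtoC PI <> 0%C). { intros Q. apply RtoC_inj in Q. lra. }
  assert (Hs2 : 0 < fst (s + 2)%C) by (simpl; lra).
  assert (E : Cintegral (fun x : R => 2 * PI * (Cexp ((s + 2) * (x + Ci * 0)) * gauss (1 * Cexp (x + Ci * 0))))%C
       = (s * mellin s 1 0)%C).
  { rewrite <- H2. apply Cintegral_ext. intros x. rewrite !Cmult_1_l.
    replace ((s + 2) * (x + Ci * 0))%C with (s * (x + Ci * 0) + ((x + Ci * 0) + (x + Ci * 0)))%C by ring.
    rewrite Cexp_plus, (Cexp_plus (x + Ci * 0) (x + Ci * 0)). ring. }
  rewrite Cintegral_scal in E by (apply (mellin_tame (s + 2) 0 Hs2 zero_lt_PI_4 1 0 Rlt_0_1 (Rle_refl _))).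
  fold (mellin (s + 2) 1 0) in E.
  replace (mellin (s + 2) 1 0) with (2 * PI * mellin (s + 2) 1 0 / (2 * PI))%C by (field; auto).
  rewrite E. field. auto.
Qed.

Lemma real_mellin_recurrence (a : R) : 0 < a -> real_mellin (a + 2) = a / (2 * PI) * real_mellin a.
Proof.
  intros Ha. pose proof PI_RGT_0. rewrite <- !mellin_real by lra. rewrite RtoC_plus, mellin_recurrence by auto.
  rewrite Cmod_mult, Cmod_div, !Cmod_mult, !Cmod_R, !Rabs_pos_eq; auto; try lra.
  rewrite <- RtoC_mult. intros Q. apply RtoC_inj in Q. lra.
Qed.

Lemma sinh_ge (y : R) : 0 <= y -> 2 * y <= exp y - exp (- y).
Proof.
  intros Hy. destruct (MVT_gen (fun y => exp y - exp (- y) - 2 * y) 0 y (fun y => exp y + exp (- y) - 2)) as [c [_ E]].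
  - intros x _. auto_derive; auto. ring.
  - intros x _. apply continuity_pt_filterlim. apply (ex_derive_continuous (V := R_NormedModule) (fun y => exp y - exp (- y) - 2 * y)). auto_derive; auto.
  - rewrite Ropp_0, exp_0 in E.
    assert (0 <= exp c + exp (- c) - 2).
    { rewrite exp_Ropp. pose proof (exp_pos c).
      replace (exp c + / exp c - 2) with ((exp c - 1) ^ 2 / exp c) by (field; lra).
      apply Rmult_le_pos. apply pow2_ge_0. left; apply Rinv_0_lt_compat; auto. }
    assert (0 <= (exp c + exp (- c) - 2) * (y - 0)) by (apply Rmult_le_pos; lra). lra.
Qed.

Lemma cosh_ge (x : R) : x ^ 2 <= exp x + exp (- x) - 2.
Proof.
  assert (H : forall y, 0 <= y -> (2 * y) ^ 2 <= exp (2 * y) + exp (- (2 * y)) - 2).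
  { intros y Hy. replace (exp (2 * y) + exp (- (2 * y)) - 2) with ((exp y - exp (- y)) ^ 2).
    - apply pow_incr. pose proof (sinh_ge y Hy). lra.
    - replace (2 * y) with (y + y) by ring. rewrite Ropp_plus_distr, !exp_plus, !exp_Ropp.
      pose proof (exp_pos y). field. lra. }
  destruct (Rle_dec 0 x).
  - specialize (H (x / 2) ltac:(lra)). replace (2 * (x / 2)) with x in H by field. auto.
  - specialize (H (- x / 2) ltac:(lra)). replace (2 * (- x / 2)) with (- x) in H by field.
    rewrite Ropp_involutive in H. replace ((- x) ^ 2) with (x ^ 2) in H by ring. lra.
Qed.

Lemma Rabs_sin_le (y : R) : 0 <= y -> Rabs (sin y) <= y.
Proof.
  intros Hy. destruct (Rle_dec y 1).
  - destruct (Rle_lt_or_eq_dec 0 y Hy) as [E|E]. 2: rewrite <- E, sin_0, Rabs_R0; lra.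
    pose proof PI_gt_3. rewrite Rabs_pos_eq by (apply sin_ge_0; lra). left; apply sin_lt_x; lra.
  - apply Rle_trans with 1. apply Rabs_le; apply SIN_bound. lra.
Qed.

Lemma cos_ge (x : R) : 1 - x ^ 2 / 2 <= cos x.
Proof.
  assert (H : forall y, 0 <= y -> 1 - (2 * y) ^ 2 / 2 <= cos (2 * y)).
  { intros y Hy. rewrite cos_2a_sin. pose proof (Rabs_sin_le y Hy).
    assert (sin y ^ 2 <= y ^ 2). { rewrite <- (pow2_abs (sin y)). apply pow_incr. split; auto. apply Rabs_pos. }
    nra. }
  destruct (Rle_dec 0 x).
  - specialize (H (x / 2) ltac:(lra)). replace (2 * (x / 2)) with x in H by field. auto.
  - specialize (H (- x / 2) ltac:(lra)). replace (2 * (- x / 2)) with (- x) in H by field.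
    rewrite cos_neg in H. replace ((- x) ^ 2) with (x ^ 2) in H by ring. lra.
Qed.

(** After recentring, [cos x >= 1 - x^2/2] leaves a second moment of [w - mu], and [cosh_ge] bounds
    it by exponential moments, which the recurrence of [real_mellin] evaluates exactly. *)
Lemma mellin_lower (s : C) : 2 < fst s ->
  real_mellin (fst s) * (1 - snd s ^ 2 / (4 * (fst s - 2))) <= Cmod (mellin s 1 0).
Proof.
  intros Hs. set (a := fst s) in *. set (t := snd s). pose proof PI_RGT_0 as HP.
  (* [m] is the mean of [exp (2 w)] under the normalised weight. *)
  set (m := a / (2 * PI)). assert (Hm : 0 < m) by (apply Rdiv_lt_0_compat; lra).
  set (mu := ln m / 2).
  destruct (fst_rotated s mu ltac:(fold a; lra)) as [Ht E]. fold a t in Ht, E.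
  assert (H1 : fst (Cexp (- (Ci * (t * mu))) * mellin s 1 0)%C <= Cmod (mellin s 1 0)).
  { eapply Rle_trans; [apply Rle_abs|]. eapply Rle_trans; [apply fst_Cmod|].
    rewrite Cmod_mult, Cmod_Cexp. replace (fst (- (Ci * (t * mu)))%C) with 0 by (simpl; ring). rewrite exp_0. lra. }
  eapply Rle_trans; [|apply H1]. fold t in E. rewrite E.
  assert (Hw : forall b, tame (weight b) -> forall c, tame (fun w => c * weight b w)) by (intros; apply tame_scal; auto).
  assert (Ha0 : tame (weight a)) by (apply tame_weight; lra).
  assert (Ha2 : tame (weight (a + 2))) by (apply tame_weight; lra).
  assert (Ham : tame (weight (a - 2))) by (apply tame_weight; lra).
  assert (Hgap : real_mellin a = (a - 2) / (2 * PI) * real_mellin (a - 2)).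
  { rewrite <- real_mellin_recurrence by lra. f_equal. ring. }
  assert (Hid : integral (fun w => (1 + t ^ 2 / 4) * weight a w - (t ^ 2 / 8 * / m * weight (a + 2) w + t ^ 2 / 8 * m * weight (a - 2) w))
     = real_mellin a * (1 - t ^ 2 / (4 * (a - 2)))).
  { rewrite integral_minus, integral_plus, !integral_scal; auto; try apply tame_plus; auto.
    fold (real_mellin a). fold (real_mellin (a + 2)). fold (real_mellin (a - 2)).
    rewrite real_mellin_recurrence by lra. rewrite Hgap. unfold m. field. lra. }
  rewrite <- Hid. apply integral_le; auto.
  - apply tame_minus; auto. apply tame_plus; auto.
  - intros w.
    assert (Ep : weight (a + 2) w = weight a w * exp (2 * w)).
    { unfold weight. replace ((a + 2) * w) with (a * w + 2 * w) by ring. rewrite exp_plus. ring. }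
    assert (Em : weight (a - 2) w = weight a w * / exp (2 * w)).
    { unfold weight. replace ((a - 2) * w) with (a * w + - (2 * w)) by ring. rewrite exp_plus, exp_Ropp. ring. }
    rewrite Ep, Em. pose proof (weight_pos a w).
    assert (Hc := cos_ge (t * (w - mu))). assert (Hh := cosh_ge (2 * w - ln m)).
    assert (Ee : exp (2 * w - ln m) = exp (2 * w) * / m).
    { unfold Rminus. rewrite exp_plus, exp_Ropp, exp_ln; auto. }
    rewrite exp_Ropp, Ee in Hh. replace (2 * w - ln m) with (2 * (w - mu)) in Hh by (unfold mu; field).
    pose proof (exp_pos (2 * w)).
    replace (/ (exp (2 * w) * / m)) with (m * / exp (2 * w)) in Hh by (field; lra).
    apply Rle_trans with (weight a w * (1 - (t * (w - mu)) ^ 2 / 2)); [|apply Rmult_le_compat_l; lra].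
    replace ((1 + t ^ 2 / 4) * weight a w - (t ^ 2 / 8 * / m * (weight a w * exp (2 * w)) + t ^ 2 / 8 * m * (weight a w * / exp (2 * w))))
      with (weight a w * (1 - t ^ 2 / 8 * (exp (2 * w) * / m + m * / exp (2 * w) - 2))) by (field; lra).
    apply Rmult_le_compat_l. lra. pose proof (pow2_ge_0 t).
    assert (t ^ 2 / 8 * (2 * (w - mu)) ^ 2 <= t ^ 2 / 8 * (exp (2 * w) * / m + m * / exp (2 * w) - 2)).
    { apply Rmult_le_compat_l; lra. }
    replace ((t * (w - mu)) ^ 2 / 2) with (t ^ 2 / 8 * (2 * (w - mu)) ^ 2) by field. lra.
Qed.

(** This is [|Gamma(s/2)| / Gamma(Re s / 2)]: the powers of [PI] cancel in modulus. *)
Definition phase_ratio (s : C) : R := Cmod (mellin s 1 0) / real_mellin (fst s).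

Lemma phase_ratio_step (s : C) : 0 < fst s ->
  phase_ratio (s + 2) = phase_ratio s * (Cmod s / fst s).
Proof.
  intros Hs. unfold phase_ratio. rewrite mellin_recurrence by auto. pose proof PI_RGT_0.
  replace (fst (s + 2)%C) with (fst s + 2) by (simpl; ring). rewrite real_mellin_recurrence by auto.
  rewrite Cmod_mult, Cmod_div, Cmod_mult, !Cmod_R, !Rabs_pos_eq; try lra.
  - pose proof (real_mellin_pos (fst s) Hs). field. lra.
  - rewrite <- RtoC_mult. intros Q. apply RtoC_inj in Q. lra.
Qed.

Lemma phase_ratio_nonneg (s : C) : 0 < fst s -> 0 <= phase_ratio s.
Proof.
  intros Hs. apply Rmult_le_pos. apply Cmod_ge_0. left. apply Rinv_0_lt_compat, real_mellin_pos; auto.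
Qed.

Lemma phase_ratio_le_1 (s : C) : 0 < fst s -> phase_ratio s <= 1.
Proof.
  intros Hs. pose proof (real_mellin_pos _ Hs). unfold phase_ratio.
  apply Rmult_le_reg_r with (real_mellin (fst s)); auto. unfold Rdiv. rewrite Rmult_assoc, Rinv_l by lra.
  rewrite Rmult_1_r, Rmult_1_l. apply Cmod_Cintegral_le.
  - apply (mellin_tame s 0 Hs zero_lt_PI_4 1 0 Rlt_0_1 (Rle_refl _)).
  - apply tame_weight; auto.
  - intros w. rewrite mellin_integrand, Cmod_mult, Cmod_R, Cmod_Cexp.
    replace (fst (Ci * (snd s * w))%C) with 0 by (simpl; ring). rewrite exp_0, Rabs_pos_eq. lra. left; apply weight_pos.
Qed.

Lemma phase_ratio_lower (s : C) : 2 < fst s -> 1 - snd s ^ 2 / (4 * (fst s - 2)) <= phase_ratio s.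
Proof.
  intros Hs. pose proof (real_mellin_pos (fst s) ltac:(lra)). unfold phase_ratio.
  apply Rmult_le_reg_l with (real_mellin (fst s)); auto. eapply Rle_trans; [apply mellin_lower; auto|].
  right. field. lra.
Qed.

Fixpoint shift2 (s : C) (n : nat) : C := match n with O => s | S k => (shift2 s k + 2)%C end.

Lemma shift2_eq (s : C) (n : nat) : fst (shift2 s n) = fst s + 2 * INR n /\ snd (shift2 s n) = snd s.
Proof.
  induction n as [|n [H1 H2]].
  - simpl. split; ring.
  - rewrite S_INR. cbn [shift2]. simpl. rewrite H1, H2. split; ring.
Qed.

Lemma phase_ratio_shift_cv (s : C) : 0 < fst s -> is_lim_seq (fun n => phase_ratio (shift2 s n)) 1.
Proof.
  intros Hs.
  apply is_lim_seq_le_le_loc with (u := fun n => 1 - snd s ^ 2 / 4 * / INR n) (w := fun _ => 1).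
  - exists 2%nat. intros n Hn. apply le_INR in Hn. simpl in Hn.
    destruct (shift2_eq s n) as [H1 H2]. split.
    + eapply Rle_trans; [|apply phase_ratio_lower; lra]. rewrite H1, H2.
      pose proof (pow2_ge_0 (snd s)).
      assert (snd s ^ 2 / (4 * (fst s + 2 * INR n - 2)) <= snd s ^ 2 / 4 * / INR n); [|lra].
      replace (snd s ^ 2 / (4 * (fst s + 2 * INR n - 2))) with (snd s ^ 2 / 4 * / (fst s + 2 * INR n - 2)) by (field; lra).
      apply Rmult_le_compat_l. lra. apply Rinv_le_contravar; lra.
    + apply phase_ratio_le_1. lra.
  - replace (Finite 1) with (Finite (1 - snd s ^ 2 / 4 * 0)) by (f_equal; ring).
    apply is_lim_seq_minus'. apply is_lim_seq_const.
    apply (is_lim_seq_scal_l _ _ 0). replace (Finite 0) with (Rbar_inv p_infty) by reflexivity.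
    apply is_lim_seq_inv. apply is_lim_seq_INR. discriminate.
  - apply is_lim_seq_const.
Qed.

Lemma Cmod_ratio_mono (a b t : R) : 0 < a -> a <= b -> Cmod (b, t) / b <= Cmod (a, t) / a.
Proof.
  intros Ha Hab.
  assert (H : forall x, 0 < x -> Cmod (x, t) / x = sqrt (1 + t ^ 2 / x ^ 2)).
  { intros x Hx. unfold Cmod. simpl fst; simpl snd. rewrite <- (sqrt_pow2 x) at 2 by lra.
    rewrite <- sqrt_div_alt by nra. f_equal. field. lra. }
  rewrite !H by lra. apply sqrt_le_1_alt. apply Rplus_le_compat_l.
  apply Rmult_le_compat_l. apply pow2_ge_0. apply Rinv_le_contravar; nra.
Qed.

(** A shift by 2 multiplies the ratio by [|s| / Re s], which decreases as the real part grows.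
    Comparing along repeated shifts, where both ratios tend to 1, takes the place of the product
    formula for Gamma. *)
Lemma phase_ratio_mono (a b t : R) : 0 < a -> a <= b -> phase_ratio (a, t) <= phase_ratio (b, t).
Proof.
  intros Ha Hab.
  assert (H : forall n, phase_ratio (shift2 (b, t) n) * phase_ratio (a, t) <= phase_ratio (b, t) * phase_ratio (shift2 (a, t) n)).
  { induction n.
    - simpl. lra.
    - cbn [shift2]. destruct (shift2_eq (a, t) n) as [A1 A2]. destruct (shift2_eq (b, t) n) as [B1 B2].
      simpl in A1, A2, B1, B2. pose proof (pos_INR n).
      rewrite !phase_ratio_step by lra.
      assert (Hq : Cmod (shift2 (b, t) n) / fst (shift2 (b, t) n) <= Cmod (shift2 (a, t) n) / fst (shift2 (a, t) n)).
      { destruct (shift2 (a, t) n) as [x1 x2]. destruct (shift2 (b, t) n) as [y1 y2]. simpl in *. subst.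
        apply Cmod_ratio_mono; lra. }
      assert (P0 : 0 <= phase_ratio (a, t)) by (apply phase_ratio_nonneg; auto).
      assert (P1 : 0 <= phase_ratio (shift2 (b, t) n)) by (apply phase_ratio_nonneg; lra).
      assert (P2 : 0 <= Cmod (shift2 (b, t) n) / fst (shift2 (b, t) n)).
      { apply Rmult_le_pos. apply Cmod_ge_0. left; apply Rinv_0_lt_compat; lra. }
      set (u := Cmod (shift2 (b, t) n) / fst (shift2 (b, t) n)) in *.
      set (v := Cmod (shift2 (a, t) n) / fst (shift2 (a, t) n)) in *.
      apply Rle_trans with ((phase_ratio (shift2 (b, t) n) * phase_ratio (a, t)) * v).
      + replace (phase_ratio (shift2 (b, t) n) * u * phase_ratio (a, t)) with (phase_ratio (shift2 (b, t) n) * phase_ratio (a, t) * u) by ring.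
        apply Rmult_le_compat_l; auto. apply Rmult_le_pos; auto.
      + rewrite <- Rmult_assoc. apply Rmult_le_compat_r; auto. lra. }
  assert (L1 := phase_ratio_shift_cv (b, t) ltac:(simpl; lra)).
  assert (L2 := phase_ratio_shift_cv (a, t) ltac:(simpl; lra)).
  assert (Q := is_lim_seq_le _ _ (1 * phase_ratio (a, t)) (phase_ratio (b, t) * 1) H
     (is_lim_seq_mult' _ _ _ _ L1 (is_lim_seq_const _)) (is_lim_seq_mult' _ _ _ _ (is_lim_seq_const _) L2)).
  simpl in Q. lra.
Qed.

(** About [t^2 + 2] shifts lead to where [phase_ratio_lower] gives 1/2, and each shift raises the
    ratio by a factor of at most [1 + |t| <= exp |t|]. *)
Lemma phase_ratio_exp_lower (a t : R) : 1 <= a -> / 2 * exp (- (Rabs t * (t ^ 2 + 3))) <= phase_ratio (a, t).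
Proof.
  intros Ha. pose proof (Rabs_pos t) as Ht. pose proof (pow2_ge_0 t) as Ht2.
  destruct (nfloor_ex (t ^ 2 + 2) ltac:(lra)) as [n Hn].
  assert (H : forall k, phase_ratio (shift2 (a, t) k) <= phase_ratio (a, t) * exp (INR k * Rabs t)).
  { induction k.
    - simpl. rewrite Rmult_0_l, exp_0. lra.
    - cbn [shift2]. destruct (shift2_eq (a, t) k) as [A1 A2]. pose proof (pos_INR k). simpl in A1, A2.
      rewrite phase_ratio_step by lra. rewrite S_INR, Rmult_plus_distr_r, exp_plus, Rmult_1_l, <- Rmult_assoc.
      apply Rmult_le_compat; auto. apply phase_ratio_nonneg; lra.
      apply Rmult_le_pos. apply Cmod_ge_0. left; apply Rinv_0_lt_compat; lra.
      apply Rmult_le_reg_r with (fst (shift2 (a, t) k)). lra. unfold Rdiv. rewrite Rmult_assoc, Rinv_l, Rmult_1_r by lra.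
      eapply Rle_trans; [apply Cmod_le_sum|]. rewrite A2, Rabs_pos_eq by lra.
      pose proof (exp_ineq1_le (Rabs t)). rewrite A1. nra. }
  specialize (H n).
  destruct (shift2_eq (a, t) n) as [A1 A2]. simpl in A1, A2.
  assert (Hl := phase_ratio_lower (shift2 (a, t) n) ltac:(rewrite A1; lra)). rewrite A1, A2 in Hl.
  assert (Hh : t ^ 2 / (4 * (a + 2 * INR n - 2)) <= / 2).
  { apply Rmult_le_reg_r with (4 * (a + 2 * INR n - 2)). lra. unfold Rdiv. rewrite Rmult_assoc, Rinv_l by lra. lra. }
  assert (He : exp (INR n * Rabs t) <= exp (Rabs t * (t ^ 2 + 3))) by (apply exp_le_exp; nra).
  rewrite exp_Ropp. pose proof (exp_pos (Rabs t * (t ^ 2 + 3))).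
  assert (P0 : 0 <= phase_ratio (a, t)) by (apply phase_ratio_nonneg; simpl; lra).
  apply Rmult_le_reg_r with (exp (Rabs t * (t ^ 2 + 3))); auto. rewrite Rmult_assoc, Rinv_l by lra. nra.
Qed.

(** The bound 26 makes [m = (a - 2)/(2 PI)] at least 3, hence [ln m >= 1]. The tangent inequalities
    [exp (2 d w) >= 1 + 2 d w] and [2 w >= ln m + 1 - m exp (-2 w)] are averaged against the weight,
    under which [m exp (-2 w)] has mean 1. *)
Lemma real_mellin_growth (a d : R) : 26 <= a -> 0 <= d -> (1 + d) * real_mellin a <= real_mellin (a + 2 * d).
Proof.
  intros Ha Hd. pose proof PI_RGT_0 as HP. pose proof PI_4 as HP4.
  set (m := (a - 2) / (2 * PI)). assert (Hm : 0 < m) by (apply Rdiv_lt_0_compat; lra).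
  assert (Hlm : 1 <= ln m).
  { assert (H3 : 3 <= m). { unfold m. apply Rmult_le_reg_r with (2 * PI). lra. unfold Rdiv. rewrite Rmult_assoc, Rinv_l by lra. lra. }
    rewrite <- (ln_exp 1). pose proof exp_le_3. pose proof (exp_pos 1).
    destruct (Rle_lt_or_eq_dec (exp 1) m ltac:(lra)) as [Hl|Hl]. left; apply ln_increasing; auto. rewrite Hl; lra. }
  assert (Ha0 : tame (weight a)) by (apply tame_weight; lra).
  assert (Ham : tame (weight (a - 2))) by (apply tame_weight; lra).
  assert (Had : tame (weight (a + 2 * d))) by (apply tame_weight; lra).
  assert (Hgap : real_mellin a = (a - 2) / (2 * PI) * real_mellin (a - 2)).
  { rewrite <- real_mellin_recurrence by lra. f_equal. ring. }
  assert (Hid : integral (fun w => (1 + d * (ln m + 1)) * weight a w - d * m * weight (a - 2) w) = (1 + d * ln m) * real_mellin a).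
  { rewrite integral_minus, !integral_scal; auto using tame_scal.
    fold (real_mellin a). fold (real_mellin (a - 2)).
    assert (Hm' : m * real_mellin (a - 2) = real_mellin a) by (rewrite Hgap; reflexivity).
    rewrite (Rmult_assoc d), Hm'. ring. }
  apply Rle_trans with ((1 + d * ln m) * real_mellin a).
  { apply Rmult_le_compat_r. left; apply real_mellin_pos; lra. nra. }
  rewrite <- Hid. apply integral_le; auto. apply tame_minus; apply tame_scal; auto.
  intros w.
  assert (Ep : weight (a + 2 * d) w = weight a w * exp (d * (2 * w))).
  { unfold weight. replace ((a + 2 * d) * w) with (a * w + d * (2 * w)) by ring. rewrite exp_plus. ring. }
  assert (Em : weight (a - 2) w = weight a w * / exp (2 * w)).
  { unfold weight. replace ((a - 2) * w) with (a * w + - (2 * w)) by ring. rewrite exp_plus, exp_Ropp. ring. }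
  rewrite Ep, Em. pose proof (weight_pos a w).
  assert (H1 := exp_ineq1_le (d * (2 * w))). assert (H2 := exp_ineq1_le (ln m + - (2 * w))).
  rewrite exp_plus, exp_Ropp, exp_ln in H2 by auto.
  replace ((1 + d * (ln m + 1)) * weight a w - d * m * (weight a w * / exp (2 * w)))
    with (weight a w * (1 + d * (ln m + 1 - m * / exp (2 * w)))) by ring.
  apply Rmult_le_compat_l. lra. nra.
Qed.

(** * The Dirichlet series on the half-plane of convergence *)

Definition dterm (s : C) (n : nat) : C := Cexp (- (s * ln (INR (S n)))).

Lemma Cmod_dterm (s : C) (n : nat) : Cmod (dterm s n) = exp (- (fst s * ln (INR (S n)))).
Proof. unfold dterm. rewrite Cmod_Cexp. f_equal. set (L := ln (INR (S n))). simpl. ring. Qed.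

Lemma ln_INR_nonneg (n : nat) : 0 <= ln (INR (S n)).
Proof.
  rewrite <- ln_1. assert (1 <= INR (S n)). { rewrite S_INR. pose proof (pos_INR n). lra. }
  destruct H as [H|H]. left; apply ln_increasing; lra. rewrite <- H. lra.
Qed.

(** For [n >= 1] this is the integral of [x^(-a)] over [x >= n]; index 0 adds the first term of the
    series. *)
Definition dmajorant (a : R) (n : nat) : R :=
  match n with
  | O => 1 + / (a - 1)
  | S _ => / (a - 1) * exp (- ((a - 1) * ln (INR n)))
  end.

Lemma dmajorant_step (a : R) (n : nat) : 1 < a ->
  exp (- (a * ln (INR (S n)))) <= dmajorant a n - dmajorant a (S n).
Proof.
  intros Ha. destruct n as [|n].
  - unfold dmajorant. change (INR 1) with 1. rewrite ln_1, !Rmult_0_r, Ropp_0, exp_0. lra.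
  - cbn [dmajorant]. set (x := INR (S n)). assert (Hx : 1 <= x). { unfold x. rewrite S_INR. pose proof (pos_INR n). lra. }
    assert (HS : INR (S (S n)) = x + 1) by (unfold x; apply S_INR). rewrite HS.
    destruct (MVT_gen (fun x => exp (- ((a - 1) * ln x))) x (x + 1) (fun x => - (a - 1) * / x * exp (- ((a - 1) * ln x)))) as [c [Hc E]].
    + intros z Hz. rewrite Rmin_left in Hz by lra. auto_derive. lra. field. lra.
    + intros z Hz. rewrite Rmin_left in Hz by lra. apply continuity_pt_filterlim.
      apply (ex_derive_continuous (V := R_NormedModule) (fun x => exp (- ((a - 1) * ln x)))). auto_derive. lra.
    + rewrite Rmin_left, Rmax_right in Hc by lra.
      replace (/ (a - 1) * exp (- ((a - 1) * ln x)) - / (a - 1) * exp (- ((a - 1) * ln (x + 1))))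
        with (/ c * exp (- ((a - 1) * ln c))).
      2:{ replace (exp (- ((a - 1) * ln x))) with (exp (- ((a - 1) * ln (x + 1))) - (exp (- ((a - 1) * ln (x + 1))) - exp (- ((a - 1) * ln x)))) by ring.
          rewrite E. field. lra. }
      replace (- (a * ln (x + 1))) with (- ln (x + 1) + - ((a - 1) * ln (x + 1))) by ring.
      rewrite exp_plus, exp_Ropp with (x := ln (x + 1)), exp_ln by lra.
      assert (Hl : ln c <= ln (x + 1)). { destruct (Req_dec c (x + 1)) as [->|]. lra. left; apply ln_increasing; lra. }
      apply Rmult_le_compat. left; apply Rinv_0_lt_compat; lra. left; apply exp_pos.
      apply Rinv_le_contravar; lra. apply exp_le_exp. nra.
Qed.

Lemma dmajorant_cv (a : R) : 1 < a -> is_lim_seq (dmajorant a) 0.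
Proof.
  intros Ha. apply is_lim_seq_incr_1. 
  apply is_lim_seq_ext with (fun n => / (a - 1) * exp (- ((a - 1) * ln (INR (S n))))). reflexivity.
  replace (Finite 0) with (Rbar_mult (/ (a - 1)) 0) by (simpl; f_equal; ring).
  apply is_lim_seq_scal_l.
  apply (is_lim_comp_seq exp _ m_infty 0). apply is_lim_exp_m. exists O; discriminate.
  apply (is_lim_seq_opp _ p_infty).
  apply (is_lim_seq_incr_1 (fun n => (a - 1) * ln (INR n))).
  assert (Hl : is_lim_seq (fun n => ln (INR n)) p_infty).
  { apply (is_lim_comp_seq ln INR p_infty p_infty). apply is_lim_ln_p. exists O; discriminate. apply is_lim_seq_INR. }
  apply is_lim_seq_spec. apply is_lim_seq_spec in Hl. intros k. destruct (Hl (k / (a - 1))) as [N0 H0].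
  exists N0. intros n Hn. specialize (H0 n Hn). apply Rmult_lt_compat_l with (r := a - 1) in H0; [|lra].
  replace ((a - 1) * (k / (a - 1))) with k in H0 by (field; lra). auto.
Qed.

(** The Boolean mask serves the sieve in [zeta_neq_0]: the remainder bound is the same for every
    mask. *)
Lemma dirichlet_series_cv (s : C) (c : nat -> bool) : 1 < fst s ->
  is_Clim (Csum (fun n => if c n then dterm s n else 0%C)) (Clim (Csum (fun n => if c n then dterm s n else 0%C))) /\
  forall N, Cmod (Clim (Csum (fun n => if c n then dterm s n else 0%C)) - Csum (fun n => if c n then dterm s n else 0%C) N)
     <= dmajorant (fst s) N.
Proof.
  intros Hs. apply Csum_cv. 2: apply dmajorant_cv; auto.
  intros n. eapply Rle_trans; [|apply dmajorant_step; auto].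
  destruct (c n). rewrite Cmod_dterm. lra. rewrite Cmod_0. left; apply exp_pos.
Qed.

Lemma zeta_series (s : C) : 1 < fst s -> is_Clim (Csum (dterm s)) (zeta s).
Proof.
  intros Hs.
  assert (Hs1 : s <> 1%C). { intros Q. rewrite Q in Hs. simpl in Hs. lra. }
  assert (Hs2 : (s - 1)%C <> 0%C). { intros Q. apply Hs1. replace s with (s - 1 + 1)%C by ring. rewrite Q. ring. }
  assert (H := zeta_cv s ltac:(lra) Hs1).
  apply is_Clim_incr.
  assert (H2 : is_Clim (fun n => - (INR (S n) * Cexp (- (s * ln (INR (S n)))) / (s - 1)))%C 0%C).
  { apply is_Clim_squeeze with (fun n => / Cmod (s - 1) * ((fst s - 1) * dmajorant (fst s) (S n))).
    - intros n. replace (- (INR (S n) * Cexp (- (s * ln (INR (S n)))) / (s - 1)) - 0)%C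
        with (- (INR (S n) * dterm s n / (s - 1)))%C by (unfold dterm; ring).
      rewrite Cmod_opp, Cmod_div, Cmod_mult, Cmod_R, Cmod_dterm by auto. cbn [dmajorant].
      assert (0 < INR (S n)) by (apply lt_0_INR; lia). rewrite Rabs_pos_eq by lra.
      right. replace (- (fst s * ln (INR (S n)))) with (- ln (INR (S n)) + - ((fst s - 1) * ln (INR (S n)))) by ring.
      rewrite exp_plus, exp_Ropp with (x := ln (INR (S n))), exp_ln by auto.
      assert (0 < Cmod (s - 1)) by (apply Cmod_gt_0; auto). field. repeat split; lra.
    - replace (Finite 0) with (Rbar_mult (/ Cmod (s - 1)) (Rbar_mult (fst s - 1) 0)) by (simpl; f_equal; ring).
      apply is_lim_seq_scal_l. apply is_lim_seq_scal_l.
      apply (is_lim_seq_incr_1 (dmajorant (fst s))). apply dmajorant_cv; auto. }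
  assert (H3 := is_Clim_plus _ _ _ _ H H2).
  replace (zeta s + 0)%C with (zeta s) in H3 by ring.
  apply is_Clim_ext with (2 := H3). intros n. unfold dirichlet_sum. change (fun n0 => Cexp (- (s * ln (INR (S n0))))%C) with (dterm s). ring.
Qed.

Definition divb (d n : nat) : bool := Nat.eqb (n mod d) 0.

(** A sieve by all the integers [2, ..., m + 1] and not only by primes, which keeps factorisation
    out of the argument. *)
Fixpoint rough (m n : nat) : bool :=
  match m with
  | O => true
  | S k => rough k n && negb (divb (S m) n)
  end.

Lemma divb_spec (d n : nat) : d <> O -> (divb d n = true <-> Nat.divide d n).
Proof. intros Hd. unfold divb. rewrite Nat.eqb_eq. rewrite Nat.Lcm0.mod_divide. tauto. Qed.

Lemma divb_lcm (a b n : nat) : a <> O -> b <> O -> (divb a n && divb b n)%bool = divb (Nat.lcm a b) n.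
Proof.
  intros Ha Hb. assert (Hl : Nat.lcm a b <> O). { intros Q. apply Nat.lcm_eq_0 in Q. lia. }
  apply Bool.eq_true_iff_eq. rewrite Bool.andb_true_iff, !divb_spec by auto. split.
  - intros [H1 H2]. apply Nat.lcm_least; auto.
  - intros H. split; eapply Nat.divide_trans; eauto. apply Nat.divide_lcm_l. apply Nat.divide_lcm_r.
Qed.

Lemma dterm_mult (s : C) (d k : nat) : dterm s (S d * S k - 1) = (dterm s d * dterm s k)%C.
Proof.
  unfold dterm. rewrite <- Cexp_plus. f_equal.
  replace (S (S d * S k - 1)) with (S d * S k)%nat by lia.
  rewrite mult_INR, ln_mult, RtoC_plus by (apply lt_0_INR; lia). ring.
Qed.

(* If [zeta s = 0] then the terms divisible by [d] sum to [d^(-s) zeta s = 0] for every [d],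
   and inclusion-exclusion makes the sum over any sifted set vanish, although it tends to [1]. *)
Lemma zeta_neq_0 (s : C) : 1 < fst s -> zeta s <> 0%C.
Proof.
  intros Hs H0.
  assert (HZ := zeta_series s Hs). rewrite H0 in HZ.
  assert (Hmult : forall d, is_Clim (Csum (fun n => if divb (S d) (S n) then dterm s n else 0%C)) 0%C).
  { intros d. destruct (dirichlet_series_cv s (fun n => divb (S d) (S n)) Hs) as [HL _].
    set (a := fun n => if divb (S d) (S n) then dterm s n else 0%C) in *.
    assert (Hstep : forall N i, (i <= d)%nat -> Csum a (S d * N + i) = Csum a (S d * N)).
    { intros N. induction i; intros Hi. f_equal; lia.
      replace (S d * N + S i)%nat with (S (S d * N + i)) by lia. cbn [Csum]. rewrite IHi by lia.
      unfold a at 2. destruct (divb (S d) (S (S d * N + i))) eqn:E; [|ring].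
      exfalso. apply divb_spec in E; [|lia].
      apply Nat.divide_add_cancel_r with (m := (S d * N)%nat) (p := S i) in E || idtac.
      assert (Nat.divide (S d) (S i)).
      { replace (S (S d * N + i)) with (S d * N + S i)%nat in E by lia.
        apply Nat.divide_add_cancel_r with (S d * N)%nat; auto. exists N. lia. }
      apply Nat.divide_pos_le in H; lia. }
    assert (Hsub : forall N, Csum a (S d * N) = (dterm s d * Csum (dterm s) N)%C).
    { induction N. replace (S d * 0)%nat with O by lia. simpl. ring.
      replace (S d * S N)%nat with (S (S d * N + d)) by lia. cbn [Csum]. rewrite Hstep, IHN by lia.
      unfold a. replace (divb (S d) (S (S d * N + d))) with true.
      - replace (S d * N + d)%nat with (S d * S N - 1)%nat by lia. rewrite dterm_mult. ring.
      - symmetry. apply divb_spec. lia. exists (S N). lia. }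
    assert (HL2 : is_Clim (fun N => Csum a (S d * N)) (Clim (Csum a))).
    { destruct HL as [H1 H2]. split.
      - apply (is_lim_seq_subseq _ _ (fun N => (S d * N)%nat)) in H1; auto.
        apply eventually_subseq. intros n. lia.
      - apply (is_lim_seq_subseq _ _ (fun N => (S d * N)%nat)) in H2; auto.
        apply eventually_subseq. intros n. lia. }
    assert (HL3 : is_Clim (fun N => Csum a (S d * N)) 0%C).
    { apply is_Clim_ext with (fun N => dterm s d * Csum (dterm s) N)%C. intros; symmetry; apply Hsub.
      replace (RtoC 0) with (dterm s d * 0)%C by ring. apply (is_Clim_mult (fun _ => dterm s d)); auto. apply is_Clim_const. }
    rewrite (is_Clim_eq _ _ _ HL2 HL3) in HL. auto. }
  (* The divisor [d] is carried along so that removing the multiples of [m + 2] is an instance of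
     the induction hypothesis at an lcm. *)
  assert (Hrough : forall m d, d <> O -> is_Clim (Csum (fun n => if (divb d (S n) && rough m (S n))%bool then dterm s n else 0%C)) 0%C).
  { induction m; intros d Hd.
    - destruct d as [|d]; [lia|]. apply is_Clim_ext with (2 := Hmult d). intros N. apply Csum_ext. intros n _.
      simpl rough. rewrite Bool.andb_true_r. auto.
    - assert (A := IHm d Hd).
      assert (Hl : Nat.lcm d (S (S m)) <> O). { intros Q. apply Nat.lcm_eq_0 in Q. lia. }
      assert (B := IHm (Nat.lcm d (S (S m))) Hl).
      assert (AB := is_Clim_plus _ _ _ _ A (is_Clim_mult (fun _ => (- (1))%C) _ _ _ (is_Clim_const _) B)).
      replace (0 + - (1) * 0)%C with (RtoC 0) in AB by ring.
      apply is_Clim_ext with (2 := AB).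
      intros N. rewrite <- Csum_scal, <- Csum_plus. apply Csum_ext. intros n _.
      rewrite <- divb_lcm by lia. cbn [rough].
      destruct (divb d (S n)), (divb (S (S m)) (S n)), (rough m (S n)); simpl; ring. }
  (* Up to [m + 1] only the integer 1 survives the sieve: the partial sum is 1 while the full sum is
     0, so the remainder bound cannot tend to 0. *)
  assert (Hone : forall m, 1 <= dmajorant (fst s) (S m)).
  { intros m. destruct (dirichlet_series_cv s (fun n => (divb 1 (S n) && rough m (S n))%bool) Hs) as [HL HT].
    specialize (HT (S m)). rewrite (is_Clim_eq _ _ _ HL (Hrough m 1%nat ltac:(lia))) in HT.
    assert (HS : forall k, (k <= m)%nat -> Csum (fun n => if (divb 1 (S n) && rough m (S n))%bool then dterm s n else 0%C) (S k) = 1%C).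
    { induction k; intros Hk.
      - cbn [Csum]. replace (divb 1 1 && rough m 1)%bool with true.
        + unfold dterm. change (INR 1) with 1. rewrite ln_1. replace (- (s * 0))%C with (RtoC 0) by ring. rewrite Cexp_0. ring.
        + change (divb 1 1) with true. clear. induction m; auto. cbn [rough]. rewrite <- (Bool.andb_true_l (rough m 1)), <- IHm. 
          unfold divb. rewrite Nat.mod_small by lia. auto.
      - cbn [Csum] in IHk |- *. rewrite IHk by lia.
        replace (rough m (S (S k))) with false. rewrite Bool.andb_false_r. ring.
        symmetry. clear - Hk. induction m; [lia|]. cbn [rough].
        destruct (Nat.eq_dec (S k) (S m)) as [E|E].
        + injection E; intros; subst. unfold divb. rewrite Nat.Div0.mod_same. rewrite Bool.andb_false_r. auto.
        + rewrite IHm by lia. auto. }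
    rewrite HS in HT by lia. replace (0 - 1)%C with (RtoC (-1)) in HT by (apply C_ext; simpl; ring).
    rewrite Cmod_R in HT. rewrite Rabs_left in HT by lra. lra. }
  assert (Hl := dmajorant_cv (fst s) Hs). apply is_lim_seq_spec in Hl.
  destruct (Hl (mkposreal _ Rlt_0_1)) as [N HN]. specialize (HN (S N) ltac:(lia)). simpl pos in HN.
  specialize (Hone N). pose proof (Rle_abs (dmajorant (fst s) (S N) - 0)). lra.
Qed.

Lemma small_power (a : R) (n : nat) : 19 <= a ->
  exp (- (a * ln (INR (S (S n))))) <= / 100 * (/ INR (S n) - / INR (S (S n))).
Proof.
  intros Ha. set (x := INR (S (S n))).
  assert (Hx : 2 <= x). { unfold x. rewrite !S_INR. pose proof (pos_INR n). lra. }
  assert (Hx1 : INR (S n) = x - 1). { unfold x. rewrite (S_INR (S n)). ring. }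
  rewrite Hx1.
  assert (Hl : 0 <= ln x). { unfold x. apply ln_INR_nonneg. }
  (* The ninth power suffices: [x^9 >= 2^7 x^2 >= 100 x (x - 1)]. *)
  apply Rle_trans with (exp (- (INR 9 * ln x))).
  { apply exp_le_exp. simpl INR. nra. }
  rewrite exp_Ropp, <- exp_pow, exp_ln by lra.
  replace (/ (x - 1) - / x) with (/ (x * (x - 1))) by (field; lra).
  rewrite <- Rinv_mult. apply Rinv_le_contravar. nra.
  replace (x ^ 9) with (x ^ 7 * (x * x)) by ring.
  assert (2 ^ 7 <= x ^ 7) by (apply pow_incr; lra). simpl (2 ^ 7) in H.
  assert (x * (x - 1) <= x * x) by nra. assert (0 <= x * (x - 1)) by nra.
  apply Rmult_le_compat; lra.
Qed.

Lemma series_tail_small (a : nat -> C) (l : C) (K : R) : 0 <= K -> is_Clim (Csum a) l ->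
  (forall n, Cmod (a (S n)) <= K * (/ INR (S n) - / INR (S (S n)))) -> Cmod (l - a O) <= K.
Proof.
  intros HK Hl Ha.
  assert (H : forall n, Cmod (Csum a (S n) - a O) <= K * (1 - / INR (S n))).
  { induction n.
    - cbn [Csum]. replace (0 + a 0%nat - a 0%nat)%C with (RtoC 0) by ring. rewrite Cmod_0. change (INR 1) with 1.
      rewrite Rinv_1. lra.
    - change (Csum a (S (S n))) with (Csum a (S n) + a (S n))%C.
      replace (Csum a (S n) + a (S n) - a 0%nat)%C with ((Csum a (S n) - a 0%nat) + a (S n))%C by ring.
      eapply Rle_trans; [apply Cmod_triangle|]. specialize (Ha n). lra. }
  apply is_Clim_Cmod_le with (fun n => Csum a (S n) - a O)%C.
  - apply (is_Clim_plus (fun n => Csum a (S n)) (fun _ => (- a O)%C)); [|apply is_Clim_const].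
    apply is_Clim_incr in Hl; auto.
  - intros n. eapply Rle_trans; [apply H|]. assert (0 < / INR (S n)) by (apply Rinv_0_lt_compat, lt_0_INR; lia). nra.
Qed.

Lemma dterm_0 (s : C) : dterm s 0 = 1%C.
Proof. unfold dterm. change (INR 1) with 1. rewrite ln_1. replace (- (s * 0))%C with (RtoC 0) by ring. apply Cexp_0. Qed.

Lemma zeta_near_1 (s : C) : 20 <= fst s -> Cmod (zeta s - 1) <= / 100.
Proof.
  intros Hs. rewrite <- (dterm_0 s). apply series_tail_small. lra. apply zeta_series; lra.
  intros n. rewrite Cmod_dterm. apply small_power. lra.
Qed.

Lemma zeta_lower (s : C) : 20 <= fst s -> / 2 <= Cmod (zeta s).
Proof.
  intros Hs. pose proof (zeta_near_1 s Hs).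
  assert (Cmod 1 <= Cmod (zeta s) + Cmod (zeta s - 1)).
  { replace (RtoC 1) with (zeta s + - (zeta s - 1))%C at 1 by ring.
    eapply Rle_trans; [apply Cmod_triangle|]. rewrite Cmod_opp. lra. }
  rewrite Cmod_1 in H0. lra.
Qed.

(** To the right of 20 the terms with [n >= 2] are tiny, so the possible loss [d / 10] is small
    beside the gain [1 + d] of [real_mellin_growth]. *)
Lemma zeta_shift (s : C) (d : R) : 20 <= fst s -> 0 <= d ->
  Cmod (zeta s) <= (1 + d / 10) * Cmod (zeta (s + 2 * d)).
Proof.
  intros Hs Hd.
  assert (Hs2 : 20 <= fst (s + 2 * d)%C) by (simpl; lra).
  assert (Hdiff : Cmod (zeta s - zeta (s + 2 * d)) <= 2 * d * / 100).
  { assert (Hl : is_Clim (Csum (fun n => dterm s n - dterm (s + 2 * d) n)%C) (zeta s - zeta (s + 2 * d))%C).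
    { apply is_Clim_ext with (fun N => Csum (dterm s) N + (- (1)) * Csum (dterm (s + 2 * d)) N)%C.
      - intros N. rewrite <- Csum_scal, <- Csum_plus. apply Csum_ext. intros; ring.
      - replace (zeta s - zeta (s + 2 * d))%C with (zeta s + - (1) * zeta (s + 2 * d))%C by ring.
        apply is_Clim_plus. apply zeta_series; lra.
        apply (is_Clim_mult (fun _ => (- (1))%C)). apply is_Clim_const. apply zeta_series; lra. }
    assert (H := series_tail_small _ _ (2 * d * / 100) ltac:(nra) Hl). cbv beta in H.
    rewrite !dterm_0 in H. replace (zeta s - zeta (s + 2 * d) - (1 - 1))%C with (zeta s - zeta (s + 2 * d))%C in H by ring.
    apply H. intros n. set (L := ln (INR (S (S n)))).
    assert (HL : 0 <= L) by apply ln_INR_nonneg.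
    assert (E : dterm (s + 2 * d) (S n) = (dterm s (S n) * RtoC (exp (- (2 * d * L))))%C).
    { unfold dterm. fold L. rewrite <- Cexp_R, <- Cexp_plus. f_equal. rewrite RtoC_opp, !RtoC_mult. ring. }
    rewrite E. replace (dterm s (S n) - dterm s (S n) * exp (- (2 * d * L)))%C
      with (dterm s (S n) * RtoC (1 - exp (- (2 * d * L))))%C by (rewrite RtoC_minus; ring).
    rewrite Cmod_mult, Cmod_dterm, Cmod_R. fold L.
    assert (H1 := exp_ineq1_le (- (2 * d * L))).
    assert (H2 : exp (- (2 * d * L)) <= 1).
    { apply Rle_trans with (exp 0). apply exp_le_exp. assert (0 <= d * L) by (apply Rmult_le_pos; auto). lra. rewrite exp_0; lra. }
    rewrite Rabs_pos_eq by lra.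
    assert (H3 := small_power (fst s - 1) n ltac:(lra)). fold L in H3.
    assert (H4 : L <= exp L) by (pose proof (exp_ineq1_le L); lra).
    assert (H5 : exp (- (fst s * L)) * L <= exp (- ((fst s - 1) * L))).
    { replace (- ((fst s - 1) * L)) with (- (fst s * L) + L) by ring. rewrite exp_plus.
      apply Rmult_le_compat_l; auto. left; apply exp_pos. }
    pose proof (exp_pos (- (fst s * L))).
    apply Rle_trans with (exp (- (fst s * L)) * (2 * d * L)). apply Rmult_le_compat_l; lra.
    replace (exp (- (fst s * L)) * (2 * d * L)) with (2 * d * (exp (- (fst s * L)) * L)) by ring.
    rewrite (Rmult_assoc (2 * d)). apply Rmult_le_compat_l; lra. }
  assert (Hlow := zeta_lower _ Hs2).
  assert (Cmod (zeta s) <= Cmod (zeta (s + 2 * d)) + Cmod (zeta s - zeta (s + 2 * d))).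
  { replace (zeta s) with (zeta (s + 2 * d) + (zeta s - zeta (s + 2 * d)))%C at 1 by ring. apply Cmod_triangle. }
  nra.
Qed.

(** * The entire function Xi *)

Definition phi (w : R) : R := fst (Phi (w, 0)).

Lemma Phi_phi (w : R) : Phi (w, 0) = RtoC (phi w).
Proof. apply C_ext; simpl; auto. apply Phi_real. Qed.

Lemma phi_pos (w : R) : 0 < phi w.
Proof. apply Phi_real. Qed.

Lemma phi_even (w : R) : phi (- w) = phi w.
Proof.
  unfold phi. replace ((- w, 0) : C) with (Copp (w, 0)) by (apply C_ext; simpl; ring).
  rewrite Phi_even; auto. apply zero_lt_PI_4.
Qed.

Lemma phi_cont (w : R) : continuous phi w.
Proof. apply (Phi_cont 0 zero_lt_PI_4 w). Qed.

Lemma phi_moment_bound (k : nat) (A : R) :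
  exists K, forall w, phi w * (Rabs w ^ k * exp (A * Rabs w)) <= K / (1 + w ^ 2).
Proof.
  destruct (Phi_decay 0 (A + 1) zero_lt_PI_4) as [K [HK H]].
  destruct (majorant_exp k 1 Rlt_0_1) as [M HM].
  exists (K * M). intros w. specialize (H w). specialize (HM w).
  rewrite Phi_phi, Cmod_R, Rabs_pos_eq in H by (left; apply phi_pos).
  pose proof (Rabs_pos w) as Hw.
  assert (Hp : Rabs w ^ k <= (1 + Rabs w) ^ k) by (apply pow_incr; lra).
  assert (0 <= Rabs w ^ k) by (apply pow_le; auto).
  pose proof (exp_pos (A * Rabs w)).
  apply Rle_trans with (K * exp (- ((A + 1) * Rabs w)) * ((1 + Rabs w) ^ k * exp (A * Rabs w))).
  - apply Rmult_le_compat; auto. left; apply phi_pos. apply Rmult_le_pos; lra. apply Rmult_le_compat_r; lra.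
  - replace (K * exp (- ((A + 1) * Rabs w)) * ((1 + Rabs w) ^ k * exp (A * Rabs w)))
      with (K * ((1 + Rabs w) ^ k * exp (- (1 * Rabs w)))).
    + unfold Rdiv. rewrite Rmult_assoc. apply Rmult_le_compat_l. lra. auto.
    + replace (- (1 * Rabs w)) with (- ((A + 1) * Rabs w) + A * Rabs w) by ring. rewrite exp_plus. ring.
Qed.

Definition xi_integrand (k : nat) (z : C) (w : R) : C := (RtoC (phi w * w ^ k) * Cexp (z * w))%C.

(** The moment against [w^k] is the [k]-th complex derivative of [Xi 0]; each is bounded on vertical
    strips. *)
Definition Xi (k : nat) (z : C) : C := Cintegral (xi_integrand k z).

Lemma Cmod_xi_integrand (k : nat) (z : C) (A w : R) : Rabs (fst z) <= A ->
  Cmod (xi_integrand k z w) <= phi w * (Rabs w ^ k * exp (A * Rabs w)).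
Proof.
  intros HA. unfold xi_integrand. rewrite Cmod_mult, Cmod_R, Cmod_Cexp, Rabs_mult, <- RPow_abs.
  rewrite (Rabs_pos_eq (phi w)) by (left; apply phi_pos). rewrite Rmult_assoc.
  apply Rmult_le_compat_l. left; apply phi_pos. apply Rmult_le_compat_l. apply pow_le, Rabs_pos.
  apply exp_le_exp. replace (fst (z * w)%C) with (fst z * w) by (simpl; ring).
  eapply Rle_trans; [apply Rle_abs|]. rewrite Rabs_mult. apply Rmult_le_compat_r; auto. apply Rabs_pos.
Qed.

Lemma Ccont_RtoC (f : R -> R) : (forall x, continuous f x) -> Ccont (fun x => RtoC (f x)).
Proof. intros H x. split; simpl. apply H. apply continuous_const. Qed.

Lemma xi_integrand_tame (k : nat) (z : C) : Ctame (xi_integrand k z).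
Proof.
  destruct (phi_moment_bound k (Rabs (fst z))) as [K HK].
  apply Ctame_intro with K.
  - apply Ccont_mult. apply Ccont_RtoC. intros w. apply (continuous_mult (K := R_AbsRing) phi). apply phi_cont.
    apply (ex_derive_continuous (V := R_NormedModule)). auto_derive; auto.
    ccont.
  - intros w. eapply Rle_trans; [apply Cmod_xi_integrand; apply Rle_refl|apply HK].
Qed.

Lemma Xi_bound (k : nat) (A : R) : exists B, 0 < B /\ forall z, Rabs (fst z) <= A -> Cmod (Xi k z) <= B.
Proof.
  destruct (phi_moment_bound k A) as [K HK]. exists (4 * Rabs K + 1). split. { pose proof (Rabs_pos K). lra. }
  intros z Hz. unfold Xi. apply Rle_trans with (4 * K).
  - apply Cintegral_bound. apply Ctame_cont, xi_integrand_tame.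
    intros w. eapply Rle_trans; [apply Cmod_xi_integrand; eauto|apply HK].
  - pose proof (Rle_abs K). lra.
Qed.

Lemma Cintegral_is_derive (f f1 f2 : R -> R -> C) (x K : R) :
  (forall t w, Cder (fun t => f t w) t (f1 t w)) ->
  (forall t w, Cder (fun t => f1 t w) t (f2 t w)) ->
  (forall t, Ctame (f t)) -> Ctame (f1 x) ->
  (forall t w, Rabs (t - x) <= 1 -> Cmod (f2 t w) <= K / (1 + w ^ 2)) ->
  Cder (fun t => Cintegral (f t)) x (Cintegral (f1 x)).
Proof.
  intros H1 H2 Hf Hf1 HK. split; simpl.
  - apply (integral_is_derive (fun t w => fst (f t w)) (fun t w => fst (f1 t w)) (fun t w => fst (f2 t w)) x K).
    + intros; apply H1. + intros; apply H2. + intros; apply Hf. + apply Hf1.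
    + intros t Ht w. eapply Rle_trans; [apply fst_Cmod|]. apply HK; auto.
  - apply (integral_is_derive (fun t w => snd (f t w)) (fun t w => snd (f1 t w)) (fun t w => snd (f2 t w)) x K).
    + intros; apply H1. + intros; apply H2. + intros; apply Hf. + apply Hf1.
    + intros t Ht w. eapply Rle_trans; [apply snd_Cmod|]. apply HK; auto.
Qed.

Lemma xi_integrand_S (k : nat) (z : C) (w : R) : xi_integrand (S k) z w = (w * xi_integrand k z w)%C.
Proof. unfold xi_integrand. simpl pow. rewrite !RtoC_mult. ring. Qed.

Lemma Cder_xi_x (k : nat) (y w t : R) : Cder (fun t : R => xi_integrand k (t, y) w) t (xi_integrand (S k) (t, y) w).
Proof.
  rewrite xi_integrand_S. apply Cder_ext with (fun t : R => RtoC (phi w * w ^ k) * Cexp ((t + Ci * y) * w))%C.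
  { intros s. unfold xi_integrand. rewrite RtoC_line. auto. }
  unfold xi_integrand. rewrite RtoC_line. eapply Cder_eq. cder. ring.
Qed.

Lemma Cder_xi_y (k : nat) (x w t : R) : Cder (fun t : R => xi_integrand k (x, t) w) t (Ci * xi_integrand (S k) (x, t) w)%C.
Proof.
  rewrite xi_integrand_S. apply Cder_ext with (fun t : R => RtoC (phi w * w ^ k) * Cexp ((x + Ci * t) * w))%C.
  { intros s. unfold xi_integrand. rewrite RtoC_line. auto. }
  unfold xi_integrand. rewrite RtoC_line. eapply Cder_eq. cder. ring.
Qed.

Lemma Xi_der_x (k : nat) (x y : R) : Cder (fun x : R => Xi k (x, y)) x (Xi (S k) (x, y)).
Proof.
  destruct (phi_moment_bound (S (S k)) (Rabs x + 1)) as [K HK].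
  apply (Cintegral_is_derive (fun t w => xi_integrand k (t, y) w) (fun t w => xi_integrand (S k) (t, y) w)
     (fun t w => xi_integrand (S (S k)) (t, y) w) x K).
  - intros; apply Cder_xi_x. - intros; apply Cder_xi_x.
  - intros; apply xi_integrand_tame. - apply xi_integrand_tame.
  - intros t w Ht. eapply Rle_trans; [apply Cmod_xi_integrand|apply HK]. simpl.
    replace t with (x + (t - x)) by ring. eapply Rle_trans; [apply Rabs_triang|]. lra.
Qed.

Lemma Xi_der_y (k : nat) (x y : R) : Cder (fun y : R => Xi k (x, y)) y (Ci * Xi (S k) (x, y))%C.
Proof.
  destruct (phi_moment_bound (S (S k)) (Rabs x)) as [K HK].
  unfold Xi at 2. rewrite <- Cintegral_scal by apply xi_integrand_tame.
  apply (Cintegral_is_derive (fun t w => xi_integrand k (x, t) w) (fun t w => Ci * xi_integrand (S k) (x, t) w)%C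
     (fun t w => Ci * (Ci * xi_integrand (S (S k)) (x, t) w))%C y K).
  - intros; apply Cder_xi_y.
  - intros t w. eapply Cder_eq. apply (Cder_mult (fun _ => Ci)). apply Cder_const. apply Cder_xi_y. ring.
  - intros; apply xi_integrand_tame. - apply Ctame_scal, xi_integrand_tame.
  - intros t w Ht. rewrite !Cmod_mult, Cmod_Ci, !Rmult_1_l. eapply Rle_trans; [apply Cmod_xi_integrand|apply HK]. simpl. lra.
Qed.

Lemma MVT_lip (f f' : R -> R) (a b M : R) :
  (forall x, is_derive f x (f' x)) -> (forall x, Rmin a b <= x <= Rmax a b -> Rabs (f' x) <= M) ->
  Rabs (f b - f a) <= M * Rabs (b - a).
Proof.
  intros Hd HM. destruct (MVT_gen f a b f') as [c [Hc E]].
  - intros; auto.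
  - intros x _. apply continuity_pt_filterlim. apply (ex_derive_continuous (V := R_NormedModule) f). eexists; eauto.
  - rewrite E, Rabs_mult. apply Rmult_le_compat_r. apply Rabs_pos. auto.
Qed.

(** The next moment bounds both partial derivatives near the point, and a Lipschitz bound in each
    variable gives joint continuity. *)
Lemma Xi_C2cont (k : nat) : C2cont (fun x y => Xi k (x, y)).
Proof.
  assert (G : forall p : C -> R, (forall z, Rabs (p z) <= Cmod z) ->
      (forall g x l, Cder g x l -> is_derive (fun t => p (g t)) x (p l)) ->
      forall x y, continuity_2d_pt (fun x y => p (Xi k (x, y))) x y).
  { intros p Hp Hd x y eps. destruct (Xi_bound (S k) (Rabs x + 1)) as [B [HB HX]].
    pose proof (cond_pos eps) as He.
    assert (Hdel : 0 < Rmin 1 (eps / (2 * B))). { apply Rmin_pos. lra. apply Rdiv_lt_0_compat; lra. }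
    exists (mkposreal _ Hdel). simpl. intros u v Hu Hv.
    assert (Hu1 : Rabs (u - x) < 1) by (eapply Rlt_le_trans; [apply Hu|apply Rmin_l]).
    assert (Hu2 : Rabs (u - x) < eps / (2 * B)) by (eapply Rlt_le_trans; [apply Hu|apply Rmin_r]).
    assert (Hv2 : Rabs (v - y) < eps / (2 * B)) by (eapply Rlt_le_trans; [apply Hv|apply Rmin_r]).
    assert (L1 : Rabs (p (Xi k (u, v)) - p (Xi k (x, v))) <= B * Rabs (u - x)).
    { apply (MVT_lip (fun x => p (Xi k (x, v))) (fun x => p (Xi (S k) (x, v)))).
      - intros t. apply Hd. apply Xi_der_x.
      - intros t Ht. eapply Rle_trans; [apply Hp|]. apply HX. simpl.
        assert (Rabs (t - x) <= Rabs (u - x)).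
        { unfold Rmin, Rmax in Ht. destruct (Rle_dec x u); unfold Rabs; destruct (Rcase_abs (t - x)), (Rcase_abs (u - x)); lra. }
        replace t with (x + (t - x)) by ring. eapply Rle_trans; [apply Rabs_triang|]. lra. }
    assert (L2 : Rabs (p (Xi k (x, v)) - p (Xi k (x, y))) <= B * Rabs (v - y)).
    { apply (MVT_lip (fun y => p (Xi k (x, y))) (fun y => p (Ci * Xi (S k) (x, y))%C)).
      - intros t. apply Hd. apply Xi_der_y.
      - intros t Ht. eapply Rle_trans; [apply Hp|]. rewrite Cmod_mult, Cmod_Ci, Rmult_1_l. apply HX. simpl. lra. }
    replace (p (Xi k (u, v)) - p (Xi k (x, y))) with ((p (Xi k (u, v)) - p (Xi k (x, v))) + (p (Xi k (x, v)) - p (Xi k (x, y)))) by ring.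
    eapply Rle_lt_trans; [apply Rabs_triang|].
    assert (B * Rabs (u - x) < eps / 2).
    { apply Rmult_lt_compat_l with (r := B) in Hu2; auto. replace (B * (eps / (2 * B))) with (eps / 2) in Hu2 by (field; lra). auto. }
    assert (B * Rabs (v - y) < eps / 2).
    { apply Rmult_lt_compat_l with (r := B) in Hv2; auto. replace (B * (eps / (2 * B))) with (eps / 2) in Hv2 by (field; lra). auto. }
    lra. }
  intros x y. split.
  - apply (G fst). apply fst_Cmod. intros g t l H; apply H.
  - apply (G snd). apply snd_Cmod. intros g t l H; apply H.
Qed.

Lemma xi_Xi (s : C) : 0 < fst s -> s <> 1%C -> xi s = Xi 0 (s - / 2)%C.
Proof.
  intros H1 H2. rewrite (xi_transform s 0 H1 H2 zero_lt_PI_4). unfold Phi_transform, Xi, xi_integrand.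
  apply Cintegral_ext. intros w. rewrite Phi_phi. simpl pow. rewrite Rmult_1_r. reflexivity.
Qed.

Lemma Xi_conj (k : nat) (x y : R) : Xi k (x, - y) = Cconj (Xi k (x, y)).
Proof.
  assert (H := xi_integrand_tame k (x, y)).
  assert (E : forall w, xi_integrand k (x, - y) w = Cconj (xi_integrand k (x, y) w)).
  { intros w. unfold xi_integrand. rewrite Cmult_conj, Cconj_R, <- Cexp_conj, Cmult_conj, Cconj_R.
    do 3 f_equal. }
  unfold Xi. rewrite (Cintegral_ext _ _ E). apply C_ext. reflexivity.
  change (integral (fun w => snd (Cconj (xi_integrand k (x, y) w))) = - integral (fun w => snd (xi_integrand k (x, y) w))).
  rewrite (integral_ext (fun w => snd (Cconj (xi_integrand k (x, y) w))) (fun w => (-1) * snd (xi_integrand k (x, y) w))).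
  rewrite integral_scal. ring. apply H. intros w. unfold Cconj. simpl snd. ring.
Qed.

Lemma integral_reflect (f : R -> R) : tame f -> tame (fun x => f (- x)) -> integral (fun x => f (- x)) = integral f.
Proof.
  intros H1 H2. apply integral_unique. apply is_lim_seq_ext with (fun n => RInt f (- INR n) (INR n)).
  - intros n. assert (E := RInt_comp_lin (V := R_CompleteNormedModule) f (-1) 0 (INR n) (- INR n)).
    replace (-1 * INR n + 0) with (- INR n) in E by ring. replace (-1 * - INR n + 0) with (INR n) in E by ring.
    rewrite <- E by (apply cont_ex_RInt, H1).
    rewrite <- (opp_RInt_swap (V := R_CompleteNormedModule)).
    + rewrite (RInt_ext _ (fun x => opp (f (- x)))).
      * rewrite (RInt_opp (V := R_CompleteNormedModule)). 
        -- rewrite opp_opp. reflexivity.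
        -- apply cont_ex_RInt. apply H2.
      * intros x _. unfold scal, opp; simpl; unfold mult; simpl.
        replace (-1 * x + 0) with (- x) by ring. change (-1 * f (- x) = - f (- x)). ring.
    + apply cont_ex_RInt. intros x. apply continuous_ext with (fun x => (-1) * f (- x)).
      * intros t. unfold scal; simpl; unfold mult; simpl. replace (-1 * t + 0) with (- t) by ring. auto.
      * apply (continuous_scal_r (V := R_NormedModule)). apply H2.
  - apply integral_cv; auto.
Qed.

Lemma Xi_even (z : C) : Xi 0 (- z) = Xi 0 z.
Proof.
  assert (E : forall w : R, xi_integrand 0 (- z) w = xi_integrand 0 z (- w)).
  { intros w. unfold xi_integrand. simpl pow. rewrite phi_even. f_equal. f_equal.
    rewrite RtoC_opp. ring. }
  unfold Xi. rewrite (Cintegral_ext _ _ E).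
  assert (T1 := xi_integrand_tame 0 z). assert (T2 := xi_integrand_tame 0 (- z)).
  apply Ctame_ext with (1 := E) in T2. destruct T1, T2.
  apply C_ext; simpl.
  - apply (integral_reflect (fun w => fst (xi_integrand 0 z w))); auto.
  - apply (integral_reflect (fun w => snd (xi_integrand 0 z w))); auto.
Qed.

(** Evenness and conjugation combine into the reflection across the imaginary axis, which makes the
    Phragmén-Lindelöf quotient unimodular there. *)
Lemma Cmod_Xi_reflect (a y : R) : Cmod (Xi 0 (- a, y)) = Cmod (Xi 0 (a, y)).
Proof.
  replace ((- a, y) : C) with (Copp (a, - y)) by (apply C_ext; simpl; ring).
  rewrite Xi_even, Xi_conj, Cmod_conj. auto.
Qed.

Lemma Xi_real (x : R) : snd (Xi 0 (x, 0)) = 0 /\ 0 < fst (Xi 0 (x, 0)).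
Proof.
  assert (E : forall w : R, xi_integrand 0 (x, 0) w = RtoC (phi w * exp (x * w))).
  { intros w. unfold xi_integrand. simpl pow. rewrite Rmult_1_r. change ((x, 0) : C) with (RtoC x).
    rewrite <- RtoC_mult, Cexp_R, <- RtoC_mult. auto. }
  assert (T := xi_integrand_tame 0 (x, 0)). apply Ctame_ext with (1 := E) in T.
  unfold Xi. rewrite (Cintegral_ext _ _ E). split; simpl.
  - apply integral_0.
  - apply integral_gt_0. apply T. intros w. apply Rmult_lt_0_compat. apply phi_pos. apply exp_pos.
Qed.

Lemma xi_product (s : C) : 0 < fst s -> s <> 1%C -> xi s = (s * (s - 1) * zeta s * mellin s 1 0)%C.
Proof.
  intros H1 H2. assert (Hs1 : (s - 1)%C <> 0%C). { intros Q. apply H2. replace s with (s - 1 + 1)%C by ring. rewrite Q. ring. }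
  assert (Ex : xi s = (/ 2 * (s * (s - 1) * zeta s * gamma_factor s))%C).
  { rewrite <- Gamma_mellin by auto. unfold xi.
    replace (RtoC (1 / 2)) with (/ 2)%C by (unfold Rdiv; rewrite Rmult_1_l; rewrite RtoC_inv; auto; lra).
    destruct (Req_EM_T (fst s) 1) as [E1|E1]; [destruct (Req_EM_T (snd s) 0) as [E2|E2]|]; try ring.
    exfalso. apply H2. apply C_ext; simpl; auto. }
  rewrite Ex. unfold gamma_factor. field.
Qed.

(** The modulus split into factors that are estimated separately: two polynomial ones, [zeta], the
    phase of Gamma and its size on the real axis. *)
Lemma Xi_product (x y : R) : / 2 < x ->
  let s : C := (x + / 2, y) in
  Cmod (Xi 0 (x, y)) = Cmod s * Cmod (s - 1) * Cmod (zeta s) * (phase_ratio s * real_mellin (x + / 2)).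
Proof.
  intros Hx s.
  assert (Hs : 0 < fst s) by (simpl; lra).
  assert (Hs1 : s <> 1%C). { intros Q. assert (fst s = 1) by (rewrite Q; auto). simpl in H. lra. }
  replace ((x, y) : C) with (s - / 2)%C.
  - rewrite <- xi_Xi, xi_product, !Cmod_mult by auto. f_equal. unfold phase_ratio. simpl fst.
    pose proof (real_mellin_pos (x + / 2) ltac:(lra)). field. lra.
  - replace (/ 2)%C with (RtoC (/ 2)) by (apply RtoC_inv; lra). apply C_ext; simpl; ring.
Qed.

Lemma Xi_neq_0_right (x y : R) : / 2 < x -> Xi 0 (x, y) <> 0%C.
Proof.
  intros Hx. apply Cmod_gt_0. rewrite Xi_product by auto. set (s := (x + / 2, y) : C).
  assert (Hs : 1 < fst s) by (simpl; lra).
  assert (P1 : 0 < Cmod s). { apply Cmod_gt_0. intros Q. rewrite Q in Hs. simpl in Hs. lra. }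
  assert (P2 : 0 < Cmod (s - 1)). { apply Cmod_gt_0. intros Q. replace s with (s - 1 + 1)%C in Hs by ring. rewrite Q in Hs. simpl in Hs. lra. }
  assert (P3 : 0 < Cmod (zeta s)). { apply Cmod_gt_0. apply zeta_neq_0; auto. }
  assert (P4 : 0 < phase_ratio s).
  { eapply Rlt_le_trans; [|apply phase_ratio_exp_lower; lra].
    apply Rmult_lt_0_compat. lra. apply exp_pos. }
  pose proof (real_mellin_pos (x + / 2) ltac:(lra)).
  apply Rmult_lt_0_compat; [apply Rmult_lt_0_compat; [apply Rmult_lt_0_compat|]|]; try assumption.
  apply (Rmult_lt_0_compat (phase_ratio s)); assumption.
Qed.

Lemma Xi_lower_far (x : R) : 20 <= x -> exists c, 0 < c /\ forall y,
  c * exp (- (Rabs y * (y ^ 2 + 3))) <= Cmod (Xi 0 (x, y)).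
Proof.
  intros Hx. pose proof (real_mellin_pos (x + / 2) ltac:(lra)) as HG.
  exists (/ 2 * (/ 2 * real_mellin (x + / 2))). split. lra. intros y. rewrite Xi_product by lra.
  set (s := (x + / 2, y) : C).
  assert (P1 : 1 <= Cmod s). { eapply Rle_trans; [|apply (fst_Cmod s)]. simpl. rewrite Rabs_pos_eq; lra. }
  assert (P2 : 1 <= Cmod (s - 1)). { eapply Rle_trans; [|apply (fst_Cmod (s - 1)%C)]. simpl. rewrite Rabs_pos_eq; lra. }
  assert (P3 : / 2 <= Cmod (zeta s)) by (apply zeta_lower; simpl; lra).
  assert (P4 := phase_ratio_exp_lower (x + / 2) y ltac:(lra)). fold s in P4.
  pose proof (exp_pos (- (Rabs y * (y ^ 2 + 3)))).
  set (e := exp (- (Rabs y * (y ^ 2 + 3)))) in *.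
  replace (/ 2 * (/ 2 * real_mellin (x + / 2)) * e) with (1 * 1 * / 2 * ((/ 2 * e) * real_mellin (x + / 2))) by ring.
  assert (0 <= 1 * 1) by lra.
  apply Rmult_le_compat; try lra. nra.
  apply Rmult_le_compat; try lra. apply Rmult_le_compat; lra.
  apply Rmult_le_compat_r; lra.
Qed.

(** Gamma gains [1 + d] on the real axis, [zeta] loses at most [1 + d/10], the other factors do not
    decrease; [exp (d / 4)] fits in between because [d <= 1]. *)
Lemma Xi_growth_far (x d y : R) : 26 <= x -> 0 <= d <= 1 ->
  Cmod (Xi 0 (x, y)) * exp (d / 4) <= Cmod (Xi 0 (x + 2 * d, y)).
Proof.
  intros Hx Hd. rewrite !Xi_product by lra.
  set (s := (x + / 2, y) : C). set (s' := (x + 2 * d + / 2, y) : C).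
  assert (Hs : s' = (s + 2 * d)%C) by (apply C_ext; simpl; ring).
  assert (M1 : Cmod s <= Cmod s').
  { unfold Cmod, s, s'. simpl fst; simpl snd. apply sqrt_le_1_alt. nra. }
  assert (M2 : Cmod (s - 1) <= Cmod (s' - 1)).
  { unfold Cmod, s, s'. simpl. apply sqrt_le_1_alt. nra. }
  assert (M3 := zeta_shift s d ltac:(simpl; lra) ltac:(lra)). rewrite <- Hs in M3.
  assert (M4 := phase_ratio_mono (x + / 2) (x + 2 * d + / 2) y ltac:(lra) ltac:(lra)). fold s s' in M4.
  assert (M5 := real_mellin_growth (x + / 2) d ltac:(lra) ltac:(lra)).
  replace (x + / 2 + 2 * d) with (x + 2 * d + / 2) in M5 by ring.
  assert (Hexp : exp (d / 4) * (1 + d / 10) <= 1 + d).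
  { assert (exp (d / 4) <= 1 + d / 2).
    { assert (H := exp_ineq1_le (- (d / 4))). rewrite exp_Ropp in H.
      assert (He := exp_pos (d / 4)). apply Rmult_le_compat_r with (r := exp (d / 4)) in H; [|lra].
      rewrite Rinv_l in H by lra. nra. }
    nra. }
  pose proof (exp_pos (d / 4)) as He.
  pose proof (real_mellin_pos (x + / 2) ltac:(lra)) as HG.
  assert (P0 : 0 <= phase_ratio s) by (apply phase_ratio_nonneg; simpl; lra).
  pose proof (Cmod_ge_0 s). pose proof (Cmod_ge_0 (s - 1)). pose proof (Cmod_ge_0 (zeta s)). pose proof (Cmod_ge_0 (zeta s')).
  replace (Cmod s * Cmod (s - 1) * Cmod (zeta s) * (phase_ratio s * real_mellin (x + / 2)) * exp (d / 4))
    with (Cmod s * Cmod (s - 1) * (Cmod (zeta s) * (exp (d / 4) * (phase_ratio s * real_mellin (x + / 2))))) by ring.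
  rewrite (Rmult_assoc (Cmod s' * Cmod (s' - 1))).
  apply Rmult_le_compat.
  - apply Rmult_le_pos; auto.
  - apply Rmult_le_pos; auto. apply Rmult_le_pos. lra. apply Rmult_le_pos; lra.
  - apply Rmult_le_compat; auto.
  - apply Rle_trans with ((1 + d / 10) * Cmod (zeta s') * (exp (d / 4) * (phase_ratio s * real_mellin (x + / 2)))).
    { apply Rmult_le_compat_r; auto. apply Rmult_le_pos. lra. apply Rmult_le_pos; lra. }
    replace ((1 + d / 10) * Cmod (zeta s') * (exp (d / 4) * (phase_ratio s * real_mellin (x + / 2))))
      with (Cmod (zeta s') * ((exp (d / 4) * (1 + d / 10)) * (phase_ratio s * real_mellin (x + / 2)))) by ring.
    apply Rmult_le_compat_l; auto.
    apply Rle_trans with ((1 + d) * (phase_ratio s * real_mellin (x + / 2))).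
    { apply Rmult_le_compat_r; auto. apply Rmult_le_pos; lra. }
    replace ((1 + d) * (phase_ratio s * real_mellin (x + / 2))) with (phase_ratio s * ((1 + d) * real_mellin (x + / 2))) by ring.
    apply Rmult_le_compat; auto. apply Rmult_le_pos; lra.
Qed.

(** * Maximum principle and Harnack inequality *)

(* [f] is twice differentiable at [x], with derivatives [g] and [a] *)
Definition has_d2 (f : R -> R) (x g a : R) : Prop :=
  exists f1, locally x (fun t => is_derive f t (f1 t)) /\ f1 x = g /\ is_derive f1 x a.

Lemma has_d2_is_derive (f : R -> R) (x g a : R) : has_d2 f x g a -> is_derive f x g.
Proof. intros [f1 [H1 [H2 _]]]. apply locally_singleton in H1. rewrite <- H2. auto. Qed.

Lemma has_d2_global (f f1 f2 : R -> R) (x : R) :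
  (forall t, is_derive f t (f1 t)) -> (forall t, is_derive f1 t (f2 t)) -> has_d2 f x (f1 x) (f2 x).
Proof. intros H1 H2. exists f1. split; [|split]; auto. exists (mkposreal 1 Rlt_0_1). intros; auto. Qed.

Lemma has_d2_const (c x : R) : has_d2 (fun _ => c) x 0 0.
Proof. apply (has_d2_global (fun _ => c) (fun _ => 0) (fun _ => 0)); intros; auto_derive; auto. Qed.

Lemma has_d2_plus (f g : R -> R) (x f1 f2 g1 g2 : R) : has_d2 f x f1 f2 -> has_d2 g x g1 g2 ->
  has_d2 (fun t => f t + g t) x (f1 + g1) (f2 + g2).
Proof.
  intros [p [H1 [H2 H3]]] [q [G1 [G2 G3]]]. exists (fun t => p t + q t). split; [|split].
  - generalize (filter_and _ _ H1 G1). apply filter_imp. intros t [A B]. apply (is_derive_plus (V := R_NormedModule)); auto.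
  - lra.
  - apply (is_derive_plus (V := R_NormedModule)); auto.
Qed.

Lemma is_derive_mult_R (f g : R -> R) (x f1 g1 : R) : is_derive f x f1 -> is_derive g x g1 ->
  is_derive (fun t => f t * g t) x (f1 * g x + f x * g1).
Proof. intros H1 H2. apply (is_derive_mult f g); auto. intros; apply Rmult_comm. Qed.

Lemma has_d2_mult (f g : R -> R) (x f1 f2 g1 g2 : R) : has_d2 f x f1 f2 -> has_d2 g x g1 g2 ->
  has_d2 (fun t => f t * g t) x (f1 * g x + f x * g1) (f2 * g x + 2 * (f1 * g1) + f x * g2).
Proof.
  intros Hf Hg. pose proof (has_d2_is_derive _ _ _ _ Hf) as Df. pose proof (has_d2_is_derive _ _ _ _ Hg) as Dg.
  destruct Hf as [p [H1 [H2 H3]]], Hg as [q [G1 [G2 G3]]]. exists (fun t => p t * g t + f t * q t). split; [|split].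
  - generalize (filter_and _ _ H1 G1). apply filter_imp. intros t [A B]. apply is_derive_mult_R; auto.
  - subst; auto.
  - replace (f2 * g x + 2 * (f1 * g1) + f x * g2) with ((f2 * g x + p x * g1) + (f1 * q x + f x * g2)) by (subst; ring).
    apply (is_derive_plus (V := R_NormedModule)); apply is_derive_mult_R; auto.
Qed.

Lemma has_d2_comp (h h1 f : R -> R) (x f1 f2 h2 : R) : has_d2 f x f1 f2 ->
  locally (f x) (fun t => is_derive h t (h1 t)) -> is_derive h1 (f x) h2 ->
  has_d2 (fun t => h (f t)) x (h1 (f x) * f1) (h2 * f1 ^ 2 + h1 (f x) * f2).
Proof.
  intros Hf Hh Hh1. pose proof (has_d2_is_derive _ _ _ _ Hf) as Df. destruct Hf as [p [H1 [H2 H3]]].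
  exists (fun t => h1 (f t) * p t). split; [|split].
  - assert (Hc : locally x (fun t => is_derive h (f t) (h1 (f t)))).
    { assert (Hc : continuous f x) by (apply (ex_derive_continuous (V := R_NormedModule) f x); eexists; eauto).
      apply (Hc (fun z => is_derive h z (h1 z))). auto. }
    generalize (filter_and _ _ H1 Hc). apply filter_imp. intros t [A B].
    rewrite Rmult_comm. apply (is_derive_comp (V := R_NormedModule) h f); auto.
  - subst; auto.
  - replace (h2 * f1 ^ 2 + h1 (f x) * f2) with ((f1 * h2) * p x + h1 (f x) * f2) by (subst; ring).
    apply (is_derive_mult_R (fun t => h1 (f t)) p); auto. apply (is_derive_comp (V := R_NormedModule) h1 f); auto.
Qed.

Lemma has_d2_ext_loc (f g : R -> R) (x g1 g2 : R) : locally x (fun t => f t = g t) -> has_d2 f x g1 g2 -> has_d2 g x g1 g2.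
Proof.
  intros He [p [H1 [H2 H3]]]. exists p. split; [|split]; auto.
  apply locally_locally in He. generalize (filter_and _ _ H1 He). apply filter_imp. intros t [A B].
  apply is_derive_ext_loc with f; auto.
Qed.

(** If [a > 0], the derivative is 0 at [x] and positive just to the right, so [f] would exceed its
    maximum. *)
Lemma has_d2_local_max (f : R -> R) (x g a : R) : has_d2 f x g a -> locally x (fun t => f t <= f x) -> a <= 0.
Proof.
  intros H Hmax. pose proof (has_d2_is_derive _ _ _ _ H) as Df. destruct H as [p [H1 [H2 H3]]].
  destruct (Rle_lt_dec a 0) as [|Ha]; auto. exfalso.
  destruct (filter_and _ _ H1 Hmax) as [d Hd].
  assert (Hball : forall t, x - d < t < x + d -> is_derive f t (p t) /\ f t <= f x).
  { intros t Ht. apply Hd. unfold ball; simpl; unfold AbsRing_ball, abs, minus, plus, opp; simpl.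
    unfold Rabs; destruct (Rcase_abs (t + - x)); lra. }
  pose proof (cond_pos d) as Hd0.
  assert (Hg : p x = 0).
  { assert (L := Hball x ltac:(lra)).
    assert (Dp : derivable_pt_lim f x (p x)) by (apply is_derive_Reals; apply L).
    assert (pr : derivable_pt f x) by (exists (p x); auto).
    rewrite <- (derive_pt_eq_0 f x (p x) pr Dp).
    apply (deriv_maximum f (x - d) (x + d) x pr); try lra. intros t Ht1 Ht2. apply Hball; lra. }
  destruct (proj1 (is_derive_Reals _ _ _) H3 (a / 2) ltac:(lra)) as [e He].
  pose proof (cond_pos e) as He0.
  set (h := Rmin (d / 2) (e / 2)).
  assert (Hh : 0 < h) by (apply Rmin_pos; lra).
  assert (Hhd : h <= d / 2) by apply Rmin_l. assert (Hhe : h <= e / 2) by apply Rmin_r.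
  assert (Hpos : forall t, x < t <= x + h -> 0 < p t).
  { intros t Ht. specialize (He (t - x) ltac:(lra) ltac:(rewrite Rabs_pos_eq; lra)).
    replace (x + (t - x)) with t in He by ring. rewrite Hg in He. apply Rabs_def2 in He.
    assert (0 < (p t - 0) / (t - x)) by lra. replace (p t) with ((p t - 0) / (t - x) * (t - x)) by (field; lra).
    apply Rmult_lt_0_compat; lra. }
  assert (HM : forall s t, x <= s -> s < t -> t <= x + h -> exists c, s <= c <= t /\ f t - f s = p c * (t - s)).
  { intros s t Hs Hst Ht. destruct (MVT_gen f s t p) as [c [Hc E]].
    - intros r. rewrite Rmin_left, Rmax_right by lra. intros Hr. apply Hball; lra.
    - intros r. rewrite Rmin_left, Rmax_right by lra. intros Hr. apply continuity_pt_filterlim.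
      apply (ex_derive_continuous (V := R_NormedModule) f). eexists; apply Hball; lra.
    - rewrite Rmin_left, Rmax_right in Hc by lra. exists c; auto. }
  (* Two half-steps: the first mean value point may be [x] itself, the second lies strictly to its
     right. *)
  destruct (HM x (x + h / 2)) as [c1 [Hc1 E1]]; try lra.
  destruct (HM (x + h / 2) (x + h)) as [c2 [Hc2 E2]]; try lra.
  assert (0 <= p c1). { destruct (Req_dec c1 x) as [->|]; [lra|]. left; apply Hpos; lra. }
  assert (0 < p c2) by (apply Hpos; lra).
  assert (f (x + h) <= f x) by (apply Hball; lra).
  nra.
Qed.

(* [gx], [gy] is the gradient of [L] at [(x, y)] and [q] its Laplacian *)
Definition has_lap (L : R -> R -> R) (x y gx gy q : R) : Prop :=
  exists a b, has_d2 (fun s => L s y) x gx a /\ has_d2 (fun s => L x s) y gy b /\ a + b = q.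

Lemma has_lap_eq (L : R -> R -> R) (x y gx gy q gx' gy' q' : R) : has_lap L x y gx gy q ->
  gx = gx' -> gy = gy' -> q = q' -> has_lap L x y gx' gy' q'.
Proof. intros; subst; auto. Qed.

Lemma has_lap_plus (L M : R -> R -> R) (x y gx gy q hx hy r : R) : has_lap L x y gx gy q -> has_lap M x y hx hy r ->
  has_lap (fun x y => L x y + M x y) x y (gx + hx) (gy + hy) (q + r).
Proof.
  intros [a [b [H1 [H2 H3]]]] [a' [b' [G1 [G2 G3]]]]. exists (a + a'), (b + b'). split; [|split].
  - apply (has_d2_plus (fun s => L s y) (fun s => M s y)); auto.
  - apply (has_d2_plus (fun s => L x s) (fun s => M x s)); auto.
  - lra.
Qed.

Lemma has_lap_mult (L M : R -> R -> R) (x y gx gy q hx hy r : R) : has_lap L x y gx gy q -> has_lap M x y hx hy r ->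
  has_lap (fun x y => L x y * M x y) x y (gx * M x y + L x y * hx) (gy * M x y + L x y * hy)
    (q * M x y + L x y * r + 2 * (gx * hx + gy * hy)).
Proof.
  intros [a [b [H1 [H2 H3]]]] [a' [b' [G1 [G2 G3]]]].
  exists (a * M x y + 2 * (gx * hx) + L x y * a'), (b * M x y + 2 * (gy * hy) + L x y * b'). split; [|split].
  - apply (has_d2_mult (fun s => L s y) (fun s => M s y)); auto.
  - apply (has_d2_mult (fun s => L x s) (fun s => M x s)); auto.
  - subst; ring.
Qed.

Lemma has_lap_const (c x y : R) : has_lap (fun _ _ => c) x y 0 0 0.
Proof. exists 0, 0. split; [|split]; try apply has_d2_const. lra. Qed.

Lemma has_lap_scal (c : R) (L : R -> R -> R) (x y gx gy q : R) : has_lap L x y gx gy q ->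
  has_lap (fun x y => c * L x y) x y (c * gx) (c * gy) (c * q).
Proof. intros H. eapply has_lap_eq. apply (has_lap_mult (fun _ _ => c) L). apply has_lap_const. exact H. ring. ring. ring. Qed.

Lemma has_lap_comp (h h1 : R -> R) (h2 : R) (L : R -> R -> R) (x y gx gy q : R) : has_lap L x y gx gy q ->
  locally (L x y) (fun t => is_derive h t (h1 t)) -> is_derive h1 (L x y) h2 ->
  has_lap (fun x y => h (L x y)) x y (h1 (L x y) * gx) (h1 (L x y) * gy) (h1 (L x y) * q + h2 * (gx ^ 2 + gy ^ 2)).
Proof.
  intros [a [b [H1 [H2 H3]]]] Hh Hh1.
  exists (h2 * gx ^ 2 + h1 (L x y) * a), (h2 * gy ^ 2 + h1 (L x y) * b). split; [|split].
  - apply (has_d2_comp h h1 (fun s => L s y)); auto.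
  - apply (has_d2_comp h h1 (fun s => L x s)); auto.
  - subst; ring.
Qed.

Lemma has_lap_ln (L : R -> R -> R) (x y gx gy q : R) : has_lap L x y gx gy q -> 0 < L x y ->
  has_lap (fun x y => ln (L x y)) x y (gx / L x y) (gy / L x y) (q / L x y - (gx ^ 2 + gy ^ 2) / L x y ^ 2).
Proof.
  intros H Hp. eapply has_lap_eq. apply (has_lap_comp ln (fun t => / t) (- / L x y ^ 2)). exact H.
  - exists (mkposreal _ Hp). intros t Ht. unfold ball in Ht; simpl in Ht; unfold AbsRing_ball, abs, minus, plus, opp in Ht; simpl in Ht.
    apply Rabs_def2 in Ht. auto_derive. lra. field. lra.
  - auto_derive. lra. field. lra.
  - field; lra. - field; lra. - field; lra.
Qed.

Lemma has_lap_x (f f1 f2 : R -> R) (x y : R) : (forall t, is_derive f t (f1 t)) -> (forall t, is_derive f1 t (f2 t)) ->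
  has_lap (fun x _ => f x) x y (f1 x) 0 (f2 x).
Proof. intros H1 H2. exists (f2 x), 0. split; [|split]. apply has_d2_global; auto. apply has_d2_const. ring. Qed.

Lemma has_lap_y (f f1 f2 : R -> R) (x y : R) : (forall t, is_derive f t (f1 t)) -> (forall t, is_derive f1 t (f2 t)) ->
  has_lap (fun _ y => f y) x y 0 (f1 y) (f2 y).
Proof. intros H1 H2. exists 0, (f2 y). split; [|split]. apply has_d2_const. apply has_d2_global; auto. ring. Qed.

(** The Cauchy-Riemann equations with a named derivative; chains [holo F0 F1], [holo F1 F2] express
    higher differentiability. *)
Definition holo (F F1 : R -> R -> C) : Prop := forall x y,
  Cder (fun x => F x y) x (F1 x y) /\ Cder (fun y => F x y) y (Ci * F1 x y)%C.

Definition nsq (z : C) : R := fst z ^ 2 + snd z ^ 2.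

Lemma nsq_Cmod (z : C) : nsq z = Cmod z ^ 2.
Proof. unfold nsq, Cmod. rewrite pow2_sqrt; auto. nra. Qed.

Lemma nsq_pos (z : C) : z <> 0%C -> 0 < nsq z.
Proof. intros H. rewrite nsq_Cmod. apply Cmod_gt_0 in H. apply pow_lt; auto. Qed.

Section HoloLog.
Variables F F1 F2 : R -> R -> C.
Hypothesis HF : holo F F1.
Hypothesis HF1 : holo F1 F2.

Lemma has_lap_fst (x y : R) : has_lap (fun x y => fst (F x y)) x y (fst (F1 x y)) (- snd (F1 x y)) 0.
Proof.
  exists (fst (F2 x y)), (- fst (F2 x y)). split; [|split; [|ring]].
  - apply (has_d2_global (fun s => fst (F s y)) (fun s => fst (F1 s y)) (fun s => fst (F2 s y))); intros.
    apply HF. apply HF1.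
  - apply (has_d2_global (fun s => fst (F x s)) (fun s => - snd (F1 x s)) (fun s => - fst (F2 x s))); intros.
    + replace (- snd (F1 x t)) with (fst (Ci * F1 x t)%C) by (simpl; ring). apply HF.
    + apply (is_derive_opp (V := R_NormedModule)). replace (fst (F2 x t)) with (snd (Ci * F2 x t)%C) by (simpl; ring). apply HF1.
Qed.

Lemma has_lap_snd (x y : R) : has_lap (fun x y => snd (F x y)) x y (snd (F1 x y)) (fst (F1 x y)) 0.
Proof.
  exists (snd (F2 x y)), (- snd (F2 x y)). split; [|split; [|ring]].
  - apply (has_d2_global (fun s => snd (F s y)) (fun s => snd (F1 s y)) (fun s => snd (F2 s y))); intros.
    apply HF. apply HF1.
  - apply (has_d2_global (fun s => snd (F x s)) (fun s => fst (F1 x s)) (fun s => - snd (F2 x s))); intros.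
    + replace (fst (F1 x t)) with (snd (Ci * F1 x t)%C) by (simpl; ring). apply HF.
    + replace (- snd (F2 x t)) with (fst (Ci * F2 x t)%C) by (simpl; ring). apply HF1.
Qed.

(** Harmonicity of [ln |F|^2] off the zeros of [F]. The gradient is kept explicit: its horizontal
    component is what [harnack] and [Xi_log_increasing] use. *)
Lemma has_lap_ln_nsq (x y : R) : F x y <> 0%C ->
  has_lap (fun x y => ln (nsq (F x y))) x y
    (2 * (fst (F x y) * fst (F1 x y) + snd (F x y) * snd (F1 x y)) / nsq (F x y))
    (2 * (snd (F x y) * fst (F1 x y) - fst (F x y) * snd (F1 x y)) / nsq (F x y)) 0.
Proof.
  intros Hn. apply nsq_pos in Hn. pose proof (has_lap_fst x y) as Hp. pose proof (has_lap_snd x y) as Hq.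
  assert (H := has_lap_plus _ _ _ _ _ _ _ _ _ _ (has_lap_mult _ _ _ _ _ _ _ _ _ _ Hp Hp) (has_lap_mult _ _ _ _ _ _ _ _ _ _ Hq Hq)).
  assert (E : fst (F x y) * fst (F x y) + snd (F x y) * snd (F x y) = nsq (F x y)) by (unfold nsq; ring).
  eapply has_lap_eq.
  - eapply (has_lap_ln (fun x y => nsq (F x y))); [|exact Hn].
    destruct H as [a [b [A1 [A2 A3]]]]. exists a, b. split; [|split]; [| |exact A3].
    + eapply has_d2_ext_loc; [|exact A1]. apply filter_forall. intros t. unfold nsq; ring.
    + eapply has_d2_ext_loc; [|exact A2]. apply filter_forall. intros t. unfold nsq; ring.
  - field. lra.
  - field. lra.
  - unfold nsq in *. field. lra.
Qed.
End HoloLog.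

Definition rect (a b c d x y : R) : Prop := a <= x <= b /\ c <= y <= d.

Lemma continuity_2d_pt_y (f : R -> R -> R) (x y : R) : continuity_2d_pt f x y -> continuity_pt (f x) y.
Proof.
  intros H. apply continuity_pt_locally. intros eps. destruct (H eps) as [d Hd]. exists d.
  intros t Ht. apply Hd. rewrite Rminus_diag, Rabs_R0. apply cond_pos. exact Ht.
Qed.

(** Two maxima in one variable: a maximal [y] is chosen for each [x], and uniform continuity makes
    the resulting maximum continuous in [x]. *)
Lemma rect_max (f : R -> R -> R) (a b c d : R) : a <= b -> c <= d ->
  (forall x y, rect a b c d x y -> continuity_2d_pt f x y) ->
  exists x0 y0, rect a b c d x0 y0 /\ forall x y, rect a b c d x y -> f x y <= f x0 y0.
Proof.
  intros Hab Hcd Hf.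
  (* Clamping to [[a, b]] makes the choice of a maximal [y] possible at every real [x]. *)
  set (cl := fun x => Rmax a (Rmin b x)).
  assert (Hcl : forall x, a <= cl x <= b).
  { intros x. unfold cl, Rmax, Rmin. destruct (Rle_dec b x); destruct (Rle_dec a _); lra. }
  assert (Hcl1 : forall x, a <= x <= b -> cl x = x).
  { intros x Hx. unfold cl. rewrite Rmin_right, Rmax_right; lra. }
  assert (HY : forall x, exists y, (forall z, c <= z <= d -> f (cl x) z <= f (cl x) y) /\ c <= y <= d).
  { intros x. apply continuity_ab_maj; auto. intros z Hz. apply continuity_2d_pt_y, Hf. split; auto. }
  set (Y := fun x => epsilon (inhabits 0) (fun y => (forall z, c <= z <= d -> f (cl x) z <= f (cl x) y) /\ c <= y <= d)).
  assert (HYs : forall x, (forall z, c <= z <= d -> f (cl x) z <= f (cl x) (Y x)) /\ c <= Y x <= d).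
  { intros x. apply (epsilon_spec (inhabits 0) _ (HY x)). }
  set (m := fun x => f (cl x) (Y x)).
  assert (Hm : forall x, a <= x <= b -> continuity_pt m x).
  { intros x Hx. apply continuity_pt_locally. intros eps.
    destruct (uniform_continuity_2d f a b c d) with (eps := eps) as [del Hdel].
    { intros s t Hs Ht. apply Hf. split; auto. }
    exists del. intros t Ht.
    assert (Hct : Rabs (cl t - cl x) < del).
    { change (Rabs (t - x) < del) in Ht. apply Rabs_def2 in Ht. rewrite (Hcl1 x) by auto.
      apply Rabs_def1; unfold cl, Rmax, Rmin; destruct (Rle_dec b t); destruct (Rle_dec a _); lra. }
    destruct (HYs t) as [Mt Rt], (HYs x) as [Mx Rx].
    assert (G1 : Rabs (f (cl t) (Y x) - f (cl x) (Y x)) < eps).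
    { apply Hdel; auto. rewrite Rminus_diag, Rabs_R0. apply cond_pos. }
    assert (G2 : Rabs (f (cl t) (Y t) - f (cl x) (Y t)) < eps).
    { apply Hdel; auto. rewrite Rminus_diag, Rabs_R0. apply cond_pos. }
    specialize (Mt (Y x) Rx). specialize (Mx (Y t) Rt). unfold m.
    apply Rabs_def2 in G1. apply Rabs_def2 in G2. apply Rabs_def1; lra. }
  destruct (continuity_ab_maj m a b Hab Hm) as [x0 [M0 R0]].
  exists x0, (Y x0). destruct (HYs x0) as [M1 R1]. split. { split; auto. }
  intros x y [Hx Hy]. destruct (HYs x) as [M2 R2]. specialize (M0 x Hx). unfold m in M0.
  specialize (M2 y Hy). rewrite (Hcl1 x), (Hcl1 x0) in * by auto. lra.
Qed.

(** [W] may vanish, so a logarithm [L] is demanded only at interior points where [W] exceeds [B];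
    there a positive Laplacian of [L] is incompatible with a maximum. *)
Lemma rect_max_principle (W : R -> R -> R) (a b c d B : R) : a <= b -> c <= d ->
  (forall x y, rect a b c d x y -> continuity_2d_pt W x y) ->
  (forall x y, rect a b c d x y -> (x = a \/ x = b \/ y = c \/ y = d) -> W x y <= B) ->
  (forall x y, a < x < b -> c < y < d -> B < W x y -> exists L gx gy q,
     has_lap L x y gx gy q /\ 0 < q /\ locally x (fun t => W t y = exp (L t y)) /\ locally y (fun t => W x t = exp (L x t))) ->
  forall x y, rect a b c d x y -> W x y <= B.
Proof.
  intros Hab Hcd Hc Hb Hi. destruct (rect_max W a b c d Hab Hcd Hc) as [x0 [y0 [H0 Hmax]]].
  intros x y Hxy. eapply Rle_trans; [apply Hmax; auto|].
  destruct (Rle_lt_dec (W x0 y0) B) as [|HB]; auto. exfalso.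
  assert (Hx : a < x0 < b). { destruct H0 as [[] []]. split; apply Rnot_le_lt; intros Q; assert (W x0 y0 <= B); try lra; apply Hb; try (split; lra).
    left; lra. right; left; lra. }
  assert (Hy : c < y0 < d). { destruct H0 as [[] []]. split; apply Rnot_le_lt; intros Q; assert (W x0 y0 <= B); try lra; apply Hb; try (split; lra).
    right; right; left; lra. right; right; right; lra. }
  destruct (Hi x0 y0 Hx Hy HB) as [L [gx [gy [q [[p [r [D1 [D2 E]]]] [Hq [L1 L2]]]]]]].
  assert (p <= 0).
  { apply (has_d2_local_max _ _ _ _ D1).
    assert (N : locally x0 (fun t => a < t < b)).
    { apply filter_and. apply (open_gt a x0); lra. apply (open_lt b x0); lra. }
    assert (E0 := locally_singleton _ _ L1). simpl in E0.
    generalize (filter_and _ _ N L1). apply filter_imp. intros t [T1 T2].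
    assert (W t y0 <= W x0 y0) by (apply Hmax; split; lra).
    rewrite T2, E0 in H. destruct (Rle_lt_dec (L t y0) (L x0 y0)) as [|Q]; auto. apply exp_increasing in Q. lra. }
  assert (r <= 0).
  { apply (has_d2_local_max _ _ _ _ D2).
    assert (N : locally y0 (fun t => c < t < d)).
    { apply filter_and. apply (open_gt c y0); lra. apply (open_lt d y0); lra. }
    assert (E0 := locally_singleton _ _ L2). simpl in E0.
    generalize (filter_and _ _ N L2). apply filter_imp. intros t [T1 T2].
    assert (W x0 t <= W x0 y0) by (apply Hmax; split; lra).
    rewrite T2, E0 in H1. destruct (Rle_lt_dec (L x0 t) (L x0 y0)) as [|Q]; auto. apply exp_increasing in Q. lra. }
  lra.
Qed.

Lemma continuity_2d_pt_x (f : R -> R -> R) (x y : R) : continuity_2d_pt f x y -> continuity_pt (fun x => f x y) x.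
Proof.
  intros H. apply continuity_pt_locally. intros eps. destruct (H eps) as [d Hd]. exists d.
  intros t Ht. apply Hd. exact Ht. rewrite Rminus_diag, Rabs_R0. apply cond_pos.
Qed.

Lemma nsq_cont (F : R -> R -> C) (x y : R) : C2cont F -> continuity_2d_pt (fun x y => nsq (F x y)) x y.
Proof.
  intros H. destruct (H x y) as [H1 H2]. unfold nsq.
  apply continuity_2d_pt_ext with (fun x y => fst (F x y) * fst (F x y) + snd (F x y) * snd (F x y)).
  intros; ring. apply continuity_2d_pt_plus; apply continuity_2d_pt_mult; auto.
Qed.

Lemma locally_pos (f : R -> R) (x : R) : continuity_pt f x -> 0 < f x -> locally x (fun t => 0 < f t).
Proof.
  intros H Hp. destruct (proj1 (continuity_pt_locally f x) H (mkposreal _ Hp)) as [d Hd]. exists d.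
  intros t Ht. specialize (Hd t Ht). simpl in Hd. apply Rabs_def2 in Hd. lra.
Qed.

Lemma quotient_exp (A B C D E : R -> R) (x : R) :
  continuity_pt A x -> continuity_pt B x -> continuity_pt C x -> continuity_pt D x -> continuity_pt E x ->
  0 < A x -> 0 < B x -> 0 < C x -> 0 < D x -> 0 < E x ->
  locally x (fun t => A t * (B t * C t) ^ 2 * (/ D t * (/ E t) ^ 2)
    = exp (ln (A t) + (2 * ln (B t) + (2 * ln (C t) + (-1 * ln (D t) + -2 * ln (E t)))))).
Proof.
  intros HA HB HC HD HE PA PB PC PD PE.
  generalize (filter_and _ _ (locally_pos A x HA PA) (filter_and _ _ (locally_pos B x HB PB)
    (filter_and _ _ (locally_pos C x HC PC) (filter_and _ _ (locally_pos D x HD PD) (locally_pos E x HE PE))))).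
  apply filter_imp. intros t [H1 [H2 [H3 [H4 H5]]]].
  rewrite !exp_plus, exp_ln by auto.
  replace (2 * ln (B t)) with (ln (B t) + ln (B t)) by ring. replace (2 * ln (C t)) with (ln (C t) + ln (C t)) by ring.
  replace (-1 * ln (D t)) with (- ln (D t)) by ring. replace (-2 * ln (E t)) with (- ln (E t) + - ln (E t)) by ring.
  rewrite !exp_plus, !exp_Ropp, !exp_ln by auto. field. lra.
Qed.

(** Each quotient is minus one half of the second derivative of [ln (R^2 - X^2)]: the sum measures
    what the cut-off of the square costs in the Laplacian. *)
Lemma one_div_sq_bound (R X Y : R) : Rabs X < R -> Rabs Y < R ->
  ((R ^ 2 + X ^ 2) / (R ^ 2 - X ^ 2) ^ 2 + (R ^ 2 + Y ^ 2) / (R ^ 2 - Y ^ 2) ^ 2) * ((R ^ 2 - X ^ 2) * (R ^ 2 - Y ^ 2)) ^ 2 <= 4 * R ^ 6.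
Proof.
  intros HX HY. apply Rabs_def2 in HX. apply Rabs_def2 in HY.
  set (p := R ^ 2 - X ^ 2). set (q := R ^ 2 - Y ^ 2). assert (0 < p) by (unfold p; nra). assert (0 < q) by (unfold q; nra).
  assert (p <= R ^ 2) by (unfold p; nra). assert (q <= R ^ 2) by (unfold q; nra).
  replace (((R ^ 2 + X ^ 2) / p ^ 2 + (R ^ 2 + Y ^ 2) / q ^ 2) * (p * q) ^ 2) with ((R ^ 2 + X ^ 2) * q ^ 2 + (R ^ 2 + Y ^ 2) * p ^ 2) by (field; lra).
  assert (q ^ 2 <= R ^ 4) by (replace (R ^ 4) with (R ^ 2 * R ^ 2) by ring; nra).
  assert (p ^ 2 <= R ^ 4) by (replace (R ^ 4) with (R ^ 2 * R ^ 2) by ring; nra).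
  assert (R ^ 2 + X ^ 2 <= 2 * R ^ 2) by nra. assert (R ^ 2 + Y ^ 2 <= 2 * R ^ 2) by nra.
  assert ((R ^ 2 + X ^ 2) * q ^ 2 <= (2 * R ^ 2) * R ^ 4) by (apply Rmult_le_compat; nra).
  assert ((R ^ 2 + Y ^ 2) * p ^ 2 <= (2 * R ^ 2) * R ^ 4) by (apply Rmult_le_compat; nra).
  replace (4 * R ^ 6) with ((2 * R ^ 2) * R ^ 4 + (2 * R ^ 2) * R ^ 4) by ring. lra.
Qed.

Section Harnack.
Variables F0 F1 F2 F3 : R -> R -> C.
Hypothesis H01 : holo F0 F1.
Hypothesis H12 : holo F1 F2.
Hypothesis H23 : holo F2 F3.
Hypothesis C0 : C2cont F0.
Hypothesis C1 : C2cont F1.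
Variables x0 y0 r M : R.
Hypothesis Hr : 0 < r.
Hypothesis Hnz : forall x y, rect (x0 - r) (x0 + r) (y0 - r) (y0 + r) x y -> F0 x y <> 0%C.
Hypothesis HM : forall x y, rect (x0 - r) (x0 + r) (y0 - r) (y0 + r) x y -> ln (nsq (F0 x y)) <= 2 * (M - 1).

(** [M - ln |F0|], harmonic where [F0] has no zero and at least 1 on the square by [HM]. *)
Let P (x y : R) : R := M + (-1 / 2) * ln (nsq (F0 x y)).

Let P_ge (x y : R) : rect (x0 - r) (x0 + r) (y0 - r) (y0 + r) x y -> 1 <= P x y.
Proof. intros H. specialize (HM x y H). unfold P. lra. Qed.

Let P_lap (x y : R) : F0 x y <> 0%C -> 0 < P x y -> exists gx gy,
  has_lap (fun x y => ln (P x y)) x y (gx / P x y) (gy / P x y) (- (nsq (F1 x y) / (nsq (F0 x y) * P x y ^ 2))) /\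
  gx = - ((fst (F0 x y) * fst (F1 x y) + snd (F0 x y) * snd (F1 x y)) / nsq (F0 x y)).
Proof.
  intros Hn Hp. assert (Hq := nsq_pos _ Hn).
  assert (H := has_lap_plus _ _ _ _ _ _ _ _ _ _ (has_lap_const M x y) (has_lap_scal (-1 / 2) _ _ _ _ _ _ (has_lap_ln_nsq F0 F1 F2 H01 H12 x y Hn))).
  eexists. eexists. split.
  - eapply has_lap_eq. apply (has_lap_ln P). exact H. exact Hp. reflexivity. reflexivity.
    set (p := P x y) in *. unfold nsq in *. field. split; lra.
  - field. lra.
Qed.

Let W (x y : R) : R := nsq (F1 x y) * ((r ^ 2 - (x - x0) ^ 2) * (r ^ 2 - (y - y0) ^ 2)) ^ 2 * (/ nsq (F0 x y) * (/ P x y) ^ 2).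

Let c_x (x y : R) : continuity_2d_pt (fun x _ => r ^ 2 - (x - x0) ^ 2) x y.
Proof.
  apply continuity_2d_pt_ext with (fun x _ => r ^ 2 - (x - x0) * (x - x0)). intros; ring.
  apply continuity_2d_pt_minus. apply continuity_2d_pt_const. apply continuity_2d_pt_mult; (apply continuity_2d_pt_minus; [apply continuity_2d_pt_id1|apply continuity_2d_pt_const]).
Qed.

Let c_y (x y : R) : continuity_2d_pt (fun _ y => r ^ 2 - (y - y0) ^ 2) x y.
Proof.
  apply continuity_2d_pt_ext with (fun _ y => r ^ 2 - (y - y0) * (y - y0)). intros; ring.
  apply continuity_2d_pt_minus. apply continuity_2d_pt_const. apply continuity_2d_pt_mult; (apply continuity_2d_pt_minus; [apply continuity_2d_pt_id2|apply continuity_2d_pt_const]).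
Qed.

Let c_P (x y : R) : F0 x y <> 0%C -> continuity_2d_pt P x y.
Proof.
  intros H. apply nsq_pos in H. unfold P. apply continuity_2d_pt_plus. apply continuity_2d_pt_const.
  apply continuity_2d_pt_mult. apply continuity_2d_pt_const. apply (continuity_1d_2d_pt_comp ln (fun x y => nsq (F0 x y))).
  - apply continuity_pt_filterlim. apply (ex_derive_continuous (V := R_NormedModule) ln). auto_derive; auto.
  - apply nsq_cont; auto.
Qed.

Let W_cont (x y : R) : rect (x0 - r) (x0 + r) (y0 - r) (y0 + r) x y -> continuity_2d_pt W x y.
Proof.
  intros H. assert (Hn := nsq_pos _ (Hnz x y H)). assert (Hp := P_ge x y H). assert (HcP := c_P x y (Hnz x y H)).
  unfold W. assert (A : continuity_2d_pt (fun x y => / P x y) x y). { apply (continuity_2d_pt_inv P); auto. lra. }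
  assert (B := continuity_2d_pt_mult _ _ _ _ (c_x x y) (c_y x y)).
  apply continuity_2d_pt_mult; [apply continuity_2d_pt_mult|apply continuity_2d_pt_mult].
  - apply nsq_cont; auto.
  - apply continuity_2d_pt_ext with (2 := continuity_2d_pt_mult _ _ _ _ B B). intros; ring.
  - apply (continuity_2d_pt_inv (fun x y => nsq (F0 x y))). apply nsq_cont; auto. lra.
  - apply continuity_2d_pt_ext with (2 := continuity_2d_pt_mult _ _ _ _ A A). intros; ring.
Qed.

(* Ahlfors' device: [W = |F1|^2 rho^2 / (|F0| P)^2] vanishes on the boundary of the square, and
   [Delta ln W = 2 W / rho^2 - 4 (...)] forces [W <= 8 r^6] at an interior maximum. *)
Lemma log_derivative_square (x y : R) : rect (x0 - r) (x0 + r) (y0 - r) (y0 + r) x y -> W x y <= 8 * r ^ 6.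
Proof.
  revert x y. apply rect_max_principle; try lra.
  - apply W_cont.
  - intros x' y' _ H. assert (r ^ 6 = (r ^ 3) ^ 2) by ring. assert (Hz : W x' y' = 0).
    { unfold W. destruct H as [->|[->|[->| ->]]]; ring. } rewrite Hz. nra.
  - intros x' y' Hx Hy HB.
    assert (HR : rect (x0 - r) (x0 + r) (y0 - r) (y0 + r) x' y') by (split; lra).
    assert (N0 := nsq_pos _ (Hnz x' y' HR)). assert (Hp := P_ge x' y' HR).
    assert (PX : 0 < r ^ 2 - (x' - x0) ^ 2) by nra. assert (PY : 0 < r ^ 2 - (y' - y0) ^ 2) by nra.
    assert (F1n : F1 x' y' <> 0%C).
    { intros Q. assert (W x' y' = 0). { unfold W, nsq. rewrite Q. simpl. ring. }
      assert (r ^ 6 = (r ^ 3) ^ 2) by ring. nra. }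
    assert (N1 := nsq_pos _ F1n).
    destruct (P_lap x' y' (Hnz x' y' HR) ltac:(lra)) as [gx [gy [HP _]]].
    assert (LX := has_lap_x (fun x => r ^ 2 - (x - x0) ^ 2) (fun x => - 2 * (x - x0)) (fun _ => -2) x' y'
      ltac:(intros; auto_derive; auto; ring) ltac:(intros; auto_derive; auto; ring)).
    assert (LY := has_lap_y (fun y => r ^ 2 - (y - y0) ^ 2) (fun y => - 2 * (y - y0)) (fun _ => -2) x' y'
      ltac:(intros; auto_derive; auto; ring) ltac:(intros; auto_derive; auto; ring)).
    apply has_lap_ln in LX; auto. apply has_lap_ln in LY; auto.
    apply (has_lap_scal 2) in LX. apply (has_lap_scal 2) in LY. apply (has_lap_scal (-2)) in HP.
    assert (L0 := has_lap_scal (-1) _ _ _ _ _ _ (has_lap_ln_nsq F0 F1 F2 H01 H12 x' y' (Hnz x' y' HR))).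
    assert (L1 := has_lap_ln_nsq F1 F2 F3 H12 H23 x' y' F1n).
    assert (L := has_lap_plus _ _ _ _ _ _ _ _ _ _ L1 (has_lap_plus _ _ _ _ _ _ _ _ _ _ LX (has_lap_plus _ _ _ _ _ _ _ _ _ _ LY (has_lap_plus _ _ _ _ _ _ _ _ _ _ L0 HP)))).
    eexists. eexists. eexists. eexists. split; [exact L|split; [|split]].
    + assert (K := one_div_sq_bound r (x' - x0) (y' - y0) ltac:(apply Rabs_def1; lra) ltac:(apply Rabs_def1; lra)).
      set (A := r ^ 2 - (x' - x0) ^ 2) in *. set (B := r ^ 2 - (y' - y0) ^ 2) in *.
      set (w := nsq (F1 x' y') / (nsq (F0 x' y') * P x' y' ^ 2)).
      assert (EW : W x' y' = w * (A * B) ^ 2). { unfold W, w. fold A B. field. split; lra. }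
      rewrite EW in HB. assert (0 < (A * B) ^ 2) by (apply pow_lt, Rmult_lt_0_compat; auto).
      set (S := (r ^ 2 + (x' - x0) ^ 2) / A ^ 2 + (r ^ 2 + (y' - y0) ^ 2) / B ^ 2) in *.
      assert (2 * S < w). { apply Rmult_lt_reg_r with ((A * B) ^ 2); auto. lra. }
      match goal with |- 0 < ?e => replace e with (2 * (w - 2 * S)) end. lra.
      unfold S. fold w.
      assert (EA : r ^ 2 = A + (x' - x0) ^ 2) by (unfold A; ring). assert (EB : r ^ 2 = B + (y' - y0) ^ 2) by (unfold B; ring).
      rewrite EA at 1. rewrite EB. field. lra.
    + apply quotient_exp; auto; try lra.
      * apply (continuity_2d_pt_x (fun x y => nsq (F1 x y))). apply nsq_cont; auto.
      * apply (continuity_2d_pt_x (fun x _ => r ^ 2 - (x - x0) ^ 2) x' y'). apply (c_x x' y').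
      * apply (continuity_2d_pt_x (fun _ y => r ^ 2 - (y - y0) ^ 2) x' y'). apply (c_y x' y').
      * apply (continuity_2d_pt_x (fun x y => nsq (F0 x y))). apply nsq_cont; auto.
      * apply (continuity_2d_pt_x P). apply c_P. auto.
    + apply (quotient_exp (fun y => nsq (F1 x' y)) (fun _ => r ^ 2 - (x' - x0) ^ 2) (fun y => r ^ 2 - (y - y0) ^ 2) (fun y => nsq (F0 x' y)) (P x')); auto; try lra.
      * apply (continuity_2d_pt_y (fun x y => nsq (F1 x y))). apply nsq_cont; auto.
      * apply (continuity_2d_pt_y (fun x _ => r ^ 2 - (x - x0) ^ 2) x' y'). apply (c_x x' y').
      * apply (continuity_2d_pt_y (fun _ y => r ^ 2 - (y - y0) ^ 2) x' y'). apply (c_y x' y').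
      * apply (continuity_2d_pt_y (fun x y => nsq (F0 x y))). apply nsq_cont; auto.
      * apply (continuity_2d_pt_y P). apply c_P. auto.
Qed.

(** On the horizontal axis of the square [log_derivative_square] bounds the derivative of [ln P] by
    [sqrt 8 r / (r^2 - s^2)], with [sqrt 8] rounded up to 3; integrating over a length of at most
    [s] gives the exponential factor. *)
Lemma harnack (s x : R) : 0 <= s < r -> Rabs (x - x0) <= s ->
  M - ln (nsq (F0 x y0)) / 2 <= (M - ln (nsq (F0 x0 y0)) / 2) * exp (3 * r / (r ^ 2 - s ^ 2) * s).
Proof.
  intros Hs Hx. set (K := 3 * r / (r ^ 2 - s ^ 2)).
  assert (Hrs : 0 < r ^ 2 - s ^ 2) by nra.
  assert (HK : 0 < K) by (apply Rdiv_lt_0_compat; lra).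
  assert (HD : forall t, Rabs (t - x0) <= s -> exists d, is_derive (fun x => ln (P x y0)) t d /\ Rabs d <= K).
  { intros t Ht. assert (Ht' := Ht). apply Rabs_le_between in Ht'.
    assert (HR : rect (x0 - r) (x0 + r) (y0 - r) (y0 + r) t y0) by (split; lra).
    assert (Hp := P_ge t y0 HR). assert (N0 := nsq_pos _ (Hnz t y0 HR)).
    destruct (P_lap t y0 (Hnz t y0 HR) ltac:(lra)) as [gx [gy [[a [b [D _]]] Egx]]].
    exists (gx / P t y0). split. apply (has_d2_is_derive _ _ _ _ D).
    rewrite <- (Rabs_pos_eq K) by lra. apply Rsqr_le_abs_0.
    assert (HW := log_derivative_square t y0 HR). unfold W in HW.
    replace ((y0 - y0) ^ 2) with 0 in HW by ring.
    set (X := (t - x0) ^ 2) in *. assert (HX : X <= s ^ 2) by (unfold X; nra). assert (0 <= X) by apply pow2_ge_0.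
    set (p := P t y0) in *. set (n := nsq (F0 t y0)) in *. set (m := nsq (F1 t y0)) in *.
    assert (Hm : 0 <= m) by (unfold m, nsq; nra).
    assert (Hg : gx ^ 2 <= m / n).
    { rewrite Egx. apply Rmult_le_reg_r with (n ^ 2). apply pow_lt; auto.
      replace (m / n * n ^ 2) with (m * n) by (field; lra).
      match goal with |- (- (?q / n)) ^ 2 * _ <= _ => replace ((- (q / n)) ^ 2 * n ^ 2) with (q ^ 2) by (field; lra) end.
      unfold m, n, nsq. generalize (fst (F0 t y0)) (snd (F0 t y0)) (fst (F1 t y0)) (snd (F1 t y0)). intros p1 p2 p3 p4.
      assert (0 <= (p1 * p4 - p2 * p3) ^ 2) by apply pow2_ge_0. lra. }
    assert (Hw : m / n * (/ p) ^ 2 * (r ^ 2 - X) ^ 2 <= 8 * r ^ 2).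
    { apply Rmult_le_reg_r with (r ^ 4). apply pow_lt; auto. eapply Rle_trans; [|eapply Rle_trans; [apply HW|]]; right.
      unfold Rdiv. ring. ring. }
    assert (Hq : 0 <= m / n * (/ p) ^ 2). { apply Rmult_le_pos. apply Rmult_le_pos; auto. left; apply Rinv_0_lt_compat; auto. apply pow2_ge_0. }
    assert (Hz : m / n * (/ p) ^ 2 * (r ^ 2 - s ^ 2) ^ 2 <= 8 * r ^ 2).
    { eapply Rle_trans; [|apply Hw]. apply Rmult_le_compat_l; auto. apply pow_incr; lra. }
    unfold Rsqr. apply Rle_trans with (m / n * (/ p) ^ 2).
    - replace (gx / p * (gx / p)) with (gx ^ 2 * (/ p) ^ 2) by (field; lra). apply Rmult_le_compat_r; auto. apply pow2_ge_0.
    - apply Rmult_le_reg_r with ((r ^ 2 - s ^ 2) ^ 2). apply pow_lt; auto. eapply Rle_trans; [apply Hz|].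
      unfold K. replace (3 * r / (r ^ 2 - s ^ 2) * (3 * r / (r ^ 2 - s ^ 2)) * (r ^ 2 - s ^ 2) ^ 2) with (9 * r ^ 2) by (field; lra). nra. }
  assert (HL : Rabs (ln (P x y0) - ln (P x0 y0)) <= K * Rabs (x - x0)).
  { destruct (MVT_gen (fun x => ln (P x y0)) x0 x (Derive (fun x => ln (P x y0)))) as [c [Hc E]].
    - intros t Ht. destruct (HD t) as [d [D _]]. { apply Rabs_le_between in Hx. apply Rabs_le_between.
        unfold Rmin, Rmax in Ht. destruct (Rle_dec x0 x); lra. }
      apply Derive_correct. eexists; eauto.
    - intros t Ht. destruct (HD t) as [d [D _]]. { apply Rabs_le_between in Hx. apply Rabs_le_between.
        unfold Rmin, Rmax in Ht. destruct (Rle_dec x0 x); lra. }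
      apply continuity_pt_filterlim. apply (ex_derive_continuous (V := R_NormedModule) (fun x => ln (P x y0))). eexists; eauto.
    - rewrite E, Rabs_mult. apply Rmult_le_compat_r. apply Rabs_pos.
      destruct (HD c) as [d [D Dk]]. { apply Rabs_le_between in Hx. apply Rabs_le_between.
        unfold Rmin, Rmax in Hc. destruct (Rle_dec x0 x); lra. }
      assert (E1 : Derive (fun x => ln (P x y0)) c = d) by (apply is_derive_unique; exact D). rewrite E1. auto. }
  assert (Hx' := Hx). apply Rabs_le_between in Hx'.
  assert (Px := P_ge x y0 ltac:(split; lra)). assert (Px0 := P_ge x0 y0 ltac:(split; lra)).
  replace (M - ln (nsq (F0 x y0)) / 2) with (P x y0) by (unfold P; field).
  replace (M - ln (nsq (F0 x0 y0)) / 2) with (P x0 y0) by (unfold P; field).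
  rewrite <- (exp_ln (P x y0)), <- (exp_ln (P x0 y0)) by lra. rewrite <- exp_plus. apply exp_le_exp.
  assert (K * Rabs (x - x0) <= K * s) by (apply Rmult_le_compat_l; lra).
  apply Rabs_le_between in HL. fold K. lra.
Qed.
End Harnack.

(** * Phragmén-Lindelöf: |Xi| increases with the real part *)

Lemma holo_Xi (k : nat) (a : R) : holo (fun x y => Xi k (x + a, y)) (fun x y => Xi (S k) (x + a, y)).
Proof.
  intros x y. split.
  - destruct (Xi_der_x k (x + a) y) as [H1 H2]. split.
    + rewrite <- (Rmult_1_l (fst _)). apply (is_derive_comp (V := R_NormedModule) (fun t => fst (Xi k (t, y))) (fun t => t + a)); auto.
      auto_derive; auto.
    + rewrite <- (Rmult_1_l (snd _)). apply (is_derive_comp (V := R_NormedModule) (fun t => snd (Xi k (t, y))) (fun t => t + a)); auto.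
      auto_derive; auto.
  - apply Xi_der_y.
Qed.

Lemma Xi_C2cont_shift (k : nat) (a : R) : C2cont (fun x y => Xi k (x + a, y)).
Proof.
  intros x y. destruct (Xi_C2cont k (x + a) y) as [H1 H2].
  split; intros eps; [destruct (H1 eps) as [d Hd]|destruct (H2 eps) as [d Hd]]; exists d; intros u v Hu Hv; apply Hd; auto;
    replace (u + a - (x + a)) with (u - x) by ring; auto.
Qed.

Lemma ln_nsq (z : C) : z <> 0%C -> ln (nsq z) = 2 * ln (Cmod z).
Proof.
  intros H. rewrite nsq_Cmod. apply Cmod_gt_0 in H. replace (Cmod z ^ 2) with (Cmod z * Cmod z) by ring. rewrite ln_mult; auto. ring.
Qed.

Section NonVanishing.
Hypothesis NZ : forall x y, 0 < x -> Xi 0 (x, y) <> 0%C.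

(** Harnack transports the explicit bound at [30 + i y]. The square of half-side [30 - a/2] stays in
    the right half-plane, and the smaller radius [30 - a] reaches [a] on one side and [60 - a >= 59]
    on the other. *)
Lemma Xi_lower (a : R) : 0 < a <= 1 -> exists C, 0 < C /\ forall x y, a <= x <= 59 ->
  exp (- (C * (1 + Rabs y) ^ 3)) <= Cmod (Xi 0 (x, y)).
Proof.
  intros Ha. destruct (Xi_bound 0 60) as [B0 [HB0 HB]].
  destruct (Xi_lower_far 30 ltac:(lra)) as [c [Hc HL]].
  set (B := Rmax B0 1). assert (1 <= B) by apply Rmax_r. assert (B0 <= B) by apply Rmax_l.
  set (M := ln B + 1). set (r := 30 - a / 2). set (s := 30 - a).
  set (E := exp (3 * r / (r ^ 2 - s ^ 2) * s)). assert (HE : 0 < E) by apply exp_pos.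
  set (M' := Rabs (M - ln c) + 1). assert (0 < M') by (unfold M'; pose proof (Rabs_pos (M - ln c)); lra).
  exists (M' * E + Rabs M). split. { pose proof (Rabs_pos M). assert (0 < M' * E) by (apply Rmult_lt_0_compat; lra). lra. }
  intros x y Hx.
  assert (Hz := NZ x y ltac:(lra)). assert (Hz0 := NZ 30 y ltac:(lra)).
  assert (HH := harnack (fun x y => Xi 0 (x + 0, y)) (fun x y => Xi 1 (x + 0, y)) (fun x y => Xi 2 (x + 0, y)) (fun x y => Xi 3 (x + 0, y))
     (holo_Xi 0 0) (holo_Xi 1 0) (holo_Xi 2 0) (Xi_C2cont_shift 0 0) (Xi_C2cont_shift 1 0) 30 y r M ltac:(unfold r; lra)).
  assert (N1 : forall x' y', rect (30 - r) (30 + r) (y - r) (y + r) x' y' -> Xi 0 (x' + 0, y') <> 0%C).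
  { intros x' y' [Hx' _]. apply NZ. unfold r in Hx'. lra. }
  specialize (HH N1).
  assert (N2 : forall x' y', rect (30 - r) (30 + r) (y - r) (y + r) x' y' -> ln (nsq (Xi 0 (x' + 0, y'))) <= 2 * (M - 1)).
  { intros x' y' Hr. rewrite ln_nsq by (apply N1; auto). apply Rmult_le_compat_l. lra. unfold M. replace (ln B + 1 - 1) with (ln B) by ring.
    apply ln_le. apply Cmod_gt_0; auto. eapply Rle_trans; [apply HB|lra]. destruct Hr as [Hr _]. unfold r in Hr. simpl. apply Rabs_le_between. lra. }
  assert (Hxs : Rabs (x - 30) <= s \/ 60 - a < x) by (destruct (Rle_lt_dec x (60 - a)); [left; unfold s; apply Rabs_le_between; lra|right; lra]).
  destruct Hxs as [Hxs|]; [|lra].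
  specialize (HH N2 s x ltac:(unfold s, r; lra) Hxs). fold E in HH. cbv beta in HH. rewrite !Rplus_0_r, !ln_nsq in HH by auto.
  specialize (HL y). apply ln_le in HL; [|apply Rmult_lt_0_compat; [auto|apply exp_pos]].
  rewrite ln_mult, ln_exp in HL by (auto; apply exp_pos).
  rewrite <- (exp_ln (Cmod (Xi 0 (x, y)))) by (apply Cmod_gt_0; auto). apply exp_le_exp.
  assert (HY := Rabs_pos y). set (Y := Rabs y) in *.
  replace (y ^ 2) with (Y ^ 2) in HL by (unfold Y; apply pow2_abs).
  set (Q := (1 + Y) ^ 3).
  assert (HQ : Y * (Y ^ 2 + 3) + 1 <= Q) by (unfold Q; nra). assert (1 <= Q) by (unfold Q in *; nra).
  set (l0 := ln (Cmod (Xi 0 (30, y)))) in *. set (l := ln (Cmod (Xi 0 (x, y)))) in *.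
  replace (M - 2 * l / 2) with (M - l) in HH by field. replace (M - 2 * l0 / 2) with (M - l0) in HH by field.
  assert (G1 : M - l0 <= M' * Q). 
  { assert (M - ln c <= M' - 1) by (unfold M'; pose proof (Rle_abs (M - ln c)); lra).
    assert (1 <= M') by (unfold M'; pose proof (Rabs_pos (M - ln c)); lra). nra. }
  assert (G2 : (M - l0) * E <= M' * Q * E) by (apply Rmult_le_compat_r; lra).
  assert (G3 : - M <= Rabs M * Q). { pose proof (Rabs_pos M). pose proof (Rle_abs (- M)) as G. rewrite Rabs_Ropp in G. nra. }
  lra.
Qed.

(* The harmonic polynomial [Re (x + i y)^4] beats the growth [(1 + |y|)^3] of [ln |Xi|]; the term [- x^2] makes the
   barrier strictly superharmonic and the constant makes it dominate [y^4 / 2] for [0 <= x <= 30]. *)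
Definition barrier (x y : R) : R := y ^ 4 - 6 * x ^ 2 * y ^ 2 + x ^ 4 - x ^ 2 + (17 * 30 ^ 4 + 900).

Lemma barrier_lower (x y : R) : 0 <= x <= 30 -> y ^ 4 / 2 <= barrier x y.
Proof.
  intros Hx. unfold barrier. assert (H1 : x ^ 2 <= 900) by nra. assert (H0 : 0 <= x ^ 2) by nra.
  replace (y ^ 4) with ((y ^ 2) ^ 2) by ring. replace (x ^ 4) with ((x ^ 2) ^ 2) by ring. set (X := x ^ 2) in *. set (Z := y ^ 2).
  replace (30 ^ 4) with 810000 by ring.
  assert (0 <= (Z - 6 * X) ^ 2) by apply pow2_ge_0. nra.
Qed.

Lemma has_lap_barrier (k e x y : R) : exists gx gy, has_lap (fun x y => k * x - e * barrier x y) x y gx gy (2 * e).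
Proof.
  exists (k - e * (- 12 * x * y ^ 2 + 4 * x ^ 3 - 2 * x)), (- e * (4 * y ^ 3 - 12 * x ^ 2 * y)).
  exists (- e * (- 12 * y ^ 2 + 12 * x ^ 2 - 2)), (- e * (12 * y ^ 2 - 12 * x ^ 2)). split; [|split].
  - apply (has_d2_global (fun s => k * s - e * barrier s y) (fun x => k - e * (- 12 * x * y ^ 2 + 4 * x ^ 3 - 2 * x))
      (fun x => - e * (- 12 * y ^ 2 + 12 * x ^ 2 - 2))); intros; unfold barrier; auto_derive; auto; ring.
  - apply (has_d2_global (fun s => k * x - e * barrier x s) (fun y => - e * (4 * y ^ 3 - 12 * x ^ 2 * y))
      (fun y => - e * (12 * y ^ 2 - 12 * x ^ 2))); intros; unfold barrier; auto_derive; auto; ring.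
  - ring.
Qed.

Lemma barrier_cont (k e x y : R) : continuity_2d_pt (fun x y => exp (k * x - e * barrier x y)) x y.
Proof.
  apply (continuity_1d_2d_pt_comp exp (fun x y => k * x - e * barrier x y)).
  - apply continuity_pt_filterlim. apply (ex_derive_continuous (V := R_NormedModule) exp). auto_derive; auto.
  - apply continuity_2d_pt_ext with (fun x y => k * x - e * ((y * y) * (y * y) - 6 * ((x * x) * (y * y)) + (x * x) * (x * x) - x * x + (17 * 30 ^ 4 + 900))).
    { intros; unfold barrier; ring. }
    repeat first [apply continuity_2d_pt_const | apply continuity_2d_pt_id1 | apply continuity_2d_pt_id2
      | apply continuity_2d_pt_mult | apply continuity_2d_pt_plus | apply continuity_2d_pt_opp].
Qed.

(** The quotient carries two corrections: [exp (- e barrier)] beats the growth along the strip, and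
    [exp (a x / 60)] spends the gain available on [Re z = 30], to keep a strict inequality
    inside. *)
Lemma quotient_barrier (a e x1 y1 : R) : 0 < a <= 1 -> 0 < e -> 0 <= x1 <= 30 ->
  nsq (Xi 0 (x1 + - a, y1)) * / nsq (Xi 0 (x1 + a, y1)) * exp (a / 60 * x1 - e * barrier x1 y1) <= 1.
Proof.
  intros Ha He Hx1. destruct (Xi_lower a Ha) as [C [HC HL]]. destruct (Xi_bound 0 60) as [B0 [HB0 HB']].
  set (B := Rmax B0 1). assert (HB1 : 1 <= B) by apply Rmax_r.
  assert (HB : forall x y, Rabs x <= 60 -> Cmod (Xi 0 (x, y)) <= B).
  { intros x y Hx. eapply Rle_trans; [apply HB'; exact Hx|apply Rmax_l]. }
  assert (HlB : 0 <= ln B). { rewrite <- ln_1. apply ln_le; lra. }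
  (* The height from which [e y^4 / 2] outweighs the cubic exponent of [Xi_lower] and the
     constants. *)
  set (T := 2 * (2 * ln B + 1 + 16 * C) / e).
  set (Y := Rmax (Rmax 1 (Rabs y1)) T).
  assert (HY1 : 1 <= Y) by (unfold Y; eapply Rle_trans; [|apply Rmax_l]; apply Rmax_l).
  assert (HYy : Rabs y1 <= Y) by (unfold Y; eapply Rle_trans; [|apply Rmax_l]; apply Rmax_r).
  assert (HYT : T <= Y) by apply Rmax_r.
  assert (HD : forall x y, 0 <= x -> Xi 0 (x + a, y) <> 0%C) by (intros; apply NZ; lra).
  pose (W := fun x y => nsq (Xi 0 (x + - a, y)) * / nsq (Xi 0 (x + a, y)) * exp (a / 60 * x - e * barrier x y)).
  change (W x1 y1 <= 1).
  apply (rect_max_principle W 0 30 (- Y) Y 1); try lra.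
  - intros x y [Hx Hy]. apply continuity_2d_pt_mult; [apply continuity_2d_pt_mult|].
    + apply (nsq_cont (fun x y => Xi 0 (x + - a, y))). apply Xi_C2cont_shift.
    + apply (continuity_2d_pt_inv (fun x y => nsq (Xi 0 (x + a, y)))). apply (nsq_cont (fun x y => Xi 0 (x + a, y))). apply Xi_C2cont_shift.
      apply Rgt_not_eq, nsq_pos. apply HD; lra.
    + apply barrier_cont.
  - intros x y [Hx Hy] Hb. unfold W. assert (Hn := nsq_pos _ (HD x y (proj1 Hx))).
    assert (Hb0 := barrier_lower x y Hx). assert (0 <= y ^ 4) by (replace (y ^ 4) with ((y ^ 2) ^ 2) by ring; apply pow2_ge_0).
    assert (Heb : 0 <= e * barrier x y) by (apply Rmult_le_pos; lra).
    assert (HN0 : 0 <= nsq (Xi 0 (x + - a, y))) by (unfold nsq; nra).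
    apply Rmult_le_reg_l with (nsq (Xi 0 (x + a, y))); auto.
    match goal with |- _ * (?n * / ?d * ?x) <= _ => replace (d * (n * / d * x)) with (n * x) by (field; lra) end. rewrite Rmult_1_r.
    destruct Hb as [->|[->|Hb]].
    + rewrite !nsq_Cmod, !Rplus_0_l, Cmod_Xi_reflect. rewrite <- (Rmult_1_r (Cmod (Xi 0 (a, y)) ^ 2)) at 2.
      apply Rmult_le_compat_l. apply pow2_ge_0. rewrite <- exp_0. apply exp_le_exp. lra.
    (* The squared gain [exp (a / 4) ^ 2] is exactly [exp (a / 60 * 30)], whence the constant 60. *)
    + assert (G := Xi_growth_far (30 + - a) a y ltac:(lra) ltac:(lra)).
      replace (30 + - a + 2 * a) with (30 + a) in G by ring. rewrite !nsq_Cmod.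
      apply Rle_trans with ((Cmod (Xi 0 (30 + - a, y)) * exp (a / 4)) ^ 2).
      * rewrite Rpow_mult_distr. apply Rmult_le_compat_l. apply pow2_ge_0. rewrite exp_pow. apply exp_le_exp. simpl. lra.
      * apply pow_incr. split; auto. apply Rmult_le_pos. apply Cmod_ge_0. left; apply exp_pos.
    + assert (Hab : Rabs y = Y) by (destruct Hb as [->| ->]; [rewrite Rabs_Ropp|]; apply Rabs_pos_eq; lra).
      rewrite !nsq_Cmod.
      assert (G1 : Cmod (Xi 0 (x + - a, y)) <= B) by (apply HB; apply Rabs_le_between; lra).
      assert (G2 := HL (x + a) y ltac:(lra)). rewrite Hab in G2.
      apply Rle_trans with (exp (- (C * (1 + Y) ^ 3)) ^ 2).
      2: { apply pow_incr. split; auto. left; apply exp_pos. }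
      apply Rle_trans with (exp (ln B) ^ 2 * exp (a / 60 * x - e * barrier x y)).
      * apply Rmult_le_compat_r. left; apply exp_pos. apply pow_incr. rewrite exp_ln by lra. split; auto. apply Cmod_ge_0.
      * rewrite !exp_pow, <- exp_plus. apply exp_le_exp. simpl INR.
        assert (EY : y ^ 4 = Y ^ 4) by (rewrite <- Hab; replace 4%nat with (2 * 2)%nat by auto; rewrite !pow_mult, pow2_abs; auto).
        rewrite EY in Hb0.
        assert (H3 : (1 + Y) ^ 3 <= 8 * Y ^ 3). { replace (8 * Y ^ 3) with ((2 * Y) ^ 3) by ring. apply pow_incr. lra. }
        assert (H4 : 1 <= Y ^ 3) by (apply pow_R1_Rle; lra).
        assert (H5 : e * (Y ^ 4 / 2) <= e * barrier x y) by (apply Rmult_le_compat_l; lra).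
        assert (H6 : (2 * ln B + 1 + 16 * C) <= e * Y / 2). { unfold T in HYT. apply Rmult_le_compat_l with (r := e / 2) in HYT; [|lra].
          replace (e / 2 * (2 * (2 * ln B + 1 + 16 * C) / e)) with (2 * ln B + 1 + 16 * C) in HYT by (field; lra). lra. }
        assert (H7 : (2 * ln B + 1 + 16 * C) * Y ^ 3 <= e * (Y ^ 4 / 2)).
        { replace (e * (Y ^ 4 / 2)) with (e * Y / 2 * Y ^ 3) by field. apply Rmult_le_compat_r; lra. }
        assert (a / 60 * x <= 1) by nra.
        assert (C * (1 + Y) ^ 3 <= C * (8 * Y ^ 3)) by (apply Rmult_le_compat_l; lra).
        assert ((2 * ln B + 1) * 1 <= (2 * ln B + 1) * Y ^ 3) by (apply Rmult_le_compat_l; lra).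
        lra.
  - intros x y Hx Hy HW.
    assert (HN : Xi 0 (x + - a, y) <> 0%C). { intros Q. unfold W in HW. rewrite Q in HW. unfold nsq in HW. simpl in HW. lra. }
    assert (HDn := HD x y ltac:(lra)).
    destruct (has_lap_barrier (a / 60) e x y) as [gx [gy HLb]].
    assert (L1 := has_lap_ln_nsq _ _ _ (holo_Xi 0 (- a)) (holo_Xi 1 (- a)) x y HN).
    assert (L2 := has_lap_ln_nsq _ _ _ (holo_Xi 0 a) (holo_Xi 1 a) x y HDn).
    apply (has_lap_scal (-1)) in L2.
    assert (L := has_lap_plus _ _ _ _ _ _ _ _ _ _ L1 (has_lap_plus _ _ _ _ _ _ _ _ _ _ L2 HLb)).
    assert (EX : forall n d b, 0 < n -> 0 < d -> n * / d * exp b = exp (ln n + (-1 * ln d + b))).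
    { intros n d b Hn Hd. replace (-1 * ln d) with (- ln d) by ring. rewrite !exp_plus, exp_Ropp, !exp_ln by auto. ring. }
    apply nsq_pos in HN. apply nsq_pos in HDn.
    assert (K1 := nsq_cont _ x y (Xi_C2cont_shift 0 (- a))). assert (K2 := nsq_cont _ x y (Xi_C2cont_shift 0 a)).
    do 4 eexists. split; [exact L|split; [lra|split]].
    + generalize (filter_and _ _ (locally_pos _ x (continuity_2d_pt_x _ x y K1) HN) (locally_pos _ x (continuity_2d_pt_x _ x y K2) HDn)).
      apply filter_imp. intros t [A1 A2]. apply EX; auto.
    + generalize (filter_and _ _ (locally_pos _ y (continuity_2d_pt_y _ x y K1) HN) (locally_pos _ y (continuity_2d_pt_y _ x y K2) HDn)).
      apply filter_imp. intros t [A1 A2]. apply (EX (nsq (Xi 0 (x + - a, t))) (nsq (Xi 0 (x + a, t)))); auto.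
  - split; auto. apply Rabs_le_between; auto.
Qed.

(** The barrier disappears as [e] tends to 0: if the inequality failed, an [e] small compared with
    [ln (A / D)] over the barrier at this point would contradict [quotient_barrier]. *)
Lemma Xi_shift_ineq (a x y : R) : 0 < a <= 1 -> 0 <= x <= 30 ->
  nsq (Xi 0 (x + - a, y)) * exp (a / 60 * x) <= nsq (Xi 0 (x + a, y)).
Proof.
  intros Ha Hx. assert (Hn := nsq_pos _ (NZ (x + a) y ltac:(lra))).
  set (A := nsq (Xi 0 (x + - a, y)) * exp (a / 60 * x)). set (D := nsq (Xi 0 (x + a, y))) in *.
  destruct (Rle_lt_dec A D) as [|HA]; auto. exfalso.
  assert (Hb := barrier_lower x y Hx). assert (0 <= y ^ 4) by (replace (y ^ 4) with ((y ^ 2) ^ 2) by ring; apply pow2_ge_0).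
  assert (Hl : 0 < ln (A / D)). { rewrite <- ln_1. apply ln_increasing; [lra|]. apply Rmult_lt_reg_r with D; auto. field_simplify; lra. }
  set (e := ln (A / D) / (2 * (barrier x y + 1))). assert (He : 0 < e) by (apply Rdiv_lt_0_compat; lra).
  assert (Q := quotient_barrier a e x y Ha He Hx). fold D in Q. unfold Rminus in Q. rewrite exp_plus in Q.
  replace (nsq (Xi 0 (x + - a, y)) * / D * (exp (a / 60 * x) * exp (- (e * barrier x y)))) with (A / D * exp (- (e * barrier x y))) in Q by (unfold A; field; lra).
  assert (HAD : 0 < A / D) by (apply Rdiv_lt_0_compat; lra).
  rewrite <- (exp_ln (A / D)) in Q by auto. rewrite <- exp_plus in Q.
  assert (Eb : e * barrier x y <= ln (A / D) / 2).
  { unfold e. replace (ln (A / D) / (2 * (barrier x y + 1)) * barrier x y) with (ln (A / D) / 2 * (barrier x y / (barrier x y + 1))) by (field; lra).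
    rewrite <- (Rmult_1_r (ln (A / D) / 2)) at 2. apply Rmult_le_compat_l. lra. apply Rmult_le_reg_r with (barrier x y + 1). lra. field_simplify; lra. }
  assert (1 < exp (ln (A / D) + - (e * barrier x y))). { rewrite <- exp_0 at 1. apply exp_increasing. lra. }
  lra.
Qed.

(** The retained factor [exp (a x / 60)] is of first order in [a]; division by [a] leaves the
    derivative of [ln |Xi|^2] at least [x / 120], so the growth is strict. *)
Lemma Xi_log_increasing (x y : R) : 0 < x <= 30 ->
  0 < fst (Xi 0 (x, y)) * fst (Xi 1 (x, y)) + snd (Xi 0 (x, y)) * snd (Xi 1 (x, y)).
Proof.
  intros Hx. assert (Hz := NZ x y (proj1 Hx)). assert (Hn := nsq_pos _ Hz).
  set (N := fst (Xi 0 (x, y)) * fst (Xi 1 (x, y)) + snd (Xi 0 (x, y)) * snd (Xi 1 (x, y))).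
  assert (Hz' : Xi 0 (x + 0, y) <> 0%C) by (rewrite Rplus_0_r; auto).
  destruct (has_lap_ln_nsq _ _ _ (holo_Xi 0 0) (holo_Xi 1 0) x y Hz') as [p [q [D _]]]. apply has_d2_is_derive in D.
  rewrite !Rplus_0_r in D. fold N in D. set (d := 2 * N / nsq (Xi 0 (x, y))) in D.
  assert (Hd : x / 120 <= d).
  { destruct (Rle_lt_dec (x / 120) d) as [|Hlt]; auto. exfalso.
    assert (D' : is_derive (fun s => ln (nsq (Xi 0 (s, y)))) x d).
    { apply is_derive_ext with (2 := D). intros; rewrite Rplus_0_r; auto. }
    assert (D2 : is_derive (fun h => ln (nsq (Xi 0 (x + h, y))) - ln (nsq (Xi 0 (x - h, y)))) 0 (2 * d)).
    { replace (2 * d) with (1 * d - (-1) * d) by ring. apply (is_derive_minus (V := R_NormedModule)).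
      - apply (is_derive_comp (V := R_NormedModule) (fun s => ln (nsq (Xi 0 (s, y)))) (fun h => x + h)).
        replace (x + 0) with x by ring; auto. auto_derive; auto.
      - apply (is_derive_comp (V := R_NormedModule) (fun s => ln (nsq (Xi 0 (s, y)))) (fun h => x - h)).
        replace (x - 0) with x by ring; auto. auto_derive; auto; ring. }
    destruct (proj1 (is_derive_Reals _ _ _) D2 (x / 60 - 2 * d) ltac:(lra)) as [e He]. pose proof (cond_pos e) as He0.
    set (a := Rmin 1 (Rmin (e / 2) (x / 2))).
    assert (Ha1 : a <= 1) by apply Rmin_l.
    assert (Ha2 : a <= e / 2) by (unfold a; eapply Rle_trans; [apply Rmin_r|apply Rmin_l]).
    assert (Ha3 : a <= x / 2) by (unfold a; eapply Rle_trans; [apply Rmin_r|apply Rmin_r]).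
    assert (Ha0 : 0 < a) by (unfold a; repeat apply Rmin_pos; lra).
    specialize (He a ltac:(lra) ltac:(rewrite Rabs_pos_eq; lra)).
    rewrite Rplus_0_l, Rplus_0_r, Rminus_0_r in He.
    assert (I := Xi_shift_ineq a x y ltac:(lra) ltac:(lra)).
    assert (P1 := nsq_pos _ (NZ (x + - a) y ltac:(lra))). assert (P2 := nsq_pos _ (NZ (x + a) y ltac:(lra))).
    apply ln_le in I; [|apply Rmult_lt_0_compat; [auto|apply exp_pos]].
    rewrite ln_mult, ln_exp in I by (auto; apply exp_pos). change (x + - a) with (x - a) in I.
    apply Rabs_def2 in He. destruct He as [He _].
    set (u := ln (nsq (Xi 0 (x + a, y)))) in *. set (v := ln (nsq (Xi 0 (x - a, y)))) in *.
    assert (x / 60 <= (u - v) / a). { apply Rmult_le_reg_r with a; auto. field_simplify; lra. }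
    lra. }
  unfold d in Hd. apply Rmult_lt_reg_r with (/ nsq (Xi 0 (x, y))). apply Rinv_0_lt_compat; auto. unfold Rdiv in Hd. lra.
Qed.
End NonVanishing.

(** * From the Riemann Hypothesis to the peak-valley structure *)

Lemma xi_line (beta t : R) : 0 < beta -> beta <> 1 / 2 \/ t <> 0 -> xi (1 / 2 + beta, t) = Xi 0 (beta, t).
Proof.
  intros H1 H2. rewrite xi_Xi.
  - f_equal. rewrite <- RtoC_inv by lra. apply C_ext; simpl; field.
  - simpl. lra.
  - intros Q. assert (Q1 : fst ((1 / 2 + beta, t) : C) = fst (RtoC 1)) by (rewrite Q; auto).
    assert (Q2 : snd ((1 / 2 + beta, t) : C) = snd (RtoC 1)) by (rewrite Q; auto). simpl in *. lra.
Qed.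

(** At [beta = 1/2] the point is [s = 1], where [xi] takes its separate value [1/2]; elsewhere [Xi]
    is positive on the real axis. Consequently zeros of [u] have [t > 0], where [xi_line]
    applies. *)
Lemma u_pos_0 (beta : R) : 0 < beta -> 0 < u 0 beta.
Proof.
  intros H. unfold u. destruct (Req_dec beta (1 / 2)) as [->|].
  - unfold xi. simpl fst; simpl snd. destruct (Req_EM_T _ _); [destruct (Req_EM_T _ _)|]; try lra. simpl. lra.
  - rewrite xi_line by auto. apply Xi_real.
Qed.

Lemma u_Xi (beta t : R) : 0 < beta -> t <> 0 -> u t beta = fst (Xi 0 (beta, t)).
Proof. intros H1 H2. unfold u. rewrite xi_line; auto. Qed.

Lemma v_Xi (beta t : R) : 0 < beta -> t <> 0 -> v t beta = snd (Xi 0 (beta, t)).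
Proof. intros H1 H2. unfold v. rewrite xi_line; auto. Qed.

Lemma right_negative (f : R -> R) (a l d : R) : is_derive f a l -> f a = 0 -> l < 0 -> 0 < d ->
  exists t, a < t < a + d /\ f t < 0.
Proof.
  intros H Ha Hl Hd. destruct (proj1 (is_derive_Reals _ _ _) H (- l) ltac:(lra)) as [e He].
  pose proof (cond_pos e) as He0. set (h := Rmin (d / 2) (e / 2)).
  assert (0 < h) by (apply Rmin_pos; lra). assert (h <= d / 2) by apply Rmin_l. assert (h <= e / 2) by apply Rmin_r.
  exists (a + h). split. lra. specialize (He h ltac:(lra) ltac:(rewrite Rabs_pos_eq; lra)).
  apply Rabs_def2 in He. assert (Hq : (f (a + h) - f a) / h < 0) by lra.
  replace (f (a + h)) with ((f (a + h) - f a) / h * h) by (rewrite Ha; field; lra). nra.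
Qed.

Lemma const_sign (f : R -> R) (a b : R) : (forall t, continuity_pt f t) -> (forall t, a < t < b -> f t <> 0) ->
  forall s t, a < s < b -> a < t < b -> 0 < f s -> 0 < f t.
Proof.
  intros Hc Hn s t Hs Ht Hp. apply Rnot_le_lt. intros Q.
  destruct (IVT_gen f s t 0) as [z [Hz E]].
  - intros x. apply Hc.
  - unfold Rmin, Rmax. destruct (Rle_dec (f s) (f t)); lra.
  - apply (Hn z); auto. unfold Rmin, Rmax in Hz. destruct (Rle_dec s t); lra.
Qed.

(** Positivity inside forces [f1 a >= 0] and [f1 b <= 0]; the strict products exclude zero
    derivatives and so fix the signs of [g]. *)
Lemma peak_valley_pos (f f1 g : R -> R) (a b : R) : a < b -> (forall t, is_derive f t (f1 t)) -> (forall t, continuity_pt g t) ->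
  f a = 0 -> f b = 0 -> (forall t, a < t < b -> f t <> 0) -> 0 < f ((a + b) / 2) ->
  g a * f1 a < 0 -> g b * f1 b < 0 -> g a < 0 /\ 0 < g b.
Proof.
  intros Hab Hf Hg Ha Hb Hn Hp Ga Gb.
  assert (Hc : forall t, continuity_pt f t).
  { intros t. apply continuity_pt_filterlim. apply (ex_derive_continuous (V := R_NormedModule) f). eexists; apply Hf. }
  assert (Hpos : forall t, a < t < b -> 0 < f t). { intros t Ht. apply (const_sign f a b) with ((a + b) / 2); auto. lra. }
  split.
  - assert (0 <= f1 a).
    { apply Rnot_lt_le. intros Q. destruct (right_negative f a (f1 a) (b - a)) as [t [T1 T2]]; auto; try lra.
      specialize (Hpos t ltac:(lra)). lra. }
    apply Rnot_le_lt. intros Q. assert (0 <= g a * f1 a) by (apply Rmult_le_pos; auto). lra.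
  - assert (f1 b <= 0).
    { apply Rnot_lt_le. intros Q. destruct (right_negative (fun t => f (- t)) (- b) (- f1 b) (b - a)) as [t [T1 T2]]; try lra.
      - replace (- f1 b) with ((-1) * f1 (- - b)) by (rewrite Ropp_involutive; ring).
        apply (is_derive_comp (V := R_NormedModule) f (fun t => - t)). apply Hf. auto_derive; auto; ring.
      - rewrite Ropp_involutive; auto.
      - specialize (Hpos (- t) ltac:(lra)). lra. }
    apply Rnot_le_lt. intros Q. nra.
Qed.

Lemma peak_valley (f f1 g : R -> R) (a b : R) : a < b -> (forall t, is_derive f t (f1 t)) -> (forall t, continuity_pt g t) ->
  f a = 0 -> f b = 0 -> (forall t, a < t < b -> f t <> 0) -> g a * f1 a < 0 -> g b * f1 b < 0 ->
  g a * g b < 0 /\ exists t, a < t < b /\ g t = 0.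
Proof.
  intros Hab Hf Hg Ha Hb Hn Ga Gb.
  assert (S : g a * g b < 0).
  { destruct (Rtotal_order (f ((a + b) / 2)) 0) as [L|[E|L]].
    - destruct (peak_valley_pos (fun t => - f t) (fun t => - f1 t) (fun t => - g t) a b); auto; try lra.
      + intros t. apply (is_derive_opp (V := R_NormedModule)); auto.
      + intros t. apply continuity_pt_opp; auto.
      + intros t Ht Q. apply (Hn t Ht). lra.
      + nra.
    - exfalso. apply (Hn ((a + b) / 2)); lra.
    - destruct (peak_valley_pos f f1 g a b); auto. nra. }
  split; auto.
  destruct (IVT_gen g a b 0) as [z [Hz E]].
  - intros x. apply Hg.
  - unfold Rmin, Rmax. destruct (Rle_dec (g a) (g b)); nra.
  - exists z. split; auto. rewrite Rmin_left, Rmax_right in Hz by lra.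
    split; apply Rnot_le_lt; intros Q.
    + assert (z = a) by lra. subst. rewrite E in S. lra.
    + assert (z = b) by lra. subst. rewrite E in S. lra.
Qed.

Lemma peak_valley_of_RH :
  (forall beta t, 0 < beta <= 1 / 2 -> 0 <= t -> xi (1 / 2 + beta, t) <> 0%C) ->
  forall beta, 0 < beta <= 1 / 2 -> forall tj tj1, root_interval (fun t => u t beta) tj tj1 ->
    v tj beta <> 0 /\ v tj1 beta <> 0 /\ v tj beta * v tj1 beta < 0 /\ exists t', tj < t' < tj1 /\ v t' beta = 0.
Proof.
  intros RH beta Hb a b [Ha [Hab [Ua [Ub Hn]]]].
  (* [RH] covers [0 < x <= 1/2] and [y >= 0]; the rest of the half-plane comes from
     [Xi_neq_0_right], positivity on the real axis and conjugation. *)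
  assert (NZ : forall x y, 0 < x -> Xi 0 (x, y) <> 0%C).
  { assert (P : forall x y, 0 < x -> 0 <= y -> Xi 0 (x, y) <> 0%C).
    { intros x y Hx Hy. destruct (Rlt_le_dec (/ 2) x). apply Xi_neq_0_right; auto.
      destruct (Req_dec y 0) as [->|Hy0].
      - intros Q. assert (G := proj2 (Xi_real x)). rewrite Q in G. simpl in G. lra.
      - rewrite <- xi_line by auto. apply RH; lra. }
    intros x y Hx. destruct (Rle_lt_dec 0 y). apply P; auto.
    rewrite <- (Ropp_involutive y), Xi_conj. intros Q. apply (P x (- y)); auto. lra.
    apply C_ext. exact (f_equal fst Q). assert (G := f_equal snd Q). simpl in G |- *. lra. }
  assert (Ha0 : 0 < a).
  { destruct Ha as [|<-]; auto. assert (G := u_pos_0 beta (proj1 Hb)). cbv beta in Ua. lra. }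
  cbv beta in Ua, Ub. rewrite u_Xi in Ua, Ub by lra.
  (* On the vertical line the derivative of [u] is [- Im Xi'], and at a zero of [u] the monotonicity
     inequality reduces to [v Im Xi' > 0]. *)
  assert (Key : forall t, fst (Xi 0 (beta, t)) = 0 -> snd (Xi 0 (beta, t)) * - snd (Xi 1 (beta, t)) < 0).
  { intros t E. assert (G := Xi_log_increasing NZ beta t ltac:(lra)). rewrite E in G. lra. }
  destruct (peak_valley (fun t => fst (Xi 0 (beta, t))) (fun t => - snd (Xi 1 (beta, t))) (fun t => snd (Xi 0 (beta, t))) a b) as [S [t [Ht E]]]; auto.
  - intros t. assert (E : fst (Ci * Xi 1 (beta, t))%C = - snd (Xi 1 (beta, t))) by (simpl; ring).
    change (is_derive (fun t : R => fst (Xi 0 (beta, t))) t (- snd (Xi 1 (beta, t)))). rewrite <- E.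
    exact (proj1 (Xi_der_y 0 beta t)).
  - intros t. apply continuity_pt_filterlim. apply (ex_derive_continuous (V := R_NormedModule) (fun t => snd (Xi 0 (beta, t)))).
    eexists. exact (proj2 (Xi_der_y 0 beta t)).
  - intros t Ht Q. specialize (Hn t Ht). cbv beta in Hn. rewrite u_Xi, Q, Rabs_R0 in Hn by lra. lra.
  - rewrite !v_Xi by lra. repeat split; try (intros Q; rewrite Q in S; lra); auto.
    exists t. rewrite v_Xi by lra. auto.
Qed.

(** * Isolated zeros *)

Section DerivativeSequence.
Variable D : nat -> R -> R.
Hypothesis D_der : forall n s, is_derive (D n) s (D (S n) s).

Lemma Derive_n_seq (n : nat) : forall s, Derive_n (D 0) n s = D n s.
Proof.
  induction n; intros s; simpl; auto. rewrite (Derive_ext _ (D n)) by auto. apply is_derive_unique; auto.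
Qed.

Lemma derivative_seq_cont (n : nat) (s : R) : continuity_pt (D n) s.
Proof. apply continuity_pt_filterlim. apply (ex_derive_continuous (V := R_NormedModule) (D n)). eexists; apply D_der. Qed.

Lemma taylor_seq (n : nat) (a t : R) : a < t -> (forall k, (k <= n)%nat -> D k a = 0) ->
  exists z, a < z < t /\ D 0 t = (t - a) ^ S n / INR (fact (S n)) * D (S n) z.
Proof.
  intros Hat H0. destruct (Taylor_Lagrange (D 0) n a t Hat) as [z [Hz E]].
  - intros s _ k _. destruct k; simpl; auto. apply ex_derive_ext with (D k). intros; symmetry; apply Derive_n_seq. eexists; apply D_der.
  - exists z. split; auto. rewrite Derive_n_seq in E. rewrite E.
    rewrite (sum_eq _ (fun _ => 0)). rewrite sum_cte. ring.
    intros k Hk. rewrite Derive_n_seq, H0 by auto. ring.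
Qed.

(** Analyticity in quantitative form: with the growth bound at [r = 2 (t - a)] the Taylor remainders
    decrease like powers of 1/2. *)
Lemma flat_seq (a t : R) : (forall r, 0 < r -> exists C, forall n s, Rabs (D n s) * r ^ n <= C * INR (fact n)) ->
  a < t -> (forall k, D k a = 0) -> D 0 t = 0.
Proof.
  intros Hg Hat H0. destruct (Hg (2 * (t - a)) ltac:(lra)) as [C HC].
  assert (B : forall n, Rabs (D 0 t) <= C * (/ 2) ^ S n).
  { intros n. destruct (taylor_seq n a t Hat) as [z [_ E]]; auto. rewrite E.
    specialize (HC (S n) z). rewrite Rpow_mult_distr in HC.
    assert (P1 : 0 < (t - a) ^ S n) by (apply pow_lt; lra).
    assert (P2 : 0 < INR (fact (S n))) by apply INR_fact_lt_0.
    assert (P3 : 0 < 2 ^ S n) by (apply pow_lt; lra).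
    rewrite Rabs_mult, Rabs_pos_eq by (left; apply Rdiv_lt_0_compat; auto). rewrite pow_inv.
    apply Rmult_le_reg_r with (INR (fact (S n)) * 2 ^ S n). apply Rmult_lt_0_compat; auto.
    replace ((t - a) ^ S n / INR (fact (S n)) * Rabs (D (S n) z) * (INR (fact (S n)) * 2 ^ S n))
      with (Rabs (D (S n) z) * (2 ^ S n * (t - a) ^ S n)) by (field; lra).
    replace (C * / 2 ^ S n * (INR (fact (S n)) * 2 ^ S n)) with (C * INR (fact (S n))) by (field; lra). auto. }
  destruct (Req_dec (D 0 t) 0) as [|Hn]; auto. exfalso. apply Rabs_pos_lt in Hn.
  assert (HC0 : 0 < C) by (specialize (B 0%nat); simpl in B; lra).
  destruct (pow_lt_1_zero (/ 2) ltac:(rewrite Rabs_pos_eq; lra) (Rabs (D 0 t) / C) ltac:(apply Rdiv_lt_0_compat; lra)) as [N HN].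
  specialize (HN (S N) ltac:(lia)). specialize (B N). apply Rle_lt_trans with (1 := Rle_abs _) in HN.
  apply Rmult_lt_compat_l with (r := C) in HN; auto. replace (C * (Rabs (D 0 t) / C)) with (Rabs (D 0 t)) in HN by (field; lra). lra.
Qed.

Lemma locally_neq (f : R -> R) (a : R) : continuity_pt f a -> f a <> 0 -> exists d, 0 < d /\ forall t, Rabs (t - a) < d -> f t <> 0.
Proof.
  intros Hc Hn. destruct (proj1 (continuity_pt_locally f a) Hc (mkposreal _ (Rabs_pos_lt _ Hn))) as [d Hd].
  exists d. split. apply cond_pos. intros t Ht Q. specialize (Hd t Ht). simpl in Hd. rewrite Q in Hd.
  rewrite Rminus_0_l, Rabs_Ropp in Hd. lra.
Qed.

(** Strong induction reaches the least order of nonvanishing; Taylor's formula then writes [D 0 t]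
    as a nonzero multiple of a derivative that does not vanish near [a]. *)
Lemma right_isolated (a : R) (n : nat) : D n a <> 0 -> exists d, 0 < d /\ forall t, a < t < a + d -> D 0 t <> 0.
Proof.
  induction n as [n IH] using (well_founded_induction lt_wf). intros Hn.
  destruct (classic (forall k, (k < n)%nat -> D k a = 0)) as [H0|H1].
  - destruct (locally_neq (D n) a (derivative_seq_cont n a) Hn) as [d [Hd HD]].
    exists d. split; auto. intros t Ht. destruct n as [|n].
    + apply HD. rewrite Rabs_pos_eq; lra.
    + destruct (taylor_seq n a t) as [z [Hz E]]; try lra. intros; apply H0; lia.
      rewrite E. apply Rmult_integral_contrapositive. split.
      * apply Rgt_not_eq. apply Rdiv_lt_0_compat. apply pow_lt; lra. apply INR_fact_lt_0.
      * apply HD. rewrite Rabs_pos_eq; lra.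
  - apply not_all_ex_not in H1. destruct H1 as [k Hk]. apply imply_to_and in Hk. destruct Hk as [K1 K2]. apply (IH k); auto.
Qed.
End DerivativeSequence.

(** The point [T] excludes a flat zero: if all derivatives vanished at [a], [flat_seq] would give
    [D 0 T = 0]. *)
Lemma isolated_zeros (D : nat -> R -> R) (a T : R) : (forall n s, is_derive (D n) s (D (S n) s)) ->
  (forall r, 0 < r -> exists C, forall n s, Rabs (D n s) * r ^ n <= C * INR (fact n)) -> D 0%nat T <> 0 ->
  exists d, 0 < d /\ (forall t, a < t < a + d -> D 0%nat t <> 0) /\ (forall t, a - d < t < a -> D 0%nat t <> 0).
Proof.
  intros HD Hg HT.
  (* The reflected sequence turns left neighbourhoods into right ones. *)
  set (E := fun n s => (-1) ^ n * D n (- s)).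
  assert (HE : forall n s, is_derive (E n) s (E (S n) s)).
  { intros n s. unfold E. replace ((-1) ^ S n * D (S n) (- s)) with ((-1) ^ n * ((-1) * D (S n) (- s))) by (simpl; ring).
    apply (is_derive_scal (fun s => D n (- s))). apply (is_derive_comp (V := R_NormedModule) (D n) (fun s => - s)). apply HD. auto_derive; auto; ring. }
  assert (Hs : forall n, Rabs ((-1) ^ n) = 1) by (intros; apply pow_1_abs).
  assert (HgE : forall r, 0 < r -> exists C, forall n s, Rabs (E n s) * r ^ n <= C * INR (fact n)).
  { intros r Hr. destruct (Hg r Hr) as [C HC]. exists C. intros n s. unfold E. rewrite Rabs_mult, Hs, Rmult_1_l. apply HC. }
  assert (Hn : exists n, D n a <> 0).
  { apply not_all_not_ex. intros Q. assert (Q' : forall n, D n a = 0) by (intros n; apply NNPP, Q).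
    destruct (Rtotal_order a T) as [L|[L|L]].
    - apply HT. apply (flat_seq D HD a T); auto.
    - subst. apply HT. auto.
    - apply HT. replace T with (- - T) by ring. replace (D 0%nat (- - T)) with (E 0%nat (- T)) by (unfold E; simpl pow; ring).
      apply (flat_seq E HE (- a) (- T)). exact HgE. lra. intros k. unfold E. rewrite Ropp_involutive, Q'. ring. }
  destruct Hn as [n Hn]. destruct (right_isolated D HD a n Hn) as [d1 [Hd1 H1]].
  destruct (right_isolated E HE (- a) n) as [d2 [Hd2 H2]].
  { unfold E. rewrite Ropp_involutive. apply Rmult_integral_contrapositive. split; auto. apply pow_nonzero; lra. }
  pose proof (Rmin_l d1 d2). pose proof (Rmin_r d1 d2).
  exists (Rmin d1 d2). split; [apply Rmin_pos; auto|split].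
  - intros t Ht. apply H1. lra.
  - intros t Ht Q. apply (H2 (- t)). lra. unfold E. rewrite Ropp_involutive, Q. ring.
Qed.

(** The zero is the supremum of the zero-free initial segments: isolation keeps it away from [a],
    and by continuity such a segment can only be stopped by a zero. *)
Lemma next_zero (f : R -> R) (a b d : R) : (forall t, continuity_pt f t) -> 0 < d -> a < b -> f b = 0 ->
  (forall t, a < t < a + d -> f t <> 0) -> exists c, a < c <= b /\ f c = 0 /\ forall t, a < t < c -> f t <> 0.
Proof.
  intros Hc Hd Hab Hb Hi.
  set (E := fun s => s <= b /\ forall t, a < t < s -> f t <> 0).
  set (s0 := Rmin b (a + d)).
  assert (Hs0 : E s0). { split. apply Rmin_l. intros t Ht. apply Hi. assert (s0 <= a + d) by apply Rmin_r. lra. }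
  assert (Has0 : a < s0) by (apply Rmin_glb_lt; lra).
  destruct (completeness E) as [c [Hub Hlub]].
  { exists b. intros s Hs. apply Hs. } { exists s0; auto. }
  assert (Hsc : s0 <= c) by (apply Hub; auto).
  assert (Hcb : c <= b) by (apply Hlub; intros s Hs; apply Hs).
  assert (Hn : forall t, a < t < c -> f t <> 0).
  { intros t Ht Q. assert (c <= t); [|lra]. apply Hlub. intros s [Hs1 Hs2]. apply Rnot_lt_le. intros Hts. apply (Hs2 t); auto. lra. }
  exists c. split; [lra|split; auto].
  destruct (Req_dec (f c) 0) as [|Hfc]; auto. exfalso.
  assert (Hcb' : c < b). { destruct Hcb as [|Q]; auto. exfalso. apply Hfc. rewrite Q. auto. }
  destruct (locally_neq f c (Hc c) Hfc) as [e [He Hne]].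
  assert (Hm : E (Rmin b (c + e))).
  { split. apply Rmin_l. intros t Ht. assert (Rmin b (c + e) <= c + e) by apply Rmin_r.
    destruct (Rlt_le_dec t c). apply Hn; lra. apply Hne. rewrite Rabs_pos_eq; lra. }
  apply Hub in Hm. assert (c < Rmin b (c + e)) by (apply Rmin_glb_lt; lra). lra.
Qed.

(** Each derivative along the vertical line brings a factor [Ci]: this is the [n]-th derivative in
    [t] of [Re Xi (beta + i t)]. *)
Definition critical_der (beta : R) (n : nat) (t : R) : R := fst (Cpow Ci n * Xi n (beta, t))%C.

Lemma critical_der_0 (beta t : R) : critical_der beta 0 t = fst (Xi 0 (beta, t)).
Proof. unfold critical_der. simpl Cpow. rewrite Cmult_1_l. auto. Qed.

Lemma critical_der_der (beta : R) (n : nat) (t : R) : is_derive (critical_der beta n) t (critical_der beta (S n) t).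
Proof.
  unfold critical_der. replace (Cpow Ci (S n) * Xi (S n) (beta, t))%C with (0 * Xi n (beta, t) + Cpow Ci n * (Ci * Xi (S n) (beta, t)))%C by (simpl Cpow; ring).
  exact (proj1 (Cder_mult (fun _ => Cpow Ci n) (fun t => Xi n (beta, t)) t _ _ (Cder_const (Cpow Ci n) t) (Xi_der_y n beta t))).
Qed.

Lemma pow_fact_le_exp (x : R) (n : nat) : 0 <= x -> x ^ n <= INR (fact n) * exp x.
Proof.
  intros Hx. assert (H := exp_ge_taylor x n Hx). assert (P := INR_fact_lt_0 n).
  assert (x ^ n / INR (fact n) <= exp x).
  { eapply Rle_trans; [|apply H]. destruct n; [simpl; lra|]. rewrite tech5.
    assert (0 <= sum_f_R0 (fun k => x ^ k / INR (fact k)) n).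
    { apply cond_pos_sum. intros k. apply Rmult_le_pos. apply pow_le; auto. left; apply Rinv_0_lt_compat, INR_fact_lt_0. }
    lra. }
  apply Rmult_le_compat_l with (r := INR (fact n)) in H0; [|lra].
  replace (INR (fact n) * (x ^ n / INR (fact n))) with (x ^ n) in H0 by (field; lra). auto.
Qed.

Lemma Cmod_Cpow_Ci (n : nat) : Cmod (Cpow Ci n) = 1.
Proof. induction n; simpl. apply Cmod_1. rewrite Cmod_mult, Cmod_Ci, IHn. ring. Qed.

(** [(r |w|)^n <= n! exp (r |w|)] under the integral; the decay of [phi] absorbs the exponential for
    every [r]. *)
Lemma critical_der_growth (beta r : R) : 0 < r -> exists C, forall n s, Rabs (critical_der beta n s) * r ^ n <= C * INR (fact n).
Proof.
  intros Hr. destruct (phi_moment_bound 0 (Rabs beta + r)) as [K HK]. exists (4 * K). intros n s.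
  assert (P := INR_fact_lt_0 n). assert (Hrn : 0 < r ^ n) by (apply pow_lt; auto).
  assert (H : Cmod (Xi n (beta, s)) <= 4 * (K * INR (fact n) / r ^ n)).
  { unfold Xi. apply Cintegral_bound. apply Ctame_cont, xi_integrand_tame.
    intros w. eapply Rle_trans. apply (Cmod_xi_integrand n (beta, s) (Rabs beta)). simpl; lra.
    specialize (HK w). simpl pow in HK at 1. rewrite Rmult_1_l in HK.
    assert (Q := pow_fact_le_exp (r * Rabs w) n ltac:(apply Rmult_le_pos; [lra|apply Rabs_pos])). rewrite Rpow_mult_distr in Q.
    apply Rmult_le_reg_l with (r ^ n); auto.
    apply Rle_trans with (INR (fact n) * (phi w * exp ((Rabs beta + r) * Rabs w))).
    - rewrite Rmult_plus_distr_r, exp_plus.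
      replace (r ^ n * (phi w * (Rabs w ^ n * exp (Rabs beta * Rabs w)))) with ((phi w * exp (Rabs beta * Rabs w)) * (r ^ n * Rabs w ^ n)) by ring.
      replace (INR (fact n) * (phi w * (exp (Rabs beta * Rabs w) * exp (r * Rabs w)))) with ((phi w * exp (Rabs beta * Rabs w)) * (INR (fact n) * exp (r * Rabs w))) by ring.
      apply Rmult_le_compat_l; auto. apply Rmult_le_pos. left; apply phi_pos. left; apply exp_pos.
    - assert (Hw := sq_pos1 w). set (W := 1 + w ^ 2) in *.
      replace (r ^ n * (K * INR (fact n) / r ^ n / W)) with (INR (fact n) * (K / W)) by (field; lra).
      apply Rmult_le_compat_l; lra. }
  unfold critical_der. eapply Rle_trans. apply Rmult_le_compat_r. lra. apply fst_Cmod.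
  rewrite Cmod_mult, Cmod_Cpow_Ci, Rmult_1_l.
  apply Rmult_le_compat_r with (r := r ^ n) in H; [|lra].
  replace (4 * (K * INR (fact n) / r ^ n) * r ^ n) with (4 * K * INR (fact n)) in H by (field; lra). auto.
Qed.

Lemma unique_zero_of_peak_valley (beta a : R) :
  (forall tj tj1, root_interval (fun t => u t beta) tj tj1 -> v tj beta <> 0 /\ v tj1 beta <> 0) ->
  0 < beta -> 0 < a -> Xi 0 (beta, a) = 0%C -> forall t, 0 < t -> fst (Xi 0 (beta, t)) = 0 -> t = a.
Proof.
  intros H Hb Ha HX t Ht HT.
  set (f := fun t => fst (Xi 0 (beta, t))).
  assert (Hf : forall t, continuity_pt f t).
  { intros s. apply continuity_pt_filterlim. apply (ex_derive_continuous (V := R_NormedModule) f). eexists. exact (proj1 (Xi_der_y 0 beta s)). }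
  destruct (isolated_zeros (critical_der beta) a 0) as [d [Hd [H1 H2]]].
  - apply critical_der_der. - apply critical_der_growth.
  - rewrite critical_der_0. apply Rgt_not_eq, Xi_real.
  - assert (H1' : forall t, a < t < a + d -> f t <> 0) by (intros s Hs; unfold f; rewrite <- critical_der_0; auto).
    assert (H2' : forall t, a - d < t < a -> f t <> 0) by (intros s Hs; unfold f; rewrite <- critical_der_0; auto).
    assert (Hfa : f a = 0) by (unfold f; rewrite HX; auto).
    assert (Hva : v a beta = 0) by (rewrite v_Xi, HX by lra; auto).
    destruct (Rtotal_order t a) as [L|[L|L]]; [exfalso|exact L|exfalso].
    (* The nearest zero to the left of [a], found by reflection, bounds with [a] a root-interval at
       whose right end [v] vanishes. *)
    + destruct (next_zero (fun s => f (- s)) (- a) (- t) d) as [c [Hc1 [Hc2 Hc3]]]; try lra.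
      * intros s. apply (continuity_pt_comp Ropp f). apply continuity_pt_opp, derivable_continuous_pt, derivable_pt_id. apply Hf.
      * rewrite Ropp_involutive. auto.
      * intros s Hs. apply H2'. lra.
      * destruct (H (- c) a) as [_ G]; [|auto]. split; [lra|split; [lra|split; [|split]]].
        -- rewrite u_Xi by lra. auto. -- rewrite u_Xi by lra. auto.
        -- intros s Hs. rewrite u_Xi by lra. apply Rabs_pos_lt. specialize (Hc3 (- s) ltac:(lra)). rewrite Ropp_involutive in Hc3. auto.
    + destruct (next_zero f a t d) as [c [Hc1 [Hc2 Hc3]]]; auto.
      destruct (H a c) as [G _]; [|auto]. split; [lra|split; [lra|split; [|split]]].
      * rewrite u_Xi by lra. auto. * rewrite u_Xi by lra. auto.
      * intros s Hs. rewrite u_Xi by lra. apply Rabs_pos_lt. apply Hc3. auto.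
Qed.

(** * Positivity of the Fourier transform at the origin *)

Lemma dominated_scale (G : R -> R) (K L : R) : 1 <= L -> dominated K G -> dominated K (fun x => G (L * x)).
Proof.
  intros HL HK x. eapply Rle_trans; [apply HK|].
  assert (0 <= K). { specialize (HK 0). pose proof (Rabs_pos (G 0)). replace (K / (1 + 0 ^ 2)) with K in HK by field. lra. }
  apply Rmult_le_compat_l; auto. apply Rinv_le_contravar. apply sq_pos1.
  rewrite Rpow_mult_distr. assert (1 <= L ^ 2) by nra. pose proof (pow2_ge_0 x). nra.
Qed.

Lemma tame_scale (G : R -> R) (L : R) : 1 <= L -> tame G -> tame (fun x => G (L * x + 0)).
Proof.
  intros HL [HG [K HK]]. apply tame_ext with (fun x => G (L * x)). intros; f_equal; ring. split.
  - intros x. apply (continuous_comp (fun x => L * x) G); [|apply HG].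
    apply (ex_derive_continuous (V := R_NormedModule) (fun x => L * x)). auto_derive; auto.
  - exists K. apply dominated_scale; auto.
Qed.

(* Poisson summation at scale [L]: the non-central lattice values are [O(1/L^2)], so [G 0] is bounded below by [-C/L^2]. *)
Lemma nonneg_fourier (G : R -> R) : tame G -> (forall w, 0 <= w -> 0 <= integral (fun x => G x * cos (w * x))) -> 0 <= G 0.
Proof.
  intros HG Hw. apply Rnot_lt_le. intros Hneg.
  destruct (proj2 HG) as [K HK].
  assert (HK0 : 0 <= K). { specialize (HK 0). pose proof (Rabs_pos (G 0)). replace (K / (1 + 0 ^ 2)) with K in HK by field. lra. }
  (* This size makes the total [4 C = 8 K / L^2] of the other lattice values smaller than
     [- G 0]. *)
  set (L := 1 + 8 * K / - G 0).
  assert (Hq : 0 <= 8 * K / - G 0). { apply Rmult_le_pos. lra. left; apply Rinv_0_lt_compat; lra. }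
  assert (HL : 1 <= L) by (unfold L; lra).
  set (f := fun x => G (L * x + 0)).
  assert (Hf : tame f) by (apply tame_scale; auto).
  assert (Hfd : dominated K f). { intros x. unfold f. rewrite Rplus_0_r. apply (dominated_scale G K L HL HK x). }
  destruct (zsum_ex_lim f K) as [S0 HS].
  { exact Hfd. }
  assert (HS0 : 0 <= S0).
  { apply (poisson_positivity f S0 Hf HS). intros k.
    rewrite (integral_ext _ (fun x => (fun X => G X * cos (2 * PI * INR k / L * X)) (L * x + 0))).
    - rewrite (integral_affine (fun X => G X * cos (2 * PI * INR k / L * X))).
      + apply Rmult_le_pos. left; apply Rinv_0_lt_compat; lra. apply Hw.
        apply Rmult_le_pos; [|left; apply Rinv_0_lt_compat; lra]. apply Rmult_le_pos. pose proof PI_RGT_0; lra. apply pos_INR.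
      + lra.
      + apply tame_cos; auto.
      + apply (tame_scale (fun X => G X * cos (2 * PI * INR k / L * X))); auto. apply tame_cos; auto.
    - intros x. unfold f. f_equal. f_equal. field. lra. }
  set (C := 2 * K / L ^ 2).
  assert (HL2 : 1 <= L ^ 2) by nra.
  assert (HC : forall n, 1 <= n -> Rabs (f n) <= C * / (1 + (n - 1 / 2) ^ 2) /\ Rabs (f (- n)) <= C * / (1 + (n - 1 / 2) ^ 2)).
  { intros n Hn. assert (B : forall m, m ^ 2 = n ^ 2 -> Rabs (f m) <= C * / (1 + (n - 1 / 2) ^ 2)).
    { intros m Hm. unfold f. rewrite Rplus_0_r. eapply Rle_trans; [apply HK|].
      replace ((L * m) ^ 2) with (L ^ 2 * n ^ 2) by (rewrite <- Hm; ring). unfold C, Rdiv. rewrite !Rmult_assoc, <- Rinv_mult.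
      assert (0 < 1 + L ^ 2 * n ^ 2) by nra.
      replace (2 * (K * / (L ^ 2 * (1 + (n - 1 * / 2) ^ 2)))) with (K * (2 * / (L ^ 2 * (1 + (n - 1 * / 2) ^ 2)))) by ring.
      apply Rmult_le_compat_l; auto. rewrite <- (Rinv_inv 2), <- Rinv_mult.
      apply Rinv_le_contravar. apply Rmult_lt_0_compat. lra. apply Rmult_lt_0_compat; nra.
      assert (/ 2 * (1 + (n - 1 * / 2) ^ 2) <= n ^ 2) by nra.
      assert (/ 2 * (L ^ 2 * (1 + (n - 1 * / 2) ^ 2)) <= L ^ 2 * n ^ 2) by nra. lra. }
    split; apply B; ring. }
  assert (HCm : forall m, zsum f (m + 1) <= G 0 + 4 * C).
  { intros m. assert (Z := zsum_gap f C 1 m (le_n 1) HC). destruct (HC 1 (Rle_refl 1)) as [Q1 Q2].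
    assert (HC0 : 0 <= C). { unfold C. apply Rmult_le_pos. lra. left; apply Rinv_0_lt_compat; lra. }
    assert (P1 : / INR (m + 1) > 0). { apply Rinv_0_lt_compat. apply lt_0_INR; lia. }
    assert (Z1 : zsum f 1 = G 0 + (f 1 + f (- 1))). { simpl. unfold f at 1. rewrite Rmult_0_r, Rplus_0_r. auto. }
    rewrite Z1 in Z. apply Rabs_le_between in Z. apply Rabs_le_between in Q1. apply Rabs_le_between in Q2.
    replace (INR 1) with 1 in Z by auto.
    replace (- (1)) with (-1) in Q2 by ring. replace (/ (1 + (1 - 1 / 2) ^ 2)) with (4 / 5) in Q1, Q2 by field.
    rewrite Rinv_1 in Z.
    nra. }
  assert (HS1 : S0 <= G 0 + 4 * C).
  { apply (is_lim_seq_le (fun m => zsum f (m + 1)) (fun _ => G 0 + 4 * C) S0 (G 0 + 4 * C)); auto.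
    - apply (is_lim_seq_incr_n (zsum f) 1). auto. - apply is_lim_seq_const. }
  assert (4 * C < - G 0).
  { unfold C. apply Rmult_lt_reg_r with (L ^ 2). lra. replace (4 * (2 * K / L ^ 2) * L ^ 2) with (8 * K) by (field; lra).
    assert (8 * K < - G 0 * L). { unfold L. replace (- G 0 * (1 + 8 * K / - G 0)) with (- G 0 + 8 * K) by (field; lra). lra. }
    nra. }
  lra.
Qed.

(** The line may be moved because both integrals are limits of the same [xi_approx (z + / 2)], whose
    Gaussian integrals were already shifted by [mellin_line]. *)
Lemma Phi_transform_Xi (y : R) (z : C) : Rabs y < PI / 4 -> - / 2 < fst z -> Phi_transform y z = Xi 0 z.
Proof.
  intros Hy Hz. assert (E2 : RtoC (/ 2) = (/ 2)%C) by (apply RtoC_inv; lra).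
  assert (Hs : 0 < fst (z + / 2)%C) by (rewrite <- E2; simpl; lra).
  assert (H1 := xi_approx_cv (z + / 2)%C y Hs Hy). assert (H2 := xi_approx_cv (z + / 2)%C 0 Hs zero_lt_PI_4).
  apply is_Clim_unique in H1. apply is_Clim_unique in H2. rewrite H1 in H2.
  replace (z + / 2 - / 2)%C with z in H2 by ring.
  assert (E : Phi_transform y z = Phi_transform 0 z).
  { replace (Phi_transform y z) with (/ 2 * (2 * Phi_transform y z))%C by field. rewrite H2. field. }
  rewrite E. unfold Phi_transform, Xi, xi_integrand. apply Cintegral_ext. intros w. rewrite Phi_phi. simpl pow. rewrite Rmult_1_r. reflexivity.
Qed.

Definition profile (beta y x : R) : R := fst (Phi (x, y) * Cexp (beta * (x, y)))%C.

Lemma profile_tame (beta y : R) : Rabs y < PI / 4 -> tame (profile beta y).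
Proof. intros Hy. apply (Phi_transform_tame y beta Hy). Qed.

(** [profile] is a real part, so its cosine transform mixes the frequencies [w] and [- w] with
    weights [exp (w y) / 2] and [exp (- w y) / 2]; conjugation symmetry merges them into [cosh]. *)
Lemma profile_fourier (beta y w : R) : 0 < beta -> Rabs y < PI / 4 ->
  integral (fun x => profile beta y x * cos (w * x)) = fst (Xi 0 (beta, w)) * cosh (w * y).
Proof.
  intros Hb Hy.
  set (g := fun (w : R) (x : R) => (Phi (x, y) * Cexp ((beta, w) * (x, y)))%C).
  assert (Hg : forall w, Ctame (g w)) by (intros; apply Phi_transform_tame; auto).
  assert (E : forall x, profile beta y x * cos (w * x) = exp (w * y) / 2 * fst (g w x) + exp (- (w * y)) / 2 * fst (g (- w) x)).
  { intros x. unfold profile, g.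
    replace ((beta, w) * (x, y))%C with (Cplus (RtoC beta * (x, y))%C (- (w * y), w * x)) by (apply C_ext; simpl; ring).
    replace (Cmult (beta, - w) (x, y)) with (Cplus (RtoC beta * (x, y))%C (w * y, - (w * x))) by (apply C_ext; simpl; ring).
    rewrite !Cexp_plus. set (Z := (Phi (x, y))). set (Q := Cexp (RtoC beta * (x, y))). unfold Cexp. simpl fst; simpl snd.
    rewrite cos_neg, sin_neg, exp_Ropp. pose proof (exp_pos (w * y)). simpl. field. lra. }
  rewrite (integral_ext _ _ E).
  assert (Hf : forall w, tame (fun x => fst (g w x))) by (intros w'; exact (proj1 (Hg w'))).
  rewrite (integral_plus (fun x => exp (w * y) / 2 * fst (g w x)) (fun x => exp (- (w * y)) / 2 * fst (g (- w) x)))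
    by (apply tame_scal; auto).
  rewrite (integral_scal _ (fun x => fst (g w x))), (integral_scal _ (fun x => fst (g (- w) x))) by auto.
  assert (T : forall w, integral (fun x => fst (g w x)) = fst (Xi 0 (beta, w))).
  { intros w'. rewrite <- (Phi_transform_Xi y (beta, w') Hy) by (simpl; lra). reflexivity. }
  rewrite !T, Xi_conj. unfold cosh. simpl. field.
Qed.

Lemma profile_0 (beta y : R) : Rabs y < PI / 4 -> profile beta y 0 = fst (Phi (0, y)) * cos (beta * y).
Proof.
  intros Hy. unfold profile. assert (Q := Phi_imaginary y Hy). revert Q. generalize (Phi (0, y)). intros z Q. unfold Cexp. simpl. rewrite Q.
  replace (beta * 0 - 0 * y) with 0 by ring. replace (beta * y + 0 * 0) with (beta * y) by ring. rewrite exp_0. ring.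
Qed.

Lemma profile_nonneg (beta y : R) : 0 < beta -> Rabs y < PI / 4 -> (forall t, 0 <= t -> 0 <= fst (Xi 0 (beta, t))) -> 0 <= profile beta y 0.
Proof.
  intros Hb Hy H. apply nonneg_fourier. apply profile_tame; auto. intros w Hw. rewrite profile_fourier by auto.
  apply Rmult_le_pos; auto. unfold cosh. pose proof (exp_pos (w * y)). pose proof (exp_pos (- (w * y))). lra.
Qed.

(* On the Fourier side the second difference in [y] multiplies by [cosh (eta t)], whence a factor
   [cosh (eta a) - cosh (eta t)] that changes sign exactly where [fst (Xi 0 (beta, t))] does. *)
Lemma profile_convexity (beta y eta a : R) : 0 < beta -> Rabs y < PI / 4 -> Rabs (y + eta) < PI / 4 -> Rabs (y - eta) < PI / 4 ->
  (forall t, 0 <= t -> 0 <= fst (Xi 0 (beta, t)) * (cosh (eta * a) - cosh (eta * t))) ->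
  profile beta (y + eta) 0 + profile beta (y - eta) 0 <= 2 * cosh (eta * a) * profile beta y 0.
Proof.
  intros Hb H0 H1 H2 H. set (c := cosh (eta * a)).
  assert (T0 := profile_tame beta y H0). assert (T1 := profile_tame beta (y + eta) H1). assert (T2 := profile_tame beta (y - eta) H2).
  assert (G : 0 <= 2 * c * profile beta y 0 + (-1) * (profile beta (y + eta) 0 + profile beta (y - eta) 0)); [|lra].
  apply (nonneg_fourier (fun x => 2 * c * profile beta y x + (-1) * (profile beta (y + eta) x + profile beta (y - eta) x))).
  { apply tame_plus; apply tame_scal; auto. apply tame_plus; auto. }
  intros w Hw.
  rewrite (integral_ext _ (fun x => 2 * c * (profile beta y x * cos (w * x)) +
    (-1) * (profile beta (y + eta) x * cos (w * x) + profile beta (y - eta) x * cos (w * x)))) by (intros; ring).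
  rewrite integral_plus, !integral_scal, integral_plus by (repeat (first [apply tame_scal | apply tame_plus | apply tame_cos]; auto)).
  rewrite !profile_fourier by auto.
  assert (E : cosh (w * (y + eta)) + cosh (w * (y - eta)) = 2 * cosh (w * y) * cosh (eta * w)).
  { unfold cosh. replace (w * (y + eta)) with (w * y + eta * w) by ring. replace (w * (y - eta)) with (w * y + - (eta * w)) by ring.
    rewrite !Ropp_plus_distr, Ropp_involutive, !exp_plus. field. }
  replace (2 * c * (fst (Xi 0 (beta, w)) * cosh (w * y)) + -1 * (fst (Xi 0 (beta, w)) * cosh (w * (y + eta)) + fst (Xi 0 (beta, w)) * cosh (w * (y - eta))))
    with (2 * cosh (w * y) * (fst (Xi 0 (beta, w)) * (c - cosh (eta * w)))).
  - apply Rmult_le_pos; [|apply H; auto]. unfold cosh. pose proof (exp_pos (w * y)). pose proof (exp_pos (- (w * y))). lra.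
  - replace (-1 * (fst (Xi 0 (beta, w)) * cosh (w * (y + eta)) + fst (Xi 0 (beta, w)) * cosh (w * (y - eta))))
      with (- fst (Xi 0 (beta, w)) * (cosh (w * (y + eta)) + cosh (w * (y - eta)))) by ring. rewrite E. ring.
Qed.

(** * Numerical values of Phi on the imaginary axis *)

(** Partial sums of the arctangent series in the Machin-type formula
    [PI/4 = 2 atan (1/3) + atan (1/7)]. *)
Lemma PI_bounds : 31415 / 10000 < PI < 31416 / 10000.
Proof.
  destruct (PI_2_3_7_ineq 3) as [H1 H2]. cbn [sum_f_R0 Nat.mul Nat.add] in H1, H2.
  unfold tg_alt, PI_2_3_7_tg, Ratan_seq in H1, H2. simpl in H1, H2. lra.
Qed.

Lemma PI_sq_bounds : (31415 / 10000) ^ 2 < PI * PI < (31416 / 10000) ^ 2.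
Proof. pose proof PI_bounds. nra. Qed.

Definition exp8 (x : R) : R := 1 + x + x ^ 2 / 2 + x ^ 3 / 6 + x ^ 4 / 24 + x ^ 5 / 120 + x ^ 6 / 720 + x ^ 7 / 5040 + x ^ 8 / 40320.

Lemma exp_taylor8 (x : R) : 0 < x -> exp x * (1 - x ^ 9 / 362880) <= exp8 x <= exp x.
Proof.
  intros Hx.
  assert (ES : sum_f_R0 (fun k => x ^ k / INR (fact k)) 8 = exp8 x).
  { cbn [sum_f_R0]. rewrite !INR_IZR_INZ.
    replace (Z.of_nat (fact 0)) with 1%Z by reflexivity. replace (Z.of_nat (fact 1)) with 1%Z by reflexivity.
    replace (Z.of_nat (fact 2)) with 2%Z by reflexivity. replace (Z.of_nat (fact 3)) with 6%Z by reflexivity.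
    replace (Z.of_nat (fact 4)) with 24%Z by reflexivity. replace (Z.of_nat (fact 5)) with 120%Z by reflexivity.
    replace (Z.of_nat (fact 6)) with 720%Z by reflexivity. replace (Z.of_nat (fact 7)) with 5040%Z by (vm_compute; reflexivity).
    replace (Z.of_nat (fact 8)) with 40320%Z by (vm_compute; reflexivity). unfold exp8. field. }
  split.
  - assert (HD : forall n s, is_derive ((fun _ : nat => exp) n) s ((fun _ : nat => exp) (S n) s)) by (intros; auto_derive; auto; ring).
    destruct (Taylor_Lagrange exp 8 0 x Hx) as [z [Hz E]].
    { intros s _ k _. destruct k; simpl; auto. apply ex_derive_ext with exp.
      intros; symmetry; apply (Derive_n_seq (fun _ : nat => exp) HD k). auto_derive; auto. }
    rewrite (Derive_n_seq (fun _ : nat => exp) HD) in E.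
    rewrite (sum_eq _ (fun k => x ^ k / INR (fact k))) in E.
    + rewrite ES, Rminus_0_r in E.
      assert (E9 : INR (fact 9) = 362880) by (rewrite INR_IZR_INZ; apply f_equal; vm_compute; reflexivity). rewrite E9 in E.
      assert (exp z <= exp x) by (apply exp_le_exp; lra).
      assert (0 < x ^ 9) by (apply pow_lt; auto).
      assert (x ^ 9 / 362880 * exp z <= x ^ 9 / 362880 * exp x) by (apply Rmult_le_compat_l; lra). lra.
    + intros k _. rewrite (Derive_n_seq (fun _ : nat => exp) HD). rewrite exp_0, Rminus_0_r. ring.
  - rewrite <- ES. apply exp_ge_taylor. lra.
Qed.

(** Expanding at a positive argument and inverting keeps all Taylor terms of one sign; with rational
    data the two side conditions are rational inequalities. *)
Lemma exp_neg_interval (x1 x2 e1 e2 x : R) : 0 < x1 -> x1 <= x <= x2 ->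
  e1 * exp8 x2 <= 1 - x2 ^ 9 / 362880 -> 1 <= e2 * exp8 x1 -> e1 <= exp (- x) <= e2.
Proof.
  intros H1 Hx L U. assert (A := exp_taylor8 x1 H1). assert (B := exp_taylor8 x2 ltac:(lra)).
  assert (P1 := exp_pos x1). assert (P2 := exp_pos x2).
  assert (S1 : 0 < exp8 x1). { unfold exp8. assert (forall k, 0 < x1 ^ k) by (intros; apply pow_lt; auto).
    pose proof (H 2%nat). pose proof (H 3%nat). pose proof (H 4%nat). pose proof (H 5%nat). pose proof (H 6%nat). pose proof (H 7%nat). pose proof (H 8%nat). lra. }
  assert (S2 : 0 < exp8 x2). { unfold exp8. assert (forall k, 0 < x2 ^ k) by (intros; apply pow_lt; lra).
    pose proof (H 2%nat). pose proof (H 3%nat). pose proof (H 4%nat). pose proof (H 5%nat). pose proof (H 6%nat). pose proof (H 7%nat). pose proof (H 8%nat). lra. }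
  split.
  - apply Rle_trans with (exp (- x2)); [|apply exp_le_exp; lra]. rewrite exp_Ropp.
    apply Rmult_le_reg_r with (exp x2 * exp8 x2). apply Rmult_lt_0_compat; auto.
    replace (/ exp x2 * (exp x2 * exp8 x2)) with (exp8 x2) by (field; lra). nra.
  - apply Rle_trans with (exp (- x1)); [apply exp_le_exp; lra|]. rewrite exp_Ropp.
    apply Rmult_le_reg_r with (exp x1). auto. rewrite Rinv_l by lra.
    assert (0 < e2). { apply Rnot_le_lt. intros Q. nra. }
    apply Rle_trans with (1 := U). apply Rmult_le_compat_l; lra.
Qed.

Lemma cos_upper (x : R) : 0 <= x <= 1 -> cos x <= 1 - x ^ 2 / 2 + x ^ 4 / 24.
Proof.
  intros Hx. destruct (pre_cos_bound x 0 ltac:(lra) ltac:(lra)) as [_ H]. eapply Rle_trans; [apply H|].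
  unfold cos_approx, cos_term. simpl. right. field.
Qed.

Lemma sin_lower (x : R) : 0 <= x <= 1 -> x - x ^ 3 / 6 <= sin x.
Proof.
  intros Hx. destruct (pre_sin_bound x 0 ltac:(lra) ltac:(lra)) as [H _]. eapply Rle_trans; [|apply H].
  unfold sin_approx, sin_term. simpl. right. field.
Qed.

Lemma sin_upper (x : R) : 0 <= x -> sin x <= x.
Proof. intros [H| <-]. left; apply sin_lt_x; auto. rewrite sin_0; lra. Qed.

(* Up to the sign [(-1)^(n+1)], the real part of the [n]-th term of the kernel at a point [r] with [r^2 = a + i b];
   as [b] is close to 1, the phase [PI n^2 b] is replaced by [PI n^2 (1 - b)]. *)
Definition peak (a b n : R) : R :=
  exp (- (PI * (n ^ 2 * a))) *
  ((4 * ((PI * (n ^ 2 * b)) ^ 2 - (PI * (n ^ 2 * a)) ^ 2) + 6 * (PI * (n ^ 2 * a))) * cos (PI * (n ^ 2 * (1 - b)))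
   + PI * (n ^ 2 * b) * (8 * (PI * (n ^ 2 * a)) - 6) * sin (PI * (n ^ 2 * (1 - b)))).

Section PeakBounds.
Variables a b n : R.
Let e := exp (- (PI * (n ^ 2 * a))).
Let A := 4 * ((PI * (n ^ 2 * b)) ^ 2 - (PI * (n ^ 2 * a)) ^ 2) + 6 * (PI * (n ^ 2 * a)).
Let B := PI * (n ^ 2 * b) * (8 * (PI * (n ^ 2 * a)) - 6).
Let d := PI * (n ^ 2 * (1 - b)).

Lemma cos_interval (d1 d2 : R) : 0 <= d1 <= d -> d <= d2 <= 1 -> 1 - d2 ^ 2 / 2 <= cos d <= 1 - d1 ^ 2 / 2 + d2 ^ 4 / 24.
Proof.
  intros H1 H2. split.
  - eapply Rle_trans; [|apply cos_ge]. nra.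
  - eapply Rle_trans; [apply cos_upper; lra|]. assert (d1 ^ 2 <= d ^ 2) by (apply pow_incr; lra). assert (d ^ 4 <= d2 ^ 4) by (apply pow_incr; lra). lra.
Qed.

Lemma sin_interval (d1 d2 : R) : 0 <= d1 <= d -> d <= d2 <= 1 -> d1 - d2 ^ 3 / 6 <= sin d <= d2.
Proof.
  intros H1 H2. split.
  - eapply Rle_trans; [|apply sin_lower; lra]. assert (d ^ 3 <= d2 ^ 3) by (apply pow_incr; lra). lra.
  - eapply Rle_trans; [apply sin_upper; lra|]. lra.
Qed.

Lemma cos_d_nonneg (d1 d2 : R) : 0 <= d1 <= d -> d <= d2 <= 1 -> 0 <= cos d.
Proof. intros H1 H2. destruct (cos_interval d1 d2 H1 H2). nra. Qed.

Lemma sin_d_nonneg (d1 d2 : R) : 0 <= d1 <= d -> d <= d2 <= 1 -> 0 <= sin d.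
Proof. intros H1 H2. eapply Rle_trans; [|apply sin_lower; lra]. assert (d * d <= 1) by nra. nra. Qed.

(** Interval arithmetic by monotonicity: [e], [A], [B], [cos d] and [sin d] being nonnegative, each
    is replaced by its bound. The variants with suffix [_neg] treat a nonpositive [B], which occurs
    for [n = 1] at two of the points. *)
Lemma peak_upper (e2 A2 B2 d1 d2 V : R) : e <= e2 -> 0 <= A <= A2 -> 0 <= B <= B2 -> 0 <= d1 <= d -> d <= d2 <= 1 ->
  e2 * (A2 * (1 - d1 ^ 2 / 2 + d2 ^ 4 / 24) + B2 * d2) <= V -> peak a b n <= V.
Proof.
  intros He HA HB H1 H2 HV. eapply Rle_trans; [|apply HV]. unfold peak. fold e A B d.
  destruct (cos_interval d1 d2 H1 H2). destruct (sin_interval d1 d2 H1 H2).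
  pose proof (cos_d_nonneg d1 d2 H1 H2). pose proof (sin_d_nonneg d1 d2 H1 H2).
  apply Rmult_le_compat; auto. left; apply exp_pos.
  - apply Rplus_le_le_0_compat; apply Rmult_le_pos; lra.
  - apply Rplus_le_compat; apply Rmult_le_compat; lra.
Qed.

Lemma peak_upper_neg (e2 A2 d1 d2 V : R) : e <= e2 -> 0 <= A <= A2 -> B <= 0 -> 0 <= d1 <= d -> d <= d2 <= 1 ->
  e2 * (A2 * (1 - d1 ^ 2 / 2 + d2 ^ 4 / 24)) <= V -> peak a b n <= V.
Proof.
  intros He HA HB H1 H2 HV. eapply Rle_trans; [|apply HV]. unfold peak. fold e A B d.
  destruct (cos_interval d1 d2 H1 H2).
  pose proof (cos_d_nonneg d1 d2 H1 H2). pose proof (sin_d_nonneg d1 d2 H1 H2).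
  assert (0 < e) by apply exp_pos. assert (B * sin d <= 0) by nra.
  apply Rle_trans with (e * (A * cos d)). apply Rmult_le_compat_l; lra.
  apply Rmult_le_compat; try lra. apply Rmult_le_pos; lra. apply Rmult_le_compat; lra.
Qed.

Lemma peak_lower (e1 A1 B1 d1 d2 V : R) : 0 <= e1 <= e -> 0 <= A1 <= A -> 0 <= B1 <= B -> 0 <= d1 <= d -> d <= d2 <= 1 ->
  0 <= d1 - d2 ^ 3 / 6 ->
  V <= e1 * (A1 * (1 - d2 ^ 2 / 2) + B1 * (d1 - d2 ^ 3 / 6)) -> V <= peak a b n.
Proof.
  intros He HA HB H1 H2 H3 HV. eapply Rle_trans; [apply HV|]. unfold peak. fold e A B d.
  destruct (cos_interval d1 d2 H1 H2). destruct (sin_interval d1 d2 H1 H2).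
  assert (0 <= 1 - d2 ^ 2 / 2) by nra.
  apply Rmult_le_compat; try lra.
  - apply Rplus_le_le_0_compat; apply Rmult_le_pos; lra.
  - apply Rplus_le_compat; apply Rmult_le_compat; lra.
Qed.

Lemma peak_lower_neg (e1 A1 B1 d1 d2 V : R) : 0 <= e1 <= e -> 0 <= A1 <= A -> - B1 <= B <= 0 -> 0 <= d1 <= d -> d <= d2 <= 1 ->
  0 <= A1 * (1 - d2 ^ 2 / 2) - B1 * d2 ->
  V <= e1 * (A1 * (1 - d2 ^ 2 / 2) - B1 * d2) -> V <= peak a b n.
Proof.
  intros He HA HB H1 H2 H3 HV. eapply Rle_trans; [apply HV|]. unfold peak. fold e A B d.
  destruct (cos_interval d1 d2 H1 H2). destruct (sin_interval d1 d2 H1 H2). pose proof (sin_d_nonneg d1 d2 H1 H2).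
  assert (0 <= 1 - d2 ^ 2 / 2) by nra.
  apply Rmult_le_compat; try lra.
  assert (A1 * (1 - d2 ^ 2 / 2) <= A * cos d) by (apply Rmult_le_compat; lra).
  assert (- B * sin d <= B1 * d2) by (apply Rmult_le_compat; lra). lra.
Qed.

Lemma exp_square (k : nat) (e1 e2 : R) : n ^ 2 = INR k -> 0 <= e1 -> e1 <= exp (- (PI * a)) <= e2 -> e1 ^ k <= e <= e2 ^ k.
Proof.
  intros Hk H0 H. unfold e. replace (- (PI * (n ^ 2 * a))) with (INR k * - (PI * a)) by (rewrite <- Hk; ring).
  rewrite <- exp_pow. split; apply pow_incr; lra.
Qed.
End PeakBounds.

(** [k] is the square of [n]: the exponential of the term is the [k]-th power of the one enclosed by
    [H], and bounds on [PI] and [PI * PI] make the rest linear. *)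
Ltac peak_tac lem H k :=
  let Hb := fresh "Hb" in
  pose proof PI_bounds; pose proof PI_sq_bounds;
  lazymatch type of H with ?l <= exp (- (PI * ?a)) <= ?u =>
    lazymatch goal with
    | |- peak _ _ ?n <= _ => pose proof (exp_square a n k l u ltac:(simpl; ring) ltac:(lra) H) as Hb
    | |- _ <= peak _ _ ?n => pose proof (exp_square a n k l u ltac:(simpl; ring) ltac:(lra) H) as Hb
    end
  end;
  apply lem; lra.

(* The three points of evaluation are [r = exp (i (PI/4 - k eta))], [k = 2, 1, 3], with [tan eta = 1/19], so that
   [r^2 = sin (2 k eta) + i cos (2 k eta)] has rational coordinates. *)
Lemma exp_4eta : (129741 / 250000) <= exp (- (PI * (6840 / 32761))) <= (25949 / 50000).
Proof. pose proof PI_bounds. apply (exp_neg_interval (65589 / 100000) (8199 / 12500)); unfold exp8; lra. Qed.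

Lemma exp_2eta : (359537 / 500000) <= exp (- (PI * (19 / 181))) <= (71909 / 100000).
Proof. pose proof PI_bounds. apply (exp_neg_interval (32977 / 100000) (32979 / 100000)); unfold exp8; lra. Qed.

Lemma exp_6eta : (377263 / 1000000) <= exp (- (PI * (1839941 / 5929741))) <= (1179 / 3125).
Proof. pose proof PI_bounds. apply (exp_neg_interval (97477 / 100000) (97481 / 100000)); unfold exp8; lra. Qed.

(** Here and below the rational arguments are outward roundings of, in this order, the exponential,
    the coefficient of the cosine, that of the sine (where it is kept), and the two ends of an
    interval for the phase. *)
Lemma peak_4eta_1 : peak (6840 / 32761) (32039 / 32761) 1 <= (2587 / 125).
Proof. peak_tac (peak_upper_neg (6840 / 32761) (32039 / 32761) 1 (25949 / 50000) (39973 / 1000) (6923 / 100000) (1731 / 25000)) exp_4eta 1%nat. Qed.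

Lemma peak_4eta_2 : (44967 / 1000) <= peak (6840 / 32761) (32039 / 32761) 2.
Proof. peak_tac (peak_lower (6840 / 32761) (32039 / 32761) 2 (362676097 / 5000000000) (592293 / 1000) (36839 / 200) (27693 / 100000) (5539 / 20000)) exp_4eta 4%nat. Qed.

Lemma peak_4eta_3 : peak (6840 / 32761) (32039 / 32761) 3 <= (4247 / 500).
Proof. peak_tac (peak_upper (6840 / 32761) (32039 / 32761) 3 (6828033 / 2500000000) (1477199 / 500) (1139961 / 1000) (6231 / 10000) (62313 / 100000)) exp_4eta 9%nat. Qed.

Lemma peak_2eta_1 : (29047 / 1000) <= peak (19 / 181) (180 / 181) 1.
Proof. peak_tac (peak_lower_neg (19 / 181) (180 / 181) 1 (359537 / 500000) (5073 / 125) (1313 / 125) (347 / 20000) (217 / 12500)) exp_2eta 1%nat. Qed.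

Lemma peak_2eta_2 : peak (19 / 181) (180 / 181) 2 <= (83971 / 500).
Proof. peak_tac (peak_upper (19 / 181) (180 / 181) 2 (2673825109 / 10000000000) (156413 / 250) (28451 / 500) (3471 / 50000) (6943 / 100000)) exp_2eta 4%nat. Qed.

Lemma peak_2eta_3 : (20458 / 125) <= peak (19 / 181) (180 / 181) 3.
Proof. peak_tac (peak_lower (19 / 181) (180 / 181) 3 (513998999 / 10000000000) (3144901 / 1000) (498893 / 1000) (781 / 5000) (7811 / 50000)) exp_2eta 9%nat. Qed.

Lemma peak_2eta_4 : peak (19 / 181) (180 / 181) 4 <= (51309 / 1000).
Proof. peak_tac (peak_upper (19 / 181) (180 / 181) 4 (51113073 / 10000000000) (198309 / 20) (1810171 / 1000) (2777 / 10000) (6943 / 25000)) exp_2eta 16%nat. Qed.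

Lemma peak_2eta_5 : (1567 / 250) <= peak (19 / 181) (180 / 181) 5.
Proof. peak_tac (peak_lower (19 / 181) (180 / 181) 5 (2626271 / 10000000000) (24178277 / 1000) (4682619 / 1000) (4339 / 10000) (43393 / 100000)) exp_2eta 25%nat. Qed.

Lemma peak_6eta_1 : (14373 / 1000) <= peak (1839941 / 5929741) (5637060 / 5929741) 1.
Proof. peak_tac (peak_lower (1839941 / 5929741) (5637060 / 5929741) 1 (377263 / 1000000) (37723 / 1000) (5369 / 1000) (3101 / 20000) (15507 / 100000)) exp_6eta 1%nat. Qed.

Lemma peak_6eta_2 : peak (1839941 / 5929741) (5637060 / 5929741) 2 <= (6289 / 500).
Proof. peak_tac (peak_upper (1839941 / 5929741) (5637060 / 5929741) 2 (202607321 / 10000000000) (533421 / 1000) (75243 / 250) (62023 / 100000) (31013 / 50000)) exp_6eta 4%nat. Qed.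

(** * Enclosures of the kernel at the three points *)

Lemma cos_sin_reflect (k : nat) (d : R) : cos (INR k * PI - d) = (-1) ^ k * cos d /\ sin (INR k * PI - d) = - (-1) ^ k * sin d.
Proof.
  induction k.
  - simpl. replace (0 * PI - d) with (- d) by ring. rewrite cos_neg, sin_neg. split; ring.
  - replace (INR (S k) * PI - d) with (INR k * PI - d + PI) by (rewrite S_INR; ring).
    rewrite neg_cos, neg_sin. destruct IHk as [-> ->]. simpl. split; ring.
Qed.

Section KernelEnclosure.
Variables (r : C) (a b : R).
Hypothesis Hr : (r * r)%C = (a, b).
Hypothesis Hab : a ^ 2 + b ^ 2 = 1.
Hypothesis Ha : 0 < a.

Lemma scaled_sq (N : nat) : (INR N * r * (INR N * r))%C = (INR N ^ 2 * a, INR N ^ 2 * b).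
Proof.
  replace (INR N * r * (INR N * r))%C with (RtoC (INR N ^ 2) * (r * r))%C by (simpl pow; rewrite Rmult_1_r, RtoC_mult; ring).
  rewrite Hr. apply C_ext; simpl; ring.
Qed.

Lemma hermite_polar (Z : C) (p q : R) : (Z * Z)%C = (p, q) ->
  hermite Z = (Cmult ((4 * ((PI * p) ^ 2 - (PI * q) ^ 2) - 6 * (PI * p)), (8 * (PI * p) * (PI * q) - 6 * (PI * q))) (Cexp (- (PI * p), - (PI * q)))).
Proof.
  intros H. unfold hermite, quartic, gauss. rewrite H. f_equal.
  - apply C_ext; simpl; ring.
  - f_equal. apply C_ext; simpl; ring.
Qed.

(** Since [PI N^2 b = N^2 PI - d], the trigonometric factors at the true phase are those at the
    phase [d] up to signs [(-1)^(N^2)]; this is the alternation of the terms. *)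
Lemma hermite_peak (N : nat) : fst (hermite (INR N * r)) = - (-1) ^ (N * N) * peak a b (INR N).
Proof.
  rewrite (hermite_polar _ _ _ (scaled_sq N)). unfold Cexp, peak. cbn [fst snd Cmult].
  rewrite cos_neg, sin_neg.
  set (d := PI * (INR N ^ 2 * (1 - b))).
  assert (E : PI * (INR N ^ 2 * b) = INR (N * N) * PI - d) by (unfold d; rewrite mult_INR; ring).
  destruct (cos_sin_reflect (N * N) d) as [E1 E2].
  set (p := PI * (INR N ^ 2 * a)) in *. set (q := PI * (INR N ^ 2 * b)) in *.
  assert (C1 : cos q = (-1) ^ (N * N) * cos d) by (rewrite E; auto).
  assert (C2 : sin q = - (-1) ^ (N * N) * sin d) by (rewrite E; auto).
  rewrite C1, C2. ring.
Qed.

Lemma Cmod_r2 (N : nat) : Cmod (INR N * r * (INR N * r)) = INR N ^ 2.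
Proof.
  rewrite scaled_sq. unfold Cmod. cbn [fst snd].
  replace ((INR N ^ 2 * a) ^ 2 + (INR N ^ 2 * b) ^ 2) with ((INR N ^ 2) ^ 2 * (a ^ 2 + b ^ 2)) by ring.
  rewrite Hab, Rmult_1_r. apply sqrt_pow2. apply pow2_ge_0.
Qed.

(** The constant 42 exceeds [4 PI^2 + 6 PI / 9]: for [N >= 3] the quadratic term is at most a ninth
    of the same multiple of [N^4]. *)
Lemma hermite_crude (N : nat) : (3 <= N)%nat ->
  Cmod (hermite (INR N * r)) <= 42 * INR N ^ 4 * exp (- (PI * a)) ^ (N * N).
Proof.
  intros HN. apply le_INR in HN. replace (INR 3) with 3 in HN by (simpl; ring).
  unfold hermite. rewrite Cmod_mult.
  assert (G : Cmod (gauss (INR N * r)) = exp (- (PI * a)) ^ (N * N)).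
  { unfold gauss. rewrite Cmod_Cexp, scaled_sq, exp_pow, mult_INR. f_equal. simpl. ring. }
  rewrite G. apply Rmult_le_compat_r. apply pow_le; left; apply exp_pos.
  unfold quartic. set (Z2 := (INR N * r * (INR N * r))%C).
  assert (HZ : Cmod Z2 = INR N ^ 2) by apply Cmod_r2.
  eapply Rle_trans; [apply Cmod_triangle|]. rewrite Cmod_opp, !Cmod_mult, HZ, !Cmod_R.
  pose proof PI_bounds. pose proof PI_sq_bounds.
  rewrite !(Rabs_pos_eq PI), (Rabs_pos_eq 4), (Rabs_pos_eq 6) by lra.
  set (x := INR N) in *. assert (9 <= x ^ 2) by nra.
  assert (6 * PI * x ^ 2 * 9 <= 6 * PI * x ^ 2 * x ^ 2) by (apply Rmult_le_compat_l; nra).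
  replace (x ^ 4) with (x ^ 2 * x ^ 2) by ring. set (w := x ^ 2 * x ^ 2) in *.
  assert (0 <= w) by (unfold w; nra).
  assert (4 * (PI * PI) * w <= 4 * (31416 / 10000) ^ 2 * w) by (apply Rmult_le_compat_r; lra).
  assert (6 * PI * w <= 6 * (31416 / 10000) * w) by (apply Rmult_le_compat_r; lra).
  replace (6 * PI * x ^ 2 * x ^ 2) with (6 * PI * w) in * by (unfold w; ring). lra.
Qed.

(** From the first omitted term on, consecutive majorants at least halve: the fourth power grows by
    at most [(4/3)^4], while the exponent of [E2] grows by at least [2 S m + 1]. The tail is then at
    most twice its first majorant [T]. *)
Lemma kernel_partial (m : nat) (E2 T : R) : (3 <= S m)%nat -> exp (- (PI * a)) <= E2 -> E2 <= 1 ->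
  (4 / 3) ^ 4 * E2 ^ (2 * S m + 1) <= / 2 -> 42 * INR (S m) ^ 4 * E2 ^ (S m * S m) <= T ->
  Rabs (fst (kernel r) - fst (Csum (kernel_term r) m)) <= 2 * T.
Proof.
  intros Hm HE HE1 Hratio HT. set (E := exp (- (PI * a))) in *. assert (HE0 : 0 < E) by apply exp_pos.
  set (g := fun N => 42 * INR N ^ 4 * E ^ (N * N)).
  assert (Hg : forall N, (S m <= N)%nat -> g (S N) <= g N * / 2).
  { intros N HN. unfold g. assert (H3 : 3 <= INR N). { replace 3 with (INR 3) by (simpl; ring). apply le_INR; lia. }
    replace (S N * S N)%nat with (N * N + (2 * N + 1))%nat by ring. rewrite pow_add, S_INR.
    assert (A1 : (INR N + 1) ^ 4 <= (4 / 3) ^ 4 * INR N ^ 4). { rewrite <- Rpow_mult_distr. apply pow_incr. lra. }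
    assert (A2 : E ^ (2 * N + 1) <= E2 ^ (2 * S m + 1)).
    { apply Rle_trans with (E ^ (2 * S m + 1)). 2: apply pow_incr; lra.
      replace (2 * N + 1)%nat with ((2 * S m + 1) + (2 * N - 2 * S m))%nat by lia. rewrite pow_add.
      rewrite <- (Rmult_1_r (E ^ (2 * S m + 1))) at 2. apply Rmult_le_compat_l. apply pow_le; lra.
      rewrite <- (pow1 (2 * N - 2 * S m)). apply pow_incr. lra. }
    assert (P1 : 0 <= E ^ (N * N)) by (apply pow_le; lra).
    assert (P2 : 0 <= E ^ (2 * N + 1)) by (apply pow_le; lra).
    assert (P3 : 0 <= INR N ^ 4) by (apply pow_le; lra).
    assert (P4 : 0 <= (INR N + 1) ^ 4) by (apply pow_le; lra).
    assert ((INR N + 1) ^ 4 * E ^ (2 * N + 1) <= ((4 / 3) ^ 4 * INR N ^ 4) * E2 ^ (2 * S m + 1)) by (apply Rmult_le_compat; auto).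
    assert (INR N ^ 4 * ((4 / 3) ^ 4 * E2 ^ (2 * S m + 1)) <= INR N ^ 4 * / 2) by (apply Rmult_le_compat_l; auto).
    assert ((INR N + 1) ^ 4 * E ^ (2 * N + 1) <= INR N ^ 4 * / 2) by lra.
    replace (42 * (INR N + 1) ^ 4 * (E ^ (N * N) * E ^ (2 * N + 1))) with (42 * E ^ (N * N) * ((INR N + 1) ^ 4 * E ^ (2 * N + 1))) by ring.
    replace (42 * INR N ^ 4 * E ^ (N * N) * / 2) with (42 * E ^ (N * N) * (INR N ^ 4 * / 2)) by ring.
    apply Rmult_le_compat_l; lra. }
  assert (Hgk : forall k, g (S m + k)%nat <= T * (/ 2) ^ k).
  { induction k.
    - rewrite Nat.add_0_r. simpl pow. rewrite Rmult_1_r. eapply Rle_trans; [|apply HT]. unfold g.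
      apply Rmult_le_compat_l. apply Rmult_le_pos. lra. apply pow_le, pos_INR. apply pow_incr. lra.
    - rewrite Nat.add_succ_r. eapply Rle_trans; [apply Hg; lia|]. simpl pow. lra. }
  assert (HS : forall k, Cmod (Csum (kernel_term r) (m + k) - Csum (kernel_term r) m) <= 2 * T * (1 - (/ 2) ^ k)).
  { induction k.
    - rewrite Nat.add_0_r. replace (Csum (kernel_term r) m - Csum (kernel_term r) m)%C with (RtoC 0) by ring. rewrite Cmod_0. simpl. lra.
    - rewrite Nat.add_succ_r. simpl Csum.
      replace (Csum (kernel_term r) (m + k) + kernel_term r (m + k) - Csum (kernel_term r) m)%C
        with ((Csum (kernel_term r) (m + k) - Csum (kernel_term r) m) + kernel_term r (m + k))%C by ring.
      eapply Rle_trans; [apply Cmod_triangle|].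
      assert (Cmod (kernel_term r (m + k)) <= T * (/ 2) ^ k).
      { unfold kernel_term. eapply Rle_trans; [apply hermite_crude; lia|]. apply (Hgk k). }
      simpl pow. lra. }
  assert (HT0 : 0 <= T).
  { eapply Rle_trans; [|apply HT]. apply Rmult_le_pos. apply Rmult_le_pos. lra. apply pow_le, pos_INR. apply pow_le. lra. }
  assert (Hmod : Cmod r ^ 2 = 1).
  { assert (Q := Cmod_r2 1). simpl INR in Q. rewrite !Cmult_1_l, Cmod_mult in Q. lra. }
  destruct (kernel_cv a Ha) as [K [_ HK]]. destruct (HK r) as [[HL _] _].
  - unfold sector. rewrite Hr, Hmod. simpl. lra.
  - intros Q. rewrite Q, Cmod_0 in Hmod. simpl in Hmod. lra.
  - apply Rabs_le_between.
    assert (Hk : forall k, Rabs (fst (Csum (kernel_term r) (m + k)) - fst (Csum (kernel_term r) m)) <= 2 * T).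
    { intros k. apply Rle_trans with (1 := fst_Cmod (Csum (kernel_term r) (m + k) - Csum (kernel_term r) m)%C).
      eapply Rle_trans; [apply HS|]. assert (0 < (/ 2) ^ k) by (apply pow_lt; lra). nra. }
    assert (HL' : is_lim_seq (fun k => fst (Csum (kernel_term r) (m + k)) - fst (Csum (kernel_term r) m)) (fst (kernel r) - fst (Csum (kernel_term r) m))).
    { apply is_lim_seq_minus'; [|apply is_lim_seq_const]. apply is_lim_seq_ext with (fun k => fst (Csum (kernel_term r) (k + m))).
      intros; rewrite Nat.add_comm; auto. apply (is_lim_seq_incr_n (fun k => fst (Csum (kernel_term r) k)) m). auto. }
    split.
    + apply (is_lim_seq_le (fun _ => - (2 * T)) _ (- (2 * T)) (fst (kernel r) - fst (Csum (kernel_term r) m)) ) with (2 := is_lim_seq_const _) (3 := HL').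
      intros k. specialize (Hk k). apply Rabs_le_between in Hk. lra.
    + apply (is_lim_seq_le _ (fun _ => 2 * T) (fst (kernel r) - fst (Csum (kernel_term r) m)) (2 * T)) with (2 := HL') (3 := is_lim_seq_const _).
      intros k. specialize (Hk k). apply Rabs_le_between in Hk. lra.
Qed.
End KernelEnclosure.

(** Three terms are summed here, five in [kernel_2eta] and two in [kernel_6eta]: convergence is
    slowest at the point nearest to the edge of the strip, where [a] is smallest. *)
Lemma kernel_4eta (r : C) : (r * r)%C = (6840 / 32761, 32039 / 32761) -> fst (kernel r) <= -15.
Proof.
  intros Hr. assert (Hab : (6840 / 32761) ^ 2 + (32039 / 32761) ^ 2 = 1) by field.
  assert (K := kernel_partial r _ _ Hr Hab ltac:(lra) 3 (25949 / 50000) (3 / 10) ltac:(lia) (proj2 exp_4eta) ltac:(lra)).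
  set (V := fst (kernel r)) in *. cbn [Csum] in K. unfold kernel_term in K. cbn [fst Cplus] in K. rewrite !(hermite_peak r _ _ Hr) in K.
  specialize (K ltac:(simpl; lra) ltac:(simpl; lra)). apply Rabs_le_between in K. simpl in K.
  pose proof peak_4eta_1. pose proof peak_4eta_2. pose proof peak_4eta_3.
  replace (1 + 1 + 1) with 3 in K by ring. replace (1 + 1) with 2 in K by ring. lra.
Qed.

Lemma kernel_2eta (r : C) : (r * r)%C = (19 / 181, 180 / 181) -> -23 <= fst (kernel r).
Proof.
  intros Hr. assert (Hab : (19 / 181) ^ 2 + (180 / 181) ^ 2 = 1) by field.
  assert (K := kernel_partial r _ _ Hr Hab ltac:(lra) 5 (71909 / 100000) (4 / 10) ltac:(lia) (proj2 exp_2eta) ltac:(lra)).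
  set (V := fst (kernel r)) in *. cbn [Csum] in K. unfold kernel_term in K. cbn [fst Cplus] in K. rewrite !(hermite_peak r _ _ Hr) in K.
  specialize (K ltac:(simpl; lra) ltac:(simpl; lra)). apply Rabs_le_between in K. simpl in K.
  pose proof peak_2eta_1. pose proof peak_2eta_2. pose proof peak_2eta_3. pose proof peak_2eta_4. pose proof peak_2eta_5.
  replace (1 + 1 + 1 + 1 + 1) with 5 in K by ring. replace (1 + 1 + 1 + 1) with 4 in K by ring.
  replace (1 + 1 + 1) with 3 in K by ring. replace (1 + 1) with 2 in K by ring. lra.
Qed.

Lemma kernel_6eta (r : C) : (r * r)%C = (1839941 / 5929741, 5637060 / 5929741) -> 0 <= fst (kernel r).
Proof.
  intros Hr. assert (Hab : (1839941 / 5929741) ^ 2 + (5637060 / 5929741) ^ 2 = 1) by field.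
  assert (K := kernel_partial r _ _ Hr Hab ltac:(lra) 2 (1179 / 3125) (6 / 10) ltac:(lia) (proj2 exp_6eta) ltac:(lra)).
  set (V := fst (kernel r)) in *. cbn [Csum] in K. unfold kernel_term in K. cbn [fst Cplus] in K. rewrite !(hermite_peak r _ _ Hr) in K.
  specialize (K ltac:(simpl; lra) ltac:(simpl; lra)). apply Rabs_le_between in K. simpl in K.
  pose proof peak_6eta_1. pose proof peak_6eta_2. replace (1 + 1) with 2 in K by ring. lra.
Qed.

(** [Phi] is real at imaginary points, so the rotation by [y / 2] that relates it to [kernel]
    contributes only its cosine to the real part. *)
Lemma Phi_kernel_imaginary (y : R) : Rabs y < PI / 4 -> fst (kernel (Cexp (0, y))) = fst (Phi (0, y)) * cos (y / 2).
Proof.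
  intros Hy. assert (HI := Phi_imaginary y Hy).
  assert (E : kernel (Cexp (0, y)) = (Cexp (- ((0, y) / 2)) * Phi (0, y))%C).
  { unfold Phi. rewrite Cmult_assoc, <- Cexp_plus. replace (- ((0, y) / 2) + (0, y) / 2)%C with (RtoC 0) by ring.
    rewrite Cexp_0. ring. }
  rewrite E. revert HI. generalize (Phi (0, y)). intros z Hz.
  assert (EC : Cexp (- ((0, y) / 2)) = (cos (y / 2), - sin (y / 2))).
  { unfold Cexp. replace (fst (- ((0, y) / 2))%C) with 0.
    - replace (snd (- ((0, y) / 2))%C) with (- (y / 2)) by (change (- snd ((0, y) / 2)%C = - (y / 2)) || idtac; rewrite ?snd_half; simpl; field).
      rewrite exp_0, cos_neg, sin_neg. apply C_ext; simpl; ring.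
    - change (0 = - fst ((0, y) / 2)%C). rewrite fst_half. simpl. field. }
  rewrite EC. simpl. rewrite Hz. ring.
Qed.

Lemma Cexp_imaginary_sq (y : R) : (Cexp (0, y) * Cexp (0, y))%C = (cos (2 * y), sin (2 * y)).
Proof.
  rewrite <- Cexp_plus. replace ((0, y) + (0, y))%C with ((0, 2 * y) : C) by (apply C_ext; simpl; ring).
  unfold Cexp. simpl fst; simpl snd. rewrite exp_0. apply C_ext; simpl; ring.
Qed.

(** * The angle eta and the final comparison *)

Definition eta : R := atan (/ 19).

Lemma eta_double : 0 < eta /\ sin (2 * eta) = 19 / 181 /\ cos (2 * eta) = 180 / 181.
Proof.
  unfold eta. assert (H0 : 0 < atan (/ 19)). { rewrite <- atan_0. apply atan_increasing. lra. }
  destruct (atan_bound (/ 19)) as [B1 B2].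
  assert (Hc : 0 < cos (atan (/ 19))) by (apply cos_gt_0; lra).
  assert (Ht := tan_atan (/ 19)). unfold tan in Ht.
  assert (Hs : sin (atan (/ 19)) = cos (atan (/ 19)) / 19). { apply Rmult_eq_reg_r with (/ cos (atan (/ 19))). unfold Rdiv in Ht. rewrite Ht. field. lra. apply Rinv_neq_0_compat; lra. }
  assert (H1 := sin2_cos2 (atan (/ 19))). unfold Rsqr in H1. rewrite Hs in H1.
  assert (Hcc : cos (atan (/ 19)) * cos (atan (/ 19)) = 361 / 362) by lra.
  split; [auto|split].
  - rewrite sin_2a, Hs. replace (2 * (cos (atan (/ 19)) / 19) * cos (atan (/ 19))) with (2 / 19 * (cos (atan (/ 19)) * cos (atan (/ 19)))) by field. rewrite Hcc. field.
  - rewrite cos_2a, Hs. lra.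
Qed.

(** [sin^2 eta = 1/362] is below [sin^2 (PI/6)]. The bound keeps the lowest point [PI/4 - 3 eta]
    inside the strip. *)
Lemma eta_small : 6 * eta < PI.
Proof.
  destruct eta_double as [H0 [Hs Hc]]. apply Rnot_le_lt. intros Q.
  assert (Hb : eta < PI / 2). { unfold eta. destruct (atan_bound (/ 19)). lra. }
  assert (E : 1 - 2 * (sin eta * sin eta) = 180 / 181) by (rewrite <- Hc, cos_2a_sin; ring).
  assert (sin (PI / 6) <= sin eta) by (apply sin_incr_1; lra). rewrite sin_PI6 in H. nra.
Qed.

Lemma eta_multiples : sin (4 * eta) = 6840 / 32761 /\ cos (4 * eta) = 32039 / 32761 /\
  sin (6 * eta) = 1839941 / 5929741 /\ cos (6 * eta) = 5637060 / 5929741.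
Proof.
  destruct eta_double as [_ [Hs Hc]].
  assert (S4 : sin (4 * eta) = 6840 / 32761). { replace (4 * eta) with (2 * (2 * eta)) by ring. rewrite sin_2a, Hs, Hc. field. }
  assert (C4 : cos (4 * eta) = 32039 / 32761). { replace (4 * eta) with (2 * (2 * eta)) by ring. rewrite cos_2a, Hs, Hc. field. }
  repeat split; auto; replace (6 * eta) with (4 * eta + 2 * eta) by ring.
  - rewrite sin_plus, S4, C4, Hs, Hc. field.
  - rewrite cos_plus, S4, C4, Hs, Hc. field.
Qed.

Lemma quarter_sq (t : R) : Cmult (Cexp (0, PI / 4 - t)) (Cexp (0, PI / 4 - t)) = (sin (2 * t), cos (2 * t)).
Proof.
  rewrite Cexp_imaginary_sq. replace (2 * (PI / 4 - t)) with (PI / 2 - 2 * t) by field. rewrite cos_shift, sin_shift. auto.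
Qed.

Lemma small_angle (y : R) : Rabs y < PI / 4 -> 92 / 100 <= cos (y / 2) <= 1.
Proof.
  intros Hy. pose proof PI_bounds. apply Rabs_def2 in Hy. split; [|apply COS_bound]. eapply Rle_trans; [|apply cos_ge]. nra.
Qed.

Lemma profile_values (beta : R) : 0 < beta <= 1 / 2 -> let y := PI / 4 - 2 * eta in
  Rabs y < PI / 4 /\ Rabs (y + eta) < PI / 4 /\ Rabs (y - eta) < PI / 4 /\
  profile beta y 0 < 0 /\ 2 * profile beta y 0 < profile beta (y + eta) 0 + profile beta (y - eta) 0.
Proof.
  intros Hb y. destruct eta_double as [H0 [S2 C2]]. destruct eta_multiples as [S4 [C4 [S6 C6]]]. pose proof eta_small as H6.
  assert (A0 : Rabs y < PI / 4) by (unfold y; apply Rabs_def1; lra).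
  assert (A1 : Rabs (y + eta) < PI / 4) by (unfold y; apply Rabs_def1; lra).
  assert (A2 : Rabs (y - eta) < PI / 4) by (unfold y; apply Rabs_def1; lra).
  assert (K0 := kernel_4eta (Cexp (0, y))). assert (K1 := kernel_2eta (Cexp (0, y + eta))). assert (K2 := kernel_6eta (Cexp (0, y - eta))).
  rewrite Phi_kernel_imaginary in K0, K1, K2 by auto.
  specialize (K0 ltac:(unfold y; rewrite quarter_sq; replace (2 * (2 * eta)) with (4 * eta) by ring; rewrite S4, C4; auto)).
  specialize (K1 ltac:(unfold y; replace (PI / 4 - 2 * eta + eta) with (PI / 4 - eta) by ring; rewrite quarter_sq, S2, C2; auto)).
  specialize (K2 ltac:(unfold y; replace (PI / 4 - 2 * eta - eta) with (PI / 4 - 3 * eta) by ring; rewrite quarter_sq; replace (2 * (3 * eta)) with (6 * eta) by ring; rewrite S6, C6; auto)).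
  destruct (small_angle y A0) as [c0 c0']. destruct (small_angle (y + eta) A1) as [c1 c1']. destruct (small_angle (y - eta) A2) as [c2 c2'].
  assert (Hbc : forall z, Rabs z < PI / 4 -> 92 / 100 <= cos (beta * z) <= 1).
  { intros z Hz. replace (beta * z) with ((2 * beta * z) / 2) by field. apply small_angle.
    rewrite Rabs_mult, Rabs_pos_eq by lra. pose proof (Rabs_pos z). nra. }
  rewrite !profile_0 by auto.
  destruct (Hbc y A0) as [d0 d0']. destruct (Hbc (y + eta) A1) as [d1 d1']. destruct (Hbc (y - eta) A2) as [d2 d2'].
  set (P0 := fst (Phi (0, y))) in *. set (P1 := fst (Phi (0, y + eta))) in *. set (P2 := fst (Phi (0, y - eta))) in *.
  (* Dividing by [cos (y / 2)], which lies between 0.92 and 1, keeps the bound -15 and turns -23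
     into -25. After the factors [cos (beta y)], again at least 0.92, the comparison is between
     -27.6 and -25. *)
  assert (P0 <= -15) by nra. assert (-25 <= P1) by nra. assert (0 <= P2) by nra.
  assert (G0 : P0 * cos (beta * y) <= -15 * (92 / 100)) by nra.
  assert (G1 : -25 <= P1 * cos (beta * (y + eta))) by nra.
  assert (G2 : 0 <= P2 * cos (beta * (y - eta))) by nra.
  repeat split; auto; lra.
Qed.

Lemma cosh_le (x y : R) : 0 <= x <= y -> cosh x <= cosh y.
Proof.
  intros H. unfold cosh. rewrite !exp_Ropp. assert (X1 := exp_ineq1_le x). assert (exp x <= exp y) by (apply exp_le_exp; lra).
  set (X := exp x) in *. set (Y := exp y) in *.
  assert (Y + / Y - (X + / X) = (Y - X) * (X * Y - 1) / (X * Y)) by (field; lra).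
  assert (0 <= (Y - X) * (X * Y - 1) / (X * Y)).
  { apply Rmult_le_pos. apply Rmult_le_pos. lra. nra. left; apply Rinv_0_lt_compat. nra. }
  lra.
Qed.

Lemma cosh_ge_1 (x : R) : 1 <= cosh x.
Proof. unfold cosh. rewrite exp_Ropp. assert (H := exp_pos x). set (X := exp x) in *.
  assert (0 <= (X - 1) ^ 2 / X). { apply Rmult_le_pos. apply pow2_ge_0. left; apply Rinv_0_lt_compat; auto. }
  assert ((X - 1) ^ 2 / X = X + / X - 2) by (field; lra). lra. Qed.

Lemma RH_of_peak_valley :
  (forall beta, 0 < beta <= 1 / 2 -> forall tj tj1, root_interval (fun t => u t beta) tj tj1 ->
     v tj beta <> 0 /\ v tj1 beta <> 0) ->
  forall beta t, 0 < beta <= 1 / 2 -> 0 <= t -> xi (1 / 2 + beta, t) <> 0%C.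
Proof.
  intros H beta a Hb Ha0 HX.
  assert (Ha : 0 < a).
  { destruct Ha0 as [|<-]; auto. assert (Q := u_pos_0 beta (proj1 Hb)). unfold u in Q. rewrite HX in Q. simpl in Q. lra. }
  rewrite xi_line in HX by lra.
  assert (Huniq := unique_zero_of_peak_valley beta a (H beta Hb) (proj1 Hb) Ha HX).
  set (U := fun t => fst (Xi 0 (beta, t))).
  assert (HUc : forall t, continuity_pt U t).
  { intros s. apply continuity_pt_filterlim. apply (ex_derive_continuous (V := R_NormedModule) U). eexists. exact (proj1 (Xi_der_y 0 beta s)). }
  assert (HUe : forall t, U (- t) = U t) by (intros t; unfold U; rewrite Xi_conj; auto).
  assert (HU0 : 0 < U 0) by apply Xi_real.
  assert (HUa : U a = 0) by (unfold U; rewrite HX; auto).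
  (* By evenness [U] has no zero on [(- a, a)], so its positivity at 0 extends up to [a]. *)
  assert (Hleft : forall t, 0 <= t < a -> 0 < U t).
  { intros t Ht. apply (const_sign U (- a) a HUc) with 0; try lra.
    intros s Hs Q. destruct (Rtotal_order s 0) as [L|[L|L]].
    - assert (- s = a); [|lra]. apply Huniq. lra. change (U (- s) = 0). rewrite HUe; auto.
    - subst. lra.
    - assert (s = a); [|lra]. apply Huniq; auto. }
  assert (Hne : forall t, a < t -> U t <> 0). { intros t Ht Q. assert (t = a); [|lra]. apply Huniq; auto. lra. }
  destruct (profile_values beta Hb) as [A0 [A1 [A2 [N0 N1]]]]. set (y := PI / 4 - 2 * eta) in *.
  pose proof eta_double as [He _].
  (* To the right of [a] the sign of [U] is constant, and its value at [a + 1] decides which of the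
     two positivity statements applies. *)
  destruct (Rtotal_order (U (a + 1)) 0) as [L|[L|L]].
  - assert (Hright : forall t, a < t -> U t < 0).
    { intros t Ht. assert (0 < - U t); [|lra].
      apply (const_sign (fun t => - U t) a (Rmax t (a + 1) + 1)) with (a + 1); try lra.
      - intros s. apply (continuity_pt_opp U); auto.
      - intros s Hs Q. apply (Hne s); lra.
      - pose proof (Rmax_r t (a + 1)). lra.
      - pose proof (Rmax_l t (a + 1)). lra. }
    assert (G := profile_convexity beta y eta a (proj1 Hb) A0 A1 A2).
    (* [profile beta y 0] is negative and [cosh] is at least 1: the unknown height [a] drops out,
       and one numerical inequality excludes every possible zero. *)
    assert (2 * cosh (eta * a) * profile beta y 0 <= 2 * profile beta y 0) by (pose proof (cosh_ge_1 (eta * a)); nra).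
    assert (profile beta (y + eta) 0 + profile beta (y - eta) 0 <= 2 * cosh (eta * a) * profile beta y 0); [|lra].
    apply G. intros t Ht. change (fst (Xi 0 (beta, t))) with (U t).
    destruct (Rtotal_order t a) as [M|[M|M]].
    + assert (cosh (eta * t) <= cosh (eta * a)) by (apply cosh_le; split; [apply Rmult_le_pos; lra|apply Rmult_le_compat_l; lra]).
      assert (0 < U t) by (apply Hleft; lra). apply Rmult_le_pos; lra.
    + subst. rewrite HUa. lra.
    + assert (cosh (eta * a) <= cosh (eta * t)) by (apply cosh_le; split; [apply Rmult_le_pos; lra|apply Rmult_le_compat_l; lra]).
      assert (U t < 0) by (apply Hright; lra). nra.
  - apply (Hne (a + 1)); lra.
  - assert (Hright : forall t, a < t -> 0 < U t).
    { intros t Ht. apply (const_sign U a (Rmax t (a + 1) + 1)) with (a + 1); auto; try lra.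
      - intros s Hs. apply Hne. lra.
      - pose proof (Rmax_r t (a + 1)). lra.
      - pose proof (Rmax_l t (a + 1)). lra. }
    assert (0 <= profile beta y 0); [|lra]. apply profile_nonneg; auto. lra.
    intros t Ht. change (0 <= U t). destruct (Rtotal_order t a) as [M|[M|M]].
    + left; apply Hleft; lra. + subst; lra. + left; apply Hright; auto.
Qed.

Theorem theorem3 :
  (forall beta t, 0 < beta <= 1/2 -> 0 <= t -> xi (1/2 + beta, t) <> 0)
  <->
  (forall beta, 0 < beta <= 1/2 ->
   forall tj tj1, root_interval (fun t => u t beta) tj tj1 ->
     v tj beta <> 0 /\ v tj1 beta <> 0 /\ v tj beta * v tj1 beta < 0 /\
     exists t', tj < t' < tj1 /\ v t' beta = 0).
Proof.
  split.
  - apply peak_valley_of_RH.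
  - intros H. apply RH_of_peak_valley. intros beta Hb tj tj1 HI. destruct (H beta Hb tj tj1 HI) as [H1 [H2 _]]. auto.
Qed.
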